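(* Let $K\ge1$, $1<p<2$ and $\alpha=\frac2p-1$. There is $C=C(K,p)\ge1$ such that for every compact $E\subset\mathbb C$ and every principal $K$-quasiconformal mapping $\phi:\mathbb C\to\mathbb C$ conformal on $\mathbb C\setminus E$, $$C^{-1}\dot C_{\alpha,p}(E)\le\dot C_{\alpha,p}(\phi(E))\le C\,\dot C_{\alpha,p}(E).$$
   Context: $K$-quasiconformal: homeomorphism of $\mathbb C$ in $W^{1,2}_{loc}$ with $\max_\alpha|\partial_\alpha\phi|\le K\min_\alpha|\partial_\alpha\phi|$ a.e.; principal: conformal outside a compact set and $\phi(z)-z=O(1/|z|)$ at $\infty$. With $I_\alpha(z)=|z|^{\alpha-2}$ and $\frac1p+\frac1q=1$, the Riesz capacity of a compact $E$ is $\dot C_{\alpha,p}(E)=\sup\mu(E)^p$ over positive measures $\mu$ supported on $E$ with $\|I_\alpha*\mu\|_{L^q}\le1$. *)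

(* Defs.v *)
(* The complex plane C is modelled as R * R. *)
From HB Require Import structures.
From mathcomp Require Import all_boot all_order all_algebra.
From mathcomp Require Import all_classical all_reals all_analysis.
Set Implicit Arguments. Unset Strict Implicit. Unset Printing Implicit Defensive.
Import Order.TTheory GRing.Theory Num.Theory.
Import numFieldNormedType.Exports.
Local Open Scope classical_set_scope.
Local Open Scope ring_scope.

Notation Pt R := (R * R)%type.

Section Defs.
Variable R : realType.


Definition cabs (z : Pt R) : R := Num.sqrt (z.1 ^+ 2 + z.2 ^+ 2).
Definition csub (z w : Pt R) : Pt R := (z.1 - w.1, z.2 - w.2).
Definition cadd (z w : Pt R) : Pt R := (z.1 + w.1, z.2 + w.2).
Definition cmul (z w : Pt R) : Pt R := (z.1 * w.1 - z.2 * w.2, z.1 * w.2 + z.2 * w.1).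
Definition cscale (a : R) (z : Pt R) : Pt R := (a * z.1, a * z.2).

Definition leb2 := (@lebesgue_measure R \x @lebesgue_measure R)%E.

Definition homeo (f : Pt R -> Pt R) : Prop :=
  exists g : Pt R -> Pt R, cancel f g /\ cancel g f /\ continuous f /\ continuous g.

Definition edir (b : bool) : Pt R := if b then (1, 0) else (0, 1).
Definition pd (b : bool) (f : Pt R -> R) : Pt R -> R := fun x => 'D_(edir b) f x.
Definition iter_pd (s : seq bool) (f : Pt R -> R) : Pt R -> R := foldr pd f s.

Definition test_fun (psi : Pt R -> R) : Prop :=
  (forall s : seq bool, continuous (iter_pd s psi) /\
     forall (b : bool) (x : Pt R), derivable (iter_pd s psi) x (edir b)) /\
  exists r : R, forall x, r < cabs x -> psi x = 0.

Definition L2loc (f : Pt R -> R) : Prop :=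
  measurable_fun setT f /\
  forall r : R, leb2.-integrable [set x | cabs x <= r] (fun x => (f x ^+ 2)%:E).

Definition weak_pd (b : bool) (f g : Pt R -> R) : Prop :=
  forall psi, test_fun psi ->
    (\int[leb2]_x (f x * pd b psi x)%:E = - \int[leb2]_x (g x * psi x)%:E)%E.

(* phi is K-quasiconformal: homeomorphism in W^{1,2}_loc whose weak partials
   Dx, Dy (C-valued) satisfy  max_a |d_a phi| <= K min_a |d_a phi| a.e.,
   where d_a phi = cos a * Dx + sin a * Dy is the directional derivative. *)
Definition quasiconformal (K : R) (phi : Pt R -> Pt R) : Prop :=
  homeo phi /\
  exists Dx Dy : Pt R -> Pt R,
    L2loc (fun x => (phi x).1) /\ L2loc (fun x => (phi x).2) /\
    L2loc (fun x => (Dx x).1) /\ L2loc (fun x => (Dx x).2) /\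
    L2loc (fun x => (Dy x).1) /\ L2loc (fun x => (Dy x).2) /\
    weak_pd true (fun x => (phi x).1) (fun x => (Dx x).1) /\
    weak_pd true (fun x => (phi x).2) (fun x => (Dx x).2) /\
    weak_pd false (fun x => (phi x).1) (fun x => (Dy x).1) /\
    weak_pd false (fun x => (phi x).2) (fun x => (Dy x).2) /\
    {ae leb2, forall x, forall a b : R,
       cabs (cadd (cscale (cos a) (Dx x)) (cscale (sin a) (Dy x)))
       <= K * cabs (cadd (cscale (cos b) (Dx x)) (cscale (sin b) (Dy x)))}.

Definition cdifferentiable_at (f : Pt R -> Pt R) (z : Pt R) : Prop :=
  exists c : Pt R, forall e : R, 0 < e -> exists2 d : R, 0 < d &
    forall h : Pt R, 0 < cabs h < d ->
      cabs (csub (csub (f (cadd z h)) (f z)) (cmul c h)) <= e * cabs h.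

Definition conformal_on (U : set (Pt R)) (f : Pt R -> Pt R) : Prop :=
  open U /\ {in U &, injective f} /\ forall z, U z -> cdifferentiable_at f z.

Definition principal (phi : Pt R -> Pt R) : Prop :=
  (exists2 F : set (Pt R), compact F & conformal_on (~` F) phi) /\
  exists M r : R, forall z, r < cabs z -> cabs (csub (phi z) z) <= M / cabs z.

Definition riesz_kernel (alpha : R) (x y : Pt R) : \bar R :=
  if x == y then +oo%E else ((cabs (csub x y)) `^ (alpha - 2))%:E.
Definition riesz_pot (alpha : R) (mu : {measure set (Pt R) -> \bar R}) (x : Pt R)
  : \bar R := (\int[mu]_y riesz_kernel alpha x y)%E.

(* L^q norm of a nonnegative extended function w.r.t. Lebesgue measure *)
Definition Lq_norm (q : R) (f : Pt R -> \bar R) : \bar R :=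
  ((\int[leb2]_x (f x `^ q)) `^ (q^-1))%E.

Definition riesz_cap (alpha p : R) (E : set (Pt R)) : \bar R :=
  let q := p / (p - 1) in
  ereal_sup [set v | exists mu : {measure set (Pt R) -> \bar R},
     mu (~` E) = 0%E /\ (Lq_norm q (riesz_pot alpha mu) <= 1)%E /\
     v = ((mu E) `^ p)%E].

End Defs.

(* Main.v *)
(* The inverse of phi satisfies the same hypotheses with phi(E) in place of E, so the lower bound is
   enough: a measure mu on E of large mass whose potential has L^q norm at most 1 has to be turned
   into such a measure nu on phi(E).  Principality and the length-area method make phi and its
   inverse psi uniformly quasisymmetric.  Let a be a cutoff on the phi(E)-side.  Since psi is
   conformal off phi(E), 1/(psi(w) - y) is holomorphic there up to its pole at phi(y), and pairing
   it with the d-bar derivative of a recovers a(phi(y)); averaging against mu bounds mu(E) by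
   sum_Q b_Q for every dyadic cover of phi(E) by squares Q of side l, where b_Q is 1/l times the
   integral over w in 2Q of the mu-integral of min(1, D/|psi(w) - y|)/|psi(w) - y| with
   D = |psi(w + l) - psi(w)|.  A max-flow argument on the 4-adic tree then produces a measure nu
   on phi(E) with nu(phi(E)) >= c mu(E) and nu(Q) <= C b_Q, and Wolff's inequality together
   with the geometric decay of the areas |psi(Q)| bounds the energy of nu by that of mu. *)
Require Import Defs.
From HB Require Import structures.
From mathcomp Require Import all_boot all_order all_algebra.
From mathcomp Require Import all_classical all_reals all_analysis.
From mathcomp Require Import measurable_realfun.
From mathcomp Require Import ring lra zify.
Set Implicit Arguments. Unset Strict Implicit. Unset Printing Implicit Defensive.
Import Order.TTheory GRing.Theory Num.Theory.
Import numFieldNormedType.Exports.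
Local Open Scope classical_set_scope.
Local Open Scope ring_scope.

(** Quasiconformality is given analytically, and [psi] is never shown to have weak derivatives. The
    symmetry between the two maps is carried by the record [qsp]: both maps are quasisymmetric with
    one constant, both stay at bounded distance from the identity, and [1/(Psi w - y)] is weakly
    holomorphic off [Phi(E)]. For [Psi = psi] the last property comes from a change of variables
    through [phi]. Analytic facts about [phi] are proved for its mollifications and passed to the
    limit; staying close to the identity, these have degree one, whence the change of variables
    formula and the sign of the Jacobian. The final constant may depend on [K] and [p] only, whereas
    the distance to the identity and the top scales depend on the map, so every estimate entering it
    is scale invariant. With [q = p/(p-1)] the kernel is [|x|] to the power [-(1+2/q)]: the energies
    become sums over scales of integrals of [(V/l)^q] with weight [l^-2], that is, with area
    measured in units of one square. Only comparability of scales and decay of image areas then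
    matter. The sum over scales larger than the image size converges because [4 * 2^-q < 1], that
    is, [p < 2]. *)

Local Notation measT := (measurable_fun setT).

(** * Continuity: algebraic rules *)

Section continuity.
Variables (R : realType) (T : topologicalType).
Implicit Types f g : T -> R.

Lemma ct_cst (c : R) : continuous (fun _ : T => c).
Proof. exact: cst_continuous. Qed.

Lemma ctD f g : continuous f -> continuous g -> continuous (fun z => f z + g z).
Proof. by move=> cf cg z; apply: cvgD; [exact: cf|exact: cg]. Qed.

Lemma ctN f : continuous f -> continuous (fun z => - f z).
Proof. by move=> cf z; apply: cvgN; exact: cf. Qed.

Lemma ctB f g : continuous f -> continuous g -> continuous (fun z => f z - g z).
Proof. by move=> cf cg z; apply: cvgB; [exact: cf|exact: cg]. Qed.

Lemma ctM f g : continuous f -> continuous g -> continuous (fun z => f z * g z).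
Proof. by move=> cf cg z; apply: cvgM; [exact: cf|exact: cg]. Qed.

Lemma ctX f n : continuous f -> continuous (fun z => f z ^+ n).
Proof.
move=> cf; elim: n => [|n IH]; first by under eq_fun do rewrite expr0; exact: ct_cst.
by under eq_fun do rewrite exprS; exact: ctM.
Qed.

Lemma ct_norm f : continuous f -> continuous (fun z => `|f z|).
Proof. by move=> cf z; apply: cvg_norm; exact: cf. Qed.

End continuity.

Lemma ct_comp (R : realType) (T : topologicalType) (f : R -> R) (g : T -> R) :
  continuous f -> continuous g -> continuous (fun z => f (g z)).
Proof. by move=> cf cg z; apply: continuous_comp; [exact: cg|exact: cf]. Qed.

Lemma ct_comp2 (R : realType) (T : topologicalType) (f : Pt R -> R) (g : T -> Pt R) :
  continuous f -> continuous g -> continuous (fun z => f (g z)).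
Proof. by move=> cf cg z; apply: continuous_comp; [exact: cg|exact: cf]. Qed.

Lemma ct_fst (R : realType) : continuous (fun z : Pt R => z.1).
Proof. by move=> z; exact: cvg_fst. Qed.

Lemma ct_snd (R : realType) : continuous (fun z : Pt R => z.2).
Proof. by move=> z; exact: cvg_snd. Qed.

Lemma ct_pair (R : realType) (T : topologicalType) (f g : T -> R) :
  continuous f -> continuous g -> continuous (fun z => (f z, g z) : Pt R).
Proof. by move=> cf cg z; exact: (cvg_pair (cf z) (cg z)). Qed.

(** * Measurability, integration and the L^2 norm on squares centred at 0 *)

Section planar_measure.
Variable R : realType.
Local Notation m2 := (@leb2 R).
Implicit Types (f g h : Pt R -> R) (M c r s : R).

(** The measurable structure of [Pt R] is the product one, so an open set has to be exhibited as a
    countable union of rectangles; the rational rectangles contained in it suffice. *)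
Lemma measurable_open2 (U : set (Pt R)) : open U -> measurable U.
Proof.
move=> oU.
pose rect (t : (rat * rat) * (rat * rat)) : set (Pt R) :=
  `]ratr t.1.1, ratr t.1.2[%classic `*` `]ratr t.2.1, ratr t.2.2[%classic.
(* [unpickle] enumerates the rational rectangles; those not contained in [U] are replaced by the
   empty set. *)
pose F (n : nat) : set (Pt R) :=
  if unpickle n is Some t then (if asbool (rect t `<=` U) then rect t else set0) else set0.
have -> : U = \bigcup_n F n.
  apply/seteqP; split => [x Ux|x [n _]]; last first.
    rewrite /F; case: unpickle => [t|]//.
    by case: asboolP => // h /h.
  have /nbhs_ballP[e /= e0 xU] : nbhs x U by apply: open_nbhs_nbhs.
  have rt (a : R) : exists q : rat * rat, [/\ a - e < ratr q.1, ratr q.1 < a, a < ratr q.2 & ratr q.2 < a + e].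
    have [q1] := @rat_in_itvoo R (a - e) a ltac:(lra).
    have [q2] := @rat_in_itvoo R a (a + e) ltac:(lra).
    rewrite !in_itv/= => /andP[h1 h2] /andP[h3 h4].
    by exists (q1, q2).
  have [q [q1 q2 q3 q4]] := rt x.1.
  have [s [s1 s2 s3 s4]] := rt x.2.
  have h : rect (q, s) `<=` U.
    move=> y [/=]; rewrite !in_itv/= => /andP[a1 a2] /andP[a3 a4].
    apply: xU; split => /=; rewrite /ball/= ltr_norml; apply/andP; split; lra.
  have Fx : F (pickle (q, s)) x.
    rewrite /F pickleK (asboolT h); split => /=; rewrite in_itv/=; apply/andP; split; assumption.
  exact (ex_intro2 _ _ (pickle (q, s)) Logic.I Fx).
apply: bigcupT_measurable => n; rewrite /F; case: unpickle => [t|]//.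
by case: asboolP => // _; apply: measurableX.
Qed.

Lemma measurable_closed2 (U : set (Pt R)) : closed U -> measurable U.
Proof.
move=> cU; rewrite -(setCK U); apply: measurableC; apply: measurable_open2.
by rewrite openC.
Qed.

Lemma compact_closed2 (U : set (Pt R)) : compact U -> closed U.
Proof. by apply: compact_closed; exact: norm_hausdorff. Qed.

Lemma measurable_cont2 (f : Pt R -> R) : continuous f -> measT f.
Proof.
move=> cf; apply: (measurability _ (RGenOpens.measurableE R)).
move=> _ [_ [a [b ->] <-]]; rewrite setTI.
by apply: measurable_open2; apply: open_comp => // x _; exact: cf.
Qed.

Lemma measurable_cont22 (f : Pt R -> Pt R) : continuous f -> measT f.
Proof.
move=> cf; apply/measurable_fun_pairP; split; apply: measurable_cont2 => x.
- by apply: continuous_comp; [exact: cf|exact: cvg_fst].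
- by apply: continuous_comp; [exact: cf|exact: cvg_snd].
Qed.

(** The norm of [Pt R] is the sup norm, so this is a closed square of side [2r]; as a product of
    intervals it lends itself to Fubini and to boundary terms. *)
Definition bx (r : R) : set (Pt R) := [set z | `|z| <= r].

Lemma bxP r z : bx r z <-> `|z.1| <= r /\ `|z.2| <= r.
Proof. by rewrite /bx/= prod_normE ge_max; split=> [/andP[]|[-> ->]]. Qed.

Lemma bxE r : bx r = `[-r, r]%classic `*` `[-r, r]%classic.
Proof.
apply/seteqP; split => z; rewrite bxP /= !in_itv/= !ler_norml.
  by case=> ? ?; split.
by case.
Qed.

Lemma bxS r s : r <= s -> bx r `<=` bx s.
Proof. by move=> rs z; rewrite /bx/= => /le_trans; apply. Qed.

Lemma measurable_bx r : measurable (bx r).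
Proof. by rewrite bxE; apply: measurableX. Qed.

Lemma leb2_bx r : 0 <= r -> m2 (bx r) = ((2 * r) ^+ 2)%:E.
Proof.
move=> r0; rewrite bxE /leb2 product_measure1E//.
have h : @lebesgue_measure R `[-r, r]%classic = (2 * r)%:E.
  rewrite lebesgue_measure_itv/= lte_fin.
  case: ltP => h; last by (have -> : r = 0 by lra); rewrite mulr0.
  by rewrite -EFinB; congr (_%:E); lra.
by rewrite [X in (X * X)%E] h -EFinM expr2.
Qed.

Lemma leb2_bx_lty r : (m2 (bx r) < +oo)%E.
Proof.
apply: (@le_lt_trans _ _ (m2 (bx `|r|))).
  by apply: le_measure; rewrite ?inE; [exact: measurable_bx|exact: measurable_bx|exact/bxS/ler_norm].
by rewrite leb2_bx// ltry.
Qed.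

Lemma compact_bx r : compact (bx r).
Proof.
rewrite bxE; apply: compact_setX; exact: segment_compact.
Qed.

Lemma cont_bounded_bx (f : Pt R -> R) r : continuous f -> exists2 M, 0 < M & forall z, bx r z -> `|f z| <= M.
Proof.
move=> cf.
have : compact (f @` bx r).
  by apply: continuous_compact; [exact: continuous_subspaceT|exact: compact_bx].
move=> /compact_bounded[M [_ h]]; exists (`|M| + 1); first by rewrite ltr_wpDl.
move=> z bz; apply: (h (`|M| + 1)); last by exists z.
by rewrite (le_lt_trans (ler_norm M))// ltrDl.
Qed.

Definition L1 (r : R) (f : Pt R -> R) := m2.-integrable (bx r) (EFin \o f).
Definition bint (r : R) (f : Pt R -> R) : R := (\int[m2]_(z in bx r) f z)%R.

Lemma L1_meas r f : L1 r f -> measurable_fun (bx r) f.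
Proof. by move=> /measurable_int /measurable_EFinP. Qed.

Lemma L1S r s f : r <= s -> L1 s f -> L1 r f.
Proof. by move=> rs; apply: integrableS; [exact: measurable_bx|exact: measurable_bx|exact: bxS]. Qed.

Lemma L1_bounded r f M : measurable_fun (bx r) f -> (forall z, bx r z -> `|f z| <= M) -> L1 r f.
Proof.
move=> mf fM; apply: measurable_bounded_integrable => //; [exact: measurable_bx|exact: leb2_bx_lty|].
exists M; split; first by rewrite num_real.
by move=> x Mx z bz; apply: (le_trans (fM z bz)); exact: ltW.
Qed.

Lemma L1_cont r f : continuous f -> L1 r f.
Proof.
move=> cf; have [M _ h] := cont_bounded_bx r cf.
apply: L1_bounded h; apply: measurable_funTS; exact: measurable_cont2.
Qed.

Lemma L1D r f g : L1 r f -> L1 r g -> L1 r (fun z => f z + g z).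
Proof. by move=> hf hg; refine (integrableD _ hf hg); exact: measurable_bx. Qed.

Lemma L1Z r c f : L1 r f -> L1 r (fun z => c * f z).
Proof. by move=> hf; refine (integrableZl _ c hf); exact: measurable_bx. Qed.

Lemma L1N r f : L1 r f -> L1 r (fun z => - f z).
Proof. by move=> hf; refine (integrableN hf). Qed.

Lemma L1B r f g : L1 r f -> L1 r g -> L1 r (fun z => f z - g z).
Proof. by move=> hf /L1N hg; apply: L1D. Qed.

Lemma L1_abs r f : L1 r f -> L1 r (fun z => `|f z|).
Proof. by move=> /integrable_norm. Qed.

Lemma L1_le r f g : measurable_fun (bx r) f -> (forall z, bx r z -> `|f z| <= g z) -> L1 r g -> L1 r f.
Proof.
move=> mf fg; apply: le_integrable; first exact: measurable_bx.
  exact/measurable_EFinP.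
by move=> z bz /=; rewrite lee_fin (le_trans (fg z bz))// ler_norm.
Qed.

Lemma eq_L1 r f g : (forall z, bx r z -> f z = g z) -> L1 r f -> L1 r g.
Proof.
move=> fg; apply: eq_integrable; first exact: measurable_bx.
by move=> z /set_mem bz /=; rewrite fg.
Qed.

Lemma L1Mb r f g M : measurable_fun (bx r) f -> (forall z, bx r z -> `|f z| <= M) -> L1 r g ->
  L1 r (fun z => f z * g z).
Proof.
move=> mf fM hg; have M1 := L1Z M (L1_abs hg).
apply: L1_le M1.
  by apply: measurable_funM => //; exact: L1_meas.
by move=> z bz; rewrite normrM ler_wpM2r// fM.
Qed.

Lemma L1Mc r f g : continuous f -> L1 r g -> L1 r (fun z => f z * g z).
Proof.
move=> cf hg; have [M _ h] := cont_bounded_bx r cf.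
apply: (L1Mb _ h) => //; apply: measurable_funTS; exact: measurable_cont2.
Qed.

Lemma eq_bint r f g : (forall z, bx r z -> f z = g z) -> bint r f = bint r g.
Proof. by move=> fg; rewrite /bint; apply: eq_Rintegral => z /set_mem; exact: fg. Qed.

Lemma bintD r f g : L1 r f -> L1 r g -> bint r (fun z => f z + g z) = bint r f + bint r g.
Proof. by move=> hf hg; rewrite /bint; apply: RintegralD => //; exact: measurable_bx. Qed.

Lemma bintB r f g : L1 r f -> L1 r g -> bint r (fun z => f z - g z) = bint r f - bint r g.
Proof. by move=> hf hg; rewrite /bint; apply: RintegralB => //; exact: measurable_bx. Qed.

Lemma bintZ r c f : L1 r f -> bint r (fun z => c * f z) = c * bint r f.
Proof. by move=> hf; rewrite /bint; apply: RintegralZl => //; exact: measurable_bx. Qed.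

Lemma bintN r f : L1 r f -> bint r (fun z => - f z) = - bint r f.
Proof.
move=> hf; rewrite -[RHS]mulN1r -bintZ//; apply: eq_bint => z _; by rewrite mulN1r.
Qed.

Lemma le_bint r f g : L1 r f -> L1 r g -> (forall z, bx r z -> f z <= g z) -> bint r f <= bint r g.
Proof. by move=> hf hg fg; refine (le_Rintegral _ hf hg fg); exact: measurable_bx. Qed.

Lemma bint_ge0 r f : (forall z, bx r z -> 0 <= f z) -> 0 <= bint r f.
Proof. by move=> h; rewrite /bint; apply: Rintegral_ge0. Qed.

Lemma bint_abs r f : L1 r f -> `|bint r f| <= bint r (fun z => `|f z|).
Proof. by move=> hf; rewrite /bint; apply: le_normr_Rintegral => //; exact: measurable_bx. Qed.

Lemma bint_cst r c : 0 <= r -> bint r (fun=> c) = c * (2 * r) ^+ 2.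
Proof. move=> r0; rewrite /bint Rintegral_cst; last exact: measurable_bx.
by rewrite [X in fine X](leb2_bx r0). Qed.

Lemma bint_bound r f M : 0 <= r -> L1 r f -> (forall z, bx r z -> `|f z| <= M) -> `|bint r f| <= M * (2 * r) ^+ 2.
Proof.
move=> r0 hf fM; rewrite (le_trans (bint_abs hf))// -bint_cst//; apply: le_bint => //; first exact: L1_abs.
apply: L1_cont => z; exact: cvg_cst.
Qed.

Lemma EFin_bint r f : L1 r f -> (bint r f)%:E = (\int[m2]_(z in bx r) (f z)%:E)%E.
Proof. by move=> hf; rewrite /bint fineK//; apply: integrable_fin_num => //; exact: measurable_bx. Qed.

Lemma le_bint_bx r s f : r <= s -> L1 s f -> (forall z, 0 <= f z) -> bint r f <= bint s f.
Proof.
move=> rs hf f0; rewrite -lee_fin !EFin_bint//; last exact: L1S hf.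
apply: ge0_subset_integral; [exact: measurable_bx|exact: measurable_bx| | |exact: bxS].
  exact: measurable_int hf.
by move=> z _; rewrite lee_fin.
Qed.

Lemma bint_support r s f : r <= s -> L1 s f -> (forall z, ~ bx r z -> f z = 0) -> bint s f = bint r f.
Proof.
move=> rs hf f0; apply: EFin_inj; rewrite !EFin_bint//; last exact: L1S hf.
rewrite integral_mkcond [RHS]integral_mkcond; apply: eq_integral => z _.
rewrite !patchE; case: ifPn => [/set_mem h|/negP h]; case: ifPn => [/set_mem h'|/negP h'] //.
  by rewrite f0// => h''; apply: h'; exact/mem_set.
by exfalso; apply: h; apply/mem_set/(bxS rs).
Qed.

Definition sq (f : Pt R -> R) z := f z ^+ 2.
Definition L2 r (f : Pt R -> R) := measurable_fun (bx r) f /\ L1 r (sq f).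

Lemma L2_cont r f : continuous f -> L2 r f.
Proof.
move=> cf; split; first by apply: measurable_funTS; exact: measurable_cont2.
by apply: L1_cont => z; rewrite /sq; apply: cvgM; exact: cf.
Qed.

Lemma L2M r f g : L2 r f -> L2 r g -> L1 r (fun z => f z * g z).
Proof.
move=> [mf hf] [mg hg]; have := L1D hf hg; apply: L1_le.
  exact: measurable_funM.
move=> z _; rewrite /sq normrM -(real_normK (num_real (f z))) -(real_normK (num_real (g z))).
have := normr_ge0 (f z); have := normr_ge0 (g z); nra.
Qed.

Lemma L2_L1 r f : L2 r f -> L1 r f.
Proof.
move=> hf; have h := L2M hf (@L2_cont r (fun=> 1) (@cst_continuous _ _ _)).
by apply: eq_L1 h => z _; rewrite mulr1.
Qed.

Lemma L2Z r c f : L2 r f -> L2 r (fun z => c * f z).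
Proof.
move=> [mf hf]; split; first by apply: measurable_funM.
by have := L1Z (c ^+ 2) hf; apply: eq_L1 => z _; rewrite /sq exprMn.
Qed.

Lemma L2D r f g : L2 r f -> L2 r g -> L2 r (fun z => f z + g z).
Proof.
move=> hf hg; have h := L2M hf hg; case: hf hg => mf hf [mg hg]; split.
  exact: measurable_funD.
have := L1D (L1D hf hg) (L1Z 2 h); apply: eq_L1 => z _; rewrite /sq; ring.
Qed.

Lemma L2B r f g : L2 r f -> L2 r g -> L2 r (fun z => f z - g z).
Proof.
move=> hf hg; have := L2D hf (L2Z (-1) hg); case=> m1 m2; split.
  by apply: measurable_funB; [case: hf|case: hg].
by apply: eq_L1 m2 => z _; rewrite /sq mulN1r.
Qed.

Lemma L2Mb r f g M : measurable_fun (bx r) f -> (forall z, bx r z -> `|f z| <= M) -> L2 r g ->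
  L2 r (fun z => f z * g z).
Proof.
move=> mf fM [mg hg]; split; first exact: measurable_funM.
have : L1 r (fun z => sq f z * sq g z).
  apply: (@L1Mb _ _ _ (M ^+ 2)) => //; first exact: measurable_funX.
  by move=> z bz; rewrite /sq normrX lerXn2r// ?nnegrE// ?(le_trans _ (fM z bz))// fM.
by apply: eq_L1 => z _; rewrite /sq exprMn.
Qed.

Definition N2 r f := Num.sqrt (bint r (sq f)).

Lemma N2_ge0 r f : 0 <= N2 r f. Proof. exact: sqrtr_ge0. Qed.

Lemma N2_sq r f : N2 r f ^+ 2 = bint r (sq f).
Proof. by rewrite sqr_sqrtr//; apply: bint_ge0 => z _; rewrite sqr_ge0. Qed.

(** The quadratic [t^2 a^2 - 2 t X + b^2] is nonnegative for every [t], and [t = b/a] is optimal.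
    When [a] or [b] is 0, another value of [t] contradicts [X > 0]. *)
Lemma CS r f g : L2 r f -> L2 r g -> bint r (fun z => `|f z * g z|) <= N2 r f * N2 r g.
Proof.
move=> hf hg; set a := N2 r f; set b := N2 r g.
have key (t : R) : 2 * t * bint r (fun z => `|f z * g z|) <= t ^+ 2 * a ^+ 2 + b ^+ 2.
  rewrite /a /b !N2_sq -!bintZ//; [|by case: hf|exact/L1_abs/L2M].
  rewrite -bintD//; [|by apply: L1Z; case: hf|by case: hg].
  apply: le_bint.
  - by apply: L1Z; apply/L1_abs/L2M.
  - by apply: L1D; [apply: L1Z; case: hf|case: hg].
  move=> z _; rewrite /sq normrM -(real_normK (num_real (f z))) -(real_normK (num_real (g z))).
  have := sqr_ge0 (t * `|f z| - `|g z|); nra.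
have a0 : 0 <= a by exact: N2_ge0.
have b0 : 0 <= b by exact: N2_ge0.
set X := bint r _ in key *.
have X0 : 0 <= X by apply: bint_ge0.
have [az|anz] := eqVneq a 0.
  rewrite az mul0r leNgt; apply/negP => Xp.
  have := key ((b ^+ 2 + 1) / (2 * X)); rewrite az expr0n mulr0 add0r.
  have -> : 2 * ((b ^+ 2 + 1) / (2 * X)) * X = b ^+ 2 + 1 by field; rewrite gt_eqF.
  lra.
have ap : 0 < a by rewrite lt_def anz.
have := key (b / a).
have -> : (b / a) ^+ 2 * a ^+ 2 + b ^+ 2 = 2 * b ^+ 2 by field.
have -> : 2 * (b / a) * X = (2 * b / a) * X by field.
move=> h.
have [bz|bnz] := eqVneq b 0.
  rewrite bz mulr0 leNgt; apply/negP => Xp.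
  have := key (X / a ^+ 2); rewrite bz expr0n addr0.
  have -> : 2 * (X / a ^+ 2) * X = 2 * (X ^+ 2 / a ^+ 2) by field.
  have -> : (X / a ^+ 2) ^+ 2 * a ^+ 2 = X ^+ 2 / a ^+ 2 by field.
  have : 0 < X ^+ 2 / a ^+ 2 by rewrite divr_gt0// exprn_gt0.
  lra.
have bp : 0 < b by rewrite lt_def bnz.
rewrite -(@ler_pM2l _ (2 * b / a)); last by rewrite divr_gt0// mulr_gt0.
by apply: (le_trans h); rewrite le_eqVlt; apply/orP; left; apply/eqP; field.
Qed.

Lemma CSI r f g : L2 r f -> L2 r g -> `|bint r (fun z => f z * g z)| <= N2 r f * N2 r g.
Proof. by move=> hf hg; apply: (le_trans (bint_abs (L2M hf hg))); exact: CS. Qed.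

Lemma N2D r f g : L2 r f -> L2 r g -> N2 r (fun z => f z + g z) <= N2 r f + N2 r g.
Proof.
move=> hf hg; rewrite -(@ler_pXn2r _ 2)// ?nnegrE ?N2_ge0 ?addr_ge0 ?N2_ge0//.
have -> : N2 r (fun z => f z + g z) ^+ 2 = N2 r f ^+ 2 + N2 r g ^+ 2 + 2 * bint r (fun z => f z * g z).
  rewrite !N2_sq -bintZ; last exact: L2M.
  rewrite -bintD; [|by case: hf|by case: hg].
  rewrite -bintD; [|by apply: L1D; [case: hf|case: hg]|by apply: L1Z; exact: L2M].
  by apply: eq_bint => z _; rewrite /sq; ring.
have := CSI hf hg; have := ler_norm (bint r (fun z => f z * g z)); nra.
Qed.

Lemma N2Z r c f : L2 r f -> N2 r (fun z => c * f z) = `|c| * N2 r f.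
Proof.
move=> [_ hf]; rewrite /N2 -[`|c|]sqrtr_sqr -sqrtrM ?sqr_ge0// -bintZ//.
by congr Num.sqrt; apply: eq_bint => z _; rewrite /sq exprMn.
Qed.

Lemma eq_N2 r f g : (forall z, bx r z -> f z = g z) -> N2 r f = N2 r g.
Proof. by move=> fg; congr Num.sqrt; apply: eq_bint => z bz; rewrite /sq fg. Qed.

Lemma N2BC r f g : N2 r (fun z => f z - g z) = N2 r (fun z => g z - f z).
Proof. by congr Num.sqrt; apply: eq_bint => z _; rewrite /sq; ring. Qed.

Lemma N2_tri r f g h : L2 r f -> L2 r g -> L2 r h ->
  N2 r (fun z => f z - h z) <= N2 r (fun z => f z - g z) + N2 r (fun z => g z - h z).
Proof.
move=> hf hg hh; rewrite (_ : N2 _ _ = N2 r (fun z => (f z - g z) + (g z - h z))).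
  by apply: N2D; exact: L2B.
by apply: eq_N2 => z _; ring.
Qed.

Lemma N2_bound r f M : 0 <= r -> 0 <= M -> L2 r f -> (forall z, bx r z -> `|f z| <= M) -> N2 r f <= M * (2 * r).
Proof.
move=> r0 M0 [mf hf] fM; rewrite -(@ler_pXn2r _ 2)// ?nnegrE ?N2_ge0 ?mulr_ge0//.
rewrite N2_sq exprMn; apply: (le_trans (ler_norm _)); apply: bint_bound => // z bz.
by rewrite /sq normrX lerXn2r ?nnegrE// fM.
Qed.

Lemma N2S r s f : r <= s -> L2 s f -> N2 r f <= N2 s f.
Proof.
move=> rs [_ hf]; rewrite /N2 ler_wsqrtr//; apply: le_bint_bx => // z; exact: sqr_ge0.
Qed.

End planar_measure.

(** The same set function as [leb2] under a name of its own, to which the sigma-finite structure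
    demanded by Tonelli's theorem is attached. *)
Definition lebm (R : realType) : set (measurableTypeR R * measurableTypeR R)%type -> \bar R := @leb2 R.
HB.instance Definition _ (R : realType) := Measure.copy (@lebm R) (@leb2 R).
Lemma lebmE (R : realType) (D : set (Pt R)) (f : Pt R -> \bar R) :
  (\int[@leb2 R]_(x in D) f x = \int[@lebm R]_(x in D) f x)%E.
Proof. reflexivity. Qed.
Lemma lebm_sigma_finite (R : realType) : sigma_finite setT (@lebm R).
Proof.
exists (fun n => `[- n%:R, n%:R]%classic `*` `[- n%:R, n%:R]%classic).
  apply/seteqP; split => // z _; exists (Num.bound `|z|) => //.
  have h := archi_boundP (normr_ge0 z).
  have [h1 h2] : `|z.1| < (Num.bound `|z|)%:R /\ `|z.2| < (Num.bound `|z|)%:R.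
    by move: h; rewrite {1}prod_normE gt_max => /andP.
  by split; rewrite /= in_itv/= -ler_norml ltW.
move=> n; split; first by apply: measurableX.
rewrite /lebm /= /leb2 product_measure1E//=.
rewrite !lebesgue_measure_itv/=; case: ifP => _; last by rewrite mul0e.
by rewrite -EFinB -EFinM ltry.
Qed.
HB.instance Definition _ (R : realType) := Measure_isSigmaFinite.Build _ _ _ (@lebm R) (lebm_sigma_finite R).

(** * Tonelli's theorem in the plane *)

Section tonelli.
Variable R : realType.
Implicit Types f : Pt R * Pt R -> \bar R.

Lemma tonelli f : measT f -> (forall p, (0 <= f p)%E) ->
  (\int[@lebm R]_x (\int[@lebm R]_y f (x, y)) = \int[@lebm R]_y (\int[@lebm R]_x f (x, y)))%E.
Proof. by move=> mf f0; exact: fubini_tonelli. Qed.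

Lemma measurable_int_snd f : measT f -> (forall p, (0 <= f p)%E) ->
  measT (fun x => \int[@lebm R]_y f (x, y))%E.
Proof. by move=> mf f0; exact: measurable_fun_fubini_tonelli_F. Qed.

Lemma measurable_int_fst f : measT f -> (forall p, (0 <= f p)%E) ->
  measT (fun y => \int[@lebm R]_x f (x, y))%E.
Proof. by move=> mf f0; exact: measurable_fun_fubini_tonelli_G. Qed.

End tonelli.

(** * Calculus in one real variable *)

Section calculus1.
Variable R : realType.
Implicit Types (f g : R -> R) (x : R).

Lemma is_derive_lin f (x a : R) :
  (forall e : R, 0 < e -> exists2 d : R, 0 < d & forall h : R, 0 < `|h| < d -> `|f (x + h) - f x - a * h| <= e * `|h|) ->
  is_derive x 1 f a.
Proof.
move=> H.
have c : (fun h => h^-1 *: ((f \o shift x) (h *: (1:R)) - f x)) @ 0^' --> a.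
  apply/cvgrPdist_le => e e0; have [d d0 hd] := H _ e0.
  near=> h.
  have h0 : h != 0 by near: h; exact: nbhs_dnbhs_neq.
  have hd' : `|h| < d.
    by near: h; exact: dnbhs0_lt.
  have := hd h; rewrite normr_gt0 h0 hd' => /(_ isT) hh.
  rewrite /= [h *: 1]mulr1 (addrC h x) -[h^-1 *: _]/(h^-1 * _).
  have -> : a - h^-1 * (f (x + h) - f x) = - ((f (x + h) - f x - a * h) / h) by field.
  by rewrite normrN normrM normfV ler_pdivrMr ?normr_gt0.
apply: DeriveDef; first by apply/cvg_ex; exists a.
exact: cvg_lim c.
Unshelve. all: by end_near.
Qed.

(** A quadratic bound on the remainder, valid for all [h], avoids limits altogether; it serves at
    the junction points of functions defined by cases such as [hk], [pos2] and [rk]. *)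
Lemma is_derive_quad f (x a C : R) :
  (forall h, `|f (x + h) - f x - a * h| <= C * h ^+ 2) -> is_derive x 1 f a.
Proof.
move=> H; apply: is_derive_lin => e e0.
have C0 : 0 <= C.
  by have := H 1; rewrite expr1n !mulr1; apply: le_trans; exact: normr_ge0.
exists (e / (C + 1)); first by rewrite divr_gt0// ltr_wpDl.
move=> h /andP[_ hd]; apply: (le_trans (H h)).
rewrite -real_normK ?num_real// expr2 mulrA ler_wpM2r//.
move: hd; rewrite ltr_pdivlMr ?ltr_wpDl// => hd.
have := normr_ge0 h; nra.
Qed.

Lemma dcst (x c : R) : is_derive x 1 (fun _ : R => c) 0.
Proof. exact: is_derive_cst. Qed.

Lemma did (x : R) : is_derive x 1 (fun t : R => t) 1.
Proof. exact: is_derive_id. Qed.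

Lemma dD f g (x a b : R) : is_derive x 1 f a -> is_derive x 1 g b -> is_derive x 1 (fun t => f t + g t) (a + b).
Proof. by move=> hf hg; exact: is_deriveD. Qed.

Lemma dN f (x a : R) : is_derive x 1 f a -> is_derive x 1 (fun t => - f t) (- a).
Proof. by move=> hf; exact: is_deriveN. Qed.

Lemma dB f g (x a b : R) : is_derive x 1 f a -> is_derive x 1 g b -> is_derive x 1 (fun t => f t - g t) (a - b).
Proof. by move=> hf hg; exact: is_deriveB. Qed.

Lemma dM f g (x a b : R) : is_derive x 1 f a -> is_derive x 1 g b ->
  is_derive x 1 (fun t => f t * g t) (a * g x + f x * b).
Proof.
move=> hf hg; have h := is_deriveM hf hg; apply: (is_derive_eq h).
by rewrite -[f x *: b]/(f x * b) -[g x *: a]/(g x * a) addrC (mulrC a).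
Qed.

Lemma dcomp f g (x a b : R) : is_derive (g x) 1 f a -> is_derive x 1 g b -> is_derive x 1 (fun t => f (g t)) (a * b).
Proof. by move=> hf hg; exact: is_derive1_comp. Qed.

Lemma deq f (x a b : R) : is_derive x 1 f a -> a = b -> is_derive x 1 f b.
Proof. by move=> h <-. Qed.

Lemma d_cont f f' : (forall x, is_derive x 1 f (f' x)) -> continuous f.
Proof.
move=> h x; apply: differentiable_continuous; apply/derivable1_diffP.
by have [] := h x.
Qed.

Lemma MVT_abs f f' (a b : R) : (forall x, is_derive x 1 f (f' x)) ->
  exists2 c, `|c - a| <= `|b - a| & f b - f a = f' c * (b - a).
Proof.
move=> h.
have key (u v : R) : u <= v -> exists2 c, u <= c <= v & f v - f u = f' c * (v - u).
  move=> uv; have [c] := @MVT_segment R f f' u v uv (fun x _ => h x) (continuous_subspaceT (d_cont h)).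
  by rewrite in_itv/= => hc ->; exists c.
have [/key[c /andP[c1 c2] e]|/ltW /key[c /andP[c1 c2] e]] := leP a b; exists c => //.
- by rewrite !ger0_norm ?subr_ge0//; lra.
- by rewrite !ler0_norm ?subr_le0//; lra.
- by rewrite -opprB e; ring.
Qed.

Local Notation m1 := (@lebesgue_measure R).

Definition lint (a b : R) f : R := \int[m1]_(x in `[a, b]) f x.

Lemma lint_L1 (a b : R) f : continuous f -> m1.-integrable `[a, b] (EFin \o f).
Proof.
move=> cf; apply: continuous_compact_integrable; first exact: segment_compact.
exact: continuous_subspaceT.
Qed.

Lemma FTC f f' (a b : R) : a <= b -> (forall x, is_derive x 1 f (f' x)) -> continuous f' ->
  lint a b f' = f b - f a.
Proof.
move=> ab h cf; rewrite /lint; have cF := d_cont h.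
move: ab; rewrite le_eqVlt => /orP[/eqP <-|ab].
  by rewrite subrr set_itv1 Rintegral_set1.
rewrite /Rintegral (@continuous_FTC2 _ f' f)//.
- exact: continuous_subspaceT.
- split.
  + by move=> x _; have [] := h x.
  + by apply: cvg_at_right_filter; exact: cF.
  + by apply: cvg_at_left_filter; exact: cF.
- by move=> x _; rewrite derive1E; have [_] := h x.
Qed.

Lemma eq_lint a b f g : (forall x, a <= x <= b -> f x = g x) -> lint a b f = lint a b g.
Proof. by move=> fg; apply: eq_Rintegral => x /set_mem /=; rewrite in_itv/=; exact: fg. Qed.

Lemma le_lint a b f g : continuous f -> continuous g -> (forall x, a <= x <= b -> f x <= g x) -> lint a b f <= lint a b g.
Proof.
move=> cf cg fg; rewrite /lint; apply: le_Rintegral => //; try exact: lint_L1.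
Qed.

Lemma lint_abs a b f : continuous f -> `|lint a b f| <= lint a b (fun x => `|f x|).
Proof. by move=> cf; rewrite /lint; apply: le_normr_Rintegral => //; exact: lint_L1. Qed.

Lemma lint_cst a b c : a <= b -> lint a b (fun=> c) = c * (b - a).
Proof.
move=> ab; have d (x : R) : is_derive x 1 (fun t => c * t) c.
  by apply: (deq (dM (dcst x c) (did x))); ring.
by rewrite (FTC ab d (@ct_cst _ _ c)); ring.
Qed.

End calculus1.

(** * Partial derivatives along coordinate lines *)

Section calculus2.
Variable R : realType.
Implicit Types f g u : Pt R -> R.

Definition upd (b : bool) (z : Pt R) (t : R) : Pt R := if b then (t, z.2) else (z.1, t).
Definition crd (b : bool) (z : Pt R) : R := if b then z.1 else z.2.
(** A partial derivative is treated as a derivative in one variable, so that all one-variable rules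
    apply; [pd_pdv] links it to the directional derivative in which test functions are stated. *)
Definition pdv b f f' := forall z, is_derive (crd b z) 1 (fun t => f (upd b z t)) (f' z).

Lemma upd_crd b z : upd b z (crd b z) = z. Proof. by case: b z => -[]. Qed.
Lemma upd_upd b z s t : upd b (upd b z s) t = upd b z t. Proof. by case: b. Qed.
Lemma crd_upd b z t : crd b (upd b z t) = t. Proof. by case: b. Qed.

Lemma pdv_upd b f f' : pdv b f f' -> forall z (t : R), is_derive t 1 (fun s => f (upd b z s)) (f' (upd b z t)).
Proof.
move=> h z t; have := h (upd b z t); rewrite crd_upd.
by under eq_fun do rewrite upd_upd.
Qed.

Lemma pdv_cst b c : pdv b (fun=> c) (fun=> 0).
Proof. by move=> z; exact: dcst. Qed.

Lemma pdvD b f g f' g' : pdv b f f' -> pdv b g g' -> pdv b (fun z => f z + g z) (fun z => f' z + g' z).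
Proof. by move=> hf hg z; apply: dD; [exact: hf|exact: hg]. Qed.

Lemma pdvB b f g f' g' : pdv b f f' -> pdv b g g' -> pdv b (fun z => f z - g z) (fun z => f' z - g' z).
Proof. by move=> hf hg z; apply: dB; [exact: hf|exact: hg]. Qed.

Lemma pdvM b f g f' g' : pdv b f f' -> pdv b g g' -> pdv b (fun z => f z * g z) (fun z => f' z * g z + f z * g' z).
Proof.
move=> hf hg z; apply: deq; first exact: (dM (hf z) (hg z)).
by rewrite /= upd_crd.
Qed.

Lemma pdv_comp1 b (h h' : R -> R) f f' : (forall x : R, is_derive x 1 h (h' x)) -> pdv b f f' ->
  pdv b (fun z => h (f z)) (fun z => h' (f z) * f' z).
Proof.
move=> hh hf z; apply: (deq (@dcomp _ h (fun t => f (upd b z t)) (crd b z) _ _ (hh _) (hf z))).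
by rewrite /= upd_crd.
Qed.

Lemma ct_upd b (z : Pt R) : continuous (upd b z).
Proof.
by case: b; apply: ct_pair => //; try exact: ct_cst; move=> t; exact: cvg_id.
Qed.

Lemma pd_pdv b f f' : pdv b f f' -> pd b f = f' /\ forall z, derivable f z (edir R b).
Proof.
move=> h.
have e z : (fun t : R => t^-1 *: ((f \o shift z) (t *: edir R b) - f z)) =
  (fun t => t^-1 *: (((fun s => f (upd b z s)) \o shift (crd b z)) (t *: 1) - f (upd b z (crd b z)))).
  rewrite upd_crd; apply/funext => t; congr (_ *: (_ - _)) => /=; congr f.
  by case: b {h}; case: z => z1 z2; apply: injective_projections => /=;
    rewrite ?scaler0 ?add0r.
split.
  apply/funext => z; rewrite /pd /derive e.
  by have [_] := h z.
by move=> z; rewrite /derivable e; have [] := h z.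
Qed.

End calculus2.

Arguments ct_upd {R} b z _ _.

(** * C^1 functions of two variables: chain rule, Fubini, integration by parts *)

Section calculus3.
Variable R : realType.
Implicit Types (f g u : Pt R -> R) (r s : R).

Lemma is_deriveP (f : R -> R) (x a : R) :
  is_derive x 1 f a <-> (fun h => h^-1 * (f (h + x) - f x)) @ 0^' --> a.
Proof.
have e : (fun h : R => h^-1 * (f (h + x) - f x)) = (fun h => h^-1 *: ((f \o shift x) (h *: (1:R)) - f x)).
  by apply/funext => h; rewrite /= [h *: 1]mulr1.
rewrite e; split.
  by case=> [d <-]; exact: d.
move=> c; apply: DeriveDef; first by apply/cvg_ex; exists a.
exact: cvg_lim c.
Qed.

Lemma shift_cvg (f : R -> R) (x a : R) : is_derive x 1 f a -> (fun h => f (h + x)) @ 0^' --> f x.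
Proof.
move=> h; have cf : {for x, continuous f}.
  by apply: differentiable_continuous; apply/derivable1_diffP; have [] := h.
have : (fun h => f (h + x)) @ (0:R) --> f x.
  have c : (fun h : R => h + x) @ (0:R) --> x.
    rewrite -{2}(add0r x); apply: cvgD; [exact: cvg_id|exact: cvg_cst].
  exact: (cvg_comp _ _ c cf).
by apply: cvg_trans; apply: cvg_app; exact: cvg_within.
Qed.

Definition C1 u u1 u2 := [/\ continuous u, continuous u1, continuous u2, pdv true u u1 & pdv false u u2].

(** The increment is split into a horizontal and a vertical leg, each treated by the mean value
    theorem in one variable. The intermediate points [xi], [et] converge by squeezing, and
    continuity of the partial derivatives gives the limit without a total derivative. *)
Lemma d_chain u u1 u2 (F G : R -> R) (x a b : R) : C1 u u1 u2 ->
  is_derive x 1 F a -> is_derive x 1 G b ->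
  is_derive x 1 (fun t => u (F t, G t)) (u1 (F x, G x) * a + u2 (F x, G x) * b).
Proof.
move=> [_ cu1 cu2 h1 h2] hF hG; apply/is_deriveP.
have /choice[xi xiP] : forall h, exists s, `|s - F x| <= `|F (h + x) - F x| /\
    u (F (h + x), G (h + x)) - u (F x, G (h + x)) = u1 (s, G (h + x)) * (F (h + x) - F x).
  move=> h; have [s s1 s2] := MVT_abs (F x) (F (h + x)) (fun t => pdv_upd h1 (0, G (h + x)) t).
  by exists s.
have /choice[et etP] : forall h, exists s, `|s - G x| <= `|G (h + x) - G x| /\
    u (F x, G (h + x)) - u (F x, G x) = u2 (F x, s) * (G (h + x) - G x).
  move=> h; have [s s1 s2] := MVT_abs (G x) (G (h + x)) (fun t => pdv_upd h2 (F x, 0) t).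
  by exists s.
have cF := shift_cvg hF; have cG := shift_cvg hG.
have sqz (s k : R -> R) (l : R) : k @ 0^' --> l -> (forall h, `|s h - l| <= `|k h - l|) -> s @ 0^' --> l.
  move=> ck sk; apply/cvgrPdist_le => e e0.
  move/cvgrPdist_le : ck => /(_ _ e0); apply: filterS => h.
  by rewrite distrC => kh; rewrite distrC (le_trans (sk h)).
have cxi : xi @ 0^' --> F x by apply: (sqz _ _ _ cF) => h; case: (xiP h).
have cet : et @ 0^' --> G x by apply: (sqz _ _ _ cG) => h; case: (etP h).
have cc (w : Pt R -> R) (k l : R -> R) (k0 l0 : R) : continuous w -> k @ 0^' --> k0 -> l @ 0^' --> l0 ->
    (fun h => w (k h, l h)) @ 0^' --> w (k0, l0).
  by move=> cw ck cl; exact: (cvg_comp _ _ (cvg_pair ck cl) (cw (k0, l0))).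
have -> : (fun h => h^-1 * (u (F (h + x), G (h + x)) - u (F x, G x))) =
  (fun h => u1 (xi h, G (h + x)) * (h^-1 * (F (h + x) - F x)) +
    u2 (F x, et h) * (h^-1 * (G (h + x) - G x))).
  apply/funext => h; have [_ e1] := xiP h; have [_ e2] := etP h.
  have -> : u (F (h + x), G (h + x)) - u (F x, G x) =
    (u (F (h + x), G (h + x)) - u (F x, G (h + x))) + (u (F x, G (h + x)) - u (F x, G x)) by ring.
  by rewrite e1 e2; ring.
apply: cvgD; apply: cvgM.
- exact: cc.
- exact/is_deriveP.
- by apply: cc => //; exact: cvg_cst.
- exact/is_deriveP.
Qed.

Lemma pdv_chain b u u1 u2 f g f' g' : C1 u u1 u2 -> pdv b f f' -> pdv b g g' ->
  pdv b (fun z => u (f z, g z)) (fun z => u1 (f z, g z) * f' z + u2 (f z, g z) * g' z).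
Proof.
move=> hu hf hg z; apply: (deq (d_chain hu (hf z) (hg z))).
by rewrite upd_crd.
Qed.

Lemma C1_cst c : C1 (fun=> c) (fun=> 0) (fun=> 0).
Proof. by split; try exact: ct_cst; exact: pdv_cst. Qed.

Lemma C1_D f f1 f2 g g1 g2 : C1 f f1 f2 -> C1 g g1 g2 ->
  C1 (fun z => f z + g z) (fun z => f1 z + g1 z) (fun z => f2 z + g2 z).
Proof. by move=> [c0 c1 c2 p1 p2] [d0 d1 d2 q1 q2]; split; try exact: ctD; exact: pdvD. Qed.

Lemma C1_B f f1 f2 g g1 g2 : C1 f f1 f2 -> C1 g g1 g2 ->
  C1 (fun z => f z - g z) (fun z => f1 z - g1 z) (fun z => f2 z - g2 z).
Proof. by move=> [c0 c1 c2 p1 p2] [d0 d1 d2 q1 q2]; split; try exact: ctB; exact: pdvB. Qed.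

Lemma C1_M f f1 f2 g g1 g2 : C1 f f1 f2 -> C1 g g1 g2 ->
  C1 (fun z => f z * g z) (fun z => f1 z * g z + f z * g1 z) (fun z => f2 z * g z + f z * g2 z).
Proof.
by move=> [c0 c1 c2 p1 p2] [d0 d1 d2 q1 q2]; split; [exact: ctM|apply: ctD; exact: ctM|apply: ctD; exact: ctM|exact: pdvM|exact: pdvM].
Qed.

Lemma C1_comp1 (h h' : R -> R) f f1 f2 : (forall x : R, is_derive x 1 h (h' x)) -> continuous h' -> C1 f f1 f2 ->
  C1 (fun z => h (f z)) (fun z => h' (f z) * f1 z) (fun z => h' (f z) * f2 z).
Proof.
move=> dh ch' [cf c1 c2 p1 p2]; split.
- by apply: ct_comp => //; exact: d_cont dh.
- by apply: ctM => //; exact: ct_comp.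
- by apply: ctM => //; exact: ct_comp.
- exact: pdv_comp1.
- exact: pdv_comp1.
Qed.

Lemma C1_fst : C1 (fun z : Pt R => z.1) (fun=> 1) (fun=> 0).
Proof. by split; try exact: ct_cst; [exact: ct_fst|by move=> w; exact: did|by move=> w; exact: dcst]. Qed.

Lemma C1_snd : C1 (fun z : Pt R => z.2) (fun=> 0) (fun=> 1).
Proof. by split; try exact: ct_cst; [exact: ct_snd|by move=> w; exact: dcst|by move=> w; exact: did]. Qed.

Lemma C1_chain u u1 u2 f f1 f2 g g1 g2 : C1 u u1 u2 -> C1 f f1 f2 -> C1 g g1 g2 ->
  C1 (fun z => u (f z, g z)) (fun z => u1 (f z, g z) * f1 z + u2 (f z, g z) * g1 z)
    (fun z => u1 (f z, g z) * f2 z + u2 (f z, g z) * g2 z).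
Proof.
move=> hu [cf cf1 cf2 p1 p2] [cg cg1 cg2 q1 q2]; have [cu cu1 cu2 _ _] := hu.
have cc (w : Pt R -> R) : continuous w -> continuous (fun z => w (f z, g z)).
  by move=> cw; exact: (ct_comp2 cw (ct_pair cf cg)).
split; [exact: cc|apply: ctD; apply: ctM => //; exact: cc|apply: ctD; apply: ctM => //; exact: cc
 |exact: pdv_chain|exact: pdv_chain].
Qed.


Lemma integrable_bx r f (cf : continuous f) : (@leb2 R).-integrable setT ((EFin \o f) \_ (bx r)).
Proof. by apply: (iffLR (integrable_mkcond _ _)); [exact: measurable_bx|exact: L1_cont]. Qed.

Lemma bint_xy r f : continuous f -> bint r f = lint (-r) r (fun x => lint (-r) r (fun y => f (x, y))).
Proof.
move=> cf; rewrite /bint /lint {1}/Rintegral [RHS]/Rintegral; congr fine.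
rewrite integral_mkcond; have h := integrable_bx r cf.
rewrite -(integral12_prod_meas1 h) [RHS]integral_mkcond; apply: eq_integral => x _.
rewrite /fubini_F [RHS]patchE; case: ifPn => [|/negP] xr; last first.
  rewrite integral0_eq// => y _; rewrite patchE; case: ifPn => // /set_mem /bxP[/= h1 _].
  by exfalso; apply: xr; apply/mem_set; rewrite /= in_itv/= -ler_norml.
rewrite /Rintegral fineK; last first.
  by apply: integrable_fin_num => //; apply: lint_L1; exact: (ct_comp2 cf (ct_upd false (x, 0))).
rewrite [RHS]integral_mkcond; apply: eq_integral => y _; rewrite !patchE.
have -> // : ((x, y) \in bx r) = (y \in `[-r, r]%classic).
apply/idP/idP => [/set_mem /bxP[_ /= h1]|/set_mem h1]; apply/mem_set.
  by rewrite /= in_itv/= -ler_norml.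
by move: xr h1 => /set_mem; rewrite /= !in_itv/= -!ler_norml => h2 h3; apply/bxP.
Qed.

Lemma bint_yx r f : continuous f -> bint r f = lint (-r) r (fun y => lint (-r) r (fun x => f (x, y))).
Proof.
move=> cf; rewrite /bint /lint {1}/Rintegral [RHS]/Rintegral; congr fine.
rewrite integral_mkcond; have h := integrable_bx r cf.
rewrite -(integral21_prod_meas1 h) [RHS]integral_mkcond; apply: eq_integral => x _.
rewrite /fubini_G [RHS]patchE; case: ifPn => [|/negP] xr; last first.
  rewrite integral0_eq// => y _; rewrite patchE; case: ifPn => // /set_mem /bxP[/= _ h1].
  by exfalso; apply: xr; apply/mem_set; rewrite /= in_itv/= -ler_norml.
rewrite /Rintegral fineK; last first.
  by apply: integrable_fin_num => //; apply: lint_L1; exact: (ct_comp2 cf (ct_upd true (0, x))).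
rewrite [RHS]integral_mkcond; apply: eq_integral => y _; rewrite !patchE.
have -> // : ((y, x) \in bx r) = (y \in `[-r, r]%classic).
apply/idP/idP => [/set_mem /bxP[/= h1 _]|/set_mem h1]; apply/mem_set.
  by rewrite /= in_itv/= -ler_norml.
by move: xr h1 => /set_mem; rewrite /= !in_itv/= -!ler_norml => h2 h3; apply/bxP.
Qed.

Lemma bint_dx r f f1 : 0 <= r -> pdv true f f1 -> continuous f1 ->
  bint r f1 = lint (-r) r (fun y => f (r, y) - f (-r, y)).
Proof.
move=> r0 h cf; rewrite bint_yx//; apply: eq_lint => y _.
have ab : -r <= r by lra.
exact: (FTC ab (fun x => pdv_upd h (0, y) x) (ct_comp2 cf (ct_upd true (0, y)))).
Qed.

Lemma bint_dy r f f2 : 0 <= r -> pdv false f f2 -> continuous f2 ->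
  bint r f2 = lint (-r) r (fun x => f (x, r) - f (x, -r)).
Proof.
move=> r0 h cf; rewrite bint_xy//; apply: eq_lint => x _.
have ab : -r <= r by lra.
exact: (FTC ab (fun y => pdv_upd h (x, 0) y) (ct_comp2 cf (ct_upd false (x, 0)))).
Qed.

(** Fubini and the fundamental theorem reduce the integral to values of [f] on the sides of [bx r],
    which lie outside the smaller square because [s < r] is strict. *)
Lemma bint_pdv0 b r s f f' : 0 <= s < r -> pdv b f f' -> continuous f' -> (forall z, ~ bx s z -> f z = 0) ->
  bint r f' = 0.
Proof.
move=> /andP[s0 sr] h cf f0; have r0 : 0 <= r by lra.
have zr (t : R) : lint (-r) r (fun=> 0) = 0 by rewrite lint_cst ?mul0r//; lra.
have nb (z : Pt R) : `|z.1| = r \/ `|z.2| = r -> f z = 0.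
  by move=> hz; apply: f0 => /bxP[h1 h2]; case: hz => hz; [move: h1|move: h2]; rewrite hz leNgt sr.
case: b h => h.
  rewrite (bint_dx r0 h)// -[RHS](zr 0); apply: eq_lint => y _.
  by rewrite !nb ?subrr//; left; rewrite /= ?normrN ger0_norm.
rewrite (bint_dy r0 h)// -[RHS](zr 0); apply: eq_lint => y _.
by rewrite !nb ?subrr//; right; rewrite /= ?normrN ger0_norm.
Qed.

Lemma bint_ibp b r s f g f' g' : 0 <= s < r -> pdv b f f' -> pdv b g g' ->
  continuous f -> continuous g -> continuous f' -> continuous g' ->
  (forall z, ~ bx s z -> f z = 0) -> bint r (fun z => f' z * g z) = - bint r (fun z => f z * g' z).
Proof.
move=> sr hf hg cf cg cf' cg' f0.
apply/eqP; rewrite -subr_eq0 opprK -bintD; [|apply/L1_cont/ctM..]; try by [].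
apply/eqP; apply: (bint_pdv0 sr (pdvM hf hg)).
  by apply: ctD; exact: ctM.
by move=> z bz; rewrite f0// mul0r.
Qed.

Lemma seg_le b f f' (z : Pt R) (s t : R) : s <= t -> pdv b f f' -> continuous f' ->
  `|f (upd b z t) - f (upd b z s)| <= lint s t (fun x => `|f' (upd b z x)|).
Proof.
move=> st h cf; have c := ct_comp2 cf (ct_upd b z).
rewrite -(FTC st (fun x => pdv_upd h z x) c); exact: lint_abs.
Qed.

End calculus3.

(** * Smooth bump functions on the line *)

Section bump.
Variable R : realType.
Implicit Types (f g : R -> R) (x t : R).

Lemma is_derive_near f g x a d : 0 < d -> (forall y, `|y - x| < d -> f y = g y) ->
  is_derive x 1 g a -> is_derive x 1 f a.
Proof.
move=> d0 fg /is_deriveP hg; apply/is_deriveP; apply: cvg_trans hg.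
apply: near_eq_cvg; near=> h.
have hd : `|h| < d by near: h; exact: dnbhs0_lt.
by rewrite !fg ?subrr ?normr0// addrK.
Unshelve. all: by end_near. Qed.

Lemma deriv_unique f x a b : is_derive x 1 f a -> is_derive x 1 f b -> a = b.
Proof. by move=> [_ <-] [_ <-]. Qed.

(** The family in [k] is closed under differentiation up to linear combinations, so smoothness of
    every member follows by induction on the order of differentiation. *)
Definition hk (k : nat) t : R := if 0 < t then (t^-1) ^+ k * expR (- t^-1) else 0.

Lemma hk_ge0 k t : 0 <= hk k t.
Proof. by rewrite /hk; case: ifP => // t0; rewrite mulr_ge0 ?expR_ge0// exprn_ge0// invr_ge0 ltW. Qed.

(** From [e^x >= (x/m)^m] with [m = k + 2], which is [e^y >= y] raised to the power [m]. The two
    surplus powers of [t] give derivative 0 at the junction point [t = 0]. *)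
Lemma hk_le k t : hk k t <= (k.+2)%:R ^+ k.+2 * t ^+ 2.
Proof.
rewrite /hk; case: ifPn => [t0|_]; last by apply: mulr_ge0; [apply: exprn_ge0|exact: sqr_ge0].
set m : R := k.+2%:R; have m0 : 0 < m by rewrite ltr0n.
have h : (t^-1 / m) ^+ k.+2 <= expR t^-1.
  have -> : expR t^-1 = expR (t^-1 / m) ^+ k.+2.
    by rewrite -expRM_natl; congr expR; rewrite -/m; field; rewrite !gt_eqF.
  have p0 : 0 <= t^-1 / m by rewrite divr_ge0 ?invr_ge0 ?ltW.
  rewrite lerXn2r ?nnegrE ?expR_ge0//.
  by apply: (le_trans _ (expR_ge1Dx _)); rewrite lerDr.
rewrite expRN ler_pdivrMr ?expR_gt0//.
have -> : t^-1 ^+ k = m ^+ k.+2 * t ^+ 2 * (t^-1 / m) ^+ k.+2.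
  rewrite expr_div_n -[in X in _ = _ * (X / _)]addn2 exprD.
  have Y0 : m ^+ k.+2 != 0 by rewrite expf_neq0// gt_eqF.
  move: (t^-1 ^+ k) (m ^+ k.+2) Y0 => X Y Y0.
  by field; rewrite Y0 gt_eqF.
by rewrite ler_wpM2l// mulr_ge0 ?exprn_ge0 ?sqr_ge0// ltW.
Qed.

Lemma hk_pos t : 0 < t -> 0 < hk 0 t.
Proof. by move=> t0; rewrite /hk t0 expr0 mul1r expR_gt0. Qed.

Lemma dinv x : x != 0 -> is_derive x 1 (fun t => t^-1) (- (x^-1) ^+ 2).
Proof.
move=> x0; apply: (deq (is_deriveV x0 (did x))).
by rewrite [_ *: _]mulr1 exprVn.
Qed.

Lemma dX f x a n : is_derive x 1 f a -> is_derive x 1 (fun t => f t ^+ n) (n%:R * f x ^+ n.-1 * a).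
Proof.
move=> hf; elim: n => [|n IH].
  rewrite mul0r mul0r; under eq_fun do rewrite expr0; exact: dcst.
under eq_fun do rewrite exprS.
apply: (deq (dM hf IH)) => /=.
case: n {IH} => [|n] /=; first by rewrite expr0; ring.
by rewrite exprS; rewrite -natr1; ring.
Qed.

Lemma dhk k t : is_derive t 1 (hk k) (hk k.+2 t - k%:R * hk k.+1 t).
Proof.
have [t0|t0|->] := ltgtP t 0.
- have -> : hk k.+2 t - k%:R * hk k.+1 t = 0.
    by rewrite /hk ltNge (ltW t0) /= mulr0 subrr.
  apply: (@is_derive_near _ (fun=> 0) _ _ (- t)); [lra|].
  move=> y; rewrite /hk ltr_norml => /andP[_ h]; rewrite ltNge.
  by have -> : y <= 0 by lra.
- have -> : hk k.+2 t - k%:R * hk k.+1 t =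
    (k%:R * (t^-1) ^+ k.-1 * (- (t^-1) ^+ 2)) * expR (- t^-1) + t^-1 ^+ k * (expR (- t^-1) * - (- (t^-1) ^+ 2)).
    rewrite /hk t0; case: k => [|k] /=; first by ring.
    by rewrite !exprS; ring.
  apply: (@is_derive_near _ (fun t => t^-1 ^+ k * expR (- t^-1)) _ _ t) => //.
    move=> y; rewrite /hk ltr_norml => /andP[h _].
    by have -> : 0 < y by lra.
  have di := dinv (lt0r_neq0 t0).
  exact: (dM (dX k di) (dcomp (is_derive_expR _) (dN di))).
- have -> : hk k.+2 0 - k%:R * hk k.+1 0 = 0 by rewrite /hk ltxx mulr0 subrr.
  apply: (@is_derive_quad _ _ _ _ ((k.+2)%:R ^+ k.+2)) => h.
  rewrite add0r mul0r subr0 {2}/hk ltxx subr0 ger0_norm ?hk_ge0//; exact: hk_le.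
Qed.

Fixpoint smn n f : Prop :=
  if n is m.+1 then exists2 f' : R -> R, (forall x, is_derive x 1 f (f' x)) & smn m f' else continuous f.

Lemma smnS n f : smn n.+1 f -> smn n f.
Proof.
elim: n f => [|n IH] f [f' d h]; first exact: d_cont d.
by exists f' => //; exact: IH.
Qed.

Lemma smnD n f g : smn n f -> smn n g -> smn n (fun t => f t + g t).
Proof.
elim: n f g => [|n IH] f g /=; first exact: ctD.
move=> [f' df hf] [g' dg hg]; exists (fun t => f' t + g' t); last exact: IH.
by move=> x; exact: dD.
Qed.

Lemma smnM n f g : smn n f -> smn n g -> smn n (fun t => f t * g t).
Proof.
elim: n f g => [|n IH] f g; first exact: ctM.
move=> hf0 hg0; have hf1 := smnS hf0; have hg1 := smnS hg0.
case: hf0 hg0 => f' df hf [g' dg hg]; exists (fun t => f' t * g t + f t * g' t).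
  by move=> x; exact: dM.
by apply: smnD; exact: IH.
Qed.

Lemma smn_cst n c : smn n (fun=> c).
Proof.
elim: n c => [|n IH] c; first exact: ct_cst.
by exists (fun=> 0) => // x; exact: dcst.
Qed.

Lemma smn_aff n f a b : smn n f -> smn n (fun t => f (a + b * t)).
Proof.
elim: n f => [|n IH] f /=.
  by move=> cf; apply: ct_comp => //; apply: ctD; [exact: ct_cst|apply: ctM; [exact: ct_cst|move=> ?; exact: cvg_id]].
move=> [f' df hf]; exists (fun t => f' (a + b * t) * b).
  move=> x; have h : is_derive x 1 (fun t => a + b * t) b.
    by apply: (deq (dD (dcst x a) (dM (dcst x b) (did x)))); ring.
  exact: (dcomp (df _) h).
by apply: smnM; [exact: IH|exact: smn_cst].
Qed.

Lemma smn_hk n k : smn n (hk k).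
Proof.
elim: n k => [|n IH] k; first exact: d_cont (dhk k).
exists (fun t => hk k.+2 t - k%:R * hk k.+1 t); first exact: dhk.
rewrite (_ : (fun t => _) = (fun t => hk k.+2 t + (- k%:R) * hk k.+1 t)).
  by apply: smnD => //; apply: smnM => //; exact: smn_cst.
by apply/funext => t; ring.
Qed.

Definition Cinf f := forall n, smn n f.

Lemma Cinf_cont f : Cinf f -> continuous f. Proof. by move=> /(_ 0%N). Qed.

(** Each order [n] comes with its own witness of a derivative; uniqueness of the derivative
    identifies them. *)
Lemma Cinf_derive f : Cinf f -> exists2 f', (forall x, is_derive x 1 f (f' x)) & Cinf f'.
Proof.
move=> h; have [f' d _] := h 1%N; exists f' => // n.
have [g dg hg] := h n.+1.
rewrite (_ : f' = g)//; apply/funext => x; exact: deriv_unique (d x) (dg x).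
Qed.

Lemma Cinf_aff f a b : Cinf f -> Cinf (fun t => f (a + b * t)).
Proof. by move=> h n; exact: smn_aff. Qed.

Definition Bp f := Cinf f /\ forall t, 1 < `|t| -> f t = 0.

Lemma Bp_derive f : Bp f -> exists2 f', (forall x, is_derive x 1 f (f' x)) & Bp f'.
Proof.
move=> [h f0]; have [f' d hf'] := Cinf_derive h; exists f' => //; split => // t t1.
apply: (deriv_unique (d t)); apply: (@is_derive_near _ (fun=> 0) _ _ (`|t| - 1)); [lra|].
move=> y yt; apply: f0.
by have := ler_distD y t 0; rewrite !subr0 distrC; lra.
Qed.

Lemma Bp_bounded f : Bp f -> exists2 M, 0 < M & forall t, `|f t| <= M.
Proof.
move=> [h f0].
have cf := Cinf_cont h; have [M M0 hM] := @cont_bounded_bx R (fun z => f z.1) 1 (ct_comp cf (@ct_fst R)).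
exists M => // t; have [t1|t1] := leP `|t| 1.
  by apply: (hM (t, 0)); apply/bxP; rewrite /= normr0 ler01.
by rewrite f0// normr0 ltW.
Qed.

Lemma Bp_lip f : Bp f -> exists2 M, 0 < M & forall s t, `|f s - f t| <= M * `|s - t|.
Proof.
move=> /Bp_derive[f' d /Bp_bounded[M M0 hM]]; exists M => // s t.
by have [c _ ->] := MVT_abs t s d; rewrite normrM ler_wpM2r.
Qed.

Lemma Bp_quad f f' : Bp f -> (forall x, is_derive x 1 f (f' x)) ->
  exists2 M, 0 < M & forall t h, `|f (t + h) - f t - f' t * h| <= M * h ^+ 2.
Proof.
move=> hf d; have [g dg hg] := Bp_derive hf.
have e : f' = g by apply/funext => x; exact: deriv_unique (d x) (dg x).
rewrite e {e d}; have [M M0 hM] := Bp_lip hg; exists M => // t h.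
have [c hc ->] := MVT_abs t (t + h) dg.
have {}hc : `|c - t| <= `|h| by move: hc; rewrite addrAC subrr add0r.
rewrite addrAC subrr add0r -mulrBl normrM -real_normK ?num_real// expr2 mulrA.
apply: ler_wpM2r => //; apply: (le_trans (hM _ _)); apply: ler_wpM2l => //; exact: ltW.
Qed.

(** The primitive is the integral from minus infinity, which exists for every upper limit because
    [f] has compact support. *)
Lemma antider f (M : R) : continuous f -> (forall t, M < `|t| -> f t = 0) ->
  exists F, forall x, is_derive x 1 F (f x).
Proof.
move=> cf f0; pose m1 := @lebesgue_measure R.
have mf : measT f by exact: continuous_measurable_fun.
have fi u : m1.-integrable [set` Interval -oo%O (BRight u)] (EFin \o f).
  have h : m1.-integrable setT ((EFin \o f) \_ `[-`|M|, `|M|]%classic).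
    by apply: (iffLR (integrable_mkcond _ _)) => //; exact: lint_L1.
  have h' : m1.-integrable `]-oo, u] ((EFin \o f) \_ `[-`|M|, `|M|]%classic).
    by apply: integrableS h.
  apply: eq_integrable h' => // t _; rewrite patchE; case: ifPn => // /negP tM.
  rewrite /= f0// ltNge; apply/negP => tM'; apply: tM; apply/mem_set.
  by rewrite /= in_itv/= -ler_norml (le_trans tM')// ler_norm.
exists (fun x => \int[m1]_(t in [set` Interval -oo%O (BRight x)]) f t)%R => x.
have xu : x < x + 1 by lra.
have [h1 h2] := continuous_FTC1 xu (fi _) (ltNyr _) (cf x).
by apply: DeriveDef; [exact: h1|rewrite -derive1E; exact: h2].
Qed.

(** The normalizing constant is the increment of a primitive of the bump, positive by the mean value
    theorem; the mass of [rho] is therefore recorded as the increment of a primitive [W]. *)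
Lemma mollifier1 : exists rho, [/\ Bp rho, forall t, 0 <= rho t,
  exists2 W : R -> R, (forall x, is_derive x 1 W (rho x)) & W 1 - W (-1) = 1 & forall t, rho (- t) = rho t].
Proof.
(* Positive exactly on []-1, 1[] and even; the arguments are written in the affine form that
   [smn_aff] expects. *)
pose b t := hk 0 (1 + 1 * t) * hk 0 (1 + (-1) * t).
have cb : Cinf b by move=> n; apply: smnM; apply: smn_aff; exact: smn_hk.
have b0 t : 1 < `|t| -> b t = 0.
  rewrite /b /hk => t1; case: ifPn => [t2|]; last by rewrite mul0r.
  case: ifPn => [t3|]; last by rewrite mulr0.
  by move: t1; rewrite ltNge ler_norml; have -> : - 1 <= t <= 1 by lra.
have [V dV] := antider (Cinf_cont cb) b0.
have [c cI e] := @MVT R V b (-1) 1 ltac:(lra) (fun x _ => dV x) (continuous_subspaceT (d_cont dV)).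
have bc : 0 < b c by move: cI; rewrite in_itv/= => /andP[c1 c2]; rewrite mulr_gt0// hk_pos//; lra.
pose Z := V 1 - V (-1); have Z0 : 0 < Z by rewrite /Z e; apply: mulr_gt0 => //; lra.
exists (fun t => Z^-1 * b t); split.
- split; first by move=> n; apply: smnM; [exact: smn_cst|exact: cb].
  by move=> t t1; rewrite b0// mulr0.
- move=> t; apply: mulr_ge0; first by rewrite invr_ge0 ltW.
  by apply: mulr_ge0; exact: hk_ge0.
- exists (fun t => Z^-1 * V t); last by rewrite -mulrBr -/Z mulVf// gt_eqF.
  by move=> x; apply: (deq (dM (dcst x Z^-1) (dV x))); ring.
- by move=> t; congr (_ * _); rewrite /b mulrC; congr (hk 0 _ * hk 0 _); ring.
Qed.

End bump.

(** * Test functions of product form *)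

Section test_functions.
Variable R : realType.
Implicit Types (f g : R -> R).

(** Iterated partial derivatives of a product of one-variable smooth functions are again such
    products, so induction on the multi-index stays within the class. *)
Lemma test_prod f g (e : R) : Cinf f -> Cinf g -> (forall t, e < `|t| -> f t = 0) -> (forall t, e < `|t| -> g t = 0) ->
  test_fun (fun z : Pt R => f z.1 * g z.2).
Proof.
move=> hf hg f0 g0; split; last first.
  exists (2 * `|e|) => x hx.
  have [h1|h1] := ltP e `|x.1|; first by rewrite f0// mul0r.
  have [h2|h2] := ltP e `|x.2|; first by rewrite g0// mulr0.
  move: hx; rewrite ltNge /cabs; case/negP.
  have e0 : 0 <= e by apply: le_trans h1; exact: normr_ge0.
  rewrite ger0_norm// -[leRHS]ger0_norm ?mulr_ge0// -sqrtr_sqr ler_wsqrtr//.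
  have s1 : x.1 ^+ 2 <= e ^+ 2 by rewrite -real_normK ?num_real// lerXn2r ?nnegrE.
  have s2 : x.2 ^+ 2 <= e ^+ 2 by rewrite -real_normK ?num_real// lerXn2r ?nnegrE.
  have := sqr_ge0 e; nra.
move=> s.
have : exists f' g', [/\ Cinf f', Cinf g' & iter_pd s (fun z : Pt R => f z.1 * g z.2) = (fun z => f' z.1 * g' z.2)].
  elim: s => [|b s [f' [g' [hf' hg' e1]]]] /=; first by exists f, g.
  rewrite [iter_pd s _]e1 {e1}.
  have [f'' df hf''] := Cinf_derive hf'; have [g'' dg hg''] := Cinf_derive hg'.
  case: b.
    exists f'', g'; split => //.
    have p : pdv true (fun z : Pt R => f' z.1 * g' z.2) (fun z => f'' z.1 * g' z.2).
      by move=> z; apply: (deq (dM (df _) (dcst _ (g' z.2)))); rewrite mulr0 addr0.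
    by have [] := pd_pdv p.
  exists f', g''; split => //.
  have p : pdv false (fun z : Pt R => f' z.1 * g' z.2) (fun z => f' z.1 * g'' z.2).
    by move=> z; apply: (deq (dM (dcst _ (f' z.1)) (dg _))); rewrite mul0r add0r.
  by have [] := pd_pdv p.
move=> [f' [g' [hf' hg' ->]]].
have [f'' df _] := Cinf_derive hf'; have [g'' dg _] := Cinf_derive hg'.
split.
  apply: ctM; apply: ct_comp; [exact: Cinf_cont|exact: ct_fst|exact: Cinf_cont|exact: ct_snd].
case=> x.
  have p : pdv true (fun z : Pt R => f' z.1 * g' z.2) (fun z => f'' z.1 * g' z.2).
    by move=> z; apply: (deq (dM (df _) (dcst _ (g' z.2)))); rewrite mulr0 addr0.
  by have [_] := pd_pdv p; exact.
have p : pdv false (fun z : Pt R => f' z.1 * g' z.2) (fun z => f' z.1 * g'' z.2).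
  by move=> z; apply: (deq (dM (dcst _ (f' z.1)) (dg _))); rewrite mul0r add0r.
by have [_] := pd_pdv p; exact.
Qed.

End test_functions.

(** * Convolution with compactly supported kernels *)

Section convolution.
Variable R : realType.
Local Notation m2 := (@leb2 R).
Implicit Types (F D k : Pt R -> R) (x y z : Pt R) (r : R).

Lemma near_norm x (e : R) : 0 < e -> \forall x' \near x, `|x - x'| < e.
Proof. by move=> e0; apply/nbhs_ballP; exists e => // y; rewrite -ball_normE. Qed.

Definition Lloc F := measT F /\ forall r, L1 r F.

Lemma Lloc_cont F : continuous F -> Lloc F.
Proof. by move=> cF; split; [exact: measurable_cont2|move=> r; exact: L1_cont]. Qed.

Definition Ker k := [/\ continuous k, forall z, 1 < `|z| -> k z = 0 &
  exists2 L, 0 < L & forall z w, `|k z - k w| <= L * `|z - w|].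

Definition cv F k x : R := (\int[m2]_y (F y * k (x - y)))%R.

Lemma ct_shift k x : continuous k -> continuous (fun y => k (x - y)).
Proof.
move=> ck; apply: (ct_comp2 ck) => y.
by apply: cvgB; [exact: cvg_cst|exact: cvg_id].
Qed.

Lemma cv_bint F k x r : Ker k -> `|x| + 1 <= r -> cv F k x = bint r (fun y => F y * k (x - y)).
Proof.
move=> [_ k0 _] xr; rewrite /cv /bint [RHS]Rintegral_mkcond; apply: eq_Rintegral => y _.
rewrite patchE; case: ifPn => // /negP yr; rewrite k0 ?mulr0// ltNge; apply/negP => h.
apply: yr; apply/mem_set; rewrite /bx /=.
have := ler_distD x y 0; rewrite !subr0 distrC; lra.
Qed.

Lemma L1_ker F k x r : Lloc F -> Ker k -> L1 r (fun y => F y * k (x - y)).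
Proof.
move=> [_ hF] [ck _ _]; apply: (@eq_L1 _ _ (fun y => k (x - y) * F y)) => [z _|]; first by rewrite mulrC.
by apply: L1Mc => //; exact: ct_shift.
Qed.

Lemma cv_cont F k : Lloc F -> Ker k -> continuous (cv F k).
Proof.
move=> hF hk; have [ck k0 [L L0 hL]] := hk.
move=> x; set r := `|x| + 2; pose C := bint r (fun y => `|F y|).
have C0 : 0 <= C by apply: bint_ge0.
apply/cvgrPdist_le => e e0; near=> x'.
have x1 : `|x - x'| < 1 by near: x'; exact: near_norm.
have xe : `|x - x'| < e / (L * (C + 1)).
  near: x'; apply: near_norm; rewrite divr_gt0// mulr_gt0//; lra.
have hx' : `|x'| + 1 <= r.
  by have := ler_distD x x' 0; rewrite !subr0 distrC /r; lra.
rewrite (@cv_bint F k x r)//; last by rewrite /r; lra.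
rewrite (@cv_bint F k x' r)//.
rewrite -bintB; [|exact: L1_ker|exact: L1_ker].
have Lb : L1 r (fun y => F y * k (x - y) - F y * k (x' - y)) by apply: L1B; exact: L1_ker.
apply: (le_trans (bint_abs Lb)).
apply: (@le_trans _ _ (L * `|x - x'| * C)).
  rewrite -bintZ; last by apply: L1_abs; case: hF.
  apply: le_bint; [exact: L1_abs|by apply: L1Z; apply: L1_abs; case: hF|].
  move=> y _; rewrite -mulrBr normrM mulrC; apply: ler_wpM2r => //.
  by apply: (le_trans (hL _ _)); rewrite opprB addrA subrK.
move: xe; rewrite ltr_pdivlMr; last by apply: mulr_gt0 => //; lra.
have : 0 <= L * `|x - x'| by rewrite mulr_ge0// ltW.
by have := normr_ge0 (x - x'); nra.
Unshelve. all: by end_near. Qed.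

Lemma upd_shift b z h : upd b z (crd b z + h) = z + (if b then (h, 0) else (0, h)).
Proof. by case: b; case: z => z1 z2; apply: injective_projections => /=; rewrite ?addr0. Qed.

(** A second-order bound on [k] uniform in the point replaces dominated convergence: differentiating
    under the integral costs [M h^2] times the L^1 norm of [F] on a fixed square. *)
Lemma cv_pdv b F k k' M : Lloc F -> Ker k -> Ker k' -> 
  (forall z h, `|k (upd b z (crd b z + h)) - k z - k' z * h| <= M * h ^+ 2) ->
  pdv b (cv F k) (cv F k').
Proof.
move=> hF hk hk' hM x; pose E (h : R) : Pt R := if b then (h, 0) else (0, h).
set r := `|x| + 2; pose C := bint r (fun y => `|F y|).
have C0 : 0 <= C by apply: bint_ge0.
have M0 : 0 <= M by have := le_trans (normr_ge0 _) (hM 0 1); rewrite expr1n mulr1.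
have NE h : `|E h| = `|h|.
  rewrite /E; case: b {hM E}; rewrite prod_normE/= normr0.
    by rewrite max_l.
  by rewrite max_r.
apply: is_derive_lin => e e0.
exists (Num.min 1 (e / (M * C + 1))).
  by rewrite lt_min ltr01 divr_gt0// ltr_wpDl ?mulr_ge0.
move=> h /andP[h0]; rewrite lt_min => /andP[h1 he].
rewrite upd_crd upd_shift -/(E h).
have hx' : `|x + E h| + 1 <= r.
  by have := ler_normD x (E h); rewrite NE /r; lra.
rewrite (@cv_bint F k x r)//; last by rewrite /r; lra.
rewrite (@cv_bint F k' x r)//; last by rewrite /r; lra.
rewrite (@cv_bint F k (x + E h) r)//.
rewrite mulrC -bintZ; last exact: L1_ker.
rewrite -bintB; [|exact: L1_ker|exact: L1_ker].
rewrite -bintB; [|by apply: L1B; exact: L1_ker|by apply: L1Z; exact: L1_ker].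
have Lb : L1 r (fun y => F y * k (x + E h - y) - F y * k (x - y) - h * (F y * k' (x - y))).
  by apply: L1B; [apply: L1B; exact: L1_ker|apply: L1Z; exact: L1_ker].
apply: (le_trans (bint_abs Lb)).
apply: (@le_trans _ _ (M * h ^+ 2 * C)).
  rewrite -bintZ; last by apply: L1_abs; case: hF.
  apply: le_bint; [exact: L1_abs|by apply: L1Z; apply: L1_abs; case: hF|].
  move=> y _; have := hM (x - y) h; rewrite upd_shift -/(E h).
  have -> : x - y + E h = x + E h - y by rewrite addrAC.
  set u := k _; set v := k _; set w := k' _ => H.
  have -> : F y * u - F y * v - h * (F y * w) = F y * (u - v - w * h) by ring.
  by rewrite normrM mulrC; apply: ler_wpM2r.
move: he; rewrite ltr_pdivlMr ?ltr_wpDl ?mulr_ge0//.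
rewrite -(real_normK (num_real h)); have := normr_ge0 h; have := mulr_ge0 M0 C0; nra.
Qed.

Definition prodk (a c : R -> R) z := a z.1 * c z.2.

Lemma norm_fst (z : Pt R) : `|z.1| <= `|z|.
Proof. by rewrite prod_normE le_max lexx. Qed.

Lemma norm_snd (z : Pt R) : `|z.2| <= `|z|.
Proof. by rewrite prod_normE le_max lexx orbT. Qed.

Lemma norm_pair_le (z : Pt R) M : `|z.1| <= M -> `|z.2| <= M -> `|z| <= M.
Proof. by move=> h1 h2; rewrite prod_normE ge_max h1. Qed.

Lemma Ker_prod a c : Bp a -> Bp c -> Ker (prodk a c).
Proof.
move=> ha hc; split.
- apply: ctM; apply: ct_comp; [exact: Cinf_cont ha.1|exact: ct_fst|exact: Cinf_cont hc.1|exact: ct_snd].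
- move=> z z1; rewrite /prodk; have [h1|h1] := ltP 1 `|z.1|; first by rewrite ha.2// mul0r.
  have [h2|h2] := ltP 1 `|z.2|; first by rewrite hc.2// mulr0.
  by move: z1; rewrite ltNge norm_pair_le.
have [Ma Ma0 hMa] := Bp_bounded ha; have [Mc Mc0 hMc] := Bp_bounded hc.
have [La La0 hLa] := Bp_lip ha; have [Lc Lc0 hLc] := Bp_lip hc.
exists (La * Mc + Ma * Lc); first by rewrite addr_gt0// mulr_gt0.
move=> z w; rewrite /prodk.
have -> : a z.1 * c z.2 - a w.1 * c w.2 = (a z.1 - a w.1) * c z.2 + a w.1 * (c z.2 - c w.2) by ring.
apply: (le_trans (ler_normD _ _)); rewrite !normrM mulrDl; apply: lerD.
  rewrite mulrAC; apply: ler_pM => //.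
  by apply: (le_trans (hLa _ _)); apply: ler_wpM2l; [exact: ltW|exact: (norm_fst (z - w))].
rewrite -mulrA; apply: ler_pM => //.
by apply: (le_trans (hLc _ _)); apply: ler_wpM2l; [exact: ltW|exact: (norm_snd (z - w))].
Qed.

Lemma cv_dx F a a' c : Lloc F -> Bp a -> Bp a' -> Bp c -> (forall t : R, is_derive t 1 a (a' t)) ->
  pdv true (cv F (prodk a c)) (cv F (prodk a' c)).
Proof.
move=> hF ha ha' hc d; have [M M0 hM] := Bp_quad ha d; have [Mc Mc0 hMc] := Bp_bounded hc.
apply: (@cv_pdv _ _ _ _ (M * Mc)) => //; try exact: Ker_prod.
move=> z h; rewrite /prodk /=.
have -> : a (z.1 + h) * c z.2 - a z.1 * c z.2 - a' z.1 * c z.2 * h = (a (z.1 + h) - a z.1 - a' z.1 * h) * c z.2 by ring.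
by rewrite normrM mulrAC; apply: ler_pM.
Qed.

Lemma cv_dy F a c c' : Lloc F -> Bp a -> Bp c -> Bp c' -> (forall t : R, is_derive t 1 c (c' t)) ->
  pdv false (cv F (prodk a c)) (cv F (prodk a c')).
Proof.
move=> hF ha hc hc' d; have [M M0 hM] := Bp_quad hc d; have [Mc Mc0 hMc] := Bp_bounded ha.
apply: (@cv_pdv _ _ _ _ (M * Mc)) => //; try exact: Ker_prod.
move=> z h; rewrite /prodk /=.
have -> : a z.1 * c (z.2 + h) - a z.1 * c z.2 - a z.1 * c' z.2 * h = (c (z.2 + h) - c z.2 - c' z.2 * h) * a z.1 by ring.
by rewrite normrM mulrAC; apply: ler_pM.
Qed.

Lemma CinfN a (x : R) : Cinf a -> Cinf (fun t => a (x - t)).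
Proof.
move=> ha; rewrite (_ : (fun t => a (x - t)) = (fun t => a (x + (-1) * t))); first exact: Cinf_aff.
by apply/funext => t; rewrite mulN1r.
Qed.

Lemma test_ker a c x : Bp a -> Bp c -> test_fun (fun y => prodk a c (x - y)).
Proof.
move=> [ha a0] [hc c0].
apply: (@test_prod _ (fun t => a (x.1 - t)) (fun t => c (x.2 - t)) (`|x| + 1)); try exact: CinfN.
  move=> t ht; apply: a0; have := norm_fst x; have := ler_distD x.1 t 0; rewrite !subr0 distrC; lra.
move=> t ht; apply: c0; have := norm_snd x; have := ler_distD x.2 t 0; rewrite !subr0 distrC; lra.
Qed.

(** The function [y -> k (x - y)] is itself the test function, and the sign of its derivative in [y]
    cancels the sign in [weak_pd]. *)
Lemma cv_weak_gen b F D k k' x : Lloc F -> Ker k -> Ker k' -> test_fun (fun y => k (x - y)) ->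
  pdv b (fun y => k (x - y)) (fun y => - k' (x - y)) -> weak_pd b F D -> cv F k' x = cv D k x.
Proof.
move=> hF hk hk' ht hp /(_ _ ht); have [-> _] := pd_pdv hp => hw.
have e1 : (\int[m2]_y (F y * - k' (x - y)))%R = - cv D k x.
  by rewrite /cv /Rintegral hw fineN.
apply: oppr_inj; rewrite -e1 (@cv_bint F k' x (`|x| + 1))// -bintN; last exact: L1_ker.
have hkn : Ker (fun z => - k' z).
  case: hk' => ck k0 [L L0 hL]; split; first exact: ctN.
    by move=> z /k0 ->; rewrite oppr0.
  by exists L => // z w; rewrite -opprD normrN.
apply: (etrans _ (esym (@cv_bint F (fun z => - k' z) x _ hkn (lexx _)))).
by apply: eq_bint => y _; rewrite mulrN.
Qed.

Lemma cv_weakx F D a a' c x : Lloc F -> Bp a -> Bp a' -> Bp c -> (forall t : R, is_derive t 1 a (a' t)) ->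
  weak_pd true F D -> cv F (prodk a' c) x = cv D (prodk a c) x.
Proof.
move=> hF ha ha' hc d; apply: cv_weak_gen => //; try exact: Ker_prod; first exact: test_ker.
move=> y /=.
have h : is_derive y.1 1 (fun t => x.1 - t) (-1).
  by apply: (deq (dB (dcst y.1 x.1) (did y.1))); rewrite sub0r.
have := dM (@dcomp _ a (fun t => x.1 - t) y.1 _ _ (d _) h) (dcst y.1 (c (x.2 - y.2))).
move=> H; apply: (deq H); rewrite /prodk /=; ring.
Qed.

Lemma cv_weaky F D a c c' x : Lloc F -> Bp a -> Bp c -> Bp c' -> (forall t : R, is_derive t 1 c (c' t)) ->
  weak_pd false F D -> cv F (prodk a c') x = cv D (prodk a c) x.
Proof.
move=> hF ha hc hc' d; apply: cv_weak_gen => //; try exact: Ker_prod; first exact: test_ker.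
move=> y /=.
have h : is_derive y.2 1 (fun t => x.2 - t) (-1).
  by apply: (deq (dB (dcst y.2 x.2) (did y.2))); rewrite sub0r.
have := dM (dcst y.2 (a (x.1 - y.1))) (@dcomp _ c (fun t => x.2 - t) y.2 _ _ (d _) h).
move=> H; apply: (deq H); rewrite /prodk /=; ring.
Qed.

End convolution.

(** * Mollifiers: uniform convergence and L^2 bounds *)

Section mollification.
Variable R : realType.
Implicit Types (F D k : Pt R -> R) (x y z : Pt R) (r : R).

Definition L2loc' F := measT F /\ forall r, L2 r F.

Lemma L2loc_Lloc F : L2loc' F -> Lloc F.
Proof. by move=> [mF hF]; split => // r; exact: L2_L1. Qed.

(** Only [x] is confined to the square, while [y] may leave it. The proof uses compactness in its
    near-covering form, with the radius as the filter variable. *)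
Lemma unif_cont_bx F r (e : R) : continuous F -> 0 < e ->
  exists2 d, 0 < d & forall x y, bx r x -> `|x - y| < d -> `|F x - F y| <= e.
Proof.
move=> cF e0; have /compact_near_coveringP nc := @compact_bx R r.
have := nc R (0:R)^'+ (fun d x => forall y, `|x - y| < d -> `|F x - F y| <= e) _.
case.
  move=> x _.
  have /cvgrPdist_lt /(_ (e / 2) ltac:(lra)) := cF x.
  rewrite near_simpl => /nbhs_ballP[d /= d0 hd].
  exists (ball x (d / 2), [set t : R | 0 < t < d / 2]); first split => /=.
  - by apply: nbhsx_ballx; lra.
  - near=> t; apply/andP; split; near: t; [exact: nbhs_right_gt|apply: nbhs_right_lt; lra].
  move=> [x' t] /= [xx' /andP[t0 td]] y xy.
  move: xx'; rewrite -ball_normE /= => xx'.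
  have h1 : `|F x - F x'| < e / 2 by apply: hd; rewrite -ball_normE /=; lra.
  have h2 : `|F x - F y| < e / 2.
    by apply: hd; rewrite -ball_normE /=; have := ler_distD x' x y; lra.
  by have := ler_distD (F x) (F x') (F y); rewrite (distrC (F x') (F x)); lra.
move=> V V0 hV; exists (V / 2); first by rewrite divr_gt0.
move=> x y bx' xy; apply: (hV (V / 2)) => //=.
  by rewrite sub0r normrN ger0_norm; [move: V0 => /=; lra|move: V0 => /=; lra].
by rewrite divr_gt0.
Unshelve. all: by end_near. Qed.

Section sequence.
Variables (rho W : R -> R).
Hypotheses (hrho : Bp rho) (rho0 : forall t, 0 <= rho t) (dW : forall t : R, is_derive t 1 W (rho t))
  (W1 : W 1 - W (-1) = 1) (rhoN : forall t, rho (- t) = rho t).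

Definition rn n t : R := n.+1%:R * rho (n.+1%:R * t).

Lemma rn_supp n t : (n.+1%:R)^-1 < `|t| -> rn n t = 0.
Proof.
move=> ht; rewrite /rn hrho.2 ?mulr0// normrM ger0_norm// mulrC -ltr_pdivrMr ?ltr0n//.
by rewrite div1r.
Qed.

Lemma Bp_rn n : Bp (rn n).
Proof.
split; last first.
  move=> t t1; apply: rn_supp; apply: le_lt_trans t1.
  by rewrite invf_le1 ?ltr0n// ler1n.
move=> m; apply: smnM; first exact: smn_cst.
rewrite (_ : (fun t => _) = (fun t => rho (0 + n.+1%:R * t))); first exact/smn_aff/hrho.1.
by apply/funext => t; rewrite add0r.
Qed.

Lemma rn_ge0 n t : 0 <= rn n t. Proof. by rewrite mulr_ge0. Qed.

Lemma rnN n t : rn n (- t) = rn n t. Proof. by rewrite /rn mulrN rhoN. Qed.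

Lemma W_const s : (1 <= s -> W s = W 1) /\ (s <= -1 -> W s = W (-1)).
Proof.
split; rewrite le_eqVlt => /orP[/eqP e|lt]; rewrite ?e//.
- have [c] := @MVT R W rho 1 s lt (fun u _ => dW u) (continuous_subspaceT (d_cont dW)).
  rewrite in_itv/= => /andP[c1 _].
  by rewrite hrho.2 ?mul0r; [move/eqP; rewrite subr_eq0 => /eqP|rewrite ger0_norm//; lra].
- have [c] := @MVT R W rho s (-1) lt (fun u _ => dW u) (continuous_subspaceT (d_cont dW)).
  rewrite in_itv/= => /andP[_ c1].
  by rewrite hrho.2 ?mul0r; [move/eqP; rewrite subr_eq0 => /eqP|rewrite ler0_norm; lra].
Qed.

Lemma lint_rn n (x r : R) : `|x| + 1 <= r -> lint (-r) r (fun t => rn n (x - t)) = 1.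
Proof.
move=> xr; set N : R := n.+1%:R; have N1 : 1 <= N by rewrite ler1n.
have dd t : is_derive (t : R) 1 (fun t => - W (N * (x - t))) (rn n (x - t)).
  have h : is_derive t 1 (fun t => N * (x - t)) (- N).
    by apply: (deq (dM (dcst t N) (dB (dcst t x) (did t)))); ring.
  apply: (deq (dN (@dcomp _ W (fun t => N * (x - t)) t _ _ (dW _) h))).
  by rewrite /rn -/N; ring.
have xr' : - (r - 1) <= x <= r - 1 by rewrite -ler_norml; lra.
have rr : -r <= r by have := normr_ge0 x; lra.
have cr : continuous (fun t => rn n (x - t)).
  apply: ct_comp; first exact: Cinf_cont (Bp_rn n).1.
  by apply: ctB; [exact: ct_cst|move=> ?; exact: cvg_id].
rewrite (FTC rr dd cr).
rewrite (W_const (N * (x - r))).2; last by nra.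
rewrite (W_const (N * (x - - r))).1; last by nra.
by rewrite opprK addrC.
Qed.

Definition kn n : Pt R -> R := prodk (rn n) (rn n).

Lemma kn_ge0 n z : 0 <= kn n z. Proof. by rewrite mulr_ge0// rn_ge0. Qed.

Lemma Ker_kn n : Ker (kn n). Proof. by apply: Ker_prod; exact: Bp_rn. Qed.

Lemma knN n z : kn n (- z) = kn n z. Proof. by rewrite /kn /prodk /= !rnN. Qed.

Lemma kn_supp n z : (n.+1%:R)^-1 < `|z| -> kn n z = 0.
Proof.
move=> z1; rewrite /kn /prodk; have [h1|h1] := ltP (n.+1%:R)^-1 `|z.1|; first by rewrite rn_supp// mul0r.
have [h2|h2] := ltP (n.+1%:R)^-1 `|z.2|; first by rewrite (rn_supp h2)// mulr0.
by move: z1; rewrite ltNge norm_pair_le.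
Qed.

Lemma bint_kn n x r : `|x| + 1 <= r -> bint r (fun y => kn n (x - y)) = 1.
Proof.
move=> xr; have [ck _ _] := Ker_kn n.
have r0 : 0 <= r by have := normr_ge0 x; lra.
rewrite bint_xy; last exact: ct_shift.
have h1 : `|x.1| + 1 <= r by have := norm_fst x; lra.
have h2 : `|x.2| + 1 <= r by have := norm_snd x; lra.
transitivity (lint (-r) r (fun t => rn n (x.1 - t))); last exact: lint_rn.
apply: eq_lint => t _; rewrite -[RHS]mulr1 -(lint_rn n h2) /lint -RintegralZl//.
apply: lint_L1; apply: ct_comp; first exact: Cinf_cont (Bp_rn n).1.
by apply: ctB; [exact: ct_cst|move=> ?; exact: cvg_id].
Qed.

Lemma bint_kn_le1 n y r : bint r (fun x => kn n (x - y)) <= 1.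
Proof.
pose s := Num.max r (`|y| + 1).
have [ck _ _] := Ker_kn n.
have e x : kn n (x - y) = kn n (y - x) by rewrite -knN opprB.
rewrite (@eq_bint _ _ _ (fun x => kn n (y - x))) => [|x _]; last exact: e.
rewrite -(@bint_kn n y s); last by rewrite /s le_max lexx orbT.
apply: le_bint_bx; [by rewrite /s le_max lexx|apply: L1_cont; exact: ct_shift|move=> z; exact: kn_ge0].
Qed.

Lemma cv_unif F r (e : R) : continuous F -> 0 < e ->
  exists N, forall n x, (N <= n)%N -> bx r x -> `|cv F (kn n) x - F x| <= e.
Proof.
move=> cF e0; have [d d0 hd] := unif_cont_bx r cF e0.
exists (Num.bound d^-1) => n x Nn bx'.
set s := `|x| + 1.
have L : L1 s (fun y => kn n (x - y)) by apply: L1_cont; apply: ct_shift; have [] := Ker_kn n.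
rewrite (@cv_bint _ _ _ _ s)//; last exact: Ker_kn.
rewrite -[F x]mulr1 -(@bint_kn n x s)// -bintZ//.
have LF : L1 s (fun y => F y * kn n (x - y)) by apply: L1_ker; [exact: Lloc_cont|exact: Ker_kn].
rewrite -bintB//; last exact: L1Z.
have Lb : L1 s (fun y => F y * kn n (x - y) - F x * kn n (x - y)) by apply: L1B => //; exact: L1Z.
apply: (le_trans (bint_abs Lb)).
rewrite -[leRHS]mulr1 -(@bint_kn n x s)// -bintZ//.
apply: le_bint; [exact: L1_abs|exact: L1Z|] => y _.
rewrite -mulrBl normrM [X in _ * X]ger0_norm ?kn_ge0//.
have [h|h] := ltP `|x - y| d.
  by apply: ler_wpM2r; [exact: kn_ge0|rewrite distrC; exact: hd].
rewrite kn_supp ?mulr0//; apply: lt_le_trans h.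
rewrite invf_plt ?posrE ?ltr0n//.
apply: (lt_le_trans (archi_boundP _)); first by rewrite invr_ge0 ltW.
by rewrite ler_nat; apply: leqW.
Qed.

(** Nonnegativity of the variance of [F] for the probability density [kn n (x - y)]. *)
Lemma cv_jensen F n x s : L2loc' F -> `|x| + 1 <= s ->
  cv F (kn n) x ^+ 2 <= bint s (fun y => F y ^+ 2 * kn n (x - y)).
Proof.
move=> hF xs; set m := cv F (kn n) x.
have em : m = bint s (fun y => F y * kn n (x - y)) by apply: cv_bint => //; exact: Ker_kn.
have hk := Ker_kn n; have [ck _ _] := hk.
have L0 : L1 s (fun y => kn n (x - y)) by apply: L1_cont; exact: ct_shift.
have L1' : L1 s (fun y => F y * kn n (x - y)) by apply: L1_ker => //; exact: L2loc_Lloc.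
have L2' : L1 s (fun y => F y ^+ 2 * kn n (x - y)).
  apply: (@eq_L1 _ _ (fun y => kn n (x - y) * sq F y)) => [z _|]; first by rewrite mulrC.
  by apply: L1Mc; [exact: ct_shift|case: (hF.2 s)].
have : 0 <= bint s (fun y => (F y - m) ^+ 2 * kn n (x - y)).
  by apply: bint_ge0 => y _; rewrite mulr_ge0 ?sqr_ge0 ?kn_ge0.
have -> : bint s (fun y => (F y - m) ^+ 2 * kn n (x - y)) =
   bint s (fun y => F y ^+ 2 * kn n (x - y)) + m ^+ 2 * 1 - 2 * m * m.
  have -> : m ^+ 2 * 1 = bint s (fun y => m ^+ 2 * kn n (x - y)) by rewrite bintZ// bint_kn.
  have -> : 2 * m * m = bint s (fun y => (2 * m) * (F y * kn n (x - y))) by rewrite bintZ// -em.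
  rewrite -bintD//; last exact: L1Z.
  rewrite -bintB; [|by apply: L1D => //; exact: L1Z|exact: L1Z].
  by apply: eq_bint => y _; ring.
by rewrite mulr1; nra.
Qed.

(** Jensen at each point, then Tonelli: integrated in its other variable over a square, the
    mollifier has mass at most 1. The square grows by 1, which bounds the support of every
    [kn n]. *)
Lemma cv_N2 F n r : L2loc' F -> N2 r (cv F (kn n)) <= N2 (r + 1) F.
Proof.
move=> hF; rewrite /N2 ler_wsqrtr//.
have hk := Ker_kn n; have [ck _ _] := hk.
have ccv : continuous (cv F (kn n)) by apply: cv_cont => //; exact: L2loc_Lloc.
have LF : L1 (r + 1) (sq F) by case: (hF.2 (r + 1)).
have mF : measT (sq F) by apply: measurable_funX; exact: hF.1.
rewrite -lee_fin EFin_bint; last by case: (L2_cont r ccv).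
rewrite EFin_bint// !lebmE.
pose G (p : Pt R * Pt R) : \bar R :=
  (\1_(bx r) p.1 * (\1_(bx (r + 1)) p.2 * (sq F p.2 * kn n (p.1 - p.2))))%:E.
have mkn : measT (fun p : Pt R * Pt R => kn n (p.1 - p.2)).
  have h1 : measT (rn n).
    by apply: continuous_measurable_fun; exact: Cinf_cont (Bp_rn n).1.
  apply: measurable_funM; apply: (measurableT_comp h1); apply: measurable_funB.
  - exact: (measurableT_comp measurable_fst measurable_fst).
  - exact: (measurableT_comp measurable_fst measurable_snd).
  - exact: (measurableT_comp measurable_snd measurable_fst).
  - exact: (measurableT_comp measurable_snd measurable_snd).
have mG : measT G.
  apply/measurable_EFinP; apply: measurable_funM.
    by apply: (measurableT_comp _ measurable_fst); apply: measurable_indic; exact: measurable_bx.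
  apply: measurable_funM.
    by apply: (measurableT_comp _ measurable_snd); apply: measurable_indic; exact: measurable_bx.
  by apply: measurable_funM => //; apply: (measurableT_comp mF measurable_snd).
have G0 p : (0 <= G p)%E.
  rewrite /G lee_fin !indicE; apply: mulr_ge0 => //; apply: mulr_ge0 => //.
  by apply: mulr_ge0; [exact: sqr_ge0|exact: kn_ge0].
have LFk x s : L1 s (fun y => sq F y * kn n (x - y)).
  apply: (@eq_L1 _ _ (fun y => kn n (x - y) * sq F y)) => [z _|]; first by rewrite mulrC.
  by apply: L1Mc; [exact: ct_shift|case: (hF.2 s)].
apply: (@le_trans _ _ (\int[@lebm R]_x \int[@lebm R]_y G (x, y))%E).
  rewrite integral_mkcond; apply: ge0_le_integral => //.
  - by move=> x _; rewrite patchE; case: ifPn => // _; rewrite lee_fin sqr_ge0.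
  - apply/(measurable_restrictT _ _).1; first exact: measurable_bx.
    apply/measurable_EFinP; apply: measurable_funX; apply: measurable_funTS; exact: measurable_cont2.
  - exact: measurable_int_snd.
  move=> x _; rewrite patchE; case: ifPn => [/set_mem|_]; last by apply: integral_ge0.
  move=> xr; have xr' : `|x| + 1 <= r + 1 by rewrite lerD2r.
  apply: (@le_trans _ _ (bint (r + 1) (fun y => sq F y * kn n (x - y)))%:E).
    by rewrite lee_fin; exact: cv_jensen.
  rewrite EFin_bint// lebmE integral_mkcond; apply: ge0_le_integral => //.
  - by move=> y _; rewrite patchE; case: ifPn => // _; rewrite lee_fin mulr_ge0 ?kn_ge0 ?sqr_ge0.
  - apply/(measurable_restrictT _ _).1; first exact: measurable_bx.
    exact: measurable_int (LFk x (r + 1)).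
  - exact: (measurableT_comp mG (pair1_measurable x)).
  move=> y _; rewrite patchE /G /= indicE (mem_set xr) mul1r indicE.
  by case: ifPn => _; rewrite ?mul1r ?mul0r.
rewrite tonelli// [X in (_ <= X)%E]integral_mkcond; apply: ge0_le_integral => //.
- by move=> y _; apply: integral_ge0.
- exact: measurable_int_fst.
- apply/(measurable_restrictT _ _).1; first exact: measurable_bx.
  by apply/measurable_EFinP; apply: measurable_funTS.
move=> y _; rewrite patchE /G /= indicE; case: ifPn => _; last first.
  by under eq_integral do rewrite mul0r mulr0; rewrite integral0.
have cs : continuous (fun x => kn n (x - y)).
  by apply: (ct_comp2 ck) => x; apply: cvgB; [exact: cvg_id|exact: cvg_cst].
rewrite (_ : (\int[@lebm R]_x _)%E = (sq F y * bint r (fun x => kn n (x - y)))%:E).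
  by rewrite lee_fin ler_piMr ?sqr_ge0// bint_kn_le1.
rewrite -bintZ; last exact: L1_cont.
rewrite EFin_bint; last by apply: L1Z; exact: L1_cont.
rewrite lebmE [RHS]integral_mkcond; apply: eq_integral => x _.
by rewrite patchE indicE; case: ifPn => _; rewrite !mul1r ?mul0r.
Qed.

End sequence.
End mollification.

(** * Open rectangles as a generating class *)

Section generator.
Variable R : realType.
Implicit Types (a b c d : R).

Definition orect a b c d : set (Pt R) := `]a, b[%classic `*` `]c, d[%classic.
Definition orects : set (set (Pt R)) := [set A | exists a b c d, A = orect a b c d].

Lemma setI_closed_orects : setI_closed orects.
Proof.
move=> _ _ [a [b [c [d ->]]]] [a' [b' [c' [d' ->]]]].
exists (Num.max a a'), (Num.min b b'), (Num.max c c'), (Num.min d d').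
apply/seteqP; split => [z [[/=]]|z [/=]]; rewrite !in_itv/=.
  move=> /andP[h1 h2] /andP[h3 h4] [/= ]; rewrite !in_itv/= => /andP[h5 h6] /andP[h7 h8].
  by split; rewrite /= in_itv/= gt_max lt_min; apply/andP; split; apply/andP.
rewrite !gt_max !lt_min => /andP[/andP[h1 h2] /andP[h3 h4]] /andP[/andP[h5 h6] /andP[h7 h8]].
by split; split; rewrite /= in_itv/=; apply/andP.
Qed.

Lemma orects_exhaust : \bigcup_n orect (- n%:R) n%:R (- n%:R) n%:R = [set: Pt R].
Proof.
apply/seteqP; split => // z _; exists (Num.bound `|z|) => //.
have h := archi_boundP (normr_ge0 z).
have h1 := le_lt_trans (norm_fst z) h; have h2 := le_lt_trans (norm_snd z) h.
by split; rewrite /= in_itv/= -ltr_norml.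
Qed.

(** Both coordinate projections are measurable for the sigma-algebra generated by rectangles, since
    open strips are countable unions of rectangles. *)
Lemma measurable_orects : (measurable : set (set (Pt R))) = <<s orects >>.
Proof.
apply/seteqP; split; last first.
  apply: smallest_sub; first exact: sigma_algebra_measurable.
  by move=> _ [a [b [c [d ->]]]]; apply: measurableX.
have mfst : measT (fst : g_sigma_algebraType orects -> R).
  apply: (measurability _ (RGenOpens.measurableE R)) => _ [_ [a [b ->] <-]]; rewrite setTI.
  have -> : fst @^-1` `]a, b[%classic = \bigcup_n orect a b (- n%:R) n%:R.
    apply/seteqP; split => [z /= zab|z [n _ []//]].
    have : [set: Pt R] z by [].
    by rewrite -orects_exhaust => -[n _ [_ h]]; exists n.
  by apply: bigcupT_measurable => n; apply: sub_gen_smallest; exists a, b, (- n%:R), n%:R.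
have msnd : measT (snd : g_sigma_algebraType orects -> R).
  apply: (measurability _ (RGenOpens.measurableE R)) => _ [_ [a [b ->] <-]]; rewrite setTI.
  have -> : snd @^-1` `]a, b[%classic = \bigcup_n orect (- n%:R) n%:R a b.
    apply/seteqP; split => [z /= zab|z [n _ []//]].
    have : [set: Pt R] z by [].
    by rewrite -orects_exhaust => -[n _ [h _]]; exists n.
  by apply: bigcupT_measurable => n; apply: sub_gen_smallest; exists (- n%:R), n%:R, a, b.
rewrite measurable_prod_measurableType; apply: smallest_sub.
  exact: smallest_sigma_algebra.
move=> _ [A mA] [B mB] <-.
have hA := mfst measurableT _ mA; have hB := msnd measurableT _ mB.
rewrite !setTI in hA hB.
have -> : A `*` B = (fst @^-1` A) `&` (snd @^-1` B) by [].
exact: (@measurableI _ (g_sigma_algebraType orects)).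
Qed.

(** A continuous trapezoid that approximates the indicator of the open interval from below as [n]
    grows. *)
Definition trap a b (n : nat) (x : R) : R := Num.min 1 (n%:R * Num.max 0 (Num.min (x - a) (b - x))).

Lemma trap_ge0 a b n x : 0 <= trap a b n x.
Proof. by rewrite /trap le_min ler01 mulr_ge0// le_max lexx. Qed.

Lemma trap_le1 a b n x : trap a b n x <= 1.
Proof. by rewrite /trap ge_min lexx. Qed.

Lemma trap_out a b n x : ~~ (a < x < b) -> trap a b n x = 0.
Proof.
move=> h; rewrite /trap max_l ?mulr0.
  by rewrite min_r// ler01.
rewrite ge_min; apply/orP; move: h; rewrite negb_and -!leNgt => /orP[|] h; [left|right]; lra.
Qed.

Lemma trap_cont a b n : continuous (trap a b n).
Proof.
move=> x; rewrite /trap.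
apply: (@continuous_min _ _ (fun=> 1) (fun x => n%:R * Num.max 0 (Num.min (x - a) (b - x)))); first exact: cvg_cst.
apply: cvgM; first exact: cvg_cst.
apply: (@continuous_max _ _ (fun=> 0) (fun x => Num.min (x - a) (b - x))); first exact: cvg_cst.
apply: (@continuous_min _ _ (fun x => x - a) (fun x => b - x)).
  by apply: cvgB; [exact: cvg_id|exact: cvg_cst].
by apply: cvgB; [exact: cvg_cst|exact: cvg_id].
Qed.

Lemma trap_cvg a b x : trap a b n x @[n --> \oo] --> (\1_(`]a, b[%classic) x : R).
Proof.
have [/andP[ax xb]|h] := boolP (a < x < b); last first.
  rewrite indicE memNset /=; last by rewrite in_itv/=; exact/negP.
  by under eq_fun do rewrite trap_out//; exact: cvg_cst.
rewrite indicE mem_set /=; last by rewrite in_itv/= ax.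
set m := Num.min (x - a) (b - x); have m0 : 0 < m by rewrite /m lt_min !subr_gt0 ax.
apply: cvg_near_cst; near=> n; rewrite /trap max_r ?ltW// min_l//.
rewrite -ler_pdivrMr// div1r; near: n.
by apply: nbhs_infty_ger; rewrite num_real.
Unshelve. all: by end_near. Qed.

End generator.

(** * A monotone class theorem for bounded functions *)

Section bounded_class.
Variables (R : realType) (Q : (Pt R -> R) -> Prop).
Hypotheses (Q_rect : forall a b c d : R, Q (\1_(orect a b c d)))
  (Q_one : Q (fun=> 1))
  (Q_lin : forall f g (c : R), Q f -> Q g -> Q (fun z => f z + c * g z))
  (Q_lim : forall (u : nat -> Pt R -> R) (v : Pt R -> R) (M : R), (forall n, measT (u n)) ->
    (forall n, Q (u n)) -> (forall n z, `|u n z| <= M) ->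
    (forall z, u n z @[n --> \oo] --> v z) -> Q v).
Import HBNNSimple.

Let Q_zero : Q (fun=> 0).
Proof.
have := Q_lin (-1) Q_one Q_one.
by rewrite (_ : (fun z => _) = (fun=> 0))//; apply/funext => z; rewrite mulN1r subrr.
Qed.

Let Q_ext f g : (forall z, f z = g z) -> Q f -> Q g.
Proof. by move=> fg; rewrite (_ : f = g)//; exact/funext. Qed.

(** Dynkin's theorem over the intersection-stable class of open rectangles. A disjoint union is the
    limit of partial sums of indicators, which are bounded by 1, as [Q_lim] requires. *)
Lemma bounded_class_indic (A : set (Pt R)) : measurable A -> Q (\1_A).
Proof.
pose P := [set A : set (Pt R) | measurable A -> Q (\1_A : Pt R -> R)].
have h1 : P setT.
  by move=> _; apply: Q_ext Q_one => z; rewrite indicE in_setT.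
have h2 : @orects R `<=` P.
  by move=> _ [a [b [c [d ->]]]] _; exact: Q_rect.
have h3 S : measurable S -> P S -> P (~` S).
  move=> mS PS _; apply: (Q_ext _ (Q_lin (-1) Q_one (PS mS))) => z.
  by rewrite !indicE in_setC; case: (_ \in _) => /=; ring.
have h4 (F : (set (Pt R))^nat) : (forall n, measurable (F n)) -> trivIset setT F -> (forall n, P (F n)) -> P (\bigcup_k F k).
  move=> mF tF PF _.
  have dj z : (exists2 j, (\1_(\bigcup_k F k) z : R) = 1 & forall k, (\1_(F k) z : R) = (k == j)%:R) \/
      ((\1_(\bigcup_k F k) z : R) = 0 /\ forall k, (\1_(F k) z : R) = 0).
    have [[j Fj]|nF] := pselect (exists j, F j z).
      left; exists j; first by rewrite indicE mem_set//; exists j.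
      move=> k; rewrite indicE; case: eqP => [->|kj]; first by rewrite mem_set.
      rewrite memNset// => Fk; apply: kj; apply: (tF _ _ Logic.I Logic.I); by exists z.
    right; split => [|k]; rewrite indicE memNset//; first by case=> k _ Fk; apply: nF; exists k.
    by move=> Fk; apply: nF; exists k.
  have ssum (j n : nat) : \sum_(k < n) ((k : nat) == j)%:R = (j < n)%:R :> R.
    elim: n => [|n IH]; first by rewrite big_ord0.
    by rewrite big_ord_recr /= IH -natrD; congr (_%:R); lia.
  have ind n : Q (fun z => \sum_(k < n) \1_(F k) z) /\ measT (fun z : Pt R => \sum_(k < n) (\1_(F k) z : R)).
    elim: n => [|n [IH mIH]].
      split; first by apply: Q_ext Q_zero => z; rewrite big_ord0.
      by under eq_fun do rewrite big_ord0; exact: measurable_cst.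
    split.
      by apply: (Q_ext _ (Q_lin 1 IH (PF n (mF n)))) => z; rewrite big_ord_recr /= mul1r.
    by under eq_fun do rewrite big_ord_recr; apply: measurable_funD => //; exact: measurable_indic.
  apply: (@Q_lim (fun n z => \sum_(k < n) \1_(F k) z) _ 1) => //.
  - by move=> n; case: (ind n).
  - by move=> n; case: (ind n).
  - move=> n z; case: (dj z) => [[j _ e]|[_ e]]; under eq_bigr do rewrite e.
      by rewrite ssum; case: (_ < _)%N; rewrite ?normr0 ?normr1.
    by rewrite big1// normr0.
  - move=> z; case: (dj z) => [[j -> e]|[-> e]]; under eq_fun do under eq_bigr do rewrite e.
      apply: cvg_near_cst; exists j.+1 => // n /= jn; by rewrite ssum jn.
    by under eq_fun do rewrite big1//; exact: cvg_cst.
move=> mA; have : <<s @orects R >> A by rewrite -measurable_orects.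
by move/(dynkin_induction (P := P) (measurable_orects R) (@setI_closed_orects R) h1 h2 h3 h4) => /(_ mA).
Qed.

Lemma bounded_class_sum (I : Type) (s : seq I) (c : I -> R) (A : I -> set (Pt R)) : (forall i, measurable (A i)) ->
  Q (fun z => \sum_(i <- s) c i * \1_(A i) z).
Proof.
move=> mA; elim: s => [|i s IH].
  by apply: Q_ext Q_zero => z; rewrite big_nil.
by apply: (Q_ext _ (Q_lin (c i) IH (bounded_class_indic (mA i)))) => z; rewrite big_cons addrC.
Qed.

Lemma bounded_class_ge0 (f : Pt R -> R) M : measT f -> (forall z, 0 <= f z) -> (forall z, f z <= M) -> Q f.
Proof.
move=> mf f0 fM; have mf' : measT (EFin \o f) by exact/measurable_EFinP.
pose u := nnsfun_approx measurableT mf'.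
have uf z : u n z @[n --> \oo] --> f z.
  have := @cvg_nnsfun_approx _ _ _ _ measurableT _ mf' (fun z _ => f0 z) z Logic.I.
  by move/fine_cvg.
have ule n z : u n z <= f z.
  have nd : nondecreasing_seq (fun n => u n z).
    by move=> a b ab; exact/lefP/nd_nnsfun_approx.
  rewrite -(cvg_lim _ (uf z))//; apply: nondecreasing_cvgn_le => //.
  by apply/cvg_ex; exists (f z).
apply: (@Q_lim (fun n => u n) _ M) => //.
  move=> n; pose s := finmap.enum_fset (fset_set (range (u n))).
  have e z : u n z = \sum_(y <- s) y * \1_(u n @^-1` [set y]) z.
    by rewrite [LHS]fimfunE fsbig_finite.
  have mA (y : R) : measurable (u n @^-1` [set y]) by exact: measurable_funPTI.
  by apply: (Q_ext _ (@bounded_class_sum R s id (fun y => u n @^-1` [set y]) mA)) => z; rewrite e.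
move=> n z; rewrite ger0_norm; last exact: fun_ge0.
exact: le_trans (ule n z) (fM z).
Qed.

(** After the shift by [M] the function is nonnegative and is a bounded limit of simple functions.
    The common bound in [Q_lim] is what lets dominated convergence verify that closure property in
    each application. *)
Lemma bounded_class (f : Pt R -> R) M : measT f -> (forall z, `|f z| <= M) -> Q f.
Proof.
move=> mf fM; have M0 : 0 <= M by exact: le_trans (fM 0).
have h : Q (fun z => f z + M).
  apply: (@bounded_class_ge0 _ (M + M)); first exact: measurable_funD.
    by move=> z; have := fM z; rewrite ler_norml; lra.
  by move=> z; have := fM z; rewrite ler_norml; lra.
by apply: (Q_ext _ (Q_lin (- M) h Q_one)) => z; ring.
Qed.

End bounded_class.

(** * Density of continuous functions in L^2 of a square *)

Section density.
Variable R : realType.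
Local Notation m2 := (@leb2 R).
Implicit Types (f g h v : Pt R -> R) (r e M : R).

Lemma bint_dominated r (u : nat -> Pt R -> R) v g : (forall n, measurable_fun (bx r) (u n)) -> measurable_fun (bx r) v ->
  L1 r g -> (forall n z, bx r z -> `|u n z| <= g z) -> (forall z, bx r z -> u n z @[n --> \oo] --> v z) ->
  bint r (u n) @[n --> \oo] --> bint r v.
Proof.
move=> mu mv hg ug uv.
have [] := @dominated_convergence _ _ _ m2 (bx r) (measurable_bx r) (fun n => EFin \o u n) (EFin \o v) (EFin \o g).
- by move=> n; apply/measurable_EFinP; exact: mu.
- by apply/measurable_EFinP; exact: mv.
- apply: aeW => z bz; apply/cvg_EFin; last exact: uv.
  by near=> n.
- exact: hg.
- by apply: aeW => z n bz; rewrite /= lee_fin; exact: ug.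
move=> hv _ hc.
have e n : (\int[m2]_(x in bx r) (EFin \o u n) x)%E = (bint r (u n))%:E.
  rewrite EFin_bint//; exact: L1_le (ug n) hg.
move: hc; rewrite -(EFin_bint hv) => /fine_cvg; rewrite /=.
by under eq_fun do rewrite /= e.
Unshelve. all: by end_near. Qed.

Lemma N2_dominated r (u : nat -> Pt R -> R) v g e : (forall n, measurable_fun (bx r) (u n)) -> measurable_fun (bx r) v ->
  L2 r g -> (forall n z, bx r z -> `|v z - u n z| <= g z) -> (forall z, bx r z -> u n z @[n --> \oo] --> v z) ->
  0 < e -> exists n, N2 r (fun z => v z - u n z) <= e.
Proof.
move=> mu mv [_ hg] ug uv e0.
have h : bint r (sq (fun z => v z - u n z)) @[n --> \oo] --> bint r (fun=> 0).
  apply: (@bint_dominated _ _ _ (sq g)) => //.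
  - by move=> n; apply: measurable_funX; exact: measurable_funB.
  - move=> n z bz; rewrite /sq normrX lerXn2r ?nnegrE//; last exact: ug.
    exact: le_trans (ug n z bz).
  - move=> z bz; rewrite /sq; under eq_fun do rewrite expr2.
    have : (v z - u n z) @[n --> \oo] --> 0.
      by rewrite -(subrr (v z)); apply: cvgB; [exact: cvg_cst|exact: uv].
    by move=> c; have h := cvgM c c; rewrite mulr0 in h; exact: h.
have z0 : bint r (fun=> 0) = 0 by rewrite /bint /Rintegral integral0.
move/cvgrPdist_le : h => /(_ (e ^+ 2) ltac:(by rewrite exprn_gt0)) [n _ /(_ n (leqnn n))].
rewrite z0 sub0r normrN => hn; exists n.
have e0' := ltW e0.
rewrite -(@ler_pXn2r _ 2) ?nnegrE ?N2_ge0// N2_sq.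
exact: le_trans (ler_norm _) hn.
Qed.

Definition Ap r f := L2 r f /\ forall e, 0 < e -> exists2 g, continuous g & N2 r (fun z => f z - g z) <= e.

Lemma Ap_cont r f : continuous f -> Ap r f.
Proof.
move=> cf; split; first exact: L2_cont.
move=> e e0; exists f => //; rewrite /N2 (@eq_bint _ _ _ (fun=> 0)) => [|z _]; last by rewrite /sq subrr expr0n.
by rewrite /bint /Rintegral integral0 sqrtr0 ltW.
Qed.

Lemma Ap_lim r f : L2 r f -> (forall e, 0 < e -> exists2 g, Ap r g & N2 r (fun z => f z - g z) <= e) -> Ap r f.
Proof.
move=> hf H; split => // e e0.
have [g [hg Hg] h1] := H (e / 2) ltac:(lra).
have [k ck h2] := Hg (e / 2) ltac:(lra).
exists k => //; have := N2_tri hf hg (L2_cont r ck); lra.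
Qed.

Lemma ApD r f g : Ap r f -> Ap r g -> Ap r (fun z => f z + g z).
Proof.
move=> [hf Hf] [hg Hg]; split; first exact: L2D.
move=> e e0; have [k ck h1] := Hf (e / 2) ltac:(lra); have [l cl h2] := Hg (e / 2) ltac:(lra).
exists (fun z => k z + l z); first exact: ctD.
have hk := L2_cont r ck; have hl := L2_cont r cl.
have := N2D (L2B hf hk) (L2B hg hl).
rewrite (@eq_N2 _ _ (fun z => f z - k z + (g z - l z)) (fun z => f z + g z - (k z + l z))) => [|z _]; last ring.
lra.
Qed.

Lemma ApZ r c f : Ap r f -> Ap r (fun z => c * f z).
Proof.
move=> [hf Hf]; split; first exact: L2Z.
move=> e e0; have c0 : 0 < `|c| + 1 by rewrite ltr_wpDl.
have [k ck h1] := Hf (e / (`|c| + 1)) ltac:(by rewrite divr_gt0).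
exists (fun z => c * k z); first by apply: ctM => //; exact: ct_cst.
have hk := L2_cont r ck.
rewrite (@eq_N2 _ _ _ (fun z => c * (f z - k z))) => [|z _]; last ring.
rewrite N2Z; last exact: L2B.
move: h1; rewrite ler_pdivlMr//; have := N2_ge0 r (fun z => f z - k z); have := normr_ge0 c; nra.
Qed.

Lemma L2_indic r (A : set (Pt R)) : measurable A -> L2 r (\1_A : Pt R -> R).
Proof.
move=> mA; have m : measurable_fun (bx r) (\1_A : Pt R -> R) by apply: measurable_funTS; exact: measurable_indic.
split => //; apply: (@L1_bounded _ _ _ 1); first exact: measurable_funX.
by move=> z _; rewrite /sq indicE; case: (_ \in _); rewrite ?expr1n ?expr0n ?normr1 ?normr0.
Qed.

Lemma Ap_dom r (u : nat -> Pt R -> R) v g : (forall n, Ap r (u n)) -> L2 r v -> L2 r g ->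
  (forall n z, bx r z -> `|v z - u n z| <= g z) -> (forall z, bx r z -> u n z @[n --> \oo] --> v z) -> Ap r v.
Proof.
move=> hu hv hg ug uv; apply: Ap_lim => // e e0.
have [n hn] := N2_dominated (fun n => (hu n).1.1) hv.1 hg ug uv e0.
by exists (u n).
Qed.

(** Bounded functions come from the monotone class theorem, with products of trapezoids
    approximating rectangles; the general case follows by truncation at height [n], dominated by
    [|f|]. *)
Lemma L2_density r f : measT f -> L2 r f -> Ap r f.
Proof.
move=> mf hf.
have bdd : forall h M, measT h -> (forall z, `|h z| <= M) -> Ap r h.
  move=> h M mh hM; apply: (@bounded_class _ (Ap r)) hM => //.
  - move=> a b c d.
    apply: (@Ap_dom _ (fun n z => trap a b n z.1 * trap c d n z.2) _ (fun=> 1)) => //.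
    + move=> n; apply: Ap_cont; apply: ctM; apply: ct_comp;
        [exact: trap_cont|exact: ct_fst|exact: trap_cont|exact: ct_snd].
    + by apply: L2_indic; apply: measurableX.
    + by apply: L2_cont; exact: ct_cst.
    + move=> n z _; have := trap_ge0 a b n z.1; have := trap_le1 a b n z.1.
      have := trap_ge0 c d n z.2; have := trap_le1 c d n z.2.
      move: (trap a b n _) (trap c d n _) => s t t1 t0 s1 s0.
      by rewrite indicE ler_norml; case: (_ \in _) => /=; apply/andP; split; nra.
    + move=> z _; have -> : (\1_(orect a b c d) z : R) = \1_(`]a, b[%classic) z.1 * \1_(`]c, d[%classic) z.2.
        by rewrite !indicE in_setX; case: (_ \in _); case: (_ \in _); rewrite ?mulr1 ?mulr0.
      by apply: cvgM; exact: trap_cvg.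
  - by apply: Ap_cont; exact: ct_cst.
  - by move=> f1 g1 c h1 h2; apply: ApD => //; exact: ApZ.
  - move=> u v M' mu hu uM uv.
    have mv : measT v by apply: (measurable_fun_cvg mu) => z _; exact: uv.
    have vM z : `|v z| <= M'.
      apply: (@closed_cvg _ _ _ _ (fun n => u n z) [set t | `|t| <= M']) (uv z) => //.
        rewrite (_ : [set t | _] = `[-M', M']%classic); first exact: itv_closed.
        by apply/seteqP; split => t; rewrite /= in_itv/= ler_norml.
      by near=> n; exact: uM.
    apply: (@Ap_dom _ u v (fun=> 2 * M')) => //.
    + split; first exact: measurable_funTS.
      apply: (@L1_bounded _ _ _ (M' ^+ 2)); first by apply: measurable_funX; exact: measurable_funTS.
      by move=> z _; rewrite /sq normrX lerXn2r ?nnegrE// (le_trans _ (vM z)).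
    + by apply: L2_cont; exact: ct_cst.
    + move=> n z _; have := ler_normB (v z) (u n z); have := vM z; have := uM n z; lra.
pose u n z := Num.max (- n%:R) (Num.min n%:R (f z)).
have mu n : measT (u n).
  by apply: measurable_maxr => //; apply: measurable_minr.
have un n z : `|u n z| <= n%:R.
  by rewrite ler_norml /u le_max lexx ge_max ge_min lexx andbT /= (le_trans _ (ler0n _ n))// lerNl oppr0.
have uf n z : `|f z - u n z| <= `|f z|.
  have n0 : (0 : R) <= n%:R by [].
  rewrite /u; case: (leP n%:R (f z)) => h1.
    by rewrite max_r; [rewrite !ger0_norm; lra|lra].
  case: (leP (- n%:R) (f z)) => h2; first by rewrite subrr normr0.
  by rewrite !ler0_norm; lra.
apply: (@Ap_dom _ u f (fun z => `|f z|)) => //.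
- by move=> n; apply: (bdd _ n%:R).
- case: hf => m1 h1; split; first exact: measurableT_comp.
  by apply: eq_L1 h1 => z _; rewrite /sq -normrX ger0_norm// sqr_ge0.
move=> z _; apply: cvg_near_cst; near=> n.
have fn : `|f z| <= n%:R by near: n; apply: nbhs_infty_ger; rewrite num_real.
by move: fn; rewrite ler_norml /u => /andP[h1 h2]; rewrite min_r// max_r.
Unshelve. all: by end_near. Qed.

End density.

(** * Squares with arbitrary centre *)

Section boxes.
Variable R : realType.
Local Notation m2 := (@leb2 R).
Implicit Types (x y : Pt R) (r d M : R).

Definition cbx x d : set (Pt R) := [set y | `|y - x| <= d].

Lemma cbxE x d : cbx x d = `[x.1 - d, x.1 + d]%classic `*` `[x.2 - d, x.2 + d]%classic.
Proof.
apply/seteqP; split => y; rewrite /cbx /= prod_normE ge_max !in_itv/= !ler_distl.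
  by case/andP.
by case=> -> ->.
Qed.

Lemma measurable_cbx x d : measurable (cbx x d).
Proof. by rewrite cbxE; apply: measurableX. Qed.

Lemma measurable_1cbx x d : measT (\1_(cbx x d) : Pt R -> R).
Proof. by apply: measurable_indic; exact: measurable_cbx. Qed.

Lemma leb2_cbx x d : 0 <= d -> m2 (cbx x d) = ((2 * d) ^+ 2)%:E.
Proof.
move=> d0; rewrite cbxE /leb2 product_measure1E//.
have h (t : R) : @lebesgue_measure R `[t - d, t + d]%classic = (2 * d)%:E.
  rewrite lebesgue_measure_itv/= lte_fin.
  case: ltP => h; last by (have -> : d = 0 by lra); rewrite mulr0.
  by rewrite -EFinB; congr (_%:E); lra.
by rewrite [X in (X * _)%E]h [X in (_ * X)%E]h -EFinM expr2.
Qed.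

Lemma bint_supp r (f : Pt R -> R) M x d : 0 <= d -> 0 <= M -> L1 r f ->
  (forall y, bx r y -> `|y - x| <= d -> `|f y| <= M) -> (forall y, bx r y -> d < `|y - x| -> f y = 0) ->
  `|bint r f| <= M * (2 * d) ^+ 2.
Proof.
move=> d0 M0 hf fM f0; apply: (le_trans (bint_abs hf)).
have hf' := L1_abs hf.
rewrite -lee_fin EFin_bint// EFinM -(leb2_cbx x d0).
rewrite -(integral_cst m2 (measurable_cbx x d) M%:E) [X in (X <= _)%E]integral_mkcond [X in (_ <= X)%E]integral_mkcond.
apply: ge0_le_integral => //.
- by move=> y _; rewrite patchE; case: ifPn => // _; rewrite lee_fin.
- by apply/(measurable_restrictT _ _).1; [exact: measurable_bx|exact: measurable_int hf'].
- by apply/(measurable_restrictT _ _).1; [exact: measurable_cbx|exact: measurable_cst].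
move=> y _; rewrite !patchE; case: ifPn => [/set_mem yr|_]; last by case: ifPn => // _; rewrite lee_fin.
case: ifPn => [/set_mem yd|/negP yd]; first by rewrite lee_fin; exact: fM.
rewrite /= lee_fin f0 ?normr0// ltNge; apply/negP => h; apply: yd; exact/mem_set.
Qed.

End boxes.

(** * Smoothing of functions with weak derivatives in L^2 *)

Section smooth_approximation.
Variable R : realType.
Implicit Types (F D : Pt R -> R) (x z : Pt R) (r e : R).

(** Both mixed derivatives are the same function [f12]; their equality makes the second-order terms
    cancel in the Jacobian identities. *)
Definition C2m f f1 f2 (f12 : Pt R -> R) :=
  [/\ C1 f f1 f2, pdv false f1 f12, pdv true f2 f12 & continuous f12].

Definition cvU (u : nat -> Pt R -> R) F := forall r e, 0 < e ->
  exists N, forall n x, (N <= n)%N -> bx r x -> `|u n x - F x| <= e.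
Definition cvN (u : nat -> Pt R -> R) F := forall r e, 0 < e ->
  exists N, forall n, (N <= n)%N -> N2 r (fun x => u n x - F x) <= e.

(** Besides uniform convergence and L^2 convergence of the derivatives, the last field gives
    pointwise convergence of the derivatives wherever [F] is differentiable; this carries classical
    information about [F] over to the weak derivatives. *)
Record smoothing F D1 D2 (u u1 u2 : nat -> Pt R -> R) : Prop := Smoothing {
  sm_C2 : exists u12, forall n, C2m (u n) (u1 n) (u2 n) (u12 n);
  sm_U : cvU u F;
  sm_N1 : cvN u1 D1;
  sm_N2 : cvN u2 D2;
  sm_diff : forall x a b, (forall e, 0 < e -> exists2 d, 0 < d & forall h : Pt R, `|h| <= d ->
      `|F (x + h) - F x - (a * h.1 + b * h.2)| <= e * `|h|) ->
    (fun n => u1 n x) @ \oo --> a /\ (fun n => u2 n x) @ \oo --> b }.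

(** Three-epsilon argument: [D] is replaced by a continuous [g], at a cost of [e/3] before and after
    smoothing, and [g] is smoothed uniformly. *)
Lemma L2loc_approx D r e (cvk : nat -> (Pt R -> R) -> Pt R -> R) : L2loc' D -> 0 < e -> 0 <= r ->
  (forall F, continuous F -> cvU (fun n => cvk n F) F) ->
  (forall n F, L2loc' F -> N2 r (cvk n F) <= N2 (r + 1) F) ->
  (forall n F, L2loc' F -> L2 r (cvk n F)) ->
  (forall n F G, L2loc' F -> L2loc' G -> forall x, cvk n (fun z => F z - G z) x = cvk n F x - cvk n G x) ->
  exists N, forall n, (N <= n)%N -> N2 r (fun x => cvk n D x - D x) <= e.
Proof.
move=> hD e0 r0 hU hN hL hB.
have [_ H] := L2_density hD.1 (hD.2 (r + 1)).
have [g cg hg] := H (e / 3) ltac:(lra).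
have hg' : L2loc' g by split; [exact: measurable_cont2|move=> s; exact: L2_cont].
have hDg : L2loc' (fun z => D z - g z).
  by split; [apply: measurable_funB; [exact: hD.1|exact: hg'.1]|move=> s; apply: L2B; [exact: hD.2|exact: hg'.2]].
(* On a square of side [2r] this uniform error contributes at most [e/3] to the L^2 norm. *)
have [N hNu] := hU g cg r (e / (3 * (2 * r + 1))) ltac:(by rewrite divr_gt0//; lra).
exists N => n Nn.
have l1 := hL n D hD; have l2 := hL n g hg'; have l3 := hg'.2 r; have l4 := hD.2 r.
have t1 := N2_tri l1 l2 l4; have t2 := N2_tri l2 l3 l4.
have b1 : N2 r (fun z => cvk n D z - cvk n g z) <= e / 3.
  rewrite (@eq_N2 _ _ _ (cvk n (fun z => D z - g z))) => [|z _]; last by rewrite hB.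
  exact: le_trans (hN n _ hDg) hg.
have b2 : N2 r (fun z => cvk n g z - g z) <= e / 3.
  have h := @N2_bound _ r (fun z => cvk n g z - g z) (e / (3 * (2 * r + 1))) r0 _ _ (hNu n ^~ Nn).
  have {}h := h ltac:(by clear -r0 e0; rewrite divr_ge0//; lra) (L2B l2 l3).
  apply: (le_trans h).
  have -> : e / (3 * (2 * r + 1)) * (2 * r) = e / 3 * (2 * r / (2 * r + 1)) by field; lra.
  apply: ler_piMr; first by clear -e0; apply: divr_ge0; lra.
  by clear -r0; rewrite ler_pdivrMr; lra.
have b3 : N2 r (fun z => g z - D z) <= e / 3.
  by rewrite N2BC; apply: le_trans hg; apply: N2S; [lra|exact: hDg.2].
clear -t1 t2 b1 b2 b3; lra.
Qed.

(** All derivatives fall on the kernel, a product of one-variable bumps: [k1], [k2] differentiate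
    one factor and [k12] both. Moving the derivative from the kernel onto [F] identifies the
    mollified derivatives with mollifications of the weak ones. *)
Lemma smoothing_exists : exists S : nat -> (Pt R -> R) -> Pt R -> R,
  exists S1 S2 : nat -> (Pt R -> R) -> Pt R -> R,
  forall F D1 D2, continuous F -> L2loc' D1 -> L2loc' D2 -> weak_pd true F D1 -> weak_pd false F D2 ->
  smoothing F D1 D2 (S ^~ F) (S1 ^~ F) (S2 ^~ F).
Proof.
have [rho [hrho rho0 [W dW W1] rhoN]] := @mollifier1 R.
have hr := Bp_rn hrho.
have [rho' drho hrho'] := Bp_derive hrho.
pose rn1 n (t : R) := n.+1%:R * rn rho' n t.
have hr1 n : (forall x : R, is_derive x 1 (rn rho n) (rn1 n x)) /\ Bp (rn1 n).
  split; last first.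
    have [h1 h2] := Bp_rn hrho' n; split; first by move=> m; apply: smnM; [exact: smn_cst|exact: h1].
    by move=> t /h2 e; rewrite /rn1 e mulr0.
  move=> x; set N : R := n.+1%:R.
  have h : is_derive x 1 (fun t => N * t) N by apply: (deq (dM (dcst x N) (did x))); ring.
  apply: (deq (dM (dcst x N) (@dcomp _ rho (fun t => N * t) x _ _ (drho _) h))).
  by rewrite /rn1 /rn -/N; ring.
pose k1 n := prodk (rn1 n) (rn rho n); pose k2 n := prodk (rn rho n) (rn1 n); pose k12 n := prodk (rn1 n) (rn1 n).
exists (fun n F => cv F (kn rho n)), (fun n F => cv F (k1 n)), (fun n F => cv F (k2 n)).
move=> F D1 D2 cF hD1 hD2 w1 w2.
have hF := Lloc_cont cF.
have e1 n x : cv F (k1 n) x = cv D1 (kn rho n) x.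
  by apply: cv_weakx w1; [|exact: hr|exact: (hr1 n).2|exact: hr|exact: (hr1 n).1].
have e2 n x : cv F (k2 n) x = cv D2 (kn rho n) x.
  by apply: cv_weaky w2; [|exact: hr|exact: hr|exact: (hr1 n).2|exact: (hr1 n).1].
have Kn n := Ker_kn hrho n.
have hB n (F' G : Pt R -> R) : L2loc' F' -> L2loc' G -> forall y,
    cv (fun z => F' z - G z) (kn rho n) y = cv F' (kn rho n) y - cv G (kn rho n) y.
  move=> /L2loc_Lloc hF' /L2loc_Lloc hG y; rewrite !(@cv_bint _ _ _ y (`|y| + 1))// -bintB; try exact: L1_ker.
  by apply: eq_bint => z _; rewrite mulrBl.
have app (D : Pt R -> R) : L2loc' D -> cvN (fun n => cv D (kn rho n)) D.
  move=> hD r e e0.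
  have r0 : 0 <= Num.max 0 r by rewrite le_max lexx.
  have [N hN] := @L2loc_approx D (Num.max 0 r) e (fun n F => cv F (kn rho n)) hD e0 r0
    (fun F cF r e he => cv_unif hrho rho0 dW W1 r cF he)
    (fun n F hF => cv_N2 hrho rho0 dW W1 rhoN n _ hF)
    (fun n F hF => L2_cont _ (cv_cont (L2loc_Lloc hF) (Kn n))) hB.
  exists N => n Nn; apply: le_trans (hN n Nn); apply: N2S; first by rewrite le_max lexx orbT.
  by apply: L2B; [apply: L2_cont; apply: cv_cont; [exact: L2loc_Lloc|exact: Kn]|exact: hD.2].
split.
- exists (fun n => cv F (k12 n)) => n; have [d1 b1] := hr1 n; have b0 := hr n.
  split; last by apply: cv_cont => //; exact: Ker_prod.
  + split; [apply: cv_cont => //; exact: Ker_prod|apply: cv_cont => //; exact: Ker_prod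
      |apply: cv_cont => //; exact: Ker_prod|exact: cv_dx|exact: cv_dy].
  + exact: cv_dy.
  + exact: cv_dx.
- move=> r e e0; exact: (cv_unif hrho rho0 dW W1 r cF e0).
- move=> r e e0; have [N hN] := app _ hD1 r e e0; exists N => n Nn.
  by rewrite (@eq_N2 _ _ _ (fun x => cv D1 (kn rho n) x - D1 x)) => [|z _]; rewrite ?e1//; exact: hN.
- move=> r e e0; have [N hN] := app _ hD2 r e e0; exists N => n Nn.
  by rewrite (@eq_N2 _ _ _ (fun x => cv D2 (kn rho n) x - D2 x)) => [|z _]; rewrite ?e2//; exact: hN.
- move=> x a b Hd; have [C C0 hC] := Bp_bounded hrho; have [C' C'0 hC'] := Bp_bounded hrho'.
  (* On the support of [kk n], of half side [1/(n+1)], the difference [F - A] is [o(1/n)]; the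
     kernel has order [n^3] and the area order [n^-2], so [F] and [A] have the same limit. *)
  have KA : forall (A : Pt R -> R) (kk : nat -> Pt R -> R) (l : R), continuous A -> (forall n, Ker (kk n)) ->
      (forall n z, (n.+1%:R)^-1 < `|z| -> kk n z = 0) ->
      (forall n z, `|kk n z| <= C * C' * n.+1%:R ^+ 3) ->
      (forall n, cv A (kk n) x = l) ->
      (forall e, 0 < e -> exists2 d, 0 < d & forall h : Pt R, `|h| <= d -> `|F (x + h) - A (x + h)| <= e * `|h|) ->
      cv F (kk n) x @[n --> \oo] --> l.
    move=> A kk l cA hk ks kb kl HA; apply/cvgrPdist_le => e e0.
    have c4 : 0 < 4 * (C * C') by rewrite !mulr_gt0.
    have [d d0 hd] := HA (e / (4 * (C * C'))) ltac:(by rewrite divr_gt0).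
    exists (Num.bound d^-1) => // n /= Nn; set N : R := n.+1%:R.
    have N0 : 0 < N by rewrite ltr0n.
    have Nd : N^-1 <= d.
      rewrite invf_ple ?posrE//; apply: (le_trans (ltW (archi_boundP _))); first by rewrite invr_ge0 ltW.
      by rewrite ler_nat; apply: leqW.
    rewrite -(kl n) distrC !(@cv_bint _ _ _ x (`|x| + 1))// -bintB; try (by apply: L1_ker => //; exact: Lloc_cont).
    have L : L1 (`|x| + 1) (fun z => F z * kk n (x - z) - A z * kk n (x - z)).
      by apply: L1B; apply: L1_ker => //; exact: Lloc_cont.
    have q0 : 0 <= e / (4 * (C * C')) / N * (C * C' * N ^+ 3).
      by apply: mulr_ge0; rewrite ?divr_ge0 ?mulr_ge0 ?exprn_ge0// ltW.
    have := @bint_supp _ (`|x| + 1) _ (e / (4 * (C * C')) / N * (C * C' * N ^+ 3)) x N^-1 _ q0 L.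
    have -> : e / (4 * (C * C')) / N * (C * C' * N ^+ 3) * (2 * N^-1) ^+ 2 = e by field; rewrite !gt_eqF.
    apply.
    - by rewrite invr_ge0 ltW.
    - move=> y _ yx; rewrite -mulrBl normrM; apply: ler_pM => //.
      have := hd (y - x) (le_trans yx Nd); rewrite addrCA subrr addr0 => /le_trans; apply.
      by rewrite ler_wpM2l// divr_ge0// ltW.
    - by move=> y _ yx; rewrite -mulrBl ks ?mulr0// distrC.
  (* The affine function tangent to [F] at [x]; its convolution with a derivative kernel is exactly
     the corresponding slope, by [kcomp]. *)
  pose A (y : Pt R) := F x + (a * (y - x).1 + b * (y - x).2).
  have pA1 : pdv true A (fun=> a).
    move=> z; apply: (deq (dD (dcst _ (F x)) (dD (dM (dcst _ a) (dB (did z.1) (dcst _ x.1))) (dcst z.1 (b * (z.2 - x.2)))))).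
    by ring.
  have pA2 : pdv false A (fun=> b).
    move=> z; apply: (deq (dD (dcst _ (F x)) (dD (dcst z.2 (a * (z.1 - x.1))) (dM (dcst _ b) (dB (did z.2) (dcst _ x.2)))))).
    by ring.
  have cA : continuous A.
    apply: ctD; first exact: ct_cst.
    by apply: ctD; apply: ctM; try exact: ct_cst; apply: ctB; try exact: ct_cst; [exact: ct_fst|exact: ct_snd].
  have HA : forall e, 0 < e -> exists2 d, 0 < d & forall h : Pt R, `|h| <= d -> `|F (x + h) - A (x + h)| <= e * `|h|.
    move=> e /Hd[d d0 hd]; exists d => // h /hd; rewrite /A.
    have -> : x + h - x = h by rewrite addrC addrA addNr add0r.
    by rewrite [in X in _ -> X]opprD addrA.
  have supp n z : (n.+1%:R)^-1 < `|z| -> k1 n z = 0 /\ k2 n z = 0.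
    move=> z1; rewrite /k1 /k2 /prodk /rn1.
    have [h1|h1] := ltP (n.+1%:R)^-1 `|z.1|.
      by rewrite (rn_supp hrho h1) (rn_supp hrho' h1) mulr0 !mul0r.
    have [h2|h2] := ltP (n.+1%:R)^-1 `|z.2|.
      by rewrite (rn_supp hrho h2) (rn_supp hrho' h2) !mulr0.
    by move: z1; rewrite ltNge norm_pair_le.
  have rb n t : `|rn rho n t| <= n.+1%:R * C by rewrite /rn normrM ger0_norm// ler_wpM2l.
  have rb' n t : `|rn1 n t| <= n.+1%:R ^+ 2 * C'.
    by rewrite /rn1 /rn !normrM ger0_norm// expr2 -mulrA !ler_wpM2l.
  have kcomp (kk : Pt R -> R) b0 (A' : R) n : pdv b0 A (fun=> A') -> pdv b0 (fun y => kn rho n (x - y)) (fun y => - kk (x - y)) ->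
      Ker kk -> cv A kk x = A'.
    move=> pA pk hk; have [ckk _ _] := hk; have [ck k0 _] := Kn n.
    rewrite (@cv_bint _ _ _ x (`|x| + 2))//; last by lra.
    have s1 : 0 <= `|x| + 1 < `|x| + 2 by have := normr_ge0 x; move=> ?; apply/andP; split; lra.
    have := bint_ibp s1 pk pA (@ct_shift _ _ x ck) cA (ctN (@ct_shift _ _ x ckk)) (@ct_cst _ _ A').
    have -> : bint (`|x| + 2) (fun z => - kk (x - z) * A z) = - bint (`|x| + 2) (fun y => A y * kk (x - y)).
      rewrite -bintN; last by apply: L1_ker => //; exact: Lloc_cont.
      by apply: eq_bint => z _; ring.
    move=> H; apply: oppr_inj; rewrite H; last first.
      move=> z bz; apply: k0; have : ~ (`|z| <= `|x| + 1) by [].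
      by move/negP; rewrite -ltNge => h; have := ler_distD x z 0; rewrite !subr0 distrC; lra.
    congr (- _); rewrite -[RHS]mulr1 -[X in _ = _ * X](@bint_kn _ _ _ hrho dW W1 n x (`|x| + 2)); last by lra.
    rewrite -bintZ; last by apply: L1_cont; exact: ct_shift.
    by apply: eq_bint => z _; rewrite mulrC.
  split.
  + apply: (KA A _ a cA) => //.
    * by move=> n; apply: Ker_prod; [exact: (hr1 n).2|exact: hr].
    * by move=> n z /supp[].
    * move=> n z; rewrite /k1 /prodk normrM (_ : C * C' * n.+1%:R ^+ 3 = (n.+1%:R ^+ 2 * C') * (n.+1%:R * C)); last by ring.
      by apply: ler_pM.
    * move=> n; apply: (kcomp (k1 n) true a n pA1); last by apply: Ker_prod; [exact: (hr1 n).2|exact: hr].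
      move=> y; have h : is_derive y.1 1 (fun t => x.1 - t) (-1).
        by apply: (deq (dB (dcst y.1 x.1) (did y.1))); rewrite sub0r.
      apply: (deq (dM (@dcomp _ (rn rho n) (fun t => x.1 - t) y.1 _ _ ((hr1 n).1 _) h) (dcst y.1 (rn rho n (x.2 - y.2))))).
      by rewrite /k1 /prodk /=; ring.
  + apply: (KA A _ b cA) => //.
    * by move=> n; apply: Ker_prod; [exact: hr|exact: (hr1 n).2].
    * by move=> n z /supp[].
    * move=> n z; rewrite /k2 /prodk normrM (_ : C * C' * n.+1%:R ^+ 3 = (n.+1%:R * C) * (n.+1%:R ^+ 2 * C')); last by ring.
      by apply: ler_pM.
    * move=> n; apply: (kcomp (k2 n) false b n pA2); last by apply: Ker_prod; [exact: hr|exact: (hr1 n).2].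
      move=> y; have h : is_derive y.2 1 (fun t => x.2 - t) (-1).
        by apply: (deq (dB (dcst y.2 x.2) (did y.2))); rewrite sub0r.
      apply: (deq (dM (dcst y.2 (rn rho n (x.1 - y.1))) (@dcomp _ (rn rho n) (fun t => x.2 - t) y.2 _ _ ((hr1 n).1 _) h))).
      by rewrite /k2 /prodk /=; ring.
Qed.

End smooth_approximation.

(** * C^1 step and plateau functions *)

Section steps.
Variable R : realType.
Implicit Types (t x a b : R).

Definition pos2 t : R := Num.max 0 t ^+ 2.

Lemma dpos2 t : is_derive t 1 pos2 (2 * Num.max 0 t).
Proof.
apply: (@is_derive_quad _ _ _ _ 1) => h; rewrite /pos2 mul1r ler_norml.
by case: (leP 0 t) => h1; case: (leP 0 (t + h)) => h2; apply/andP; split; nra.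
Qed.

(** The quadratic spline rising from 0 to 1 on [[0, 1]] with nodes 0, 1/2, 1; its derivative is a
    tent of height 2. *)
Definition stp t : R := 2 * pos2 t - 4 * pos2 (t - 2^-1) + 2 * pos2 (t - 1).
Definition dstp t : R := 4 * Num.max 0 t - 8 * Num.max 0 (t - 2^-1) + 4 * Num.max 0 (t - 1).

Lemma dstpE t : is_derive t 1 stp (dstp t).
Proof.
have h c : is_derive t 1 (fun s => pos2 (s - c)) (2 * Num.max 0 (t - c)).
  apply: (deq (@dcomp _ pos2 (fun s => s - c) t _ _ (dpos2 _) (dB (did t) (dcst t c)))).
  by rewrite subr0 mulr1.
apply: (deq (dD (dB (dM (dcst t 2) (dpos2 t)) (dM (dcst t 4) (h _))) (dM (dcst t 2) (h _)))).
by rewrite /dstp; ring.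
Qed.

Lemma dstp_cont : continuous dstp.
Proof.
have h c : continuous (fun t : R => Num.max 0 (t - c)).
  move=> t; apply: (@continuous_max _ _ (fun=> 0) (fun t => t - c)); first exact: cvg_cst.
  by apply: cvgB; [exact: cvg_id|exact: cvg_cst].
have h0 : continuous (fun t : R => Num.max 0 t).
  move=> t; apply: (@continuous_max _ _ (fun=> 0) (fun t => t)); first exact: cvg_cst.
  exact: cvg_id.
apply: ctD; [apply: ctB|]; apply: ctM => //; exact: ct_cst.
Qed.

Lemma stp_cont : continuous stp.
Proof. exact: d_cont dstpE. Qed.

Lemma stp_le0 t : t <= 0 -> stp t = 0.
Proof.
move=> t0; rewrite /stp /pos2 !max_l//; last lra; last lra.
by rewrite expr0n /=; ring.
Qed.

Lemma stp_ge1 t : 1 <= t -> stp t = 1.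
Proof. by move=> t1; rewrite /stp /pos2 !max_r; [field|lra..]. Qed.

Lemma stp_bd t : 0 <= stp t <= 1.
Proof.
have [h|h] := leP t 0; first by rewrite stp_le0// lexx ler01.
have [h'|h'] := leP 1 t; first by rewrite stp_ge1// lexx ler01.
rewrite /stp /pos2 ?(max_r (ltW h)) (max_l (_ : t - 1 <= 0)); last lra.
have [h2|h2] := leP t 2^-1.
  by rewrite max_l ?subr_le0// expr0n /=; apply/andP; split; nra.
rewrite (max_r (_ : 0 <= t - 2^-1)); last lra.
by rewrite expr0n /=; apply/andP; split; nra.
Qed.

Lemma stp_ge0 t : 0 <= stp t. Proof. by case/andP: (stp_bd t). Qed.
Lemma stp_le1 t : stp t <= 1. Proof. by case/andP: (stp_bd t). Qed.

Lemma dstp_bd t : 0 <= dstp t <= 2.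
Proof.
rewrite /dstp; have [h|h] := leP t 0.
  by rewrite !max_l; [apply/andP; split; lra|lra..].
rewrite ?(max_r (ltW h)); have [h2|h2] := leP t 2^-1.
  by rewrite !max_l; [apply/andP; split; lra|lra..].
rewrite (max_r (_ : 0 <= t - 2^-1)); last lra.
have [h'|h'] := leP 1 t.
  by rewrite max_r; [apply/andP; split; lra|lra].
by rewrite max_l; [apply/andP; split; lra|lra].
Qed.

Lemma dstp_out t : t <= 0 \/ 1 <= t -> dstp t = 0.
Proof.
by rewrite /dstp => -[h|h]; [rewrite !max_l; [lra|lra..]|rewrite !max_r; [lra|lra..]].
Qed.

(* a C^1 plateau: positive exactly on ]a, b[, equal to 1 on [a + 1/n, b - 1/n] *)
Definition plat a b (n x : R) : R := stp (n * (x - a)) * stp (n * (b - x)).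
Definition dplat a b (n x : R) : R := n * (dstp (n * (x - a)) * stp (n * (b - x)) - stp (n * (x - a)) * dstp (n * (b - x))).

Lemma dplatE a b n x : is_derive x 1 (plat a b n) (dplat a b n x).
Proof.
have h1 : is_derive x 1 (fun x => n * (x - a)) n.
  by apply: (deq (dM (dcst x n) (dB (did x) (dcst x a)))); ring.
have h2 : is_derive x 1 (fun x => n * (b - x)) (- n).
  by apply: (deq (dM (dcst x n) (dB (dcst x b) (did x)))); ring.
apply: (deq (dM (@dcomp _ stp (fun x => n * (x - a)) x _ _ (dstpE _) h1)
  (@dcomp _ stp (fun x => n * (b - x)) x _ _ (dstpE _) h2))).
by rewrite /dplat; ring.
Qed.

Lemma plat_arg_cont a b n : continuous (fun x : R => n * (x - a)) /\ continuous (fun x : R => n * (b - x)).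
Proof.
split; apply: ctM; try exact: ct_cst; apply: ctB; try exact: ct_cst; move=> x; exact: cvg_id.
Qed.

Lemma dplat_cont a b n : continuous (dplat a b n).
Proof.
have [c1 c2] := plat_arg_cont a b n.
apply: ctM; first exact: ct_cst.
by apply: ctB; apply: ctM; apply: ct_comp => //; (exact: stp_cont || exact: dstp_cont).
Qed.

Lemma plat_cont a b n : continuous (plat a b n).
Proof. exact: d_cont (dplatE a b n). Qed.

Lemma plat_ge0 a b n x : 0 <= plat a b n x.
Proof. by rewrite mulr_ge0// stp_ge0. Qed.

Lemma plat_le1 a b n x : plat a b n x <= 1.
Proof. by rewrite mulr_ile1// ?stp_ge0 ?stp_le1. Qed.

Lemma plat_out a b n x : 0 <= n -> ~~ (a < x < b) -> plat a b n x = 0.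
Proof.
move=> n0 h; rewrite /plat; move: h; rewrite negb_and -!leNgt => /orP[|] h.
  by rewrite (stp_le0 (t := n * (x - a))) ?mul0r//; nra.
by rewrite (stp_le0 (t := n * (b - x))) ?mulr0//; nra.
Qed.

Lemma dplat_out a b n x : 0 <= n -> ~~ (a < x < b) -> dplat a b n x = 0.
Proof.
move=> n0 h; rewrite /dplat; move: h; rewrite negb_and -!leNgt => /orP[|] h.
  have h' : n * (x - a) <= 0 by nra.
  by rewrite (stp_le0 h') dstp_out ?mul0r ?subrr ?mulr0//; left.
have h' : n * (b - x) <= 0 by nra.
by rewrite (stp_le0 h') (dstp_out (t := n * (b - x))) ?mulr0 ?subrr ?mulr0//; left.
Qed.

Lemma plat_in a b n x : 0 < n -> a + n^-1 <= x -> x <= b - n^-1 -> plat a b n x = 1 /\ dplat a b n x = 0.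
Proof.
move=> n0 h1 h2.
have g1 : 1 <= n * (x - a) by rewrite -ler_pdivrMl// mulr1; lra.
have g2 : 1 <= n * (b - x) by rewrite -ler_pdivrMl// mulr1; lra.
by rewrite /plat /dplat !stp_ge1// !dstp_out; [split; ring|right|right].
Qed.

Lemma dplat_bd a b n x : 0 <= n -> `|dplat a b n x| <= 2 * n.
Proof.
move=> n0; rewrite /dplat normrM ger0_norm// mulrC; apply: ler_wpM2r => //.
have := stp_bd (n * (b - x)); have := stp_bd (n * (x - a)).
have := dstp_bd (n * (b - x)); have := dstp_bd (n * (x - a)).
move: (stp _) (stp _) (dstp _) (dstp _) => s t u v /andP[? ?] /andP[? ?] /andP[? ?] /andP[? ?].
by rewrite ler_norml; apply/andP; split; nra.
Qed.

Lemma plat_cvg a b x : plat a b n%:R x @[n --> \oo] --> (\1_(`]a, b[%classic) x : R).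
Proof.
have [/andP[ax xb]|h] := boolP (a < x < b); last first.
  rewrite indicE memNset /=; last by rewrite in_itv/=; exact/negP.
  by under eq_fun do rewrite plat_out//; exact: cvg_cst.
rewrite indicE mem_set /=; last by rewrite in_itv/= ax.
set m := Num.min (x - a) (b - x); have m0 : 0 < m by rewrite /m lt_min !subr_gt0 ax.
apply: cvg_near_cst; near=> n.
have nm : m^-1 <= n%:R by near: n; apply: nbhs_infty_ger; rewrite num_real.
have n0 : (0 : R) < n%:R by apply: lt_le_trans nm; rewrite invr_gt0.
have h : n%:R^-1 <= m by rewrite invf_ple ?posrE.
have m1 : m <= x - a by rewrite ge_min lexx.
have m2 : m <= b - x by rewrite ge_min lexx orbT.
by apply: (plat_in _ _ _).1 => //; lra.
Unshelve. all: by end_near. Qed.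

End steps.

(** * Change of variables for a smooth map close to the identity *)

Section smooth_cov.
Variable R : realType.
Implicit Types (u v : Pt R -> R) (r s M : R).

(** The integrand is [d_x(X(u) c2(v) v_y) - d_y(X(u) c2(v) v_x)], where the terms in [c2'] and in
    the mixed derivative cancel. Closeness to the identity determines the boundary terms: [c2(v)]
    vanishes on the horizontal sides, [X(u)] is constant on each vertical side, and there the
    remaining factor is the derivative of [Y(v)]. *)
Lemma box_cov u u1 u2 u12 v v1 v2 v12 (c1 c2 c2' X Y : R -> R) r s M :
  C2m u u1 u2 u12 -> C2m v v1 v2 v12 -> continuous c1 -> continuous c2' ->
  (forall t : R, is_derive t 1 c2 (c2' t)) -> (forall t : R, is_derive t 1 X (c1 t)) -> (forall t : R, is_derive t 1 Y (c2 t)) ->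
  (forall t, s <= `|t| -> c1 t = 0 /\ c2 t = 0) -> 0 <= s -> 0 <= M -> s + M <= r ->
  (forall z, bx r z -> `|u z - z.1| <= M /\ `|v z - z.2| <= M) ->
  bint r (fun z => c1 (u z) * c2 (v z) * (u1 z * v2 z - u2 z * v1 z)) = (X s - X (-s)) * (Y s - Y (-s)).
Proof.
move=> [[cu cu1 cu2 pu1 pu2] pu12 pu21 cu12] [[cv cv1 cv2 pv1 pv2] pv12 pv21 cv12] cc1 cc2' dc2 dX dY c0 s0 M0 sr huv.
have cX := d_cont dX; have cc2 := d_cont dc2; have cY := d_cont dY.
have r0 : 0 <= r by lra.
pose P z := X (u z) * (c2 (v z) * v2 z).
pose Q z := X (u z) * (c2 (v z) * v1 z).
pose P1 z := c1 (u z) * u1 z * (c2 (v z) * v2 z) + X (u z) * (c2' (v z) * v1 z * v2 z + c2 (v z) * v12 z).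
pose Q2 z := c1 (u z) * u2 z * (c2 (v z) * v1 z) + X (u z) * (c2' (v z) * v2 z * v1 z + c2 (v z) * v12 z).
have pP : pdv true P P1 := pdvM (pdv_comp1 dX pu1) (pdvM (pdv_comp1 dc2 pv1) pv21).
have pQ : pdv false Q Q2 := pdvM (pdv_comp1 dX pu2) (pdvM (pdv_comp1 dc2 pv2) pv12).
have cXu : continuous (fun z => X (u z)) by exact: ct_comp.
have cc1u : continuous (fun z => c1 (u z)) by exact: ct_comp.
have cc2v : continuous (fun z => c2 (v z)) by exact: ct_comp.
have cc2'v : continuous (fun z => c2' (v z)) by exact: ct_comp.
have cP1 : continuous P1.
  apply: ctD; first by apply: ctM; exact: ctM.
  by apply: ctM => //; apply: ctD; [apply: ctM => //; exact: ctM|exact: ctM].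
have cQ2 : continuous Q2.
  apply: ctD; first by apply: ctM; exact: ctM.
  by apply: ctM => //; apply: ctD; [apply: ctM => //; exact: ctM|exact: ctM].
transitivity (bint r P1 - bint r Q2).
  rewrite -bintB; [|exact: L1_cont|exact: L1_cont].
  by apply: eq_bint => z _; rewrite /P1 /Q2; ring.
have Xc t : s <= t -> X t = X s.
  move=> st; have [c] := MVT_abs s t dX.
  have [<-|/eqP nst] := eqVneq s t => //.
  have lt : s < t by rewrite lt_neqAle st andbT; exact/eqP.
  have [d] := @MVT R X c1 s t lt (fun x _ => dX x) (continuous_subspaceT cX).
  rewrite in_itv/= => /andP[d1 _] e _ _; apply/eqP; rewrite -subr_eq0 e (c0 d _).1 ?mul0r//.
  by rewrite ger0_norm ltW//; apply: le_lt_trans d1.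
have Xc' t : t <= -s -> X t = X (-s).
  have [->//|/eqP nst] := eqVneq t (-s) => st.
  have lt : t < - s by rewrite lt_neqAle st andbT; exact/eqP.
  have [d] := @MVT R X c1 t (-s) lt (fun x _ => dX x) (continuous_subspaceT cX).
  rewrite in_itv/= => /andP[_ d1] e; apply/eqP; rewrite eq_sym -subr_eq0 e (c0 d _).1 ?mul0r//.
  by rewrite ler0_norm; lra.
have Yc t : s <= t -> Y t = Y s.
  have [<-//|/eqP nst] := eqVneq s t => st.
  have lt : s < t by rewrite lt_neqAle st andbT; exact/eqP.
  have [d] := @MVT R Y c2 s t lt (fun x _ => dY x) (continuous_subspaceT cY).
  rewrite in_itv/= => /andP[d1 _] e; apply/eqP; rewrite -subr_eq0 e (c0 d _).2 ?mul0r//.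
  by rewrite ger0_norm ltW//; apply: le_lt_trans d1.
have Yc' t : t <= -s -> Y t = Y (-s).
  have [->//|/eqP nst] := eqVneq t (-s) => st.
  have lt : t < - s by rewrite lt_neqAle st andbT; exact/eqP.
  have [d] := @MVT R Y c2 t (-s) lt (fun x _ => dY x) (continuous_subspaceT cY).
  rewrite in_itv/= => /andP[_ d1] e; apply/eqP; rewrite eq_sym -subr_eq0 e (c0 d _).2 ?mul0r//.
  by rewrite ler0_norm; lra.
have bd (a b : R) : `|a| <= r -> `|b| <= r -> `|u (a, b) - a| <= M /\ `|v (a, b) - b| <= M.
  by move=> ha hb; apply: (huv (a, b)); apply/bxP.
have nr : `|r| <= r /\ `|- r| <= r by rewrite normrN !ger0_norm.
rewrite (bint_dx r0 pP cP1) (bint_dy r0 pQ cQ2).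
have -> : lint (-r) r (fun x => Q (x, r) - Q (x, -r)) = 0.
  rewrite (@eq_lint _ _ _ _ (fun=> 0)) ?lint_cst ?mul0r//; first lra.
  move=> x; rewrite -ler_norml => xr.
  have [_ h1] := bd x r xr nr.1; have [_ h2] := bd x (-r) xr nr.2.
  rewrite /Q (c0 (v (x, r)) _).2; last by move: h1; rewrite ler_distl => /andP[h1 _]; rewrite ger0_norm; lra.
  rewrite (c0 (v (x, -r)) _).2; last by move: h2; rewrite ler_distl => /andP[_ h2]; rewrite ler0_norm; lra.
  by ring.
rewrite subr0.
have rr : -r <= r by lra.
have cl (a : R) : continuous (fun y : R => c2 (v (a, y)) * v2 (a, y)).
  exact: (ct_comp2 (ctM cc2v cv2) (ct_upd false (a, 0))).
have L (a : R) : `|a| <= r -> lint (-r) r (fun y => c2 (v (a, y)) * v2 (a, y)) = Y s - Y (-s).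
  move=> ar.
  have dd (y : R) : is_derive y 1 (fun y => Y (v (a, y))) (c2 (v (a, y)) * v2 (a, y)).
    exact: (@dcomp _ Y (fun y => v (a, y)) y _ _ (dY _) (pv2 (a, y))).
  rewrite (FTC rr dd (cl a)).
  have [_ h1] := bd a r ar nr.1; have [_ h2] := bd a (-r) ar nr.2.
  rewrite (Yc (v (a, r))); last by move: h1; rewrite ler_distl => /andP[h1 _]; lra.
  by rewrite (Yc' (v (a, -r)))//; move: h2; rewrite ler_distl => /andP[_ h2]; lra.
rewrite (@eq_lint _ _ _ _ (fun y => X s * (c2 (v (r, y)) * v2 (r, y)) - X (-s) * (c2 (v (-r, y)) * v2 (-r, y)))); last first.
  move=> y; rewrite -ler_norml => yr.
  have [h1 _] := bd r y nr.1 yr; have [h2 _] := bd (-r) y nr.2 yr.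
  rewrite /P (Xc (u (r, y))); last by move: h1; rewrite ler_distl => /andP[h1 _]; lra.
  rewrite (Xc' (u (-r, y)))//; by move: h2; rewrite ler_distl => /andP[_ h2]; lra.
rewrite /lint RintegralB//; last 2 first.
  by apply: lint_L1; apply: ctM => //; exact: ct_cst.
  by apply: lint_L1; apply: ctM => //; exact: ct_cst.
rewrite !RintegralZl//; try exact: lint_L1.
rewrite -!/(lint _ _ _) !L//; first by ring.
- exact: nr.2.
- exact: nr.1.
Qed.

End smooth_cov.

(** * Passage to the limit in integrals of products *)

Section limits.
Variable R : realType.
Implicit Types (w A B : Pt R -> R) (r e : R).

Definition tends (a : nat -> R) (l : R) := forall e, 0 < e -> exists N, forall n, (N <= n)%N -> `|a n - l| <= e.

(** The form in which an identity valid for all late mollifications passes to the weak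
    derivatives. *)
Lemma tends_cst_eq (a : nat -> R) (l m : R) : tends a l -> (exists N, forall n, (N <= n)%N -> a n = m) -> l = m.
Proof.
move=> ha [N hN]; apply/eqP; rewrite -subr_eq0 -normr_eq0; apply/negPn/negP => ne.
have p : 0 < `|l - m| by rewrite lt_def ne normr_ge0.
have [N' hN'] := ha (`|l - m| / 2) ltac:(lra).
have := hN' (maxn N N') (leq_maxr _ _); rewrite hN ?leq_maxl// distrC; lra.
Qed.

Lemma tends_le (a b : nat -> R) (l m : R) : tends a l -> tends b m -> (exists N, forall n, (N <= n)%N -> a n <= b n) -> l <= m.
Proof.
move=> ha hb [N hN]; rewrite leNgt; apply/negP => lm.
have [N1 h1] := ha ((l - m) / 3) ltac:(lra); have [N2 h2] := hb ((l - m) / 3) ltac:(lra).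
pose n := maxn N (maxn N1 N2).
have := h1 n ltac:(by rewrite /n; lia); have := h2 n ltac:(by rewrite /n; lia); have := hN n ltac:(by rewrite /n; lia).
rewrite !ler_distl => ? /andP[? ?] /andP[? ?]; lra.
Qed.

Lemma tends_cst c : tends (fun=> c) c.
Proof. by move=> e e0'; exists 0%N => n _; rewrite subrr normr0 ltW. Qed.

Lemma tendsD a b l m : tends a l -> tends b m -> tends (fun n => a n + b n) (l + m).
Proof.
move=> ha hb e ep; have [N1 h1] := ha (e / 2) ltac:(lra); have [N2 h2] := hb (e / 2) ltac:(lra).
exists (maxn N1 N2) => n; rewrite geq_max => /andP[le1 le2].
rewrite opprD addrACA (le_trans (ler_normD _ _))//.
have := h1 n le1; have := h2 n le2; lra.
Qed.

Lemma tendsN a l : tends a l -> tends (fun n => - a n) (- l).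
Proof. by move=> ha e ep; have [N h] := ha e ep; exists N => n /h; rewrite -opprB normrN opprK addrC. Qed.

Lemma tendsB a b l m : tends a l -> tends b m -> tends (fun n => a n - b n) (l - m).
Proof. by move=> ha hb; apply: tendsD => //; exact: tendsN. Qed.

Lemma eq_tends a b l : (forall n, a n = b n) -> tends a l -> tends b l.
Proof. by move=> /funext ->. Qed.

Definition Lim2 r (a : nat -> Pt R -> R) A := [/\ forall n, L2 r (a n), L2 r A &
  forall e, 0 < e -> exists N, forall n, (N <= n)%N -> N2 r (fun x => a n x - A x) <= e].
Definition LimU r (w : nat -> Pt R -> R) w' := [/\ forall n, continuous (w n), continuous w' &
  forall e, 0 < e -> exists N, forall n x, (N <= n)%N -> bx r x -> `|w n x - w' x| <= e].

Lemma L1M3 r w A B : continuous w -> L2 r A -> L2 r B -> L1 r (fun z => w z * (A z * B z)).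
Proof. by move=> cw hA hB; apply: L1Mc => //; exact: L2M. Qed.

(** Quadratic expressions in L^2 convergent derivatives with uniformly convergent weights: the
    difference splits into three terms, each controlled by Cauchy-Schwarz. *)
Lemma lim_wAB r (w a b : nat -> Pt R -> R) w' A B : LimU r w w' -> Lim2 r a A -> Lim2 r b B ->
  tends (fun n => bint r (fun z => w n z * (a n z * b n z))) (bint r (fun z => w' z * (A z * B z))).
Proof.
move=> [cw cw' hw] [ha hA la] [hb hB lb] e ep.
have [W W0 hW] := cont_bounded_bx r cw'.
set na := N2 r A; set nb := N2 r B.
have na0 : 0 <= na by exact: N2_ge0.
have nb0 : 0 <= nb by exact: N2_ge0.
(* [C] collects the coefficients of the three error terms, so accuracy [e/C], and at most 1, in each
   of the limits is enough. *)
pose C := (na + 1) * (nb + 1) + W * (nb + 1) + W * na.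
have C0 : 0 < C.
  have p1 := mulr_ge0 (ltW W0) na0; have p2 := mulr_ge0 (ltW W0) nb0; have p3 := mulr_ge0 na0 nb0.
  by rewrite /C; nra.
pose d := Num.min 1 (e / C).
have d0 : 0 < d by rewrite /d lt_min ltr01 divr_gt0.
have d1 : d <= 1 by rewrite /d ge_min lexx.
have dC : d * C <= e by rewrite -ler_pdivlMr// /d ge_min lexx orbT.
have [N1 h1] := hw d d0; have [M1 h2] := la d d0; have [M2 h3] := lb d d0.
exists (maxn N1 (maxn M1 M2)) => n; rewrite !geq_max => /and3P[le1 le2 le3].
have {}h1 := h1 n _ le1; have {}h2 := h2 n le2; have {}h3 := h3 n le3.
have L1' := L1M3 (cw n) (ha n) (hb n); have L2' := L1M3 cw' hA hB.
have bn : N2 r (b n) <= nb + 1.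
  have := N2D (L2B (hb n) hB) hB; rewrite (@eq_N2 _ _ _ (b n)) => [|z _]; last ring.
  by rewrite -/nb; lra.
have an : N2 r (a n) <= na + 1.
  have := N2D (L2B (ha n) hA) hA; rewrite (@eq_N2 _ _ _ (a n)) => [|z _]; last ring.
  by rewrite -/na; lra.
rewrite -bintB//.
have L3 := L1B L1' L2'.
have hD1 := L2B (ha n) hA; have hD2 := L2B (hb n) hB.
apply: (le_trans (bint_abs L3)).
apply: (@le_trans _ _ (bint r (fun z => d * `|a n z * b n z| + W * `|(a n z - A z) * b n z| + W * `|A z * (b n z - B z)|))).
  apply: le_bint; first exact: L1_abs.
    by apply: L1D; [apply: L1D|]; apply: L1Z; apply: L1_abs; exact: L2M.
  move=> z bz.
  have -> : w n z * (a n z * b n z) - w' z * (A z * B z) =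
    (w n z - w' z) * (a n z * b n z) + w' z * ((a n z - A z) * b n z) + w' z * (A z * (b n z - B z)) by ring.
  apply: (le_trans (ler_normD _ _)); apply: lerD; last by rewrite normrM; apply: ler_wpM2r => //; exact: hW.
  apply: (le_trans (ler_normD _ _)); apply: lerD; last by rewrite normrM; apply: ler_wpM2r => //; exact: hW.
  by rewrite normrM; apply: ler_wpM2r => //; exact: h1.
rewrite !bintD; try (by repeat apply: L1D; apply: L1Z; apply: L1_abs; exact: L2M).
rewrite !bintZ; try (by apply: L1_abs; exact: L2M).
have c1 := CS (ha n) (hb n); have c2 := CS hD1 (hb n); have c3 := CS hA hD2.
have n1 := N2_ge0 r (a n); have n2 := N2_ge0 r (b n).
have n3 := N2_ge0 r (fun z => a n z - A z); have n4 := N2_ge0 r (fun z => b n z - B z).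
apply: le_trans dC.
have e1 : d * bint r (fun z => `|a n z * b n z|) <= d * ((na + 1) * (nb + 1)).
  by apply: ler_wpM2l; [exact: ltW|apply: (le_trans c1); apply: ler_pM].
have e2 : W * bint r (fun z => `|(a n z - A z) * b n z|) <= W * (d * (nb + 1)).
  by apply: ler_wpM2l; [exact: ltW|apply: (le_trans c2); apply: ler_pM].
have e3 : W * bint r (fun z => `|A z * (b n z - B z)|) <= W * (na * d).
  by apply: ler_wpM2l; [exact: ltW|apply: (le_trans c3); apply: ler_pM].
clear -e1 e2 e3; rewrite /C; lra.
Qed.

Lemma LimU_cst r w : continuous w -> LimU r (fun=> w) w.
Proof. by move=> cw; split => // e ep; exists 0%N => n x _ _; rewrite subrr normr0 ltW. Qed.

Lemma Lim2_cst r A : L2 r A -> Lim2 r (fun=> A) A.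
Proof.
move=> hA; split => // e ep; exists 0%N => n _.
rewrite (@eq_N2 _ _ _ (fun z => 0 * A z)) => [|z _]; last by ring.
by rewrite N2Z// normr0 mul0r ltW.
Qed.

Lemma lim_wA r (w a : nat -> Pt R -> R) w' A : LimU r w w' -> Lim2 r a A ->
  tends (fun n => bint r (fun z => w n z * a n z)) (bint r (fun z => w' z * A z)).
Proof.
move=> hw ha; have h1 := Lim2_cst (L2_cont r (@ct_cst _ _ 1)).
rewrite (@eq_bint _ _ _ (fun z => w' z * (A z * 1))) => [|z _]; last by rewrite mulr1.
apply: eq_tends (lim_wAB hw ha h1) => n.
by apply: eq_bint => z _; rewrite mulr1.
Qed.

Lemma LimU_comp2 r (h : Pt R -> R) (u v : nat -> Pt R -> R) u' v' : continuous h -> LimU r u u' -> LimU r v v' ->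
  LimU r (fun n z => h (u n z, v n z)) (fun z => h (u' z, v' z)).
Proof.
move=> ch [cu cu' hu] [cv' cv'' hv]; split; [by move=> n; exact: (ct_comp2 ch (ct_pair (cu n) (cv' n)))|exact: (ct_comp2 ch (ct_pair cu' cv''))|].
move=> e ep.
have [M1 M10 b1] := cont_bounded_bx r cu'; have [M2 M20 b2] := cont_bounded_bx r cv''.
have [d d0 hd] := unif_cont_bx (M1 + M2) ch ep.
have [N1 h1] := hu (d / 2) ltac:(lra); have [N2' h2] := hv (d / 2) ltac:(lra).
exists (maxn N1 N2') => n x; rewrite geq_max => /andP[le1 le2] bx'; rewrite distrC; apply: hd.
  by apply/bxP => /=; have := b1 x bx'; have := b2 x bx'; split; lra.
rewrite prod_normE gt_max /= -![`|_ - _ n x|]distrC.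
have := h1 n x le1 bx'; have := h2 n x le2 bx' => ? ?; apply/andP; split; lra.
Qed.

Lemma LimU_comp1 r (h : R -> R) (u : nat -> Pt R -> R) u' : continuous h -> LimU r u u' ->
  LimU r (fun n z => h (u n z)) (fun z => h (u' z)).
Proof.
move=> ch hu; exact: (LimU_comp2 (h := fun p => h p.1) (ct_comp ch (@ct_fst R)) hu hu).
Qed.

Lemma LimUM r (u v : nat -> Pt R -> R) u' v' : LimU r u u' -> LimU r v v' ->
  LimU r (fun n z => u n z * v n z) (fun z => u' z * v' z).
Proof.
by move=> hu hv; apply: (LimU_comp2 (h := fun p => p.1 * p.2) _ hu hv); apply: ctM; [exact: ct_fst|exact: ct_snd].
Qed.

End limits.

(** * Quasiconformal data: distortion, weak derivatives, distance to the identity *)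

Section qc_data.
Variable R : realType.
Implicit Types (r e s M : R) (x z : Pt R).

Lemma cabs_ge (z : Pt R) : `|z| <= cabs z.
Proof.
have h (a b : R) : `|a| <= Num.sqrt (a ^+ 2 + b ^+ 2).
  by rewrite -sqrtr_sqr ler_wsqrtr// lerDl sqr_ge0.
by rewrite prod_normE ge_max /cabs h addrC h.
Qed.

Lemma cabs_le (z : Pt R) : cabs z <= 2 * `|z|.
Proof.
rewrite -[leRHS]ger0_norm ?mulr_ge0// -sqrtr_sqr ler_wsqrtr// exprMn.
have h1 : z.1 ^+ 2 <= `|z| ^+ 2 by rewrite -real_normK ?num_real// lerXn2r ?nnegrE ?norm_fst.
have h2 : z.2 ^+ 2 <= `|z| ^+ 2 by rewrite -real_normK ?num_real// lerXn2r ?nnegrE ?norm_snd.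
have := sqr_ge0 `|z|; nra.
Qed.

Lemma cabs2 (z : Pt R) : cabs z ^+ 2 = z.1 ^+ 2 + z.2 ^+ 2.
Proof. by rewrite sqr_sqrtr// addr_ge0 ?sqr_ge0. Qed.

Lemma csubE (z w : Pt R) : csub z w = z - w. Proof. by []. Qed.
Lemma caddE (z w : Pt R) : Defs.cadd z w = z + w. Proof. by []. Qed.

(* Bounded distortion in terms of the Jacobian: compare the largest derivative with the one in the
   direction orthogonal (in the image) to Dx. *)
Lemma distortion (K : R) (Dx Dy : Pt R) : 1 <= K ->
  (forall a b : R, cabs (Defs.cadd (Defs.cscale (cos a) Dx) (Defs.cscale (sin a) Dy))
     <= K * cabs (Defs.cadd (Defs.cscale (cos b) Dx) (Defs.cscale (sin b) Dy))) ->
  Dx.1 ^+ 2 + Dx.2 ^+ 2 + Dy.1 ^+ 2 + Dy.2 ^+ 2 <= (K + K ^+ 3) * `|Dx.1 * Dy.2 - Dy.1 * Dx.2|.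
Proof.
move=> K1; case: Dx => a c; case: Dy => b d H.
have K0 : 0 <= K by lra.
have H2 (s1 s2 c1 c2 : R) : (exists al, cos al = c1 /\ sin al = s1) -> (exists be, cos be = c2 /\ sin be = s2) ->
    (c1 * a + s1 * b) ^+ 2 + (c1 * c + s1 * d) ^+ 2 <= K ^+ 2 * ((c2 * a + s2 * b) ^+ 2 + (c2 * c + s2 * d) ^+ 2).
  move=> [al [<- <-]] [be [<- <-]]; have := H al be.
  rewrite -(@ler_pXn2r _ 2) ?nnegrE ?mulr_ge0 ?sqrtr_ge0// exprMn !cabs2 //=.
have A0 : exists al : R, cos al = 1 /\ sin al = 0 by exists 0; rewrite cos0 sin0.
have A1 : exists al : R, cos al = 0 /\ sin al = 1 by exists (pi / 2); rewrite cos_pihalf sin_pihalf.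
have h1 := H2 _ _ _ _ A1 A0; rewrite !mul0r !mul1r !add0r !addr0 in h1.
rewrite /=; set J := a * d - b * c.
have [z|nz] := eqVneq (a ^+ 2 + c ^+ 2) 0.
  have az : a = 0 by have := sqr_ge0 a; have := sqr_ge0 c; move=> ? ?; apply/eqP; rewrite -sqrf_eq0; apply/eqP; lra.
  have cz : c = 0 by have := sqr_ge0 a; have := sqr_ge0 c; move=> ? ?; apply/eqP; rewrite -sqrf_eq0; apply/eqP; lra.
  move: h1; rewrite z mulr0 /J az cz !(mul0r, mulr0) subrr normr0 mulr0; lra.
set N := a ^+ 2 + c ^+ 2 in nz h1; have N0 : 0 < N by rewrite lt_def nz addr_ge0 ?sqr_ge0.
set p := a * b + c * d; set n := Num.sqrt (p ^+ 2 + N ^+ 2).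
have n2 : n ^+ 2 = p ^+ 2 + N ^+ 2 by rewrite sqr_sqrtr// addr_ge0 ?sqr_ge0.
have n0 : 0 < n by rewrite sqrtr_gt0 ltr_wpDl ?sqr_ge0// exprn_gt0.
(* In the direction [(-p, N)/n] the derivative is orthogonal to [Dx], and its squared length is
   [N J^2 / n^2]. *)
have B : exists be : R, cos be = - p / n /\ sin be = N / n.
  have cb : -1 <= - p / n <= 1.
    rewrite -ler_norml normrM normrN normfV (gtr0_norm n0) ler_pdivrMr// mul1r.
    by rewrite -sqrtr_sqr ler_wsqrtr// lerDl sqr_ge0.
  exists (acos (- p / n)); rewrite acosK// sin_acos//; split => //.
  have -> : 1 - (- p / n) ^+ 2 = (N / n) ^+ 2.
    rewrite !expr_div_n sqrrN n2; field.
    by rewrite -n2 expf_neq0// gt_eqF.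
  by rewrite sqrtr_sqr ger0_norm// divr_ge0 ?ltW.
have h2 := H2 _ _ _ _ A0 B; rewrite !mul0r !mul1r !addr0 -/N in h2.
have e : (- p / n * a + N / n * b) ^+ 2 + (- p / n * c + N / n * d) ^+ 2 = N * J ^+ 2 / n ^+ 2.
  by rewrite /p /N /J; field; rewrite gt_eqF.
have J2 : J ^+ 2 = `|J| ^+ 2 by rewrite real_normK ?num_real.
have nN : N ^+ 2 <= n ^+ 2 by rewrite n2 lerDr sqr_ge0.
have h3 : N ^+ 2 <= (K * `|J|) ^+ 2.
  rewrite exprMn -J2; move: h2; rewrite e => h2.
  have h4 : K ^+ 2 * (N * J ^+ 2 / n ^+ 2) <= K ^+ 2 * (J ^+ 2 / N).
    apply: ler_wpM2l; first exact: exprn_ge0.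
    rewrite ler_pdivrMr ?exprn_gt0// mulrAC ler_pdivlMr//.
    have := sqr_ge0 J; nra.
  have := le_trans h2 h4; rewrite mulrA ler_pdivlMr// -expr2.
have h5 : N <= K * `|J|.
  by move: h3; rewrite ler_pXn2r ?nnegrE ?mulr_ge0// ltW.
have -> : a ^+ 2 + c ^+ 2 + b ^+ 2 + d ^+ 2 = N + (b ^+ 2 + d ^+ 2) by rewrite /N; ring.
have -> : (K + K ^+ 3) * `|J| = K * `|J| + K ^+ 2 * (K * `|J|) by ring.
apply: lerD => //; apply: (le_trans h1); apply: ler_wpM2l => //; exact: exprn_ge0.
Qed.

(* [Q] bounds the distortion, [M] bounds |phi z - z|; [fx .. gy] are the weak partial derivatives,
   normalized on a null set so that the distortion inequality (with J >= 0) holds everywhere *)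
Record qcmap (Q M : R) (phi psi : Pt R -> Pt R) (fx fy gx gy : Pt R -> R) : Prop := Qcmap {
  qc_K : cancel phi psi; qc_K' : cancel psi phi;
  qc_c : continuous phi; qc_c' : continuous psi;
  qc_fx : L2loc' fx; qc_fy : L2loc' fy; qc_gx : L2loc' gx; qc_gy : L2loc' gy;
  qc_wfx : weak_pd true (fun z => (phi z).1) fx; qc_wfy : weak_pd false (fun z => (phi z).1) fy;
  qc_wgx : weak_pd true (fun z => (phi z).2) gx; qc_wgy : weak_pd false (fun z => (phi z).2) gy;
  qc_M0 : 0 <= M;
  qc_M : forall z, `|phi z - z| <= M;
  qc_Q0 : 0 <= Q }.

Definition Jac (fx fy gx gy : Pt R -> R) z := fx z * gy z - fy z * gx z.

Lemma L2locD (F : Pt R -> R) : Defs.L2loc F -> L2loc' F.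
Proof.
move=> [mF hF]; split => // r; split; first exact: measurable_funTS.
have := hF (2 * r); rewrite /L1; apply: integrableS => //.
- have -> : [set x : Pt R | cabs x <= 2 * r] = @cabs R @^-1` `]-oo, 2 * r]%classic.
    by apply/seteqP; split => z; rewrite /= in_itv.
  have mc : measT (@cabs R).
    apply: measurable_cont2; apply: ct_comp; first exact: sqrt_continuous.
    by apply: ctD; apply: ctX; [exact: ct_fst|exact: ct_snd].
  by rewrite -[X in measurable X]setTI; exact: mc.
- exact: measurable_bx.
- by move=> z; rewrite /bx /= => zr; apply: (le_trans (cabs_le z)); rewrite ler_pM2l.
Qed.

(** The expansion at infinity enters the proof as this global bound: compactness near the origin,
    [M / cabs z <= |M|] beyond. *)
Lemma principal_bounded (phi : Pt R -> Pt R) : continuous phi -> principal phi ->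
  exists2 M, 0 <= M & forall z, `|phi z - z| <= M.
Proof.
move=> cphi [_ [M [r H]]].
have c1 : continuous (fun z => (phi z - z).1).
  by apply: ctB; [exact: (ct_comp2 (@ct_fst R) cphi)|exact: ct_fst].
have c2 : continuous (fun z => (phi z - z).2).
  by apply: ctB; [exact: (ct_comp2 (@ct_snd R) cphi)|exact: ct_snd].
pose s := `|r| + 1.
have [M1 M10 h1] := cont_bounded_bx s c1; have [M2 M20 h2] := cont_bounded_bx s c2.
exists (`|M| + M1 + M2); first by rewrite !addr_ge0// ltW.
move=> z; have [zs|zs] := leP `|z| s.
  apply: norm_pair_le; [have := h1 z zs|have := h2 z zs]; have := normr_ge0 M; lra.
have cz : s < cabs z by apply: lt_le_trans zs (cabs_ge z).
have zr : r < cabs z by have := ler_norm r; rewrite /s in cz; lra.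
have := H z zr; rewrite csubE => h; have h' := le_trans (cabs_ge _) h.
apply: (le_trans h').
have c1' : 1 <= cabs z by have := normr_ge0 r; rewrite /s in cz; lra.
have : M / cabs z <= `|M|.
  rewrite ler_pdivrMr; last by lra.
  have := ler_norm M; have := normr_ge0 M; nra.
by lra.
Qed.

End qc_data.

(** * Change of variables for the quasiconformal map *)

Section change_of_variables.
Variables (R : realType) (Q M : R) (phi psi : Pt R -> Pt R) (fx fy gx gy : Pt R -> R).
Hypothesis H : qcmap Q M phi psi fx fy gx gy.
Local Notation m2 := (@leb2 R).
Local Notation J := (Jac fx fy gx gy).
Implicit Types (r s e : R) (x z w : Pt R) (h : Pt R -> R).

Lemma qc_L2 r : [/\ L2 r fx, L2 r fy, L2 r gx & L2 r gy].
Proof. by case: H => *; split; match goal with h : L2loc' ?f |- L2 _ ?f => exact: h.2 end. Qed.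

Lemma L1_Jac r : L1 r J.
Proof. by have [h1 h2 h3 h4] := qc_L2 r; apply: L1B; exact: L2M. Qed.

Lemma measurable_Jac : measT J.
Proof.
case: H => *; apply: measurable_funB; apply: measurable_funM;
  match goal with h : L2loc' ?f |- measurable_fun _ ?f => exact: h.1 end.
Qed.

Lemma phi1_cont : continuous (fun z => (phi z).1).
Proof. exact: (ct_comp2 (@ct_fst R) (qc_c H)). Qed.

Lemma phi2_cont : continuous (fun z => (phi z).2).
Proof. exact: (ct_comp2 (@ct_snd R) (qc_c H)). Qed.

Lemma measurable_phi : measT phi.
Proof. exact: measurable_cont22 (qc_c H). Qed.

Lemma measurable_psi : measT psi.
Proof. exact: measurable_cont22 (qc_c' H). Qed.

Lemma phi_bx s x : bx s (phi x) -> bx (s + M) x.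
Proof.
rewrite /bx /= => h; have := qc_M H x; have := ler_distD (phi x) x 0; rewrite !subr0 distrC; lra.
Qed.

Lemma smoothings : exists u u1 u2 u12 v v1 v2 v12 : nat -> Pt R -> R,
  [/\ forall n, C2m (u n) (u1 n) (u2 n) (u12 n), forall n, C2m (v n) (v1 n) (v2 n) (v12 n),
    smoothing (fun z => (phi z).1) fx fy u u1 u2 & smoothing (fun z => (phi z).2) gx gy v v1 v2].
Proof.
have [S [S1 [S2 hS]]] := smoothing_exists R.
have h1 := hS _ _ _ phi1_cont (qc_fx H) (qc_fy H) (qc_wfx H) (qc_wfy H).
have h2 := hS _ _ _ phi2_cont (qc_gx H) (qc_gy H) (qc_wgx H) (qc_wgy H).
have [u12 hu] := sm_C2 h1; have [v12 hv] := sm_C2 h2.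
by eexists; eexists; eexists; exists u12; eexists; eexists; eexists; exists v12; split; [exact: hu|exact: hv|exact: h1|exact: h2].
Qed.

Lemma smoothing_Lim F D1 D2 u u1 u2 r : continuous F -> L2loc' D1 -> L2loc' D2 ->
  smoothing F D1 D2 u u1 u2 -> [/\ LimU r u F, Lim2 r u1 D1 & Lim2 r u2 D2].
Proof.
move=> cF h1 h2 [[u12 hu] hU hN1 hN2 _]; split; split => //.
- by move=> n; case: (hu n) => -[].
- exact: hU.
- by move=> n; apply: L2_cont; case: (hu n) => -[].
- exact: h1.2.
- exact: hN1.
- by move=> n; apply: L2_cont; case: (hu n) => -[].
- exact: h2.2.
- exact: hN2.
Qed.

(** [box_cov] holds for the mollifications as soon as they are within [M + 1] of the identity, with
    a value independent of the index; both halves of the Jacobian pass to the limit by [lim_wAB]. *)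
Lemma cov_plat a b c d (n r s : R) : 0 <= n -> 0 <= s -> s + M + 1 <= r -> -s <= a -> b <= s -> -s <= c -> d <= s ->
  bint r (fun z => plat a b n (phi z).1 * plat c d n (phi z).2 * J z) = bint s (fun w => plat a b n w.1 * plat c d n w.2).
Proof.
move=> n0 s0 sr ha hb hc hd.
have out a' b' t : -s <= a' -> b' <= s -> s <= `|t| -> plat a' b' n t = 0.
  move=> h1 h2 st; apply: plat_out => //; apply/negP => /andP[h3 h4].
  by move: st; rewrite leNgt ltr_norml; have -> : - s < t < s by lra.
have [X dX] := antider (@plat_cont _ a b n) (M := s) (fun t st => out _ _ _ ha hb (ltW st)).
have [Y dY] := antider (@plat_cont _ c d n) (M := s) (fun t st => out _ _ _ hc hd (ltW st)).
have ss : -s <= s by lra.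
have -> : bint s (fun w => plat a b n w.1 * plat c d n w.2) = (X s - X (-s)) * (Y s - Y (-s)).
  rewrite bint_xy; last by apply: ctM; apply: ct_comp; (exact: plat_cont || exact: ct_fst || exact: ct_snd).
  rewrite -(FTC ss dX); last exact: plat_cont.
  rewrite -(FTC ss dY); last exact: plat_cont.
  rewrite mulrC {2}/lint -RintegralZl//; last by apply: lint_L1; exact: plat_cont.
  apply: eq_lint => x _; rewrite mulrC /= {1}/lint RintegralZl//; by apply: lint_L1; exact: plat_cont.
have [u [u1 [u2 [u12 [v [v1 [v2 [v12 [hu hv su sv]]]]]]]]] := smoothings.
have [lu lu1 lu2] := smoothing_Lim r phi1_cont (qc_fx H) (qc_fy H) su.
have [lv lv1 lv2] := smoothing_Lim r phi2_cont (qc_gx H) (qc_gy H) sv.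
have lw := LimUM (LimU_comp1 (@plat_cont _ a b n) lu) (LimU_comp1 (@plat_cont _ c d n) lv).
have t1 := lim_wAB lw lu1 lv2; have t2 := lim_wAB lw lu2 lv1.
have t := tendsB t1 t2.
have [h1 h2 h3 h4] := qc_L2 r.
have cw : continuous (fun z => plat a b n (phi z).1 * plat c d n (phi z).2) by case: lw.
have cwn k : continuous (fun z => plat a b n (u k z) * plat c d n (v k z)) by case: lw.
have e : bint r (fun z => plat a b n (phi z).1 * plat c d n (phi z).2 * J z) =
    bint r (fun z => plat a b n (phi z).1 * plat c d n (phi z).2 * (fx z * gy z)) -
    bint r (fun z => plat a b n (phi z).1 * plat c d n (phi z).2 * (fy z * gx z)).
  by rewrite -bintB; [apply: eq_bint => z _; rewrite /Jac; ring|exact: L1M3|exact: L1M3].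
rewrite e; apply: (tends_cst_eq t).
have [N1 hN1] := sm_U su r ltr01; have [N2' hN2] := sm_U sv r ltr01.
exists (maxn N1 N2') => k; rewrite geq_max => /andP[k1 k2].
have [[_ cu1 cu2 _ _] _ _ _] := hu k; have [[_ cv1 cv2 _ _] _ _ _] := hv k.
rewrite -bintB; [|by apply: L1M3 => //; exact: L2_cont|by apply: L1M3 => //; exact: L2_cont].
have bc := @box_cov R (u k) (u1 k) (u2 k) (u12 k) (v k) (v1 k) (v2 k) (v12 k) (plat a b n) (plat c d n) (dplat c d n) X Y r s (M + 1).
apply: etrans (bc (hu k) (hv k) (@plat_cont _ _ _ _) (@dplat_cont _ _ _ _) _ dX dY _ s0 _ _ _).
- by apply: eq_bint => z _; ring.
- by move=> t'; exact: dplatE.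
- by move=> t' st; split; exact: out.
- by have := qc_M0 H; lra.
- lra.
move=> z bz; have := hN1 k z k1 bz; have := hN2 k z k2 bz; have := qc_M H z => hM.
have m1 : `|(phi z).1 - z.1| <= M by apply: le_trans hM; exact: (norm_fst (phi z - z)).
have m2' : `|(phi z).2 - z.2| <= M by apply: le_trans hM; exact: (norm_snd (phi z - z)).
by move=> g1 g2; have := ler_distD (phi z).1 (u k z) z.1; have := ler_distD (phi z).2 (v k z) z.2; split; lra.
Qed.

Lemma cov_rect a b c d r s : 0 <= s -> s + M + 1 <= r -> -s <= a -> b <= s -> -s <= c -> d <= s ->
  bint r (fun z => \1_(orect a b c d) (phi z) * J z) = bint s (\1_(orect a b c d)).
Proof.
move=> s0 sr ha hb hc hd.
have e z : (\1_(orect a b c d) z : R) = \1_(`]a, b[%classic) z.1 * \1_(`]c, d[%classic) z.2.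
  by rewrite !indicE in_setX; case: (_ \in _); case: (_ \in _); rewrite ?mulr1 ?mulr0.
have mi : measT (\1_(orect a b c d) : Pt R -> R) by apply: measurable_indic; exact: measurableX.
have mp (n : R) : measT (fun w : Pt R => plat a b n w.1 * plat c d n w.2).
  by apply: measurable_cont2; apply: ctM; apply: ct_comp; (exact: plat_cont || exact: ct_fst || exact: ct_snd).
have bd (n : R) (w : Pt R) : `|plat a b n w.1 * plat c d n w.2| <= 1.
  rewrite ger0_norm; last by apply: mulr_ge0; exact: plat_ge0.
  by apply: mulr_ile1; (exact: plat_ge0 || exact: plat_le1).
have cvg1 w : (fun n : nat => plat a b n%:R w.1 * plat c d n%:R w.2) @ \oo --> (\1_(orect a b c d) w : R).
  by rewrite e; apply: cvgM; exact: plat_cvg.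
have c1 : bint r (fun z => plat a b n%:R (phi z).1 * plat c d n%:R (phi z).2 * J z) @[n --> \oo] -->
    bint r (fun z => \1_(orect a b c d) (phi z) * J z).
  apply: (@bint_dominated _ r (fun n z => plat a b n%:R (phi z).1 * plat c d n%:R (phi z).2 * J z) _ (fun z => `|J z|)).
  - move=> n; apply: measurable_funTS; apply: measurable_funM; last exact: measurable_Jac.
    exact: (measurableT_comp (mp n%:R) measurable_phi).
  - apply: measurable_funTS; apply: measurable_funM; last exact: measurable_Jac.
    exact: (measurableT_comp mi measurable_phi).
  - by apply: L1_abs; exact: L1_Jac.
  - by move=> n z _; rewrite normrM ler_piMl.
  - by move=> z _; apply: cvgM; [exact: cvg1|exact: cvg_cst].
have c2 : bint s (fun w => plat a b n%:R w.1 * plat c d n%:R w.2) @[n --> \oo] --> bint s (\1_(orect a b c d)).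
  apply: (@bint_dominated _ s (fun n w => plat a b n%:R w.1 * plat c d n%:R w.2) _ (fun=> 1)).
  - by move=> n; exact: measurable_funTS.
  - exact: measurable_funTS.
  - by apply: L1_cont; exact: ct_cst.
  - by move=> n z _; exact: bd.
  - by move=> z _; exact: cvg1.
have ee : (fun n : nat => bint r (fun z => plat a b n%:R (phi z).1 * plat c d n%:R (phi z).2 * J z)) =
   (fun n : nat => bint s (fun w => plat a b n%:R w.1 * plat c d n%:R w.2)).
  by apply/funext => n; apply: cov_plat.
by rewrite ee in c1; rewrite -(cvg_lim _ c1)// -(cvg_lim _ c2).
Qed.

Definition ob s : set (Pt R) := orect (-s) s (-s) s.

Lemma L1_cov r s h m : measT h -> (forall z, `|h z| <= m) ->
  L1 r (fun x => \1_(ob s) (phi x) * h (phi x) * J x) /\ L1 s (fun w => \1_(ob s) w * h w).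
Proof.
move=> mh hm.
have mi : measT (\1_(ob s) : Pt R -> R) by apply: measurable_indic; exact: measurableX.
have bd z : `|\1_(ob s) z * h z| <= m.
  by rewrite normrM indicE; case: (_ \in _); rewrite ?normr1 ?normr0 ?mul1r ?mul0r// (le_trans _ (hm z)).
split.
  apply: (@L1Mb _ r (fun x => \1_(ob s) (phi x) * h (phi x)) J m) => //; last exact: L1_Jac.
  by apply: measurable_funTS; exact: (measurableT_comp (measurable_funM mi mh) measurable_phi).
apply: (@L1_bounded _ _ _ m) => //; apply: measurable_funTS; exact: measurable_funM.
Qed.

(** Rectangles extend to bounded measurable functions by the monotone class theorem. The Jacobian
    stands without absolute value: this is a degree formula with degree one, and nothing is yet
    known about its sign. *)
Lemma cov r s h m : 0 <= s -> s + M + 1 <= r -> measT h -> (forall z, `|h z| <= m) ->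
  bint r (fun x => \1_(ob s) (phi x) * h (phi x) * J x) = bint s (fun w => \1_(ob s) w * h w).
Proof.
move=> s0 sr mh0 hm0.
pose P h := [/\ measT h, exists m, forall z, `|h z| <= m &
  bint r (fun x => \1_(ob s) (phi x) * h (phi x) * J x) = bint s (fun w => \1_(ob s) w * h w)].
suff : P h by case.
apply: (@bounded_class _ P) hm0 => //.
- move=> a b c d; split.
  + by apply: measurable_indic; exact: measurableX.
  + by exists 1 => z; rewrite indicE; case: (_ \in _); rewrite ?normr1 ?normr0.
  pose a' := Num.max (-s) a; pose b' := Num.min s b; pose c' := Num.max (-s) c; pose d' := Num.min s d.
  have e z : (\1_(ob s) z : R) * \1_(orect a b c d) z = \1_(orect a' b' c' d') z.
    rewrite -[LHS]/((\1_(ob s) \* \1_(orect a b c d)) z) -indicI; congr (\1_ _ z).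
    apply/seteqP; split => [y [[/=]]|y [/=]]; rewrite !in_itv/=.
      move=> /andP[h1 h2] /andP[h3 h4] [/= ]; rewrite !in_itv/= => /andP[h5 h6] /andP[h7 h8].
      by split; rewrite /= in_itv/= gt_max lt_min; apply/andP; split; apply/andP.
    rewrite !gt_max !lt_min => /andP[/andP[h1 h2] /andP[h3 h4]] /andP[/andP[h5 h6] /andP[h7 h8]].
    by split; split; rewrite /= in_itv/=; apply/andP.
  rewrite (eq_bint (g := fun x => \1_(orect a' b' c' d') (phi x) * J x)) => [|x _]; last by rewrite e.
  rewrite [RHS](eq_bint (g := \1_(orect a' b' c' d'))) => [|x _]; last by rewrite e.
  by apply: cov_rect => //; rewrite ?le_max ?ge_min lexx.
- split; first exact: measurable_cst.
    by exists 1 => z; rewrite normr1.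
  rewrite (eq_bint (g := fun x => \1_(ob s) (phi x) * J x)) => [|x _]; last by rewrite mulr1.
  rewrite [RHS](eq_bint (g := \1_(ob s))) => [|x _]; last by rewrite mulr1.
  by apply: cov_rect.
- move=> k l c [mk [a ka] ek] [ml [b lb] el].
  have [k1 k2] := L1_cov r s mk ka; have [l1 l2] := L1_cov r s ml lb.
  split; first by apply: measurable_funD => //; apply: measurable_funM.
    exists (a + `|c| * b) => z; apply: (le_trans (ler_normD _ _)); rewrite normrM; apply: lerD => //.
    exact: ler_wpM2l.
  rewrite (eq_bint (g := fun x => \1_(ob s) (phi x) * k (phi x) * J x + c * (\1_(ob s) (phi x) * l (phi x) * J x))) => [|x _]; last ring.
  rewrite [RHS](eq_bint (g := fun w => \1_(ob s) w * k w + c * (\1_(ob s) w * l w))) => [|x _]; last ring.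
  by rewrite !bintD ?bintZ ?ek ?el//; exact: L1Z.
- move=> u v a mu Pu ua uv.
  have mv : measT v by apply: (measurable_fun_cvg mu) => z _; exact: uv.
  have va z : `|v z| <= a.
    apply: (@closed_cvg _ _ _ _ (fun n => u n z) [set t | `|t| <= a]) (uv z) => //.
      rewrite (_ : [set t | _] = `[-a, a]%classic); first exact: itv_closed.
      by apply/seteqP; split => t; rewrite /= in_itv/= ler_norml.
    by near=> n; exact: ua.
  split => //; first by exists a.
  have mi : measT (\1_(ob s) : Pt R -> R) by apply: measurable_indic; exact: measurableX.
  have a0 : 0 <= a by exact: le_trans (va 0).
  have i1 z : `|\1_(ob s) z : R| <= 1 by rewrite indicE; case: (_ \in _); rewrite ?normr1 ?normr0.
  have c1 : bint r (fun x => \1_(ob s) (phi x) * u n (phi x) * J x) @[n --> \oo] -->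
      bint r (fun x => \1_(ob s) (phi x) * v (phi x) * J x).
    apply: (@bint_dominated _ r (fun n x => \1_(ob s) (phi x) * u n (phi x) * J x) _ (fun x => a * `|J x|)).
    + move=> n; exact: L1_meas (L1_cov r s (mu n) (ua n)).1.
    + exact: L1_meas (L1_cov r s mv va).1.
    + by apply: L1Z; apply: L1_abs; exact: L1_Jac.
    + move=> n z _; rewrite !normrM; apply: ler_wpM2r => //; rewrite -[a]mul1r; exact: ler_pM.
    + by move=> z _; apply: cvgM; [apply: cvgM; [exact: cvg_cst|exact: uv]|exact: cvg_cst].
  have c2 : bint s (fun w => \1_(ob s) w * u n w) @[n --> \oo] --> bint s (fun w => \1_(ob s) w * v w).
    apply: (@bint_dominated _ s (fun n w => \1_(ob s) w * u n w) _ (fun=> a)).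
    + move=> n; exact: L1_meas (L1_cov r s (mu n) (ua n)).2.
    + exact: L1_meas (L1_cov r s mv va).2.
    + by apply: L1_cont; exact: ct_cst.
    + move=> n z _; rewrite normrM -[a]mul1r; exact: ler_pM.
    + by move=> z _; apply: cvgM; [exact: cvg_cst|exact: uv].
  have ee : (fun n : nat => bint r (fun x => \1_(ob s) (phi x) * u n (phi x) * J x)) =
     (fun n : nat => bint s (fun w => \1_(ob s) w * u n w)).
    by apply/funext => n; case: (Pu n).
  by rewrite ee in c1; rewrite -(cvg_lim _ c1)// -(cvg_lim _ c2).
Unshelve. all: by end_near. Qed.

(** In [cov] with the indicator of the image of [N], the set where the Jacobian is negative, the
    left side is an integral of a negative function and the right side an area, so both vanish.
    Injectivity enters by writing that indicator as the indicator of [N] composed with [psi]. *)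
Lemma Jac_ae_ge0 : m2 [set x | J x < 0] = 0%E.
Proof.
have mN : measurable [set x | J x < 0].
  rewrite -[X in measurable X]setTI.
  have -> : [set x | J x < 0] = J @^-1` `]-oo, 0[%classic by apply/seteqP; split => x; rewrite /= in_itv.
  by apply: measurable_Jac.
set N := [set x | J x < 0] in mN *.
have piece (k : nat) : m2 (N `&` phi @^-1` (ob k%:R)) = 0%E.
  set s : R := k%:R; have s0 : 0 <= s by [].
  set r := s + M + 1.
  pose h (w : Pt R) : R := \1_N (psi w).
  have mh : measT h.
    by apply: (measurableT_comp _ measurable_psi); exact: measurable_indic.
  have h1 z : `|h z| <= 1 by rewrite /h indicE; case: (_ \in _); rewrite ?normr1 ?normr0.
  have e := cov s0 (lexx r) mh h1.
  have [L _] := L1_cov r s mh h1.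
  have ige : 0 <= bint s (fun w => \1_(ob s) w * h w).
    by apply: bint_ge0 => w _; rewrite mulr_ge0// /h indicE.
  set A := N `&` _.
  have mA : measurable A.
    apply: measurableI => //; rewrite -[X in measurable X]setTI; apply: measurable_phi => //; exact: measurableX.
  have eA x : \1_(ob s) (phi x) * h (phi x) * J x = \1_A x * J x.
    rewrite /h (qc_K H); congr (_ * _); rewrite !indicE -natrM mulnb; congr (_%:R); congr nat_of_bool.
    by rewrite /A in_setI andbC; congr (_ && _).
  have LA : L1 r (fun x => \1_A x * J x) by apply: eq_L1 L => z _; exact: eA.
  have neg x : \1_A x * J x <= 0.
    rewrite indicE; case: (boolP (x \in A)) => [/set_mem[Nx _]|_]; last by rewrite mul0r.
    by rewrite mul1r ltW.
  have z0 : bint r (fun x => `|\1_A x * J x|) = 0.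
    apply/eqP; rewrite eq_le bint_ge0 ?andbT//.
    rewrite (eq_bint (g := fun x => - (\1_A x * J x))) => [|x _]; last by rewrite ler0_norm.
    rewrite bintN// oppr_le0 -(eq_bint (f := fun x => \1_(ob s) (phi x) * h (phi x) * J x)) => [|x _]; last exact: eA.
    by rewrite e.
  have iz : (\int[m2]_(x in bx r) `|(EFin \o (fun x => \1_A x * J x)%R) x|)%E = 0%E.
    by have := EFin_bint (L1_abs LA); rewrite z0 => <-.
  have mE : measurable_fun (bx r) (EFin \o (fun x => \1_A x * J x)) by apply/measurable_EFinP; exact: L1_meas LA.
  have [+ _] := ae_eq_integral_abs m2 (measurable_bx r) mE.
  move=> /(_ iz) nB.
  apply: measure_negligible; first exact: mA.
  apply: negligibleS nB => x Ax /= hx.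
  have bxx : bx r x.
    apply: (@bxS _ (s + M)); first by rewrite /r; lra.
    apply: phi_bx; case: Ax => _ [/= ]; rewrite !in_itv/= => h2 h3.
    by apply: norm_pair_le; rewrite ler_norml; lra.
  have /eqP := hx bxx; rewrite eqe indicE mem_set// mul1r => /eqP Jx.
  by move: Ax => [Nx _]; move: Nx; rewrite /N /= Jx ltxx.
have -> : N = \bigcup_k (N `&` phi @^-1` (ob k%:R)).
  rewrite -setI_bigcupr; apply/esym/setIidPl => x _.
  have : [set: Pt R] (phi x) by [].
  by rewrite -orects_exhaust => -[k _ hk]; exists k.
have mp k : measurable (N `&` phi @^-1` (ob k%:R)).
  apply: measurableI => //; rewrite -[X in measurable X]setTI; apply: measurable_phi => //; exact: measurableX.
apply: measure_negligible; first exact: bigcupT_measurable.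
apply: negligible_bigcup => k; apply/negligibleP; first exact: mp.
exact: piece.
Qed.

End change_of_variables.

(** * Cauchy-Riemann equations and removal of null sets *)

Section normalization.
Variable R : realType.
Local Notation m2 := (@leb2 R).
Implicit Types (r e s M : R) (x z : Pt R).

(** The two limits are compared through the truncation [min(1, |.|)]: its integral over [A] tends to
    0 by dominated convergence and is continuous for the L^2 norm. No subsequence has to be
    extracted. *)
Lemma ae0_of_lim (A : set (Pt R)) (a : nat -> Pt R -> R) (w : Pt R -> R) r : measurable A -> Lim2 r a w ->
  (forall x, A x -> a n x @[n --> \oo] --> (0 : R)) -> m2.-negligible [set x | bx r x /\ A x /\ w x <> 0].
Proof.
move=> mA [ha hw la] a0.
pose t (f : Pt R -> R) x : R := \1_A x * Num.min 1 `|f x|.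
have mt f : measurable_fun (bx r) f -> measurable_fun (bx r) (t f).
  move=> mf; apply: measurable_funM; first by apply: measurable_funTS; exact: measurable_indic.
  by apply: measurable_minr => //; exact: measurableT_comp.
have t01 f x : 0 <= t f x <= 1.
  rewrite /t; have : 0 <= Num.min 1 `|f x| <= 1 by rewrite le_min ler01 normr_ge0/= ge_min lexx.
  by rewrite indicE; case: (_ \in _); rewrite ?mul1r ?mul0r; lra.
have tn f x : `|t f x| <= 1 by have := t01 f x; rewrite ler_norml; lra.
have Lt f : measurable_fun (bx r) f -> L1 r (t f).
  by move=> mf; apply: (@L1_bounded _ _ _ 1) => //; exact: mt.
have mw := hw.1; have ma n := (ha n).1.
have c0 : bint r (t (a n)) @[n --> \oo] --> bint r (fun=> 0 : R).
  apply: (@bint_dominated _ r (fun n => t (a n)) _ (fun=> 1)).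
  - by move=> n; apply: mt.
  - exact: measurable_cst.
  - by apply: L1_cont; exact: ct_cst.
  - by move=> n z _; exact: tn.
  move=> z _; rewrite /t indicE; case: (boolP (z \in A)) => [/set_mem Az|_]; last first.
    by rewrite (_ : (fun n => _) = (fun=> 0)); [exact: cvg_cst|apply/funext => n; rewrite mul0r].
  apply: (@squeeze_cvgr _ _ _ _ (fun=> 0) (fun n => `|a n z|)); last 2 first.
  - exact: cvg_cst.
  - apply/cvgrPdist_le => e ep; move/cvgrPdist_le: (a0 _ Az) => /(_ _ ep) h; near=> n.
    rewrite sub0r normrN normr_id -normrN -sub0r; near: n; exact: h.
  by near=> n; rewrite mul1r le_min ler01 normr_ge0/= ge_min lexx orbT.
have c1 : N2 r (fun=> 1 : R) = N2 r (fun=> 1) by [].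
have tz : bint r (t w) = 0.
  apply/eqP; rewrite eq_le; apply/andP; split; last by apply: bint_ge0 => x _; case/andP: (t01 w x).
  apply/ler_addgt0Pl => e ep; rewrite addr0.
  pose N1 := N2 r (fun=> 1 : R); have N10 : 0 <= N1 by exact: N2_ge0.
  have [n1 hn1] := la (e / 2 / (N1 + 1)) ltac:(by rewrite !divr_gt0// ltr_wpDl).
  have [n2 _ hn2] : \forall n \near \oo, `|bint r (t (a n))| < e / 2.
    have : bint r (t (a n)) @[n --> \oo] --> (0 : R) by move: c0; rewrite {2}/bint /Rintegral integral0.
    by move=> /cvgrPdist_lt /(_ (e / 2)) h; near=> n; rewrite -normrN -[X in `|X|]add0r; near: n; apply: h; lra.
  pose n := maxn n1 n2.
  have L2d : L2 r (fun x => a n x - w x) by exact: L2B.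
  have l1 : bint r (t w) <= bint r (fun x => t (a n) x + `|(a n x - w x) * 1|).
    apply: le_bint; [exact: Lt| |].
      apply: L1D; first exact: Lt.
      by apply: L1_abs; apply: L2M => //; apply: L2_cont; exact: ct_cst.
    move=> x _; rewrite mulr1 /t indicE; case: (_ \in _); rewrite ?mul0r ?mul1r ?add0r//.
    have := ler_distD (a n x) (w x) 0; rewrite !subr0 (distrC (w x)) => h; have p := normr_ge0 (a n x - w x).
    by case: (leP 1 `|w x|) => ?; case: (leP 1 `|a n x|) => ?; lra.
  have l2 := CS L2d (L2_cont r (@ct_cst _ _ (1 : R))).
  have l3 := hn1 n (leq_maxl _ _); have l4 := hn2 n (leq_maxr _ _).
  rewrite bintD in l1; [|exact: Lt|by apply: L1_abs; apply: L2M => //; apply: L2_cont; exact: ct_cst].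
  have l5 : N2 r (fun x => a n x - w x) * N1 <= e / 2.
    apply: (@le_trans _ _ (e / 2 / (N1 + 1) * N1)); first exact: ler_wpM2r.
    rewrite -mulrA ger_pMr; last lra.
    by rewrite mulrC ler_pdivrMr ?mul1r; lra.
  have := ler_norm (bint r (t (a n))); rewrite /N1 in l5; rewrite /= in l4; lra.
have mE : measurable_fun (bx r) (EFin \o t w) by apply/measurable_EFinP; exact: mt.
have iz : (\int[m2]_(x in bx r) `|(EFin \o t w) x|)%E = 0%E.
  have := EFin_bint (L1_abs (Lt w mw)).
  rewrite (eq_bint (g := t w)) ?tz => [<- //|x _]; by rewrite ger0_norm; case/andP: (t01 w x).
have [+ _] := ae_eq_integral_abs m2 (measurable_bx r) mE.
move=> /(_ iz) nB; apply: negligibleS nB => x [bx_ [Ax wx]] /= h.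
have /eqP := h bx_; rewrite eqe /t indicE mem_set// mul1r; case: leP; first by rewrite oner_eq0.
by move=> _; rewrite normr_eq0 => /eqP.
Unshelve. all: by end_near. Qed.

Lemma negligible_bx (P : set (Pt R)) : (forall k : nat, m2.-negligible (bx k%:R `&` P)) -> m2.-negligible P.
Proof.
move=> h; have -> : P = \bigcup_k (bx k%:R `&` P).
  rewrite -setI_bigcupl; apply/esym/setIidPr => z _; exists (Num.truncn `|z|).+1 => //.
  by rewrite /bx /= ltW// truncnS_gt.
by apply: negligible_bigcup => k; exact: h.
Qed.

Lemma weak_pd_mod (N : set (Pt R)) b F (D : Pt R -> R) : measurable N -> m2 N = 0%E -> measT D ->
  weak_pd b F D -> weak_pd b F (fun x => \1_(~` N) x * D x).
Proof.
move=> mN N0 mD h eta te; rewrite h//; congr (- _)%E.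
have ceta : continuous eta by case: te => /(_ [::]) [].
have me : measT eta by exact: measurable_cont2.
apply: ae_eq_integral => //.
- by apply/measurable_EFinP; exact: measurable_funM.
- apply/measurable_EFinP; apply: measurable_funM => //; apply: measurable_funM => //.
  by apply: measurable_indic; exact: measurableC.
exists N; split => // x /= nx; apply: contrapT => Nx; apply: nx => _.
by rewrite indicE mem_set//= mul1r.
Qed.

Lemma L2loc_mod (N : set (Pt R)) (D : Pt R -> R) : measurable N -> L2loc' D -> L2loc' (fun x => \1_(~` N) x * D x).
Proof.
move=> mN [mD hD]; have mi : measT (\1_(~` N) : Pt R -> R) by apply: measurable_indic; exact: measurableC.
split; first exact: measurable_funM.
by move=> r; apply: (@L2Mb _ r (\1_(~` N)) D 1) => // [|x _]; [exact: measurable_funTS|rewrite indicE; case: (_ \in _); rewrite ?normr1 ?normr0].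
Qed.

(** The complex derivative [p + iq] acts as the matrix with rows [(p, -q)] and [(q, p)]. The factor
    2 between [cabs] and the sup norm is absorbed by [e / 2] and [d / 4]. *)
Lemma cdiff_real (phi : Pt R -> Pt R) x : cdifferentiable_at phi x -> exists p q : R,
  (forall e, 0 < e -> exists2 d, 0 < d & forall h : Pt R, `|h| <= d ->
      `|(phi (x + h)).1 - (phi x).1 - (p * h.1 + (- q) * h.2)| <= e * `|h|) /\
  (forall e, 0 < e -> exists2 d, 0 < d & forall h : Pt R, `|h| <= d ->
      `|(phi (x + h)).2 - (phi x).2 - (q * h.1 + p * h.2)| <= e * `|h|).
Proof.
move=> [[p q] hc]; exists p, q.
suff hh e : 0 < e -> exists2 d, 0 < d & forall h : Pt R, `|h| <= d ->
    `|phi (x + h) - phi x - cmul (p, q) h| <= e * `|h|.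
  split=> e ep; have [d dp hd] := hh e ep; exists d => // h hhd; apply: le_trans (hd h hhd).
  - by apply: le_trans (norm_fst _); rewrite /= le_eqVlt; apply/orP; left; apply/eqP; congr `|_|; ring.
  - by apply: le_trans (norm_snd _); rewrite /= le_eqVlt; apply/orP; left; apply/eqP; congr `|_|; ring.
move=> ep; have [d dp hd] := hc (e / 2) ltac:(lra).
exists (d / 4); first lra.
move=> h hh; have [->|h0] := eqVneq h 0.
  rewrite addr0 subrr sub0r normrN /cmul /= !mulr0 subrr addr0.
  by rewrite (_ : (0, 0) = 0 :> Pt R)// !normr0 mulr0.
have p0 : 0 < `|h| by rewrite normr_gt0.
have := hd h; rewrite (lt_le_trans p0 (cabs_ge h)) /= (le_lt_trans (cabs_le h)); last lra.
rewrite !csubE caddE => /(_ isT) h1; apply: (le_trans (cabs_ge _)); apply: (le_trans h1).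
have := cabs_le h; nra.
Qed.

(* the exceptional null sets are removed by modifying the weak derivatives *)
Record qcnorm (Q M : R) (E : set (Pt R)) (phi psi : Pt R -> Pt R) (fx fy gx gy : Pt R -> R) : Prop := Qcnorm {
  qn_H : qcmap Q M phi psi fx fy gx gy;
  qn_cpt : compact E;
  qn_dist : forall z, fx z ^+ 2 + fy z ^+ 2 + gx z ^+ 2 + gy z ^+ 2 <= Q * Jac fx fy gx gy z;
  qn_CR : forall z, ~ E z -> fx z = gy z /\ fy z = - gx z }.

Lemma measurable_compact2 (E : set (Pt R)) : compact E -> measurable E.
Proof. by move=> cE; apply: measurable_closed2; exact: compact_closed2. Qed.

Lemma negligibleUn (A B : set (Pt R)) : m2.-negligible A -> m2.-negligible B -> m2.-negligible (A `|` B).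
Proof. exact: negligibleU. Qed.

(** Off [E] the mollified derivatives converge pointwise to the entries of the complex derivative,
    and everywhere in L^2 to the weak ones; [ae0_of_lim] is applied to [u_x - v_y] and to
    [u_y + v_x]. *)
Lemma cauchy_riemann (Q M : R) (E : set (Pt R)) phi psi fx fy gx gy : qcmap Q M phi psi fx fy gx gy ->
  measurable E -> (forall x, ~ E x -> cdifferentiable_at phi x) ->
  m2.-negligible [set x | ~ E x /\ ~ (fx x = gy x /\ fy x = - gx x)].
Proof.
move=> H mE hE.
have [u [u1 [u2 [u12 [v [v1 [v2 [v12 [hu hv su sv]]]]]]]]] := smoothings H.
have LB r a b A B : Lim2 r a A -> Lim2 r b B -> Lim2 r (fun n x => a n x - b n x) (fun x => A x - B x).
  move=> [ha hA la] [hb hB lb]; split; [by move=> n; exact: L2B|exact: L2B|].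
  move=> e ep; have [n1 h1] := la (e / 2) ltac:(lra); have [n2 h2] := lb (e / 2) ltac:(lra).
  exists (maxn n1 n2) => n; rewrite geq_max => /andP[l1 l2].
  rewrite (@eq_N2 _ _ _ (fun x => (a n x - A x) + (-1) * (b n x - B x))) => [|x _]; last ring.
  have k2 : L2 r (fun x => b n x - B x) by exact: L2B.
  apply: (le_trans (N2D _ _)); [exact: L2B|exact: L2Z|].
  rewrite N2Z// normrN1 mul1r; have := h1 n l1; have := h2 n l2; lra.
have mE' : measurable (~` E) by exact: measurableC.
have lim r : [/\ Lim2 r u1 fx, Lim2 r u2 fy, Lim2 r v1 gx & Lim2 r v2 gy].
  have [_ ? ?] := smoothing_Lim r (phi1_cont H) (qc_fx H) (qc_fy H) su.
  by have [_ ? ?] := smoothing_Lim r (phi2_cont H) (qc_gx H) (qc_gy H) sv.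
have pt x : ~ E x -> (u1 n x - v2 n x @[n --> \oo] --> (0 : R)) /\ (u2 n x - (-1 * v1 n x) @[n --> \oo] --> (0 : R)).
  move=> /hE /cdiff_real [p [q [h1 h2]]].
  have [a1 a2] := sm_diff su h1; have [b1 b2] := sm_diff sv h2.
  split; first by rewrite -(subrr p); exact: cvgB.
  by rewrite -(subrr (- q)) -{2}(mulN1r q); apply: cvgB => //; apply: cvgM => //; exact: cvg_cst.
have LN r a A c : Lim2 r a A -> Lim2 r (fun n x => c * a n x) (fun x => c * A x).
  move=> [ha hA la]; split; [by move=> n; exact: L2Z|exact: L2Z|].
  move=> e ep; have [n1 h1] := la (e / (`|c| + 1)) ltac:(by rewrite divr_gt0// ltr_wpDl).
  exists n1 => n l1; have k2 : L2 r (fun x => a n x - A x) by exact: L2B.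
  rewrite (@eq_N2 _ _ _ (fun x => c * (a n x - A x))) => [|x _]; last ring.
  rewrite N2Z//; apply: (@le_trans _ _ (`|c| * (e / (`|c| + 1)))); first by apply: ler_wpM2l => //; exact: h1.
  by rewrite mulrA ler_pdivrMr ?ltr_wpDl// mulrC ler_wpM2l// ?lerDl// ltW.
apply: negligible_bx => k; have [l1 l2 l3 l4] := lim k%:R.
have n1 := ae0_of_lim mE' (LB _ _ _ _ _ l1 l4) (fun x hx => (pt x hx).1).
have n2 := ae0_of_lim mE' (LB _ _ _ _ _ l2 (LN _ _ _ (-1) l3)) (fun x hx => (pt x hx).2).
apply: negligibleS (negligibleUn n1 n2) => x [bkx [nEx ne]].
have [h1|h1] := eqVneq (fx x) (gy x); last by left; split => //; split => // /eqP; rewrite subr_eq0 (negbTE h1).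
right; split => //; split => // /eqP; rewrite subr_eq0 mulN1r => /eqP h2; exact: ne.
Qed.

(** One null set covers the failures of the Cauchy-Riemann equations off [E], of the sign of the
    Jacobian and of the distortion inequality. The weak derivatives are set to 0 there, where all
    three conditions then hold trivially. *)
Lemma qc_normalize (K : R) (E : set (Pt R)) phi : 1 <= K -> compact E -> principal phi -> quasiconformal K phi ->
  conformal_on (~` E) phi -> exists M psi fx fy gx gy, qcnorm (K + K ^+ 3) M E phi psi fx fy gx gy.
Proof.
move=> K1 cE pphi [[psi [K1' [K2' [cphi cpsi]]]] [Dx [Dy [_ [_ [hfx [hgx [hfy [hgy [wfx [wgx [wfy [wgy hae]]]]]]]]]]]]] [_ [_ hE]].
have [M M0 hM] := principal_bounded cphi pphi.
have K0 : 0 <= K by lra.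
have Q0 : 0 <= K + K ^+ 3 by rewrite addr_ge0// exprn_ge0.
pose fx z := (Dx z).1; pose gx z := (Dx z).2; pose fy z := (Dy z).1; pose gy z := (Dy z).2.
have H : qcmap (K + K ^+ 3) M phi psi fx fy gx gy by split => //; exact: L2locD.
have mE := measurable_compact2 cE.
have nCR := cauchy_riemann H mE (fun x hx => hE x hx).
have nJ : m2.-negligible [set x | Jac fx fy gx gy x < 0].
  apply/negligibleP; last exact: Jac_ae_ge0 H.
  rewrite -[X in measurable X]setTI.
  have -> : [set x | Jac fx fy gx gy x < 0] = Jac fx fy gx gy @^-1` `]-oo, 0[%classic by apply/seteqP; split => x; rewrite /= in_itv.
  by apply: (measurable_Jac H).
have [N [mN N0 hN]] := negligibleUn (negligibleUn nCR nJ) hae.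
exists M, psi, (fun x => \1_(~` N) x * fx x), (fun x => \1_(~` N) x * fy x),
  (fun x => \1_(~` N) x * gx x), (fun x => \1_(~` N) x * gy x).
have NE x : (\1_(~` N) x = 0 :> R) \/ (\1_(~` N) x = 1 :> R /\ ~ N x).
  rewrite indicE; case: (boolP (x \in _)) => [/set_mem h|_]; [by right|by left].
split => //.
- split => //; try (by apply: L2loc_mod => //; exact: L2locD).
  + by apply: weak_pd_mod => //; case: hfx.
  + by apply: weak_pd_mod => //; case: hfy.
  + by apply: weak_pd_mod => //; case: hgx.
  + by apply: weak_pd_mod => //; case: hgy.
- move=> z; rewrite /Jac; have [->|[-> nN]] := NE z; first by rewrite !mul0r subrr mulr0 expr0n /= !addr0.
  rewrite !mul1r.
  have d : forall a b : R, cabs (Defs.cadd (Defs.cscale (cos a) (Dx z)) (Defs.cscale (sin a) (Dy z)))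
       <= K * cabs (Defs.cadd (Defs.cscale (cos b) (Dx z)) (Defs.cscale (sin b) (Dy z))).
    by apply: contrapT => nd; apply: nN; apply: hN; right.
  have J0 : 0 <= Jac fx fy gx gy z.
    by rewrite leNgt; apply/negP => nd; apply: nN; apply: hN; left; right.
  have := distortion K1 d; rewrite -/(fx z) -/(fy z) -/(gx z) -/(gy z) -/(Jac fx fy gx gy z) ger0_norm// /Jac; lra.
- move=> z nEz; have [->|[-> nN]] := NE z; first by rewrite !mul0r oppr0.
  by rewrite !mul1r; apply: contrapT => nd; apply: nN; apply: hN; left; left.
Qed.

End normalization.

(** * The length-area method on concentric squares *)

Section loops.
Variable R : realType.
Implicit Types (r e s a t x y : R) (f g h : R -> R) (z : Pt R).

Lemma lintD a b f g : continuous f -> continuous g -> lint a b (fun x => f x + g x) = lint a b f + lint a b g.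
Proof. by move=> cf cg; rewrite /lint RintegralD//; exact: lint_L1. Qed.

Lemma lintZ a b c f : continuous f -> lint a b (fun x => c * f x) = c * lint a b f.
Proof. by move=> cf; rewrite /lint RintegralZl//; exact: lint_L1. Qed.

(** [antider] asks for compact support, so [h] is cut off beyond [[-r, r]] by a plateau;
    nonnegativity survives and makes the primitive monotone. *)
Lemma antider_on h r : 0 <= r -> continuous h -> (forall x, 0 <= h x) ->
  exists H k, [/\ forall x, is_derive x 1 H (k x), continuous k, forall x, `|x| <= r -> k x = h x & forall x, 0 <= k x].
Proof.
move=> r0 ch h0; pose c := plat (- r - 1) (r + 1) 1; pose k x := h x * c x.
have ck : continuous k by apply: ctM => //; exact: plat_cont.
have out t : r + 1 < `|t| -> k t = 0.
  move=> ht; rewrite /k /c plat_out ?mulr0//; apply/negP => /andP[t1 t2].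
  by move: ht; rewrite ltNge ler_norml; have -> : - (r + 1) <= t <= r + 1 by lra.
have [H dH] := @antider _ k (r + 1) ck out.
exists H, k; split => //.
- move=> x; rewrite ler_norml => /andP[x1 x2]; rewrite /k /c (plat_in (n := 1) _ _ _).1 ?mulr1// invr1; lra.
- by move=> x; rewrite mulr_ge0// plat_ge0.
Qed.

Lemma lint_shift h (a c p q r : R) : 0 <= r -> continuous h -> (forall x, 0 <= h x) -> c = 1 \/ c = -1 -> p <= q ->
  (forall t, p <= t <= q -> `|a + c * t| <= r) -> lint p q (fun t => h (a + c * t)) <= lint (-r) r h.
Proof.
move=> r0 ch h0 hc pq hpq; have [H [k [dH ck kh k0]]] := antider_on r0 ch h0.
have ii (u v : R) : u <= v -> 0 <= H v - H u.
  move=> uv; rewrite -(FTC uv dH ck); apply: le_trans (le_lint (f := fun=> 0) (@ct_cst _ _ 0) ck _).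
    by rewrite lint_cst// mul0r.
  by move=> x _; exact: k0.
have cc : continuous (fun t => k (a + c * t)).
  by apply: ct_comp => //; apply: ctD; [exact: ct_cst|apply: ctM; [exact: ct_cst|move=> t; exact: cvg_id]].
have e1 : lint (-r) r h = H r - H (-r).
  rewrite -(FTC (_ : -r <= r) dH ck); last lra.
  by apply: eq_lint => x hx; rewrite kh// ler_norml.
have d (x : R) : is_derive x 1 (fun t => c * H (a + c * t)) (k (a + c * x)).
  have d1 : is_derive x 1 (fun t => a + c * t) c by apply: (deq (dD (dcst x a) (dM (dcst x c) (did x)))); ring.
  apply: (deq (dM (dcst x c) (@dcomp _ H _ x _ _ (dH _) d1))).
  by case: hc => ->; ring.
have -> : lint p q (fun t => h (a + c * t)) = c * H (a + c * q) - c * H (a + c * p).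
  by rewrite -(FTC pq d cc); apply: eq_lint => x hx; rewrite kh//; exact: hpq.
rewrite e1.
have := hpq q; rewrite pq lexx ler_norml => /(_ isT) /andP[q1 q2].
have := hpq p; rewrite pq lexx ler_norml => /(_ isT) /andP[p1 p2].
case: hc => hc; subst c; rewrite !(mul1r, mulN1r) in q1 q2 p1 p2 *.
- have := ii _ _ q2; have := ii _ _ p1; lra.
- have := ii _ _ q1; have := ii _ _ p2; lra.
Qed.

Lemma lintS h p q r : 0 <= r -> continuous h -> (forall x, 0 <= h x) -> -r <= p -> p <= q -> q <= r -> lint p q h <= lint (-r) r h.
Proof.
move=> r0 ch h0 p1 pq q1; have := @lint_shift h 0 1 p q r r0 ch h0 (or_introl erefl) pq _.
rewrite (eq_lint (g := h)) => [|x _]; last by rewrite add0r mul1r.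
by apply => t /andP[t1 t2]; rewrite add0r mul1r ler_norml; lra.
Qed.

(** The base point [(t, t)] lets one definition serve both families: the horizontal line at height
    [t] for [b = true], the vertical line at abscissa [t] otherwise. *)
Definition slice b r (g : Pt R -> R) t : R := lint (-r) r (fun x => g (upd b (t, t) x)).

Lemma slice_cont b r (g : Pt R -> R) : 0 <= r -> continuous g -> continuous (slice b r g).
Proof.
move=> r0 cg t; apply/cvgrPdist_le => e ep.
pose s := r + `|t| + 1.
have sr : r <= s by rewrite /s; have := normr_ge0 t; lra.
have [d dp hd] := unif_cont_bx s cg (e := e / (2 * r + 1)) ltac:(by rewrite divr_gt0//; lra).
near=> t'.
have tt : `|t - t'| < d by near: t'; exact: cvgr_dist_lt.
have ct u : continuous (fun x => g (upd b (u, u) x)) by exact: (ct_comp2 cg (@ct_upd _ b (u, u))).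
have h x : -r <= x <= r -> `|g (upd b (t, t) x) - g (upd b (t', t') x)| <= e / (2 * r + 1).
  move=> hx; have hx' : `|x| <= r by rewrite ler_norml.
  have nt := normr_ge0 t; apply: hd.
    by rewrite /bx /=; apply: norm_pair_le; case: (b) => /=; rewrite /s; lra.
  by rewrite prod_normE /= gt_max; case: (b) => /=; rewrite ?subrr ?normr0 dp tt.
have cB : continuous (fun x => g (upd b (t, t) x) - g (upd b (t', t') x)) by exact: ctB.
have -> : slice b r g t - slice b r g t' = lint (-r) r (fun x => g (upd b (t, t) x) - g (upd b (t', t') x)).
  rewrite (eq_lint (g := fun x => g (upd b (t, t) x) + (-1) * g (upd b (t', t') x))) => [|x _]; last ring.
  rewrite lintD; [|exact: ct|by apply: ctM; [exact: ct_cst|exact: ct]].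
  by rewrite lintZ; [rewrite mulN1r|exact: ct].
apply: (le_trans (lint_abs _ _ cB)).
apply: (le_trans (le_lint (g := fun=> e / (2 * r + 1)) (ct_norm cB) (@ct_cst _ _ _) h)).
rewrite lint_cst; last lra.
rewrite -mulrA ger_pMr// mulrC ler_pdivrMr; lra.
Unshelve. all: by end_near. Qed.

Lemma bint_slice b r (g : Pt R -> R) : continuous g -> bint r g = lint (-r) r (slice b r g).
Proof. by case: b => cg; [rewrite bint_yx|rewrite bint_xy]. Qed.

Lemma slice_ge0 b r (g : Pt R -> R) t : 0 <= r -> continuous g -> (forall z, 0 <= g z) -> 0 <= slice b r g t.
Proof.
move=> r0 cg g0; have c := ct_comp2 cg (@ct_upd _ b (t, t)).
apply: le_trans (le_lint (f := fun=> 0) (@ct_cst _ _ 0) c _); first by rewrite lint_cst ?mul0r//; lra.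
by move=> x _; exact: g0.
Qed.

(** The inequality [|v'| <= k v'^2 + 1/(4k)] takes the place of Cauchy-Schwarz, so slice integrals
    enter linearly and can be integrated over [t] afterwards. *)
Lemma side_bound b (v v' : Pt R -> R) (r p q t k z1 z2 : R) : 0 <= r -> -r <= p -> p <= q -> q <= r -> 0 < k ->
  pdv b v v' -> continuous v' -> p <= z1 <= q -> p <= z2 <= q ->
  `|v (upd b (t, t) z1) - v (upd b (t, t) z2)| <= k * slice b r (fun z => v' z ^+ 2) t + (q - p) / (4 * k).
Proof.
move=> r0 p1 pq q1 k0 dv cv'.
have c : continuous (fun x => v' (upd b (t, t) x)) by exact: (ct_comp2 cv' (@ct_upd _ b (t, t))).
wlog : z1 z2 / z1 <= z2.
  by move=> w h1 h2; case: (leP z1 z2) => h; [exact: w|rewrite distrC; apply: w => //; exact: ltW].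
move=> z12 /andP[a1 a2] /andP[b1 b2]; rewrite distrC.
apply: (le_trans (seg_le (t, t) z12 dv cv')).
have c2 : continuous (fun x => v' (upd b (t, t) x) ^+ 2) by exact: ctX.
have am (x : R) : `|x| <= k * x ^+ 2 + (4 * k)^-1.
  have k4 : 0 < 4 * k by lra.
  rewrite -(ler_pM2l k4) mulrDr divff ?gt_eqF// -[x ^+ 2]real_normK ?num_real//; have := sqr_ge0 (2 * k * `|x| - 1); nra.
have c3 : continuous (fun x => k * v' (upd b (t, t) x) ^+ 2) by apply: ctM => //; exact: ct_cst.
have c4 : continuous (fun x => k * v' (upd b (t, t) x) ^+ 2 + (4 * k)^-1) by apply: ctD => //; exact: ct_cst.
apply: (le_trans (le_lint (g := fun x => k * v' (upd b (t, t) x) ^+ 2 + (4 * k)^-1) (ct_norm c) c4 (fun x _ => am _))).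
rewrite lintD//; last exact: ct_cst.
rewrite lintZ// lint_cst//; apply: lerD.
  by apply: ler_wpM2l; [exact: ltW|apply: lintS => //; [move=> x; exact: sqr_ge0|lra|lra]].
by rewrite mulrC; apply: ler_wpM2r; [rewrite invr_ge0; lra|lra].
Qed.

(* p lies on one side of the square of radius s around a; it is joined to the upper right corner
   by at most two sides *)
Lemma loop_bound (v v1 v2 : Pt R -> R) (r s rho k : R) (a p q : Pt R) : C1 v v1 v2 -> 0 < k -> 0 <= s <= rho ->
  `|a.1| + rho <= r -> `|a.2| + rho <= r -> `|p - a| = s -> `|q - a| = s ->
  `|v p - v q| <= 2 * (k * (slice true r (fun z => v1 z ^+ 2) (a.2 + s) + slice true r (fun z => v1 z ^+ 2) (a.2 - s)
     + slice false r (fun z => v2 z ^+ 2) (a.1 + s) + slice false r (fun z => v2 z ^+ 2) (a.1 - s)) + 2 * rho / k).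
Proof.
move=> [cv cv1 cv2 d1 d2] k0 /andP[s0 srho] ar1 ar2.
have r0 : 0 <= r by have := normr_ge0 a.1; lra.
set T := slice true r _ (a.2 + s); set B := slice true r _ (a.2 - s); set Rt := slice false r _ _; set L := slice false r _ _.
have c1s : continuous (fun z => v1 z ^+ 2) by exact: ctX.
have c2s : continuous (fun z => v2 z ^+ 2) by exact: ctX.
have T0 : 0 <= T by apply: slice_ge0 => // z; exact: sqr_ge0.
have B0 : 0 <= B by apply: slice_ge0 => // z; exact: sqr_ge0.
have Rt0 : 0 <= Rt by apply: slice_ge0 => // z; exact: sqr_ge0.
have L0 : 0 <= L by apply: slice_ge0 => // z; exact: sqr_ge0.
have := ler_norm a.1; have := ler_norm (- a.1); have := ler_norm a.2; have := ler_norm (- a.2).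
rewrite !normrN => n1 n2 n3 n4.
have H (t x y : R) : a.1 - s <= x <= a.1 + s -> a.1 - s <= y <= a.1 + s ->
    `|v (x, t) - v (y, t)| <= k * slice true r (fun z => v1 z ^+ 2) t + rho / (2 * k).
  move=> hx hy; apply: (le_trans (@side_bound true v v1 r (a.1 - s) (a.1 + s) t k x y r0 _ _ _ k0 d1 cv1 hx hy)); try by clear -n1 n2 n3 n4 ar1 ar2 s0 srho; lra.
  rewrite lerD2l (_ : a.1 + s - (a.1 - s) = 2 * s); last ring.
  have -> : rho / (2 * k) = 2 * rho / (4 * k) by field; rewrite gt_eqF.
  by clear -k0 s0 srho; rewrite ler_pM2r ?invr_gt0; lra.
have V (t x y : R) : a.2 - s <= x <= a.2 + s -> a.2 - s <= y <= a.2 + s ->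
    `|v (t, x) - v (t, y)| <= k * slice false r (fun z => v2 z ^+ 2) t + rho / (2 * k).
  move=> hx hy; apply: (le_trans (@side_bound false v v2 r (a.2 - s) (a.2 + s) t k x y r0 _ _ _ k0 d2 cv2 hx hy)); try by clear -n1 n2 n3 n4 ar1 ar2 s0 srho; lra.
  rewrite lerD2l (_ : a.2 + s - (a.2 - s) = 2 * s); last ring.
  have -> : rho / (2 * k) = 2 * rho / (4 * k) by field; rewrite gt_eqF.
  by clear -k0 s0 srho; rewrite ler_pM2r ?invr_gt0; lra.
pose W := k * (T + B + Rt + L) + 2 * rho / k.
suff hW p' : `|p' - a| = s -> `|v p' - v (a.1 + s, a.2 + s)| <= W.
  move=> hp hq; have h3 := hW _ hp; have h4 := hW _ hq; rewrite -/W.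
  have := ler_distD (v (a.1 + s, a.2 + s)) (v p) (v q); rewrite (distrC (v (a.1 + s, a.2 + s)) (v q)); clear -h3 h4; lra.
have K0 : 0 <= rho / k by rewrite divr_ge0//; lra.
have e2 : rho / (2 * k) = rho / k / 2 by field; rewrite gt_eqF.
have e3 : 2 * rho / k = 2 * (rho / k) by ring.
have kT : 0 <= k * T by rewrite mulr_ge0// ltW.
have kB : 0 <= k * B by rewrite mulr_ge0// ltW.
have kR : 0 <= k * Rt by rewrite mulr_ge0// ltW.
have kL : 0 <= k * L by rewrite mulr_ge0// ltW.
have eW : W = k * T + k * B + k * Rt + k * L + 2 * (rho / k) by rewrite /W e3; ring.
case: p' => x y hp.
have : `|x - a.1| <= s by rewrite -hp; exact: (norm_fst ((x, y) - a)).
have : `|y - a.2| <= s by rewrite -hp; exact: (norm_snd ((x, y) - a)).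
move=> /ler_normlP[y1 y2] /ler_normlP[x1 x2].
have hx : a.1 - s <= x <= a.1 + s by clear -x1 x2; lra.
have hy : a.2 - s <= y <= a.2 + s by clear -y1 y2; lra.
have hxs : a.1 - s <= a.1 + s <= a.1 + s by clear -s0; lra.
have hys : a.2 - s <= a.2 + s <= a.2 + s by clear -s0; lra.
have hxm : a.1 - s <= a.1 - s <= a.1 + s by clear -s0; lra.
have hym : a.2 - s <= a.2 - s <= a.2 + s by clear -s0; lra.
have cases : [\/ x = a.1 + s, x = a.1 - s, y = a.2 + s | y = a.2 - s].
  have : s = `|x - a.1| \/ s = `|y - a.2|.
    by rewrite -hp prod_normE /=; case: (leP `|x - a.1| `|y - a.2|); [right|left].
  case=> hs.
    by case: (ger0P (x - a.1)) hs => _ hs; [apply: Or41; rewrite hs addrC subrK|apply: Or42; rewrite hs opprK addrC subrK].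
  by case: (ger0P (y - a.2)) hs => _ hs; [apply: Or43; rewrite hs addrC subrK|apply: Or44; rewrite hs opprK addrC subrK].
have rp : forall A B' C : R, `|A - C| <= `|A - B'| + `|B' - C| by move=> A B' C; exact: ler_distD.
case: cases => ->.
- have := V (a.1 + s) y (a.2 + s) hy hys; rewrite -/Rt; clear -kT kB kR kL eW K0 e2; lra.
- have := V (a.1 - s) y (a.2 + s) hy hys; have := H (a.2 + s) (a.1 - s) (a.1 + s) hxm hxs; rewrite -/T -/L.
  have := rp (v (a.1 - s, y)) (v (a.1 - s, a.2 + s)) (v (a.1 + s, a.2 + s)); clear -kT kB kR kL eW K0 e2; lra.
- have := H (a.2 + s) x (a.1 + s) hx hxs; rewrite -/T; clear -kT kB kR kL eW K0 e2; lra.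
- have := H (a.2 - s) x (a.1 + s) hx hxs; have := V (a.1 + s) (a.2 - s) (a.2 + s) hym hys; rewrite -/B -/Rt.
  have := rp (v (x, a.2 - s)) (v (a.1 + s, a.2 - s)) (v (a.1 + s, a.2 + s)); clear -kT kB kR kL eW K0 e2; lra.
Qed.

(** The four lines through the sides of each loop carry slice energy at least [1/(8k)] in total.
    Integrating over [s] in [[rho/2, rho]] sweeps out area, and each of the two families of lines is
    met at most twice. *)
Lemma loops (v v1 v2 : Pt R -> R) r rho (a : Pt R) : C1 v v1 v2 -> 0 < rho -> `|a.1| + rho <= r -> `|a.2| + rho <= r ->
  (forall s, rho / 2 <= s <= rho -> exists p q : Pt R, [/\ `|p - a| = s, `|q - a| = s & 3 / 4 <= `|v p - v q|]) ->
  1 / 256 <= 4 * bint r (fun z => v1 z ^+ 2 + v2 z ^+ 2).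
Proof.
move=> hv rp ar1 ar2 hs; have [cv cv1 cv2 d1 d2] := hv.
have r0 : 0 <= r by have := normr_ge0 a.1; lra.
have c1s : continuous (fun z => v1 z ^+ 2) by exact: ctX.
have c2s : continuous (fun z => v2 z ^+ 2) by exact: ctX.
(* With this [k] the term [2 rho / k] is 1/8, so of the oscillation 3/4 at least 1/2 is left to the
   slices. *)
pose k := 16 * rho; have k0 : 0 < k by rewrite /k; lra.
pose h1 := slice true r (fun z => v1 z ^+ 2); pose h2 := slice false r (fun z => v2 z ^+ 2).
have ch1 : continuous h1 by exact: slice_cont.
have ch2 : continuous h2 by exact: slice_cont.
have h10 x : 0 <= h1 x by apply: slice_ge0 => // z; exact: sqr_ge0.
have h20 x : 0 <= h2 x by apply: slice_ge0 => // z; exact: sqr_ge0.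
have id1 : continuous (fun s : R => s) by move=> s; exact: cvg_id.
have sh (h : R -> R) (b c : R) : continuous h -> continuous (fun s => h (b + c * s)).
  by move=> ch; apply: ct_comp => //; apply: ctD; [exact: ct_cst|apply: ctM => //; exact: ct_cst].
have pt s : rho / 2 <= s <= rho ->
    1 / 8 / k <= h1 (a.2 + 1 * s) + h1 (a.2 + (-1) * s) + (h2 (a.1 + 1 * s) + h2 (a.1 + (-1) * s)).
  move=> hs'; have [p [q [hp hq hpq]]] := hs s hs'.
  have sr : 0 <= s <= rho by lra.
  have := loop_bound hv k0 sr ar1 ar2 hp hq; rewrite -/(h1 _) -/(h1 _) -/(h2 _) -/(h2 _) !mul1r !mulN1r => hb.
  have e : 2 * rho / k = 1 / 8 by rewrite /k; field; rewrite gt_eqF.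
  rewrite ler_pdivrMr// mulrC addrA; rewrite e in hb; set A := k * _ in hb *; lra.
have cc1 : continuous (fun s => h1 (a.2 + 1 * s) + h1 (a.2 + (-1) * s)) by apply: ctD; exact: sh.
have cc2 : continuous (fun s => h2 (a.1 + 1 * s) + h2 (a.1 + (-1) * s)) by apply: ctD; exact: sh.
have := le_lint (f := fun=> 1 / 8 / k) (@ct_cst _ _ _) (ctD cc1 cc2) pt.
rewrite lint_cst; last lra.
rewrite lintD// !lintD; try exact: sh.
have := normr_ge0 a.1; have := normr_ge0 a.2 => na2 na1.
have bd b c t : c = 1 \/ c = -1 -> `|b| + rho <= r -> rho / 2 <= t <= rho -> `|b + c * t| <= r.
  move=> hc hb ht; apply: (le_trans (ler_normD _ _)); rewrite normrM.
  have -> : `|c| = 1 by case: hc => ->; rewrite ?normrN normr1.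
  rewrite mul1r ger0_norm; lra.
have p1 : (1 : R) = 1 \/ (1 : R) = -1 by left.
have p2 : (-1 : R) = 1 \/ (-1 : R) = -1 by right.
have rr : rho / 2 <= rho by lra.
have b1 := @lint_shift h1 a.2 1 (rho / 2) rho r r0 ch1 h10 p1 rr (fun t => bd _ _ t p1 ar2).
have b2 := @lint_shift h1 a.2 (-1) (rho / 2) rho r r0 ch1 h10 p2 rr (fun t => bd _ _ t p2 ar2).
have b3 := @lint_shift h2 a.1 1 (rho / 2) rho r r0 ch2 h20 p1 rr (fun t => bd _ _ t p1 ar1).
have b4 := @lint_shift h2 a.1 (-1) (rho / 2) rho r r0 ch2 h20 p2 rr (fun t => bd _ _ t p2 ar1).
have -> : 1 / 8 / k * (rho - rho / 2) = 1 / 256 by rewrite /k; field; rewrite gt_eqF.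
rewrite bintD; [|exact: L1_cont|exact: L1_cont].
have -> : bint r (fun z => v1 z ^+ 2) = lint (-r) r h1 by exact: bint_slice.
have -> : bint r (fun z => v2 z ^+ 2) = lint (-r) r h2 by exact: bint_slice.
move: b1 b2 b3 b4; clear.
set A1 := lint (rho / 2) rho _; set A2 := lint (rho / 2) rho _; set A3 := lint (rho / 2) rho _; set A4 := lint (rho / 2) rho _.
move: A1 A2 A3 A4 (lint (-r) r h1) (lint (-r) r h2) => A1 A2 A3 A4 B1 B2; lra.
Qed.

End loops.

(** * Cutoffs on squares and a discrete logarithm *)

Section square_cutoffs.
Variable R : realType.
Implicit Types (t d r s : R) (A w z : Pt R).

Lemma C1_Z c (f f1 f2 : Pt R -> R) : C1 f f1 f2 -> C1 (fun z => c * f z) (fun z => c * f1 z) (fun z => c * f2 z).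
Proof.
move=> [cf c1 c2 p1 p2]; have cc : continuous ((fun=> c) : Pt R -> R) by exact: ct_cst.
have e b f' : pdv b f f' -> pdv b (fun z => c * f z) (fun z => c * f' z).
  by move=> p z; apply: (deq (dM (dcst _ c) (p z))); ring.
by split; [exact: ctM|exact: ctM|exact: ctM|exact: e|exact: e].
Qed.

Lemma C1_eq (f f1 f2 g1 g2 : Pt R -> R) : C1 f f1 f2 -> (forall z, f1 z = g1 z) -> (forall z, f2 z = g2 z) -> C1 f g1 g2.
Proof. by move=> h /funext <- /funext <-. Qed.

(* equal to 1 on the square of half side t around A, to 0 off the square of half side 2t *)
Definition sqc A t w : R := plat (A.1 - 2 * t) (A.1 + 2 * t) t^-1 w.1 * plat (A.2 - 2 * t) (A.2 + 2 * t) t^-1 w.2.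
Definition sqc1 A t w : R := dplat (A.1 - 2 * t) (A.1 + 2 * t) t^-1 w.1 * plat (A.2 - 2 * t) (A.2 + 2 * t) t^-1 w.2.
Definition sqc2 A t w : R := plat (A.1 - 2 * t) (A.1 + 2 * t) t^-1 w.1 * dplat (A.2 - 2 * t) (A.2 + 2 * t) t^-1 w.2.

Lemma sqc_C1 A t : C1 (sqc A t) (sqc1 A t) (sqc2 A t).
Proof.
have h1 := C1_comp1 (@dplatE _ (A.1 - 2 * t) (A.1 + 2 * t) t^-1) (@dplat_cont _ _ _ _) (C1_fst R).
have h2 := C1_comp1 (@dplatE _ (A.2 - 2 * t) (A.2 + 2 * t) t^-1) (@dplat_cont _ _ _ _) (C1_snd R).
by apply: (C1_eq (C1_M h1 h2)) => z; rewrite /sqc1 /sqc2; ring.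
Qed.

Lemma sqc_ge0 A t w : 0 <= sqc A t w.
Proof. by rewrite mulr_ge0// plat_ge0. Qed.

Lemma sqc_le1 A t w : sqc A t w <= 1.
Proof. by apply: mulr_ile1; (exact: plat_ge0 || exact: plat_le1). Qed.

Lemma sqc_in A t w : 0 < t -> `|w - A| <= t -> [/\ sqc A t w = 1, sqc1 A t w = 0 & sqc2 A t w = 0].
Proof.
move=> t0 h; have := le_trans (norm_fst (w - A)) h; have := le_trans (norm_snd (w - A)) h.
rewrite /= => /ler_normlP[h1 h2] /ler_normlP[h3 h4].
have ti : 0 < t^-1 by rewrite invr_gt0.
have [|| a1 a2] := @plat_in _ (A.1 - 2 * t) (A.1 + 2 * t) t^-1 w.1 ti; [by rewrite invrK; lra|by rewrite invrK; lra|].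
have [|| b1 b2] := @plat_in _ (A.2 - 2 * t) (A.2 + 2 * t) t^-1 w.2 ti; [by rewrite invrK; lra|by rewrite invrK; lra|].
by rewrite /sqc /sqc1 /sqc2 a1 a2 b1 b2 !mulr1 mulr0.
Qed.

Lemma sqc_out A t w : 0 < t -> 2 * t <= `|w - A| -> [/\ sqc A t w = 0, sqc1 A t w = 0 & sqc2 A t w = 0].
Proof.
move=> t0 h; have ti : 0 <= t^-1 by rewrite invr_ge0 ltW.
have k (x c : R) : 2 * t <= `|x - c| -> ~~ (c - 2 * t < x < c + 2 * t).
  by move=> hx; apply/negP => hh; move: hx; rewrite leNgt ltr_norml; have -> : - (2 * t) < x - c < 2 * t by lra.
have : 2 * t <= `|w.1 - A.1| \/ 2 * t <= `|w.2 - A.2|.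
  by move: h; rewrite prod_normE /= le_max => /orP[]; [left|right].
by case=> /k hk; rewrite /sqc /sqc1 /sqc2 (plat_out ti hk) (dplat_out ti hk) ?mul0r ?mulr0.
Qed.

Lemma sqc_bd A t w : 0 < t -> `|sqc1 A t w| <= 2 * t^-1 /\ `|sqc2 A t w| <= 2 * t^-1.
Proof.
move=> t0; have ti : 0 <= t^-1 by rewrite invr_ge0 ltW.
have ap a b n (x : R) : `|plat a b n x| <= 1 by rewrite ger0_norm ?plat_ge0 ?plat_le1.
split; rewrite normrM.
  by rewrite -[leRHS]mulr1; apply: ler_pM => //; exact: dplat_bd.
by rewrite -[leRHS]mul1r; apply: ler_pM => //; exact: dplat_bd.
Qed.

Lemma bint_indic_cbx r A d : 0 <= d -> L1 r (\1_(cbx A d) : Pt R -> R) /\ bint r (\1_(cbx A d) : Pt R -> R) <= (2 * d) ^+ 2.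
Proof.
move=> d0; have mi : measT (\1_(cbx A d) : Pt R -> R) by exact: measurable_1cbx.
have L : L1 r (\1_(cbx A d) : Pt R -> R).
  apply: (@L1_bounded _ _ _ 1); first exact: measurable_funTS.
  by move=> x _; rewrite indicE; case: (_ \in _); rewrite ?normr1 ?normr0.
split => //; apply: le_trans (ler_norm _) _; rewrite -[leRHS]mul1r.
apply: (@bint_supp _ r _ 1 A) => //.
  by move=> y _ _; rewrite indicE; case: (_ \in _); rewrite ?normr1 ?normr0.
by move=> y _ dy; rewrite indicE memNset// /cbx /= => h; move: dy; rewrite ltNge h.
Qed.

Fixpoint fsum (F : nat -> Pt R -> R) n w : R := if n is k.+1 then fsum F k w + F k w else 0.

Lemma fsum_C1 F F1 F2 n : (forall j, C1 (F j) (F1 j) (F2 j)) -> C1 (fsum F n) (fsum F1 n) (fsum F2 n).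
Proof. by move=> h; elim: n => [|n ih]; [exact: C1_cst|exact: C1_D]. Qed.

Lemma fsum_le F G n w : (forall j, (j < n)%N -> F j w <= G j w) -> fsum F n w <= fsum G n w.
Proof. by elim: n => //= n ih h; apply: lerD; [apply: ih => j jn; apply: h; exact: ltnW|exact: h]. Qed.

Lemma fsum_norm F n w : `|fsum F n w| <= fsum (fun j w => `|F j w|) n w.
Proof. by elim: n => /= [|n ih]; rewrite ?normr0// (le_trans (ler_normD _ _))// lerD2r. Qed.

Lemma fsum_const F n w c : (forall j, (j < n)%N -> F j w = c) -> fsum F n w = n%:R * c.
Proof.
elim: n => /= [|n ih h]; first by rewrite mul0r.
rewrite ih ?h// => [|j jn]; last by apply: h; exact: ltnW.
by rewrite -[in RHS]addn1 natrD; ring.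
Qed.

Lemma fsumZ F n w c : fsum (fun j w => c * F j w) n w = c * fsum F n w.
Proof. by elim: n => /= [|n ->]; ring. Qed.

Lemma fsum_ge0 F n w : (forall j w, 0 <= F j w) -> 0 <= fsum F n w.
Proof. by move=> h; elim: n => //= n ih; rewrite addr_ge0. Qed.

Definition dil (rho : R) (j : nat) : R := rho * 2 ^+ j.

Lemma dil_gt0 rho j : 0 < rho -> 0 < dil rho j.
Proof. by move=> h; rewrite /dil mulr_gt0// exprn_gt0. Qed.

Lemma dil_le rho j n : 0 < rho -> (j <= n)%N -> dil rho j <= dil rho n.
Proof. by move=> h jn; rewrite /dil ler_pM2l// ler_eXn2l// ltr1n. Qed.

(** A discrete logarithm: cutoffs at the radii [rho 2^j] are added, giving [n] on the square of half
    side [rho] and 0 off the one of half side [2^n rho]. Its energy grows like [n], the square of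
    its oscillation like [n^2]. *)
Definition logc A rho n : Pt R -> R := fsum (fun j => sqc A (dil rho j)) n.
Definition logc1 A rho n : Pt R -> R := fsum (fun j => sqc1 A (dil rho j)) n.
Definition logc2 A rho n : Pt R -> R := fsum (fun j => sqc2 A (dil rho j)) n.
Definition logG A rho n : Pt R -> R := fsum (fun j w => (dil rho j)^-1 * \1_(cbx A (2 * dil rho j)) w) n.

Lemma logc_C1 A rho n : C1 (logc A rho n) (logc1 A rho n) (logc2 A rho n).
Proof. by apply: fsum_C1 => j; exact: sqc_C1. Qed.

Lemma logG_ge0 A rho n w : 0 < rho -> 0 <= logG A rho n w.
Proof. by move=> h; apply: fsum_ge0 => j z; rewrite mulr_ge0 ?invr_ge0// ltW// dil_gt0. Qed.

Lemma logc_bd A rho n w : 0 < rho -> `|logc1 A rho n w| <= 2 * logG A rho n w /\ `|logc2 A rho n w| <= 2 * logG A rho n w.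
Proof.
move=> h.
have k j : `|sqc1 A (dil rho j) w| <= 2 * ((dil rho j)^-1 * \1_(cbx A (2 * dil rho j)) w) /\
           `|sqc2 A (dil rho j) w| <= 2 * ((dil rho j)^-1 * \1_(cbx A (2 * dil rho j)) w).
  have d0 := dil_gt0 j h; have [wA|wA] := leP `|w - A| (2 * dil rho j).
    by rewrite indicE mem_set// mulr1; exact: sqc_bd.
  have [_ -> ->] := sqc_out d0 (ltW wA); rewrite normr0.
  by rewrite mulr_ge0// mulr_ge0// invr_ge0 ltW.
by split; apply: (le_trans (fsum_norm _ _ _)); rewrite /logG -fsumZ; apply: fsum_le => j _; case: (k j).
Qed.

Lemma logG_out A rho n w : 0 < rho -> dil rho n < `|w - A| -> logG A rho n w = 0.
Proof.
move=> h wA; rewrite /logG (@fsum_const _ _ _ 0) ?mulr0// => j jn.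
rewrite indicE memNset ?mulr0// /cbx /=; apply/negP; rewrite -ltNge; apply: le_lt_trans wA.
by apply: le_trans (dil_le h jn); rewrite /dil exprS mulrCA.
Qed.

Lemma logG_meas A rho n : measT (logG A rho n).
Proof.
elim: n => [|n ih] /=; first exact: measurable_cst.
apply: measurable_funD => //; apply: measurable_funM => //; exact: measurable_1cbx.
Qed.

Lemma logG_bounded A rho n : 0 < rho -> exists m, forall w, `|logG A rho n w| <= m.
Proof.
move=> h; exists (n%:R * rho^-1) => w; apply: (le_trans (fsum_norm _ _ _)).
rewrite -(@fsum_const (fun _ _ => rho^-1) n w)//; apply: fsum_le => j _.
have d0 := dil_gt0 j h; rewrite normrM ger0_norm ?invr_ge0 ?(ltW d0)// -[leRHS]mulr1; apply: ler_pM => //.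
- by rewrite invr_ge0 ltW.
- by rewrite lef_pV2 ?posrE//; have := dil_le h (leq0n j); rewrite {1}/dil expr0 mulr1.
- by rewrite indicE; case: (_ \in _); rewrite ?normr1 ?normr0.
Qed.

(** The two bounds are proved together. The new term is [1/d] on a square of area [16 d^2], so its
    square contributes at most 16; the cross term is at most [2/d] times the previous first bound
    [16 d]. Hence 48 per step. *)
Lemma logG_energy A rho n r : 0 < rho ->
  bint r (logG A rho n) <= 16 * dil rho n /\ bint r (fun w => logG A rho n w ^+ 2) <= 48 * n%:R.
Proof.
move=> h; elim: n => [|n [ih1 ih2]].
  have z : bint r (fun=> 0 : R) = 0 by rewrite /bint /Rintegral integral0.
  rewrite /logG /= z mulr0; split; first by rewrite mulr_ge0// ltW// dil_gt0.
  by rewrite (eq_bint (g := fun=> 0)) ?z// => x _; rewrite expr0n.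
have d0 := dil_gt0 n h; set d := dil rho n in d0 *.
pose t w : R := d^-1 * \1_(cbx A (2 * d)) w.
have [m hm] := logG_bounded A n h.
have LG : L1 r (logG A rho n) by apply: (@L1_bounded _ _ _ m) => //; apply: measurable_funTS; exact: logG_meas.
have LG2 : L1 r (fun w => logG A rho n w ^+ 2).
  apply: (@L1_bounded _ _ _ (m ^+ 2)); first by apply: measurable_funTS; apply: measurable_funX; exact: logG_meas.
  by move=> x _; rewrite normrX lerXn2r// nnegrE// (le_trans _ (hm x)).
have [Li bi] := bint_indic_cbx r A (mulr_ge0 (ler0n _ 2) (ltW d0)).
have Lt : L1 r t by exact: L1Z.
have bt : bint r t <= 16 * d.
  rewrite bintZ// (_ : 16 * d = d^-1 * (2 * (2 * d)) ^+ 2); last by field; rewrite gt_eqF.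
  by rewrite ler_pM2l ?invr_gt0.
split.
  have -> : bint r (logG A rho n.+1) = bint r (logG A rho n) + bint r t by rewrite -bintD.
  have -> : dil rho n.+1 = 2 * d by rewrite /d /dil exprS mulrCA.
  move: ih1 bt; rewrite -/d; move: (bint r (logG A rho n)) (bint r t) => X Y; clear; lra.
have c : bint r (fun w => logG A rho n.+1 w ^+ 2) <= bint r (fun w => logG A rho n w ^+ 2 + ((2 * d^-1) * logG A rho n w + d^-1 * t w)).
  have [m' hm'] := logG_bounded A n.+1 h.
  apply: le_bint.
  - apply: (@L1_bounded _ _ _ (m' ^+ 2)); first by apply: measurable_funTS; apply: measurable_funX; exact: logG_meas.
    by move=> x _; rewrite normrX lerXn2r// nnegrE// (le_trans _ (hm' x)).
  - by apply: L1D => //; apply: L1D; exact: L1Z.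
  move=> x _; rewrite -[logG A rho n.+1 x]/(logG A rho n x + t x).
  have g0 := logG_ge0 A n x h; set g := logG A rho n x in g0 *.
  have e : 0 < d^-1 by rewrite invr_gt0.
  by rewrite /t indicE; move: (d^-1) e => D e; case: (_ \in _); rewrite /= ?mulr1 ?mulr0; nra.
apply: (le_trans c); rewrite bintD//; last by apply: L1D; exact: L1Z.
rewrite bintD ?bintZ//; try exact: L1Z.
have e1 : 2 * d^-1 * bint r (logG A rho n) <= 32.
  rewrite mulrAC ler_pdivrMr//; rewrite -/d in ih1; lra.
have e2 : d^-1 * (d^-1 * bint r (\1_(cbx A (2 * d)))) <= 16.
  by rewrite -(bintZ _ Li) mulrC ler_pdivrMr.
rewrite -[n.+1]addn1 natrD; lra.
Qed.

Lemma path_hit (g : R -> Pt R) a (t0 t1 s : R) : continuous g -> t0 <= t1 -> `|g t0 - a| <= s -> s <= `|g t1 - a| ->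
  exists2 t, t0 <= t <= t1 & `|g t - a| = s.
Proof.
move=> cg t01 h0 h1.
have c : continuous (fun t => `|g t - a|).
  move=> t; apply: cvg_norm; apply: cvgB; [exact: cg|exact: cvg_cst].
have [|t ht e] := @IVT R (fun t => `|g t - a|) t0 t1 s t01 (continuous_subspaceT c).
  by rewrite ge_min le_max h0 h1 orbT.
by exists t => //; move: ht; rewrite in_itv.
Qed.

Lemma line_cont (a b : Pt R) : continuous (fun t : R => a + t *: (b - a)).
Proof.
move=> t; apply: cvgD; first exact: cvg_cst.
by apply: cvgZ; [exact: cvg_id|exact: cvg_cst].
Qed.

Lemma energy_ratio (x Q : R) : 0 < x -> x ^+ 2 / 256 / 4 <= 8 * Q * (48 * x) -> x <= 256 * (4 * (8 * Q * 48)).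
Proof.
move=> x0; rewrite expr2 => h; have : x * (x / 256 / 4) <= x * (8 * Q * 48) by lra.
by rewrite ler_pM2l// => g; lra.
Qed.

End square_cutoffs.

(** * Quasisymmetry of the map at small ratios *)

Section quasisymmetry.
Variables (R : realType) (Q M : R) (E : set (Pt R)) (phi psi : Pt R -> Pt R) (fx fy gx gy : Pt R -> R).
Hypothesis HN : qcnorm Q M E phi psi fx fy gx gy.
Local Notation H := (qn_H HN).
Local Notation J := (Jac fx fy gx gy).
Implicit Types (r s rho : R) (x z w a b c : Pt R).

Let D2 z := fx z ^+ 2 + fy z ^+ 2 + gx z ^+ 2 + gy z ^+ 2.

(** The distortion inequality replaces the squared derivatives by [Q] times the Jacobian, and [cov]
    moves the integral to the image side. The 8 comes from two partial derivatives, each bounded by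
    [2 logG]. *)
Lemma logc_energy (A : Pt R) rho n r s : 0 < rho -> 0 <= s -> s + M + 1 <= r -> `|A| + dil rho n < s ->
  bint r (fun z => (logc1 A rho n (phi z) ^+ 2 + logc2 A rho n (phi z) ^+ 2) * D2 z) <= 8 * Q * (48 * n%:R).
Proof.
move=> h s0 sr As.
have Q0 := qc_Q0 H.
have [m hm] := logG_bounded A n h.
have m0 : 0 <= m by exact: le_trans (hm 0).
have mG2 : measT (fun w => logG A rho n w ^+ 2) by apply: measurable_funX; exact: logG_meas.
have bG2 w : `|logG A rho n w ^+ 2| <= m ^+ 2 by rewrite normrX lerXn2r// nnegrE.
have [L1a L1b] := L1_cov H r s mG2 bG2.
have e := cov H s0 sr mG2 bG2.
have [h1 h2 h3 h4] := qc_L2 H r.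
have LD : L1 r D2 by apply: L1D; [apply: L1D; [apply: L1D|]|]; [exact: h1.2|exact: h2.2|exact: h3.2|exact: h4.2].
have [cu cu1 cu2 _ _] := logc_C1 A rho n.
have cw : continuous (fun z => logc1 A rho n (phi z) ^+ 2 + logc2 A rho n (phi z) ^+ 2).
  by apply: ctD; apply: ctX; apply: (ct_comp2 _ (qc_c H)).
apply: (@le_trans _ _ (bint r (fun x => (8 * Q) * (\1_(ob s) (phi x) * logG A rho n (phi x) ^+ 2 * J x)))).
  apply: le_bint; [exact: L1Mc|exact: L1Z|].
  move=> z _; have d := qn_dist HN z; rewrite -/(D2 z) in d.
  have D20 : 0 <= D2 z by rewrite /D2 !addr_ge0// sqr_ge0.
  have G0 := logG_ge0 A n (phi z) h.
  have [b1 b2] := logc_bd A n (phi z) h.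
  have sq1 (x y : R) : `|x| <= 2 * y -> x ^+ 2 <= 4 * y ^+ 2.
    by move=> hxy; rewrite -[x ^+ 2]real_normK ?num_real//; have := normr_ge0 x; nra.
  have b := lerD (sq1 _ _ b1) (sq1 _ _ b2).
  have i1 : \1_(ob s) (phi z) * logG A rho n (phi z) ^+ 2 = logG A rho n (phi z) ^+ 2.
    have [yo|no] := boolP (phi z \in ob s); first by rewrite indicE yo mul1r.
    rewrite logG_out ?expr0n ?mulr0//; rewrite ltNge; apply/negP => hA.
    move/negP: no; apply; apply: mem_set; have : `|phi z| < s.
      by have := ler_normD (phi z - A) A; rewrite subrK; lra.
    rewrite prod_normE gt_max => /andP[]; rewrite !ltr_norml => o1 o2.
    by split; rewrite /= in_itv.
  rewrite i1; apply: (@le_trans _ _ (8 * logG A rho n (phi z) ^+ 2 * D2 z)).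
    by apply: ler_wpM2r => //; apply: (le_trans b); lra.
  have -> : 8 * Q * (logG A rho n (phi z) ^+ 2 * J z) = 8 * logG A rho n (phi z) ^+ 2 * (Q * J z) by ring.
  by apply: ler_wpM2l => //; rewrite mulr_ge0// sqr_ge0.
rewrite bintZ//; apply: ler_wpM2l; first by rewrite mulr_ge0.
rewrite e; apply: le_trans (logG_energy A n s h).2; apply: le_bint => //.
  by apply: (@L1_bounded _ _ _ (m ^+ 2)) => //; exact: measurable_funTS.
move=> w _; rewrite indicE; case: (_ \in _); rewrite ?mul1r ?mul0r//; exact: sqr_ge0.
Qed.

(** Connectedness on the image side: the preimage of the segment from [phi a] to [phi c] starts at
    [a] and ends outside the loop; the preimage of the ray from [phi b] away from [phi a] starts
    inside it and leaves it. Both cross the loop. *)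
Lemma hit_points a b c s : a != b -> `|a - b| <= s -> s <= `|a - c| -> exists p q : Pt R,
  [/\ `|p - a| = s, `|q - a| = s, `|phi p - phi a| <= `|phi a - phi c| & `|phi a - phi b| <= `|phi q - phi a|].
Proof.
move=> ab h1 h2; set A := phi a; set B := phi b.
have cl e : continuous (fun t : R => psi (A + t *: (e - A))).
  by move=> t; apply: continuous_comp; [exact: line_cont|exact: (qc_c' H)].
have s0 : 0 <= s by exact: le_trans h1.
have M0 := qc_M0 H.
have [t ht et] : exists2 t, 0 <= t <= 1 & `|psi (A + t *: (phi c - A)) - a| = s.
  apply: (path_hit (cl (phi c)) ler01).
    by rewrite /= scale0r addr0 (qc_K H) subrr normr0.
  by rewrite /= scale1r (addrC A) subrK (qc_K H) distrC.
have BA0 : 0 < `|B - A|.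
  rewrite normr_gt0 subr_eq0; apply/eqP => e; move/eqP: ab; apply.
  by rewrite -(qc_K H a) -/A -e (qc_K H).
(* Far enough along the ray that the preimage, within [M] of its image, has left the square of half
   side [s]. *)
pose T1 := 1 + (`|a| + `|A| + s + M) / `|B - A|.
have T11 : 1 <= T1 by rewrite /T1 lerDl divr_ge0 ?normr_ge0// !addr_ge0.
have [t' ht' et'] : exists2 t, 1 <= t <= T1 & `|psi (A + t *: (B - A)) - a| = s.
  apply: (path_hit (cl B) T11); first by rewrite /= scale1r (addrC A) subrK (qc_K H) distrC.
  set W := A + T1 *: (B - A).
  have hM := qc_M H (psi W); rewrite (qc_K' H) in hM.
  have nT : `|T1 *: (B - A)| = `|B - A| + (`|a| + `|A| + s + M).
    by rewrite normrZ ger0_norm ?(le_trans ler01)// /T1 mulrDl mul1r divfK// gt_eqF.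
  have e1 : `|T1 *: (B - A)| <= `|W - psi W| + `|psi W - a| + `|a| + `|A|.
    have -> : T1 *: (B - A) = (W - psi W) + (psi W - a) + a + (- A) by rewrite subrKA subrK /W addrAC subrr add0r.
    rewrite -[`|A|]normrN; do 3! (apply: (le_trans (ler_normD _ _)); rewrite ?lerD2r).
    exact: lexx.
  rewrite nT in e1; lra.
exists (psi (A + t *: (phi c - A))), (psi (A + t' *: (B - A))); split => //.
  rewrite (qc_K' H) addrAC subrr add0r normrZ distrC.
  by rewrite ler_piMl// ger0_norm//; case/andP: ht.
rewrite (qc_K' H) addrAC subrr add0r normrZ distrC.
by rewrite ler_peMl// ger0_norm//; case/andP: ht' => ? ?; lra.
Qed.

(** If the image ratio exceeded [2^n], the discrete logarithm composed with [phi] would oscillate by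
    [n] on every loop of radius between [|a - c| / 2] and [|a - c|]. The length-area bound then
    forces energy at least [n^2/1024], while [logc_energy] allows only a multiple of [n]. *)
Lemma qs_half (n : nat) a b c : 256 * (4 * (8 * Q * 48)) < n%:R -> `|a - b| <= `|a - c| / 2 ->
  `|phi a - phi b| <= dil `|phi a - phi c| n.
Proof.
move=> hn hab.
have Q0 := qc_Q0 H; have M0 := qc_M0 H.
have n0 : 0 < n%:R :> R by apply: le_lt_trans hn; rewrite !mulr_ge0.
have [ab|ab] := eqVneq a b; first by rewrite ab subrr normr0 /dil mulr_ge0// exprn_ge0.
have ac : a != c by apply/eqP => e; move: hab; rewrite e subrr normr0 mul0r normr_le0 subr_eq0 -e (negbTE ab).
rewrite leNgt; apply/negP => big.
set rho := `|phi a - phi c| in big.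
have rho0 : 0 < rho.
  rewrite normr_gt0 subr_eq0; apply/eqP => e; move/eqP: ac; apply.
  by rewrite -(qc_K H a) e (qc_K H).
pose R1 := `|a - c|; have R10 : 0 < R1 by rewrite normr_gt0 subr_eq0.
set A := phi a; set B := phi b; pose s := `|A| + dil rho n + 1.
have d0 := dil_gt0 n rho0.
have s0 : 0 <= s by rewrite /s; have := normr_ge0 A; lra.
pose r := s + M + 1 + `|a| + R1.
have sr : s + M + 1 <= r by rewrite /r; have := normr_ge0 a; lra.
have [u [u1 [u2 [u12 [v [v1 [v2 [v12 [hu hv su sv]]]]]]]]] := smoothings H.
have [lu lu1 lu2] := smoothing_Lim r (phi1_cont H) (qc_fx H) (qc_fy H) su.
have [lv lv1 lv2] := smoothing_Lim r (phi2_cont H) (qc_gx H) (qc_gy H) sv.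
have C1U := logc_C1 A rho n; have [cU cU1 cU2 _ _] := C1U.
pose w := fun p : Pt R => logc1 A rho n p ^+ 2 + logc2 A rho n p ^+ 2.
have cw : continuous w by apply: ctD; exact: ctX.
have lw := LimU_comp2 cw lu lv.
have lU := LimU_comp2 cU lu lv.
have T := tendsD (tendsD (tendsD (lim_wAB lw lu1 lu1) (lim_wAB lw lu2 lu2)) (lim_wAB lw lv1 lv1)) (lim_wAB lw lv2 lv2).
have [h1 h2 h3 h4] := qc_L2 H r.
have cwphi : continuous (fun z => w ((phi z).1, (phi z).2)) by case: lw.
have sumE (w' A1 A2 A3 A4 : Pt R -> R) : continuous w' -> L2 r A1 -> L2 r A2 -> L2 r A3 -> L2 r A4 ->
   bint r (fun z => w' z * (A1 z * A1 z)) + bint r (fun z => w' z * (A2 z * A2 z)) +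
   bint r (fun z => w' z * (A3 z * A3 z)) + bint r (fun z => w' z * (A4 z * A4 z)) =
   bint r (fun z => w' z * (A1 z ^+ 2 + A2 z ^+ 2 + A3 z ^+ 2 + A4 z ^+ 2)) /\
   L1 r (fun z => w' z * (A1 z ^+ 2 + A2 z ^+ 2 + A3 z ^+ 2 + A4 z ^+ 2)).
  move=> cw' k1 k2 k3 k4; have LL A' : L2 r A' -> L1 r (fun z => w' z * (A' z * A' z)) by move=> hA; exact: L1M3.
  have l1 := LL _ k1; have l2 := LL _ k2; have l3 := LL _ k3; have l4 := LL _ k4.
  have l12 := L1D l1 l2; have l123 := L1D l12 l3; have l1234 := L1D l123 l4.
  rewrite -!bintD//; split; first by apply: eq_bint => z _; ring.
  by apply: eq_L1 l1234 => z _; ring.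
have lim_le : bint r (fun z => w ((phi z).1, (phi z).2) * (fx z * fx z)) + bint r (fun z => w ((phi z).1, (phi z).2) * (fy z * fy z)) +
  bint r (fun z => w ((phi z).1, (phi z).2) * (gx z * gx z)) + bint r (fun z => w ((phi z).1, (phi z).2) * (gy z * gy z)) <= 8 * Q * (48 * n%:R).
  rewrite (sumE _ _ _ _ _ cwphi h1 h2 h3 h4).1.
  apply: le_trans (@logc_energy A rho n r s rho0 s0 sr _); last by rewrite /s; lra.
  by rewrite le_eqVlt; apply/orP; left; apply/eqP; apply: eq_bint => z _; rewrite /w /D2; case: (phi z).
have low : n%:R ^+ 2 / 256 / 4 <= bint r (fun z => w ((phi z).1, (phi z).2) * (fx z * fx z)) + bint r (fun z => w ((phi z).1, (phi z).2) * (fy z * fy z)) +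
  bint r (fun z => w ((phi z).1, (phi z).2) * (gx z * gx z)) + bint r (fun z => w ((phi z).1, (phi z).2) * (gy z * gy z)).
  apply: (tends_le (tends_cst _) T).
  (* An error of [n/8] at each of the two points leaves [3n/4] of the oscillation [n], as [loops]
     requires after division by [n]. *)
  have [_ _ hU] := lU; have [k0 hk0] := hU (n%:R / 8) ltac:(lra).
  exists k0 => k kk.
  have [Cu _ _ _] := hu k; have [Cv _ _ _] := hv k.
  have [_ cu1 cu2 _ _] := Cu; have [_ cv1 cv2 _ _] := Cv.
  have cwk : continuous (fun z => w (u k z, v k z)) by case: lw.
  have [-> Lk] := sumE _ _ _ _ _ cwk (L2_cont r cu1) (L2_cont r cu2) (L2_cont r cv1) (L2_cont r cv2).
  have CV := C1_Z n%:R^-1 (C1_chain C1U Cu Cv).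
  have na1 := norm_fst a; have na2 := norm_snd a.
  have L := loops CV (rho := R1) (r := r) (a := a) R10.
  have : 1 / 256 <= 4 * bint r (fun z => (n%:R ^+ 2)^-1 * (w (u k z, v k z) * (u1 k z ^+ 2 + u2 k z ^+ 2 + v1 k z ^+ 2 + v2 k z ^+ 2))).
    apply: (le_trans (L _ _ _)).
    - by rewrite /r; clear -na1 s0 M0; lra.
    - by rewrite /r; clear -na2 s0 M0; lra.
    - move=> s' hs'.
      have [s'1 s'2] := andP hs'.
      have [p [q [et et' hp hq]]] := @hit_points a b c s' ab (le_trans hab s'1) s'2.
      exists p, q; split => //.
      have bxp y : `|y - a| = s' -> bx r y.
        move=> ey; rewrite /bx /=; have := ler_normD (y - a) a; rewrite subrK ey /r; clear -s'1 s'2 s0 M0; lra.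
      have vp : logc A rho n ((phi p).1, (phi p).2) = n%:R.
        rewrite -[RHS]mulr1; apply: fsum_const => j _.
        have [|-> //] := @sqc_in _ A (dil rho j) ((phi p).1, (phi p).2) (dil_gt0 j rho0) _.
        rewrite -surjective_pairing; apply: (le_trans hp).
        by have := dil_le rho0 (leq0n j); rewrite {1}/dil expr0 mulr1.
      have vq : logc A rho n ((phi q).1, (phi q).2) = 0.
        rewrite -[RHS](mulr0 n%:R); apply: fsum_const => j jn.
        have [|-> //] := @sqc_out _ A (dil rho j) ((phi q).1, (phi q).2) (dil_gt0 j rho0) _.
        rewrite -surjective_pairing; have := dil_le rho0 jn; rewrite {1}/dil exprS mulrCA => hj.
        by apply: (le_trans hj); apply: le_trans hq; exact: ltW.
      have gp := hk0 k p kk (bxp _ et); have gq := hk0 k q kk (bxp _ et').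
      rewrite vp in gp; rewrite vq in gq.
      rewrite -mulrBr normrM ger0_norm ?invr_ge0// [leRHS]mulrC ler_pdivlMr//.
      move: gp gq => /ler_normlP[g1 g2] /ler_normlP[g3 g4]; apply: le_trans (ler_norm _); clear -g1 g2 g3 g4; lra.
    rewrite ler_pM2l//; apply: le_bint.
    - case: CV => _ c1 c2 _ _; apply: L1_cont; apply: ctD; exact: ctX.
    - exact: L1Z.
    move=> z _; rewrite !exprMn -mulrDr exprVn; apply: ler_wpM2l; first by rewrite invr_ge0 exprn_ge0// ltW.
    rewrite /w; set p1 := logc1 _ _ _ _; set p2 := logc2 _ _ _ _.
    (* Lagrange's identity: these squares are the defects in Cauchy-Schwarz for the two partial
       derivatives of the composition. *)
    have := sqr_ge0 (p1 * v1 k z - p2 * u1 k z); have := sqr_ge0 (p1 * v2 k z - p2 * u2 k z); clear -n0; lra.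
  rewrite bintZ//; move: (bint r _) => X; rewrite mulrCA [leRHS]mulrC ler_pdivlMr ?exprn_gt0// => hX; lra.
by move: hn; rewrite ltNge (energy_ratio n0 (le_trans low lim_le)).
Qed.

End quasisymmetry.

(** * Quasisymmetric homeomorphisms: chaining, area decay, inverse *)

Section abstract_quasisymmetry.
Variable R : realType.
Local Notation m2 := (@leb2 R).
Implicit Types (r s H : R) (a b c x y z w : Pt R).

(** Weak quasisymmetry with room: the ratio 8 covers the geometric comparisons made later, for
    instance the ratio 7 in [area_decay]. *)
Definition qs H (F : Pt R -> Pt R) := forall a b c, `|a - b| <= 8 * `|a - c| -> `|F a - F b| <= H * `|F a - F c|.

(** The segment from [a] to [b] is cut into 32 steps of length at most [|a - c| / 4]. Each point
    [p i] is at distance at least [|a - c| / 2] from [a] or from [c], and that endpoint serves as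
    reference for the next step; every step costs a factor [1 + H]. *)
Lemma qs_chain H (F : Pt R -> Pt R) : 0 <= H ->
  (forall a b c, `|a - b| <= `|a - c| / 2 -> `|F a - F b| <= H * `|F a - F c|) -> qs ((1 + H) ^+ 32) F.
Proof.
move=> H0 h a b c hab; pose p (i : nat) := a + (i%:R / 32) *: (b - a); set D := `|F a - F c|.
have D0 : 0 <= D by exact: normr_ge0.
have st i : `|F (p i) - F (p i.+1)| <= H * (`|F a - F (p i)| + D).
  have e : p i - p i.+1 = - (32^-1 *: (b - a)).
    have e1 : i.+1%:R / 32 = i%:R / 32 + 32^-1 :> R by rewrite -[i.+1]addn1 natrD; field.
    by rewrite /p e1 scalerDl [X in _ - X]addrA opprD addrA subrr add0r.
  have l : `|p i - p i.+1| <= `|a - c| / 4.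
    rewrite e normrN normrZ (distrC b) ger0_norm ?invr_ge0//; lra.
  have [big|small] := leP (`|a - c| / 2) `|p i - a|.
    apply: (le_trans (h (p i) (p i.+1) a _)); first by lra.
    by apply: ler_wpM2l => //; rewrite distrC lerDl.
  apply: (le_trans (h (p i) (p i.+1) c _)).
    by have := ler_distD (p i) a c; rewrite (distrC a (p i)); lra.
  by apply: ler_wpM2l => //; have := ler_distD (F a) (F (p i)) (F c); rewrite (distrC (F (p i)) (F a)).
have cl i : `|F a - F (p i)| + D <= (1 + H) ^+ i * D.
  elim: i => [|i ih]; first by rewrite /p mul0r scale0r addr0 subrr normr0 add0r expr0 mul1r.
  have := st i; have := ler_distD (F (p i)) (F a) (F (p i.+1)); rewrite exprS -mulrA => h1 h2.
  apply: (@le_trans _ _ ((1 + H) * (`|F a - F (p i)| + D))); first by rewrite mulrDl mul1r; lra.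
  by apply: ler_wpM2l => //; lra.
have := cl 32%N; have -> : p 32%N = b by rewrite /p divff// scale1r addrC subrK.
lra.
Qed.

(** [1/(4 H^4)] is the ratio of the areas of a square of side [D/H] inside the image and of one of
    side [2 H D] containing it. *)
Definition theta H : R := 1 - (4 * H ^+ 4)^-1.

Lemma theta_ge0 H : 1 <= H -> 0 <= theta H.
Proof.
move=> H1; have H0 : 0 < H by lra.
rewrite /theta subr_ge0 invf_le1; last by rewrite mulr_gt0// exprn_gt0.
by have : 1 <= H ^+ 4 by [exact: exprn_ege1]; lra.
Qed.

Lemma theta_lt1 H : 1 <= H -> theta H < 1.
Proof. move=> H1; have H0 : 0 < H by lra.
by rewrite /theta ltrBlDr ltrDl invr_gt0 mulr_gt0// exprn_gt0. Qed.

Section homeo.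
Variables (H : R) (Phi Psi : Pt R -> Pt R).
Hypotheses (H1 : 1 <= H) (K : cancel Phi Psi) (K' : cancel Psi Phi) (cPsi : continuous Psi) (hq : qs H Phi).

Let mPsi : measT Psi. Proof. exact: measurable_cont22. Qed.
Let H0 : 0 < H. Proof. exact: lt_le_trans ltr01 H1. Qed.

Lemma measurable_pre (A : set (Pt R)) : measurable A -> measurable (Psi @^-1` A).
Proof. by move=> mA; rewrite -[X in measurable X]setTI; apply: mPsi. Qed.

(** Contrapositive of quasisymmetry at [y]; it places a square of comparable size inside the image
    of a square. *)
Lemma qs_ball_in y z0 w : `|w - Phi y| < `|Phi z0 - Phi y| / H -> `|Psi w - y| < `|z0 - y|.
Proof.
move=> h; rewrite ltNge; apply/negP => h2; move: h; rewrite ltNge => /negP; apply.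
rewrite ler_pdivrMr// mulrC distrC (distrC w) -{1}(K' w); apply: hq.
by rewrite distrC (distrC y (Psi w)); have := normr_ge0 (Psi w - y); lra.
Qed.

Lemma qs_ball_out y z z0 : `|z - y| <= 8 * `|z0 - y| -> `|Phi z - Phi y| <= H * `|Phi z0 - Phi y|.
Proof. by move=> h; rewrite distrC (distrC (Phi z0)); apply: hq; rewrite distrC (distrC y z0). Qed.

Lemma leb2_le (A B : set (Pt R)) : measurable A -> measurable B -> A `<=` B -> (m2 A <= m2 B)%E.
Proof. by move=> mA mB AB; apply: le_measure; rewrite ?inE. Qed.

(** The image of a square under [Phi] is written as a preimage under [Psi], which gives its
    measurability at once. *)
Lemma area_upper x r z0 : r <= 8 * `|z0 - x| ->
  (m2 (Psi @^-1` cbx x r) <= ((2 * (H * `|Phi z0 - Phi x|)) ^+ 2)%:E)%E.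
Proof.
move=> hr; rewrite -(@leb2_cbx _ (Phi x)); last by rewrite mulr_ge0// ltW.
apply: leb2_le; [exact: measurable_pre (measurable_cbx _ _)|exact: measurable_cbx|].
move=> w; rewrite /cbx /= => hw; rewrite -[w]K'; apply: qs_ball_out; exact: le_trans hr.
Qed.

Lemma area_lower x r z0 : `|z0 - x| <= r ->
  (((`|Phi z0 - Phi x| / H) ^+ 2)%:E <= m2 (Psi @^-1` cbx x r))%E.
Proof.
move=> hr; set D := `|_|.
have [D0|Dp] := eqVneq D 0; first by rewrite D0 mul0r expr0n/=; exact: measure_ge0.
have D0 : 0 < D by rewrite lt_def Dp normr_ge0.
have -> : D / H = 2 * (D / H / 2) by field; rewrite gt_eqF.
have D2 : 0 < D / H by rewrite divr_gt0.
rewrite -(@leb2_cbx _ (Phi x)); last lra.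
apply: leb2_le; [exact: measurable_cbx|exact: measurable_pre (measurable_cbx _ _)|].
move=> w; rewrite /cbx /= => hw; apply: le_trans hr; apply: ltW; apply: qs_ball_in.
rewrite -/D; lra.
Qed.

(* the square of half side r/4 centred at x + (3r/4, 0) lies in the outer annulus, and by
   quasisymmetry its image has area comparable with that of the image of the large square *)
Lemma area_decay x r : 0 < r -> (m2 (Psi @^-1` cbx x (r / 2)) <= (theta H)%:E * m2 (Psi @^-1` cbx x r))%E.
Proof.
move=> r0; pose y := x + (3 * r / 4, 0); pose z0 := y + (r / 4, 0).
have nz (t : R) : 0 <= t -> `|((t, 0) : Pt R)| = t by move=> t0; rewrite prod_normE /= normr0 ger0_norm// max_l.
have yx : `|y - x| = 3 * r / 4 by rewrite /y addrAC subrr add0r nz//; lra.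
have zy : `|z0 - y| = r / 4 by rewrite /z0 addrAC subrr add0r nz//; lra.
have D0 : 0 < `|Phi z0 - Phi y|.
  rewrite normr_gt0 subr_eq0; apply/eqP => e.
  have : `|z0 - y| = 0 by rewrite -(K z0) e K subrr normr0.
  by rewrite zy; lra.
set D := `|Phi z0 - Phi y| in D0.
have D2 : 0 < D / H by rewrite divr_gt0.
set B := Psi @^-1` cbx x r; set S := Psi @^-1` cbx x (r / 2).
have mB : measurable B by exact: measurable_pre (measurable_cbx _ _).
have mS : measurable S by exact: measurable_pre (measurable_cbx _ _).
have mC := measurable_cbx (Phi y) (D / H / 2).
have up : (m2 B <= ((2 * (H * D)) ^+ 2)%:E)%E.
  rewrite -(@leb2_cbx _ (Phi y)); last by rewrite mulr_ge0// ltW.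
  apply: leb2_le => //; first exact: measurable_cbx.
  move=> w; rewrite /B /cbx /= => hw; rewrite -[w]K'; apply: qs_ball_out.
  by have := ler_distD x (Psi w) y; rewrite (distrC x y) yx zy; lra.
have lo : (m2 S + m2 (cbx (Phi y) (D / H / 2)) <= m2 B)%E.
  rewrite -measureU//.
    apply: leb2_le => //; first exact: measurableU.
    move=> w [|]; rewrite /S /B /cbx /= => hw; first lra.
    have : `|Psi w - y| < `|z0 - y| by apply: qs_ball_in; rewrite -/D; lra.
    by have := ler_distD y (Psi w) x; rewrite yx zy; lra.
  apply/seteqP; split => // w []; rewrite /S /cbx /= => h1 h2.
  have : `|Psi w - y| < `|z0 - y| by apply: qs_ball_in; rewrite -/D; lra.
  by have := ler_distD (Psi w) x y; rewrite (distrC x y) (distrC x (Psi w)) yx zy; lra.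
rewrite leb2_cbx in lo; last lra.
have fB : m2 B \is a fin_num by rewrite ge0_fin_numE ?measure_ge0// (le_lt_trans up)// ltry.
have fS : m2 S \is a fin_num.
  rewrite ge0_fin_numE ?measure_ge0//; apply: (le_lt_trans _ (ltry ((2 * (H * D)) ^+ 2))); apply: (le_trans _ up).
  by apply: leb2_le => // w; rewrite /S /B /cbx /=; lra.
move: lo up; rewrite -(fineK fB) -(fineK fS); move: (fine (m2 B)) (fine (m2 S)) => X Y.
rewrite -EFinD -EFinM !lee_fin => lo up.
have e1 : X * (4 * H ^+ 4)^-1 <= (2 * (D / H / 2)) ^+ 2.
  rewrite ler_pdivrMr; last by rewrite mulr_gt0// exprn_gt0.
  apply: (le_trans up); rewrite le_eqVlt; apply/orP; left; apply/eqP; field.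
  by rewrite gt_eqF.
rewrite /theta mulrBl mul1r mulrC; lra.
Qed.

Lemma area_decayX x r n : 0 < r -> (m2 (Psi @^-1` cbx x (r / 2 ^+ n)) <= (theta H ^+ n)%:E * m2 (Psi @^-1` cbx x r))%E.
Proof.
move=> r0; elim: n => [|n ih]; first by rewrite !expr0 divr1 mul1e.
have -> : r / 2 ^+ n.+1 = r / 2 ^+ n / 2 by rewrite exprS; field; rewrite expf_neq0.
apply: (le_trans (area_decay x _)); first by rewrite divr_gt0// exprn_gt0.
rewrite exprS EFinM -muleA; apply: lee_wpmul2l => //; rewrite lee_fin; exact: theta_ge0.
Qed.

(** If the preimage ratio exceeded [2^n], the square about [a] through [c] would lie [n] halvings
    below the one through [b]. Area decay makes its image small, yet that image contains a square of
    side [|A - C| / H]. The number 256 is [4 * 8^2], with the 8 of [qs]. *)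
Lemma qs_inv (n : nat) : 256 * H ^+ 4 * theta H ^+ n < 1 -> qs (2 ^+ n) Psi.
Proof.
move=> hn A B C hAB; rewrite leNgt; apply/negP => big.
set a := Psi A in big; set b := Psi B in big; set c := Psi C in big.
have eA : Phi a = A by exact: K'. 
have eB : Phi b = B by exact: K'. 
have eC : Phi c = C by exact: K'. 
pose r := `|b - a|.
have r0 : 0 < r by rewrite /r distrC; apply: le_lt_trans big; rewrite mulr_ge0// exprn_ge0.
have AC : 0 < `|A - C|.
  rewrite lt_def normr_ge0 andbT; apply/eqP => z.
  have : `|A - B| <= 0 by rewrite z mulr0 in hAB.
  rewrite normr_le0 subr_eq0 => /eqP e; move: r0; rewrite /r /a /b e subrr normr0; lra.
have u := @area_upper a r b ltac:(by rewrite /r; have := normr_ge0 (b - a); lra).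
have d := area_decayX a n r0.
have l := @area_lower a (r / 2 ^+ n) c ltac:(by rewrite ler_pdivlMr ?exprn_gt0// mulrC ltW// /r (distrC b) (distrC c)).
have := le_trans l (le_trans d (lee_wpmul2l _ u)); rewrite lee_fin exprn_ge0 ?(theta_ge0 H1)// => /(_ isT).
rewrite -EFinM lee_fin eA eB eC (distrC C) (distrC B) expr_div_n ler_pdivrMr ?exprn_gt0// => h.
have AB2 : `|A - B| ^+ 2 <= 64 * `|A - C| ^+ 2.
  by have -> : 64 * `|A - C| ^+ 2 = (8 * `|A - C|) ^+ 2 by [ring]; apply: lerXn2r => //; rewrite nnegrE ?mulr_ge0.
have h2 : `|A - C| ^+ 2 <= `|A - C| ^+ 2 * (256 * H ^+ 4 * theta H ^+ n).
  apply: (le_trans h).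
  have -> : theta H ^+ n * (2 * (H * `|A - B|)) ^+ 2 * H ^+ 2 = (4 * H ^+ 4 * theta H ^+ n) * `|A - B| ^+ 2 by ring.
  have -> : `|A - C| ^+ 2 * (256 * H ^+ 4 * theta H ^+ n) = (4 * H ^+ 4 * theta H ^+ n) * (64 * `|A - C| ^+ 2) by ring.
  by apply: ler_wpM2l => //; rewrite !mulr_ge0 ?exprn_ge0 ?(theta_ge0 H1)// ltW.
rewrite -{1}[`|A - C| ^+ 2]mulr1 ler_pM2l ?exprn_gt0// in h2; lra.
Qed.

Lemma exp_small (t e : R) : 0 <= t -> t < 1 -> 0 < e -> exists n : nat, t ^+ n < e.
Proof.
move=> t0 t1 e0; have : `|t| < 1 by rewrite ger0_norm.
move/cvg_expr => /cvgrPdist_lt /(_ e e0) [n _ hn]; exists n.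
by have := hn n (leqnn n); rewrite /= sub0r normrN; apply: le_lt_trans; exact: ler_norm.
Qed.

End homeo.

Lemma qs_inv_ex H : 1 <= H -> exists2 H', 1 <= H' & forall Phi Psi, cancel Phi Psi -> cancel Psi Phi -> continuous Psi ->
  qs H Phi -> qs H' Psi.
Proof.
move=> H1; have H0 : 0 < H by lra.
have P : 0 < 256 * H ^+ 4 by have := exprn_gt0 4 H0; lra.
have [n hn] := @exp_small (theta H) (256 * H ^+ 4)^-1 (theta_ge0 H1) (theta_lt1 H1) ltac:(by rewrite invr_gt0).
exists (2 ^+ n); first by apply: exprn_ege1; lra.
move=> Phi Psi K K' cPsi hq; apply: (qs_inv H1 K K' cPsi hq).
by rewrite mulrC -ltr_pdivlMr ?mul1r.
Qed.

Lemma qs_le H H' F : H <= H' -> qs H F -> qs H' F.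
Proof. by move=> h hF a b c /hF; move/le_trans; apply; exact: ler_wpM2r. Qed.

Lemma qcnorm_qs (Q : R) : 0 <= Q -> exists2 H, 1 <= H & forall M E phi psi fx fy gx gy,
  qcnorm Q M E phi psi fx fy gx gy -> qs H phi /\ qs H psi.
Proof.
move=> Q0; pose n := (Num.truncn (256 * (4 * (8 * Q * 48)))).+1.
have hn : 256 * (4 * (8 * Q * 48)) < n%:R by exact: truncnS_gt.
pose H := (1 + 2 ^+ n) ^+ 32 : R.
have H1 : 1 <= H by apply: exprn_ege1; rewrite lerDl exprn_ge0.
have [H' H'1 hH'] := qs_inv_ex H1.
exists (Num.max H H'); first by rewrite le_max H1.
move=> M E phi psi fx fy gx gy hN.
have q : qs H phi.
  apply: qs_chain; first exact: exprn_ge0.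
  move=> a b c hab; rewrite mulrC; exact: (qs_half hN hn hab).
have K := qn_H hN; split; first by apply: qs_le q; rewrite le_max lexx.
apply: (@qs_le H'); first by rewrite le_max lexx orbT.
apply: hH' q; [exact: (qc_K K)|exact: (qc_K' K)|exact: (qc_c' K)].
Qed.

End abstract_quasisymmetry.

(** * The Cauchy kernel, its C^1 regularization and weak holomorphy *)

Section kernel_dbar.
Variable R : realType.
Implicit Types (e r s d t h : R) (x y z w : Pt R).

(* 1/t, continued below e by its tangent at e *)
Definition rk e t : R := (Num.max t e)^-1 + (Num.max t e - t) / e ^+ 2.
Definition drk e t : R := - ((Num.max t e) ^+ 2)^-1.

(** The remainder is at most [h^2 / e^3], since half the second derivative of [1/t] is at most
    [1/e^3] for [t >= e] and the continuation is affine. The four cases record the sides of [e] on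
    which the two points lie. *)
Lemma rkE e t : 0 < e -> is_derive t 1 (rk e) (drk e t).
Proof.
move=> e0; apply: (@is_derive_quad _ _ _ _ (e ^+ 3)^-1) => h; rewrite /rk /drk.
have e3 : 0 < e ^+ 3 by exact: exprn_gt0.
have [s es] : exists s, s = t + h by exists (t + h).
rewrite -es; have -> : h = s - t by rewrite es addrC addKr.
clear es.
case: (leP t e) => te; case: (leP s e) => se.
- rewrite (_ : _ - _ - _ = 0) ?normr0; last by field; rewrite gt_eqF.
  by rewrite mulr_ge0 ?sqr_ge0// invr_ge0 ltW.
- have s0 : 0 < s by lra.
  have -> : s^-1 + (s - s) / e ^+ 2 - (e^-1 + (e - t) / e ^+ 2) - - (e ^+ 2)^-1 * (s - t) = (s - e) ^+ 2 * (s * e ^+ 2)^-1.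
    by field; rewrite !gt_eqF.
  rewrite ger0_norm; last by rewrite mulr_ge0 ?sqr_ge0// invr_ge0 ltW// mulr_gt0// exprn_gt0.
  rewrite mulrC; apply: ler_pM; rewrite ?sqr_ge0 ?invr_ge0 ?mulr_ge0 ?exprn_ge0 ?(ltW s0) ?(ltW e0)//.
    rewrite lef_pV2 ?posrE// ?mulr_gt0 ?exprn_gt0// exprS; apply: ler_wpM2r; [by rewrite exprn_ge0 ?ltW|exact: ltW].
  by rewrite lerXn2r ?nnegrE; lra.
- have t0 : 0 < t by lra.
  have -> : e^-1 + (e - s) / e ^+ 2 - (t^-1 + (t - t) / e ^+ 2) - - (t ^+ 2)^-1 * (s - t) =
     (e ^+ 3)^-1 * ((t - e) ^+ 2 * (e ^+ 2 / t ^+ 2) + (e - s) * (t - e) * ((t + e) * e / t ^+ 2)).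
    by field; rewrite !gt_eqF.
  have t2 : 0 < t ^+ 2 by exact: exprn_gt0.
  have k1 : 0 <= e ^+ 2 / t ^+ 2 <= 1.
    apply/andP; split; first by rewrite divr_ge0// exprn_ge0// ltW.
    by rewrite ler_pdivrMr// mul1r lerXn2r ?nnegrE; lra.
  have k2 : 0 <= (t + e) * e / t ^+ 2 <= 2.
    apply/andP; split; first by apply: divr_ge0; [apply: mulr_ge0; lra|exact: ltW].
    by rewrite ler_pdivrMr//; nra.
  have a1 : 0 <= t - e by lra.
  have a2 : 0 <= e - s by lra.
  have p : 0 <= (e - s) * (t - e) by exact: mulr_ge0.
  rewrite normrM ger0_norm ?invr_ge0 ?(ltW e3)//; apply: ler_wpM2l; first by rewrite invr_ge0 ltW.
  move: (e ^+ 2 / t ^+ 2) ((t + e) * e / t ^+ 2) k1 k2 => A B /andP[A0 A1] /andP[B0 B1].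
  have q : 0 <= (t - e) ^+ 2 by exact: sqr_ge0.
  by rewrite ger0_norm; nra.
- have s0 : 0 < s by lra.
  have t0 : 0 < t by lra.
  have -> : s^-1 + (s - s) / e ^+ 2 - (t^-1 + (t - t) / e ^+ 2) - - (t ^+ 2)^-1 * (s - t) = (s - t) ^+ 2 * (s * t ^+ 2)^-1.
    by field; rewrite !gt_eqF.
  rewrite ger0_norm; last by rewrite mulr_ge0 ?sqr_ge0// invr_ge0 ltW// mulr_gt0// exprn_gt0.
  rewrite mulrC; apply: ler_wpM2r; first exact: sqr_ge0.
  rewrite lef_pV2 ?posrE ?mulr_gt0 ?exprn_gt0// exprS; apply: ler_pM; rewrite ?exprn_ge0 ?(ltW e0) ?(ltW se)//.
  by rewrite lerXn2r ?nnegrE; lra.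
Qed.

Lemma drk_cont e : 0 < e -> continuous (drk e).
Proof.
move=> e0 t; rewrite /drk; apply: cvgN; apply: cvgV.
  by rewrite sqrf_eq0 gt_eqF// lt_max e0 orbT.
have c : continuous (fun t : R => Num.max t e) by move=> u; apply: continuous_max; [exact: cvg_id|exact: cvg_cst].
exact: (ctX (n := 2) c).
Qed.

Definition nsq y z : R := (z.1 - y.1) ^+ 2 + (z.2 - y.2) ^+ 2.

(* the real and imaginary parts of 1/(z - y); both are 0 at z = y *)
Definition ka y z : R := (z.1 - y.1) / nsq y z.
Definition kb y z : R := - ((z.2 - y.2) / nsq y z).

Definition ke1 e y z : R := (z.1 - y.1) * rk e (nsq y z).
Definition ke2 e y z : R := - (z.2 - y.2) * rk e (nsq y z).
Definition ke11 e y z : R := rk e (nsq y z) + (z.1 - y.1) * (drk e (nsq y z) * (2 * (z.1 - y.1))).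
Definition ke12 e y z : R := (z.1 - y.1) * (drk e (nsq y z) * (2 * (z.2 - y.2))).
Definition ke21 e y z : R := - (z.2 - y.2) * (drk e (nsq y z) * (2 * (z.1 - y.1))).
Definition ke22 e y z : R := - rk e (nsq y z) - (z.2 - y.2) * (drk e (nsq y z) * (2 * (z.2 - y.2))).

Lemma nsq_C1 y : C1 (nsq y) (fun z => 2 * (z.1 - y.1)) (fun z => 2 * (z.2 - y.2)).
Proof.
have a := C1_B (C1_fst R) (C1_cst y.1); have b := C1_B (C1_snd R) (C1_cst y.2).
by apply: (C1_eq (C1_D (C1_M a a) (C1_M b b))) => z; ring.
Qed.

Lemma ke_C1 e y : 0 < e -> C1 (ke1 e y) (ke11 e y) (ke12 e y) /\ C1 (ke2 e y) (ke21 e y) (ke22 e y).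
Proof.
move=> e0; have a := C1_B (C1_fst R) (C1_cst y.1); have b := C1_B (C1_snd R) (C1_cst y.2).
have c := C1_comp1 (fun t => rkE t e0) (drk_cont e0) (nsq_C1 y).
split; first by apply: (C1_eq (C1_M a c)) => z; rewrite /ke11 /ke12; ring.
have h := C1_Z (-1) (C1_M b c).
have -> : ke2 e y = (fun z => -1 * ((z.2 - y.2) * rk e (nsq y z))) by apply/funext => z; rewrite /ke2; ring.
by apply: (C1_eq h) => z; rewrite /ke21 /ke22; ring.
Qed.

Lemma ke_far e y z : 0 < e -> e <= nsq y z ->
  [/\ ke1 e y z = ka y z, ke2 e y z = kb y z, ke11 e y z = ke22 e y z & ke12 e y z = - ke21 e y z].
Proof.
move=> e0 h; have n0 : 0 < nsq y z by exact: lt_le_trans h.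
have r1 : rk e (nsq y z) = (nsq y z)^-1 by rewrite /rk (max_l h) subrr mul0r addr0.
have r2 : drk e (nsq y z) = - (nsq y z ^+ 2)^-1 by rewrite /drk (max_l h).
split; rewrite /ke1 /ke2 /ke11 /ke22 /ke12 /ke21 /ka /kb ?r1 ?r2 ?mulNr//; last by ring.
rewrite /nsq in n0 *; field; by rewrite gt_eqF.
Qed.

Lemma nsq_ge y z d : 0 <= d -> d <= `|z - y| -> d ^+ 2 <= nsq y z.
Proof.
move=> d0 h; apply: (@le_trans _ _ (`|z - y| ^+ 2)); first by rewrite lerXn2r ?nnegrE.
rewrite prod_normE /= /nsq -[(z.1 - y.1) ^+ 2]real_normK ?num_real// -[(z.2 - y.2) ^+ 2]real_normK ?num_real//.
by case: (leP `|z.1 - y.1| `|z.2 - y.2|) => _; rewrite ?lerDl ?lerDr sqr_ge0.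
Qed.

Lemma pdv_zero_near b (f f' : Pt R -> R) z d : 0 < d -> pdv b f f' -> (forall w, `|w - z| < d -> f w = 0) -> f' z = 0.
Proof.
move=> d0 hf f0; have h := hf z.
apply: (deriv_unique h); apply: (is_derive_near d0 _ (dcst (crd b z) 0)) => t ht.
by apply: f0; rewrite prod_normE; case: (b) ht => /= ht; rewrite subrr normr0 gt_max d0 ht.
Qed.

(** The real part of [(a1 + i a2)/(Psi w - y)]; when [(a1, a2)] is the gradient of a real function
    [f], the numerator is twice its d-bar derivative. *)
Definition dbarint (Psi : Pt R -> Pt R) y (a1 a2 : Pt R -> R) w := ka y (Psi w) * a1 w - kb y (Psi w) * a2 w.

(* 1/(Psi w - y) is weakly holomorphic off Phi(E) *)
Definition dbar (Phi Psi : Pt R -> Pt R) (E : set (Pt R)) := forall y (f f1 f2 : Pt R -> R) d s, E y -> C1 f f1 f2 -> 0 < d -> 0 <= s ->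
  (forall w x, E x -> `|w - Phi x| < d -> f w = 0) -> (forall w, s <= `|w| -> f w = 0) ->
  exists r0, forall r, r0 <= r -> bint r (dbarint Psi y f1 f2) = 0.

(** When [Psi w] is near the pole [y], [w] is near [Phi y], where [f] and its gradient vanish.
    Elsewhere the regularized kernel with small [e] is the Cauchy kernel and satisfies the
    Cauchy-Riemann equations. *)
Lemma dbarint_reg (Phi Psi : Pt R -> Pt R) (E : set (Pt R)) y f f1 f2 d : cancel Psi Phi -> continuous Phi -> E y -> C1 f f1 f2 -> 0 < d ->
  (forall w x, E x -> `|w - Phi x| < d -> f w = 0) ->
  exists2 e, 0 < e & forall w, dbarint Psi y f1 f2 w = ke1 e y (Psi w) * f1 w - ke2 e y (Psi w) * f2 w /\
    (f w = 0 \/ (ke11 e y (Psi w) = ke22 e y (Psi w) /\ ke12 e y (Psi w) = - ke21 e y (Psi w))).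
Proof.
move=> K' cPhi Ey [cf c1 c2 p1 p2] d0 f0.
have [e1 e10 he1] : exists2 e, 0 < e & forall z, `|z - y| < e -> `|Phi z - Phi y| < d.
  have /cvgrPdist_lt /(_ d d0) := cPhi y.
  move=> /nbhs_normP [e /= e0 he]; exists e => // z hz; rewrite distrC.
  by apply: he; rewrite /= distrC.
exists (e1 ^+ 2) => [|w]; first exact: exprn_gt0.
have [near|far] := ltP `|Psi w - y| e1; last first.
  have [k1 k2 k3 k4] := @ke_far (e1 ^+ 2) y (Psi w) (exprn_gt0 _ e10) (nsq_ge (ltW e10) far).
  by rewrite /dbarint k1 k2; split => //; right.
have wd : `|w - Phi y| < d by have := he1 _ near; rewrite K'.
have dw : 0 < d - `|w - Phi y| by lra.
have z w' : `|w' - w| < d - `|w - Phi y| -> f w' = 0.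
  by move=> h; apply: (f0 _ y Ey); have := ler_distD w w' (Phi y); lra.
have z1 := pdv_zero_near dw p1 z; have z2 := pdv_zero_near dw p2 z.
by rewrite /dbarint z1 z2 !mulr0; split => //; left; exact: f0 Ey wd.
Qed.

Lemma C1_supp (f f1 f2 : Pt R -> R) s : C1 f f1 f2 -> (forall w, s <= `|w| -> f w = 0) -> forall w, s < `|w| -> f1 w = 0 /\ f2 w = 0.
Proof.
move=> [cf c1 c2 p1 p2] f0 w sw; have d0 : 0 < `|w| - s by lra.
have z w' : `|w' - w| < `|w| - s -> f w' = 0.
  by move=> h; apply: f0; have := ler_normD (w - w') w'; rewrite subrK distrC; lra.
by split; [exact: pdv_zero_near d0 p1 z|exact: pdv_zero_near d0 p2 z].
Qed.

End kernel_dbar.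

(** * Weak holomorphy of the Cauchy kernel composed with either map *)

Section dbar_qc.
Variables (R : realType) (Q M : R) (E : set (Pt R)) (phi psi : Pt R -> Pt R) (fx fy gx gy : Pt R -> R).
Hypothesis HN : qcnorm Q M E phi psi fx fy gx gy.
Local Notation H := (qn_H HN).
Local Notation J := (Jac fx fy gx gy).
Implicit Types (r s d : R) (x y z w : Pt R).

(** The kernel is composed with [phi], which has weak derivatives: parts are integrated for the
    mollifications and the limit is taken. In the limit the integrand vanishes pointwise: on [E]
    because [f] does, off [E] by the Cauchy-Riemann equations of the kernel and of [phi]. *)
Lemma dbar_psi : dbar psi phi (phi @` E).
Proof.
move=> y f f1 f2 d s Ey hf d0 s0 f0 fs.
have [e e0 he] := dbarint_reg (qc_K H) (qc_c' H) Ey hf d0 f0.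
have [hk1 hk2] := ke_C1 y e0.
have [ck1 ck11 ck12 pk11 pk12] := hk1; have [ck2 ck21 ck22 pk21 pk22] := hk2.
have [cf cf1 cf2 pf1 pf2] := hf.
exists (s + 1) => r hr.
have sr : 0 <= s < r by lra.
have [u [u1 [u2 [u12 [v [v1 [v2 [v12 [hu hv su sv]]]]]]]]] := smoothings H.
have [lu lu1 lu2] := smoothing_Lim r (phi1_cont H) (qc_fx H) (qc_fy H) su.
have [lv lv1 lv2] := smoothing_Lim r (phi2_cont H) (qc_gx H) (qc_gy H) sv.
have lf := LimU_cst r cf; have lf1 := LimU_cst r cf1; have lf2 := LimU_cst r cf2.
have f0' w : ~ bx s w -> f w = 0 by rewrite /bx /= => /negP; rewrite -ltNge => h; apply: fs; exact: ltW.
have L1' := Lim2_cst (L2_cont r (@ct_cst _ _ (1 : R))).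
have TL := tendsB (lim_wA (LimUM lf1 (LimU_comp2 ck1 lu lv)) L1') (lim_wA (LimUM lf2 (LimU_comp2 ck2 lu lv)) L1').
have TR := tendsB (tendsD (lim_wA (LimUM lf (LimU_comp2 ck21 lu lv)) lu2) (lim_wA (LimUM lf (LimU_comp2 ck22 lu lv)) lv2))
  (tendsD (lim_wA (LimUM lf (LimU_comp2 ck11 lu lv)) lu1) (lim_wA (LimUM lf (LimU_comp2 ck12 lu lv)) lv1)).
have [h1 h2 h3 h4] := qc_L2 H r.
have L1c (w' A : Pt R -> R) : continuous w' -> L2 r A -> L1 r (fun z => w' z * A z).
  by move=> cw hA; apply: L1Mc => //; exact: L2_L1 hA.
have cphi (F : Pt R -> R) : continuous F -> continuous (fun w : Pt R => F ((phi w).1, (phi w).2)).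
  by move=> cF; apply: (ct_comp2 cF); apply: ct_pair; [exact: phi1_cont H|exact: phi2_cont H].
have cM (F G : Pt R -> R) : continuous F -> continuous G -> continuous (fun w : Pt R => F w * G ((phi w).1, (phi w).2)).
  by move=> cF cG; apply: ctM => //; exact: cphi.
have e1 : bint r (dbarint phi y f1 f2) = bint r (fun z => f1 z * ke1 e y ((phi z).1, (phi z).2) * 1) - bint r (fun z => f2 z * ke2 e y ((phi z).1, (phi z).2) * 1).
  rewrite -bintB; [|by apply: L1c; [exact: cM|exact: L2_cont (@ct_cst _ _ _)]|by apply: L1c; [exact: cM|exact: L2_cont (@ct_cst _ _ _)]].
  by apply: eq_bint => z _; have [-> _] := he z; rewrite -surjective_pairing; ring.
have e2 : bint r (fun z => f z * ke21 e y ((phi z).1, (phi z).2) * fy z) + bint r (fun z => f z * ke22 e y ((phi z).1, (phi z).2) * gy z) -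
   (bint r (fun z => f z * ke11 e y ((phi z).1, (phi z).2) * fx z) + bint r (fun z => f z * ke12 e y ((phi z).1, (phi z).2) * gx z)) = 0.
  have La := L1c _ _ (cM _ _ cf ck21) h2; have Lb := L1c _ _ (cM _ _ cf ck22) h4.
  have Lc := L1c _ _ (cM _ _ cf ck11) h1; have Ld := L1c _ _ (cM _ _ cf ck12) h3.
  rewrite -!bintD// -bintB; [|exact: L1D|exact: L1D].
  rewrite (eq_bint (g := fun=> 0)) => [|z _]; first by rewrite /bint /Rintegral integral0.
  have [_ [->|[k1 k2]]] := he z; first by rewrite !mul0r; ring.
  have [Ez|nEz] := pselect (E z).
    have -> : f z = 0 by apply: (f0 z (phi z)); [exists z|rewrite (qc_K H) subrr normr0].
    by rewrite !mul0r; ring.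
  have [c1 c2] := qn_CR HN nEz.
  by rewrite -surjective_pairing k1 k2 c1 c2; ring.
rewrite e1; rewrite -[RHS]e2; apply/eqP; rewrite -subr_eq0; apply/eqP.
apply: (tends_cst_eq (tendsB TL TR)); exists 0%N => k _.
have [Cu _ _ _] := hu k; have [Cv _ _ _] := hv k.
have [_ cu1 cu2 _ _] := Cu; have [_ cv1 cv2 _ _] := Cv.
have [ca ca1 ca2 pa1 pa2] := C1_chain hk1 Cu Cv; have [cb cb1 cb2 pb1 pb2] := C1_chain hk2 Cu Cv.
have i1 := bint_ibp sr pf1 pa1 cf ca cf1 ca1 f0'.
have i2 := bint_ibp sr pf2 pb2 cf cb cf2 cb2 f0'.
under eq_bint do rewrite mulr1.
rewrite [X in _ - X - _](eq_bint (g := fun z => f2 z * ke2 e y (u k z, v k z))) => [|z _]; last by rewrite mulr1.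
rewrite i1 i2.
have cK (F : Pt R -> R) : continuous F -> continuous (fun z => F (u k z, v k z)).
  by move=> cF; apply: (ct_comp2 cF); apply: ct_pair; [case: Cu|case: Cv].
have LL (F A : Pt R -> R) : continuous F -> continuous A -> L1 r (fun z => f z * F (u k z, v k z) * A z).
  by move=> cF cA; apply: L1_cont; apply: ctM => //; apply: ctM => //; exact: cK.
rewrite -!bintD; try exact: LL.
have s1 : bint r (fun z => f z * (ke11 e y (u k z, v k z) * u1 k z + ke12 e y (u k z, v k z) * v1 k z)) =
  bint r (fun z => f z * ke11 e y (u k z, v k z) * u1 k z + f z * ke12 e y (u k z, v k z) * v1 k z).
  by apply: eq_bint => z _; ring.
have s2 : bint r (fun z => f z * (ke21 e y (u k z, v k z) * u2 k z + ke22 e y (u k z, v k z) * v2 k z)) =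
  bint r (fun z => f z * ke21 e y (u k z, v k z) * u2 k z + f z * ke22 e y (u k z, v k z) * v2 k z).
  by apply: eq_bint => z _; ring.
rewrite s1 s2; ring.
Qed.

Lemma bint_pdv_bd b r (f f' : Pt R -> R) : 0 <= r -> pdv b f f' -> continuous f' -> (forall z, `|z| = r -> f z = 0) -> bint r f' = 0.
Proof.
move=> r0 h cf f0; have rr : -r <= r by lra.
have nz (x y' : R) : `|x| = r -> -r <= y' <= r -> f (x, y') = 0 /\ f (y', x) = 0.
  move=> hx hy; have hy' : `|y'| <= r by rewrite ler_norml.
  by split; apply: f0; rewrite prod_normE /= hx; [apply: max_l|apply: max_r].
have n1 : `|r| = r by rewrite ger0_norm.
have n2 : `|- r| = r by rewrite normrN.
case: b h => h.
  rewrite (bint_dx r0 h cf) (eq_lint (g := fun=> 0)) ?lint_cst ?mul0r// => y' hy.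
  by rewrite (nz r y' n1 hy).1 (nz (-r) y' n2 hy).1 subrr.
rewrite (bint_dy r0 h cf) (eq_lint (g := fun=> 0)) ?lint_cst ?mul0r// => y' hy.
by rewrite (nz r y' n1 hy).2 (nz (-r) y' n2 hy).2 subrr.
Qed.

Lemma bint_comb r (a1 a2 a3 a4 a5 a6 a7 a8 p1 p2 p3 p4 : Pt R -> R) :
  continuous a1 -> continuous a2 -> continuous a3 -> continuous a4 ->
  continuous a5 -> continuous a6 -> continuous a7 -> continuous a8 ->
  continuous p1 -> continuous p2 -> continuous p3 -> continuous p4 ->
  (forall z, a1 z - a2 z - (a3 z - a4 z) - (a5 z - a6 z - (a7 z - a8 z)) = p1 z - p2 z - (p3 z - p4 z)) ->
  bint r a1 - bint r a2 - (bint r a3 - bint r a4) - (bint r a5 - bint r a6 - (bint r a7 - bint r a8)) =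
  bint r p1 - bint r p2 - (bint r p3 - bint r p4).
Proof.
do 12! move=> /(L1_cont r) ?; move=> e.
by rewrite -!bintB; try (by do ?[assumption|apply: L1B]); apply: eq_bint => z _; exact: e.
Qed.

(** The kernel is composed with [psi], for which no weak derivatives are at hand. The integral is
    pulled back by [phi], where the kernel no longer contains a map and the Jacobian appears; the
    pulled-back integrand is a divergence plus terms annihilated by the Cauchy-Riemann equations. *)
Lemma dbar_phi : dbar phi psi E.
Proof.
move=> y f f1 f2 d s Ey hf d0 s0 f0 fs.
have [e e0 he] := dbarint_reg (qc_K' H) (qc_c H) Ey hf d0 f0.
have [hk1 hk2] := ke_C1 y e0.
have [ck1 ck11 ck12 pk11 pk12] := hk1; have [ck2 ck21 ck22 pk21 pk22] := hk2.
have [cf cf1 cf2 pf1 pf2] := hf.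
have fs12 := C1_supp hf fs.
have M0 := qc_M0 H.
exists (s + 1 + M + 1) => r hr.
have r0 : 0 <= r by lra.
pose h := dbarint psi y f1 f2.
have hE w : h w = ke1 e y (psi w) * f1 w - ke2 e y (psi w) * f2 w by have [] := he w.
have h_out w : s < `|w| -> h w = 0 by move=> sw; have [z1 z2] := fs12 w sw; rewrite hE z1 z2; ring.
have ch : continuous h.
  rewrite (funext hE); apply: ctB; apply: ctM => //.
    exact: (ct_comp2 ck1 (qc_c' H)).
  exact: (ct_comp2 ck2 (qc_c' H)).
have [m m0 hm'] := cont_bounded_bx (s + 1) ch.
have hm w : `|h w| <= m.
  have [hw|hw] := leP `|w| (s + 1); first exact: hm'.
  by rewrite h_out ?normr0 ?ltW//; lra.
have mh : measT h by exact: measurable_cont2.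
have s10 : 0 <= s + 1 by lra.
have cv := cov H s10 (hr : s + 1 + M + 1 <= r) mh hm.
have ih w : \1_(ob (s + 1)) w * h w = h w.
  have [hw|hw] := leP `|w| s; last by rewrite h_out ?mulr0.
  rewrite indicE mem_set ?mul1r//.
  have : `|w| < s + 1 by lra.
  by rewrite prod_normE gt_max => /andP[]; rewrite !ltr_norml => b1 b2; split; rewrite /= in_itv.
have -> : bint r (dbarint psi y f1 f2) = bint (s + 1) h.
  apply: bint_support; [lra|exact: L1_cont|].
  by move=> z; rewrite /bx /= => /negP; rewrite -ltNge => hz; apply: h_out; lra.
rewrite -[LHS](eq_bint (fun z _ => ih z)) -cv.
have [u [u1 [u2 [u12 [v [v1 [v2 [v12 [hu hv su sv]]]]]]]]] := smoothings H.
have [lu lu1 lu2] := smoothing_Lim r (phi1_cont H) (qc_fx H) (qc_fy H) su.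
have [lv lv1 lv2] := smoothing_Lim r (phi2_cont H) (qc_gx H) (qc_gy H) sv.
have lk1 := LimU_cst r ck1; have lk2 := LimU_cst r ck2.
have lk11 := LimU_cst r ck11; have lk12 := LimU_cst r ck12; have lk21 := LimU_cst r ck21; have lk22 := LimU_cst r ck22.
have lf := LimU_comp2 cf lu lv; have lf1 := LimU_comp2 cf1 lu lv; have lf2 := LimU_comp2 cf2 lu lv.
have TL := tendsB (tendsB (lim_wAB (LimUM lk1 lf1) lu1 lv2) (lim_wAB (LimUM lk1 lf1) lu2 lv1))
  (tendsB (lim_wAB (LimUM lk2 lf2) lu1 lv2) (lim_wAB (LimUM lk2 lf2) lu2 lv1)).
have TR := tendsB (tendsB (lim_wA (LimUM lf lk22) lu1) (lim_wA (LimUM lf lk21) lu2))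
  (tendsB (lim_wA (LimUM lf lk11) lv2) (lim_wA (LimUM lf lk12) lv1)).
have [h1 h2 h3 h4] := qc_L2 H r.
have L1c (w' A : Pt R -> R) : continuous w' -> L2 r A -> L1 r (fun z => w' z * A z).
  by move=> cw hA; apply: L1Mc => //; exact: L2_L1 hA.
have cphi (F : Pt R -> R) : continuous F -> continuous (fun w : Pt R => F ((phi w).1, (phi w).2)).
  by move=> cF; apply: (ct_comp2 cF); apply: ct_pair; [exact: phi1_cont H|exact: phi2_cont H].
have cM (F G : Pt R -> R) : continuous F -> continuous G -> continuous (fun w : Pt R => F ((phi w).1, (phi w).2) * G w).
  by move=> cF cG; apply: ctM => //; exact: cphi.
have cM' (F G : Pt R -> R) : continuous F -> continuous G -> continuous (fun w : Pt R => G w * F ((phi w).1, (phi w).2)).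
  by move=> cF cG; apply: ctM => //; exact: cphi.
set l1 := (X in tends _ X) in TL; set l2 := (X in tends _ X) in TR.
have eL : bint r (fun x => \1_(ob (s + 1)) (phi x) * h (phi x) * J x) = l1.
  have A1 := L1M3 (cM' _ _ cf1 ck1) h1 h4; have A2 := L1M3 (cM' _ _ cf1 ck1) h2 h3.
  have A3 := L1M3 (cM' _ _ cf2 ck2) h1 h4; have A4 := L1M3 (cM' _ _ cf2 ck2) h2 h3.
  rewrite /l1 -!bintB//; [|exact: L1B|exact: L1B].
  by apply: eq_bint => z _; rewrite ih hE (qc_K H) -surjective_pairing /Jac; ring.
have eR : l2 = 0.
  have A1 := L1c _ _ (cM _ _ cf ck22) h1; have A2 := L1c _ _ (cM _ _ cf ck21) h2.
  have A3 := L1c _ _ (cM _ _ cf ck11) h4; have A4 := L1c _ _ (cM _ _ cf ck12) h3.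
  rewrite /l2 -!bintB//; [|exact: L1B|exact: L1B].
  rewrite (eq_bint (g := fun=> 0)) => [|z _]; first by rewrite /bint /Rintegral integral0.
  have [_ ] := he (phi z); rewrite (qc_K H) -surjective_pairing => -[->|[k1 k2]]; first by ring.
  have [Ez|nEz] := pselect (E z).
    have -> : f (phi z) = 0 by apply: (f0 _ z) => //; rewrite subrr normr0.
    by ring.
  have [c1 c2] := qn_CR HN nEz.
  by rewrite k1 k2 c1 c2; ring.
rewrite eL -[RHS]eR; apply/eqP; rewrite -subr_eq0; apply/eqP.
apply: (tends_cst_eq (tendsB TL TR)).
have [N1 hN1] := sm_U su r ltr01; have [N2' hN2] := sm_U sv r ltr01.
exists (maxn N1 N2') => k; rewrite geq_max => /andP[kN1 kN2].
have [Cu pu12 pu21 cu12] := hu k; have [Cv pv12 pv21 cv12] := hv k.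
have [cu cu1 cu2 pu1 pu2] := Cu; have [cv0 cv1 cv2 pv1 pv2] := Cv.
have [ct ct1 ct2 pt1 pt2] := C1_chain hf Cu Cv.
have bd z : `|z| = r -> f (u k z, v k z) = 0.
  move=> zr; have bz : bx r z by rewrite /bx /= zr.
  have g1 := hN1 k z kN1 bz; have g2 := hN2 k z kN2 bz; have hM := qc_M H z.
  have g3 : `|(u k z, v k z) - phi z| <= 1 by exact: norm_pair_le.
  apply: fs; move: (u k z, v k z) g3 => p g3.
  have := ler_distD (phi z) z p; have := ler_normD (z - p) p; rewrite subrK (distrC z (phi z)) (distrC (phi z) p) zr; lra.
have cf1k : continuous (fun z => f1 (u k z, v k z)) by apply: (ct_comp2 cf1); exact: ct_pair.
have cf2k : continuous (fun z => f2 (u k z, v k z)) by apply: (ct_comp2 cf2); exact: ct_pair.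
have bdk (g h' : Pt R -> R) z : `|z| = r -> g z * (f (u k z, v k z) * h' z) = 0.
  by move=> /bd ->; rewrite mul0r mulr0.
(* The four total derivatives, such as [d_x(k f v_y)], integrate to 0 because [f (u, v)] vanishes on
   the boundary of the square; in their combination the mixed derivatives cancel. *)
have b1 := bint_pdv_bd r0 (pdvM pk11 (pdvM pt1 pv21)) _ (bdk _ _).
have b2 := bint_pdv_bd r0 (pdvM pk12 (pdvM pt2 pv12)) _ (bdk _ _).
have b3 := bint_pdv_bd r0 (pdvM pk22 (pdvM pt2 pu12)) _ (bdk _ _).
have b4 := bint_pdv_bd r0 (pdvM pk21 (pdvM pt1 pu21)) _ (bdk _ _).
have cP1 := ctD (ctM ck11 (ctM ct cv2)) (ctM ck1 (ctD (ctM ct1 cv2) (ctM ct cv12))).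
have cP2 := ctD (ctM ck12 (ctM ct cv1)) (ctM ck1 (ctD (ctM ct2 cv1) (ctM ct cv12))).
have cP3 := ctD (ctM ck22 (ctM ct cu1)) (ctM ck2 (ctD (ctM ct2 cu1) (ctM ct cu12))).
have cP4 := ctD (ctM ck21 (ctM ct cu2)) (ctM ck2 (ctD (ctM ct1 cu2) (ctM ct cu12))).
have := bint_comb r (ctM (ctM ck1 cf1k) (ctM cu1 cv2)) (ctM (ctM ck1 cf1k) (ctM cu2 cv1))
  (ctM (ctM ck2 cf2k) (ctM cu1 cv2)) (ctM (ctM ck2 cf2k) (ctM cu2 cv1))
  (ctM (ctM ct ck22) cu1) (ctM (ctM ct ck21) cu2) (ctM (ctM ct ck11) cv2) (ctM (ctM ct ck12) cv1) cP1 cP2 cP3 cP4.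
rewrite (b1 cP1) (b2 cP2) (b3 cP3) (b4 cP4) !subrr; apply => z; ring.
Qed.

End dbar_qc.

(** * Recovering a cutoff from its d-bar derivative *)

Section pairing.
Variable R : realType.
Implicit Types (r s d t : R) (x y z w : Pt R).

Lemma dplat_sign (t x : R) : 0 < t -> x * dplat (0 - 2 * t) (0 + 2 * t) t^-1 x <= 0.
Proof.
move=> t0; have ti : 0 < t^-1 by rewrite invr_gt0.
have tt : t^-1 * t = 1 by rewrite mulVf// gt_eqF.
have d0 (u : R) : 0 <= dstp u by case/andP: (dstp_bd u).
rewrite /dplat; case: (lerP 0 x) => x0.
  rewrite (@dstp_out _ (t^-1 * (x - (0 - 2 * t)))); last by right; rewrite sub0r opprK mulrDr mulrCA tt; have := mulr_ge0 (ltW ti) x0; lra.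
  rewrite mul0r sub0r mulrN mulrN oppr_le0; do 2! (apply: mulr_ge0; [assumption || exact: ltW|]).
  by apply: mulr_ge0; [exact: stp_ge0|exact: d0].
rewrite (@dstp_out _ (t^-1 * (0 + 2 * t - x))); last by right; rewrite add0r mulrBr mulrCA tt; have := mulr_gt0 ti (_ : 0 < - x); rewrite oppr_gt0 mulrN => /(_ x0); lra.
rewrite mulr0 subr0; apply: mulr_le0_ge0; first exact: ltW.
by apply: mulr_ge0; [exact: ltW|apply: mulr_ge0; [exact: d0|exact: stp_ge0]].
Qed.

Lemma sqc_sign t w : 0 < t -> w.1 * sqc1 0 t w + w.2 * sqc2 0 t w <= 0.
Proof.
move=> t0; have h1 := dplat_sign w.1 t0; have h2 := dplat_sign w.2 t0.
rewrite /sqc1 /sqc2 mulrA [X in _ + X]mulrCA -[leRHS]addr0; apply: lerD.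
  by apply: mulr_le0_ge0; [exact: h1|exact: plat_ge0].
by apply: mulr_ge0_le0; [exact: plat_ge0|exact: h2].
Qed.

(** By the divergence theorem the integral of [w . grad s] is [-2] times the integral of the cutoff
    [s], which equals 1 on a square of side [2t]. *)
Lemma sqc_flux t r : 0 < t -> 2 * t < r ->
  bint r (fun w => w.1 * sqc1 0 t w + w.2 * sqc2 0 t w) <= - 2 * (2 * t) ^+ 2.
Proof.
move=> t0 tr; have [cf c1 c2 p1 p2] := sqc_C1 (0 : Pt R) t.
have [_ _ _ q1 _] := C1_fst R; have [_ _ _ _ q2] := C1_snd R.
have z w : ~ bx (2 * t) w -> sqc 0 t w = 0.
  rewrite /bx /= => /negP; rewrite -ltNge => h.
  by have [|-> //] := @sqc_out _ 0 t w t0; rewrite subr0 ltW.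
have tr' : 0 <= 2 * t < r by lra.
have cx : continuous (fun w : Pt R => w.1) by exact: ct_fst.
have cy : continuous (fun w : Pt R => w.2) by exact: ct_snd.
have k1 : continuous (fun z : Pt R => 1 * sqc 0 t z + z.1 * sqc1 0 t z) by apply: ctD; apply: ctM => //; exact: ct_cst.
have k2 : continuous (fun z : Pt R => 1 * sqc 0 t z + z.2 * sqc2 0 t z) by apply: ctD; apply: ctM => //; exact: ct_cst.
have zz (g : Pt R -> R) w : ~ bx (2 * t) w -> g w * sqc 0 t w = 0 by move=> /z ->; rewrite mulr0.
have i1 := bint_pdv0 tr' (pdvM q1 p1) k1 (zz _).
have i2 := bint_pdv0 tr' (pdvM q2 p2) k2 (zz _).
have l0 := L1_cont r cf.
have l1 : L1 r (fun z => z.1 * sqc1 0 t z) by apply: L1_cont; exact: ctM.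
have l2 : L1 r (fun z => z.2 * sqc2 0 t z) by apply: L1_cont; exact: ctM.
have e1 : bint r (fun z => 1 * sqc 0 t z + z.1 * sqc1 0 t z) = bint r (sqc 0 t) + bint r (fun z => z.1 * sqc1 0 t z).
  by rewrite -bintD//; apply: eq_bint => w _; rewrite mul1r.
have e2 : bint r (fun z => 1 * sqc 0 t z + z.2 * sqc2 0 t z) = bint r (sqc 0 t) + bint r (fun z => z.2 * sqc2 0 t z).
  by rewrite -bintD//; apply: eq_bint => w _; rewrite mul1r.
rewrite bintD//.
have : (2 * t) ^+ 2 <= bint r (sqc 0 t).
  rewrite -[leLHS]mul1r -bint_cst; last exact: ltW.
  rewrite (eq_bint (g := sqc 0 t)) => [|w hw]; last first.
    by have [|-> //] := @sqc_in _ 0 t w t0; rewrite subr0.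
  by apply: le_bint_bx => //; [lra|move=> w; exact: sqc_ge0].
lra.
Qed.

(** The hypotheses of the one-sided capacity bound. They hold for [(phi, psi, E)] and for
    [(psi, phi, phi(E))] with the same [H] and [M], so one bound yields both inequalities of the
    theorem. *)
Record qsp (H M : R) (Phi Psi : Pt R -> Pt R) (E : set (Pt R)) : Prop := Qsp {
  qp_K : cancel Phi Psi; qp_K' : cancel Psi Phi; qp_c : continuous Phi; qp_c' : continuous Psi;
  qp_E : compact E; qp_M0 : 0 <= M; qp_M : forall z, `|Phi z - z| <= M; qp_M' : forall z, `|Psi z - z| <= M;
  qp_q : qs H Phi; qp_q' : qs H Psi; qp_dbar : dbar Phi Psi E }.

Lemma dbarint_cont (Phi Psi : Pt R -> Pt R) (E : set (Pt R)) y (f f1 f2 : Pt R -> R) d : cancel Psi Phi -> continuous Phi -> continuous Psi ->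
  E y -> C1 f f1 f2 -> 0 < d -> (forall w x, E x -> `|w - Phi x| < d -> f w = 1) -> continuous (dbarint Psi y f1 f2).
Proof.
move=> K' cP cS Ey hf d0 h.
have hf' : C1 (fun w => f w - 1) f1 f2 by apply: (C1_eq (C1_B hf (C1_cst 1))) => z; ring.
have h' w x : E x -> `|w - Phi x| < d -> f w - 1 = 0 by move=> Ex hw; rewrite (h w x)// subrr.
have [e e0 he] := dbarint_reg K' cP Ey hf' d0 h'.
have -> : dbarint Psi y f1 f2 = fun w => ke1 e y (Psi w) * f1 w - ke2 e y (Psi w) * f2 w.
  by apply/funext => w; case: (he w).
have [[c1 _ _ _ _] [c2 _ _ _ _]] := ke_C1 y e0; case: hf => _ cf1 cf2 _ _.
by apply: ctB; apply: ctM => //; [exact: (ct_comp2 c1 cS)|exact: (ct_comp2 c2 cS)].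
Qed.

Lemma bounded_compact (E : set (Pt R)) : compact E -> exists2 B, 0 <= B & forall x, E x -> `|x| <= B.
Proof.
move=> cE; have [B [_ hB]] := compact_bounded cE.
exists (`|B| + 1) => [|x Ex]; first by rewrite addr_ge0.
by apply: (hB (`|B| + 1)) => //; have := ler_norm B; lra.
Qed.

(** By [dbar] the integral is the same for every cutoff equal to 1 near [Phi(E)], so it is evaluated
    for a square cutoff at a huge scale [t]. There [Psi w - y] is nearly [w], and the integrand is
    nearly [w . grad s / |w|^2] with [|w|] the Euclidean length. Only an upper bound is needed, so
    no residue is computed. *)
Lemma pairing H M (Phi Psi : Pt R -> Pt R) (E : set (Pt R)) y (f f1 f2 : Pt R -> R) d s : qsp H M Phi Psi E -> E y -> C1 f f1 f2 -> 0 < d -> 0 <= s ->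
  (forall w x, E x -> `|w - Phi x| < d -> f w = 1) -> (forall w, s <= `|w| -> f w = 0) ->
  bint s (dbarint Psi y f1 f2) <= - (1 / 2).
Proof.
move=> hq Ey hf d0 s0 f1' fs; have [K K' cP cS cE M0 hM hM' _ _ hd] := hq.
have [B B0 hB] := bounded_compact cE.
pose m := M + B; have m0 : 0 <= m by exact: addr_ge0.
(* For [t >= 512 m] the main term is at most [-(2t/(2t+m))^2 <= -3/4] and the error at most
   [1/4]. *)
pose t := s + d + 512 * (m + 1).
have t0 : 0 < t by rewrite /t; lra.
have tm : 512 * m <= t by rewrite /t; lra.
have hT := sqc_C1 (0 : Pt R) t; have [cT cT1 cT2 pT1 pT2] := hT.
have T1 w x : E x -> `|w - Phi x| < d -> sqc 0 t w = 1.
  move=> Ex hw; have [|-> //] := @sqc_in _ 0 t w t0.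
  rewrite subr0; have := ler_normD (w - Phi x) (Phi x); have := ler_normD (Phi x - x) x; rewrite !subrK.
  have := hM x; have := hB x Ex; rewrite /t /m; lra.
have Ts w : 2 * t <= `|w| -> [/\ sqc 0 t w = 0, sqc1 0 t w = 0 & sqc2 0 t w = 0].
  by move=> h; apply: sqc_out => //; rewrite subr0.
have cd := dbarint_cont K' cP cS Ey hf d0 f1'.
have cTd := dbarint_cont K' cP cS Ey hT d0 T1.
have t20 : 0 <= 2 * t by lra.
have z1 w x : E x -> `|w - Phi x| < d -> f w - sqc 0 t w = 0.
  by move=> Ex hw; rewrite (f1' w x Ex hw) (T1 w x Ex hw) subrr.
have z2 w : 2 * t <= `|w| -> f w - sqc 0 t w = 0.
  by move=> hw; have [-> _ _] := Ts w hw; rewrite fs ?subrr//; rewrite /t in hw; lra.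
have [r0 hr0] := hd y _ _ _ d (2 * t) Ey (C1_B hf hT) d0 t20 z1 z2.
clear z1 z2.
pose r := Num.max r0 (2 * t + 1).
have r1 : r0 <= r by rewrite le_max lexx.
have r2 : 2 * t + 1 <= r by rewrite le_max lexx orbT.
have := hr0 r r1.
have -> : bint r (dbarint Psi y (fun z => f1 z - sqc1 0 t z) (fun z => f2 z - sqc2 0 t z)) =
   bint r (dbarint Psi y f1 f2) - bint r (dbarint Psi y (sqc1 0 t) (sqc2 0 t)).
  by rewrite -bintB; [apply: eq_bint => w _; rewrite /dbarint; ring|exact: L1_cont|exact: L1_cont].
have fs12 := C1_supp hf fs.
have -> : bint r (dbarint Psi y f1 f2) = bint s (dbarint Psi y f1 f2).
  apply: bint_support; [rewrite /t in r2; lra|exact: L1_cont|].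
  move=> w; rewrite /bx /= => /negP; rewrite -ltNge => sw; have [z1 z2] := fs12 w sw.
  by rewrite /dbarint z1 z2; ring.
move/eqP; rewrite subr_eq0 => /eqP ->.
(* [c] is a lower bound for the inverse squared distance, which gives an upper bound for the
   integrand because [w . grad s <= 0]; [k] bounds the error of replacing [Psi w - y] by [w]. *)
pose c := (2 * (2 * t + m) ^+ 2)^-1; pose k := 4 * m / (t * (t - m) ^+ 2).
have tm0 : 0 < t - m by lra.
have c0 : 0 < c by rewrite invr_gt0 mulr_gt0// exprn_gt0//; lra.
have k0 : 0 <= k.
  by apply: divr_ge0; [exact: mulr_ge0|apply: mulr_ge0; [exact: ltW|exact: sqr_ge0]].
have [Li bi] := bint_indic_cbx r (0 : Pt R) t20.
have lw : L1 r (fun w : Pt R => w.1 * sqc1 0 t w + w.2 * sqc2 0 t w).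
  apply: L1_cont; apply: ctD; apply: ctM => //; [exact: ct_fst|exact: ct_snd].
have pt w : dbarint Psi y (sqc1 0 t) (sqc2 0 t) w <= c * (w.1 * sqc1 0 t w + w.2 * sqc2 0 t w) + k * \1_(cbx 0 (2 * t)) w.
  have kk : 0 <= k * \1_(cbx 0 (2 * t)) w by rewrite mulr_ge0// indicE.
  have [big|small] := leP (2 * t) `|w|.
    by have [_ e1 e2] := Ts w big; rewrite /dbarint e1 e2 !mulr0 subrr addr0 mulr0 add0r.
  have [in1|out1] := leP `|w| t.
    have [|_ e1 e2] := @sqc_in _ 0 t w t0; first by rewrite subr0.
    by rewrite /dbarint e1 e2 !mulr0 subrr addr0 mulr0 add0r.
  rewrite indicE mem_set ?mulr1; last by rewrite /cbx /= subr0 ltW.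
  set z := Psi w.
  have zw : `|(z - y) - w| <= m.
    rewrite addrAC; apply: (le_trans (ler_normB _ _)); apply: lerD; [exact: hM'|exact: hB].
  have z1 : t - m <= `|z - y|.
    by have := ler_distD (z - y) w 0; rewrite !subr0 (distrC w); lra.
  have z2 : `|z - y| <= 2 * t + m.
    by have := ler_distD w (z - y) 0; rewrite !subr0; lra.
  have N1 := nsq_ge (ltW tm0) z1.
  have N2' : nsq y z <= 2 * (2 * t + m) ^+ 2.
    rewrite /nsq; have a1 := le_trans (norm_fst (z - y)) z2; have a2 := le_trans (norm_snd (z - y)) z2.
    rewrite -[(z.1 - y.1) ^+ 2]real_normK ?num_real// -[(z.2 - y.2) ^+ 2]real_normK ?num_real//.
    have q1 : `|z.1 - y.1| ^+ 2 <= (2 * t + m) ^+ 2 by rewrite lerXn2r// nnegrE; lra.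
    have q2 : `|z.2 - y.2| ^+ 2 <= (2 * t + m) ^+ 2 by rewrite lerXn2r// nnegrE; lra.
    lra.
  have tm2 : 0 < (t - m) ^+ 2 by exact: exprn_gt0.
  have N0 : 0 < nsq y z by exact: lt_le_trans N1.
  have [b1 b2] := sqc_bd (0 : Pt R) w t0.
  have sg := sqc_sign w t0.
  set T1' := sqc1 0 t w in b1 sg *; set T2' := sqc2 0 t w in b2 sg *.
  have -> : dbarint Psi y (sqc1 0 t) (sqc2 0 t) w =
     (w.1 * T1' + w.2 * T2') / nsq y z + ((z.1 - y.1 - w.1) * T1' + (z.2 - y.2 - w.2) * T2') / nsq y z.
    by rewrite /dbarint /ka /kb -/z -/T1' -/T2'; ring.
  apply: lerD.
    rewrite mulrC; apply: ler_wnM2r => //; rewrite /c lef_pV2// posrE.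
    exact: lt_le_trans N2'.
  have u1 : (z.1 - y.1 - w.1) * T1' <= m * (2 * t^-1).
    apply: (le_trans (ler_norm _)); rewrite normrM; apply: ler_pM => //.
    exact: le_trans (norm_fst (z - y - w)) zw.
  have u2 : (z.2 - y.2 - w.2) * T2' <= m * (2 * t^-1).
    apply: (le_trans (ler_norm _)); rewrite normrM; apply: ler_pM => //.
    exact: le_trans (norm_snd (z - y - w)) zw.
  rewrite ler_pdivrMr//; apply: (le_trans (lerD u1 u2)).
  have -> : m * (2 / t) + m * (2 / t) = k * (t - m) ^+ 2 by rewrite /k; field; rewrite !gt_eqF.
  exact: ler_wpM2l.
apply: le_trans (le_bint (L1_cont r cTd) _ (fun w _ => pt w)) _.
  by apply: L1D; exact: L1Z.
rewrite bintD ?bintZ//; try exact: L1Z.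
have fl := sqc_flux t0 (_ : 2 * t < r); have {}fl := fl ltac:(lra).
have g1 : c * bint r (fun w => w.1 * sqc1 0 t w + w.2 * sqc2 0 t w) <= - (3 / 4).
  apply: (le_trans (ler_wpM2l (ltW c0) fl)).
  rewrite /c mulrC ler_pdivrMr; last by rewrite mulr_gt0// exprn_gt0//; lra.
  nra.
have g2 : k * bint r (\1_(cbx (0 : Pt R) (2 * t))) <= 1 / 4.
  apply: (le_trans (ler_wpM2l k0 bi)).
  have -> : k * (2 * (2 * t)) ^+ 2 = 64 * m * t / (t - m) ^+ 2 by rewrite /k; field; rewrite !gt_eqF.
  rewrite ler_pdivrMr ?exprn_gt0//; nra.
lra.
Qed.

Lemma qcnorm_qsp (Q : R) : 0 <= Q -> exists2 H, 1 <= H & forall M E phi psi fx fy gx gy,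
  qcnorm Q M E phi psi fx fy gx gy -> qsp H M phi psi E /\ qsp H M psi phi (phi @` E).
Proof.
move=> Q0; have [H H1 hH] := qcnorm_qs Q0; exists H => // M E phi psi fx fy gx gy hN.
have [q q'] := hH _ _ _ _ _ _ _ _ hN.
have K := qn_H hN.
have hM' z : `|psi z - z| <= M by have := qc_M K (psi z); rewrite (qc_K' K) distrC.
split; split; try exact: (qc_K K); try exact: (qc_K' K); try exact: (qc_c K); try exact: (qc_c' K);
  try exact: (qn_cpt hN); try exact: (qc_M0 K); try exact: (qc_M K); try exact: hM'; try assumption.
- exact: dbar_phi hN.
- apply: continuous_compact; last exact: (qn_cpt hN).
  by apply: continuous_subspaceT; exact: (qc_c K).
- exact: dbar_psi hN.
Qed.

End pairing.

(** * Power inequalities and geometric sums *)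

Section power_sums.
Variable R : realType.
Implicit Types (q x y A B C : R) (a u : nat -> R) (L m l n : nat).

Lemma powR_superadd q a L : 1 <= q -> (forall l, 0 <= a l) -> \sum_(l < L) (a l) `^ q <= (\sum_(l < L) a l) `^ q.
Proof.
move=> q1 a0; have q0 : 0 < q by lra.
elim: L => [|L ih]; first by rewrite !big_ord0 powR0// gt_eqF.
rewrite !big_ord_recr /=; set S := \sum_(l < L) a l in ih *.
have S0 : 0 <= S by apply: sumr_ge0 => i _.
apply: (le_trans (lerD ih (lexx _))).
rewrite -(mulr_powRB1 S0 q0) -(mulr_powRB1 (a0 L) q0) -(mulr_powRB1 (addr_ge0 S0 (a0 L)) q0) mulrDl.
have q10 : 0 <= q - 1 by lra.
apply: lerD; apply: ler_wpM2l => //; apply: ge0_ler_powR => //; rewrite ?nnegrE ?addr_ge0// ?lerDl ?lerDr//.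
Qed.

(** With [S] the weighted sum on the right, each single term gives [a l <= (S u l)^(1/q)]; summing
    over [l] proves the claim. This stands in for Hölder's inequality when the weights are
    geometric. *)
Lemma suptrick q a u L C : 0 < q -> (forall l, 0 <= a l) -> (forall l, 0 < u l) ->
  \sum_(l < L) (u l) `^ q^-1 <= C -> (\sum_(l < L) a l) `^ q <= C `^ q * \sum_(l < L) ((u l)^-1 * (a l) `^ q).
Proof.
move=> q0 a0 u0 hC; have qi : 0 < q^-1 by rewrite invr_gt0.
set S := \sum_(l < L) ((u l)^-1 * (a l) `^ q).
have t0 l : 0 <= (u l)^-1 * (a l) `^ q by rewrite mulr_ge0 ?invr_ge0 ?powR_ge0// ltW.
have S0 : 0 <= S by apply: sumr_ge0 => i _; exact: t0.
have al (l : 'I_L) : a l <= S `^ q^-1 * (u l) `^ q^-1.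
  have : (u l)^-1 * (a l) `^ q <= S.
    by rewrite /S (bigD1 l)//= lerDl sumr_ge0// => i _; exact: t0.
  rewrite mulrC ler_pdivrMr// => h.
  have := ge0_ler_powR (ltW qi) (powR_ge0 _ _ : _ \in Num.nneg) (mulr_ge0 S0 (ltW (u0 l)) : _ \in Num.nneg) h.
  by rewrite -powRrM mulfV ?gt_eqF// powRr1// powRM// ltW.
have h1 : \sum_(l < L) a l <= S `^ q^-1 * C.
  apply: (@le_trans _ _ (\sum_(l < L) (S `^ q^-1 * (u l) `^ q^-1))); first by apply: ler_sum.
  by rewrite -mulr_sumr; apply: ler_wpM2l => //; exact: powR_ge0.
have C0 : 0 <= C by apply: le_trans hC; apply: sumr_ge0 => i _; exact: powR_ge0.
have s0 : 0 <= \sum_(l < L) a l by apply: sumr_ge0.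
apply: (le_trans (ge0_ler_powR (ltW q0) (s0 : _ \in Num.nneg) (mulr_ge0 (powR_ge0 _ _) C0 : _ \in Num.nneg) h1)).
by rewrite powRM ?powR_ge0// -powRrM mulVf ?gt_eqF// powRr1// mulrC.
Qed.

Lemma geo_sum x L : 0 <= x -> x < 1 -> \sum_(l < L) x ^+ l <= (1 - x)^-1.
Proof.
move=> x0 x1; rewrite -[leRHS]mul1r ler_pdivlMr; last lra.
have -> : (\sum_(l < L) x ^+ l) * (1 - x) = 1 - x ^+ L.
  elim: L => [|L ih]; first by rewrite big_ord0 mul0r expr0 subrr.
  by rewrite big_ord_recr /= mulrDl ih exprS; ring.
by rewrite gerBl exprn_ge0.
Qed.

(** Truncated subtraction makes one of the two exponents 0, so the sum is one geometric series on
    each side of [m]. *)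
Lemma geo2 x y m L : 0 <= x -> x < 1 -> 0 <= y -> y < 1 ->
  \sum_(l < L) x ^+ (l - m) * y ^+ (m - l) <= (1 - x)^-1 + (1 - y)^-1.
Proof.
move=> x0 x1 y0 y1; have iy : 0 < 1 - y by lra.
have b m' : (1 - y ^+ m') / (1 - y) <= (1 - y)^-1.
  by rewrite -[leRHS]mul1r ler_pM2r ?invr_gt0// gerBl exprn_ge0.
apply: (@le_trans _ _ ((1 - x)^-1 + (1 - y ^+ m) / (1 - y))); last by rewrite lerD2l.
elim: m L => [|m ih] L.
  rewrite expr0 subrr mul0r addr0; apply: le_trans (geo_sum L x0 x1).
  by apply: ler_sum => l _; rewrite subn0 mulr1.
case: L => [|L].
  by rewrite big_ord0 addr_ge0 ?invr_ge0 ?divr_ge0 ?subr_ge0 ?exprn_ile1// ltW.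
rewrite big_ord_recl /= sub0n expr0 mul1r subn0.
under eq_bigr do rewrite /bump leq0n add1n !subSS.
have := ih L; set S := \sum_(l < L) _ => hS.
have e : (1 - y ^+ m.+1) / (1 - y) = (1 - y ^+ m) / (1 - y) + y ^+ m.
  by rewrite exprS; field; rewrite gt_eqF.
have : y ^+ m.+1 <= y ^+ m by rewrite exprS ler_piMl ?exprn_ge0// ltW.
rewrite e; lra.
Qed.

(** With ratio at least 2, the last admissible term dominates the sum of all earlier ones,
    admissible or not. *)
Lemma geo_top (P : pred nat) A B W L : 0 <= A -> 2 <= B -> 0 <= W -> (forall l, P l -> A * B ^+ l <= W) ->
  \sum_(l < L | P l) A * B ^+ l <= 2 * W.
Proof.
move=> A0 B2 W0 h; have B0 : 0 <= B by lra.
have full n : \sum_(l < n) A * B ^+ l <= 2 * (A * B ^+ n.-1).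
  case: n => [|n]; first by rewrite big_ord0 mulr_ge0// mulr_ge0// exprn_ge0.
  elim: n => [|n ih]; first by rewrite big_ord_recr big_ord0 /= add0r; have := mulr_ge0 A0 (exprn_ge0 0 B0); lra.
  rewrite big_ord_recr /=; rewrite /= in ih.
  have p : 0 <= A * B ^+ n by rewrite mulr_ge0// exprn_ge0.
  have e : A * B ^+ n.+1 = B * (A * B ^+ n) by rewrite exprS; ring.
  rewrite e; move: ih; move: (\sum_(i < n.+1) _) => S ih; nra.
elim: L => [|L ih]; first by rewrite big_ord0 mulr_ge0.
rewrite big_mkcond big_ord_recr /= -big_mkcond /=; case: ifP => PL; last by rewrite addr0.
apply: (@le_trans _ _ (\sum_(l < L.+1) A * B ^+ l)).
  rewrite big_ord_recr /= lerD2r big_mkcond /=; apply: ler_sum => l _.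
  by case: ifP => // _; rewrite mulr_ge0// exprn_ge0.
by apply: (le_trans (full _)); rewrite ler_pM2l//; exact: h.
Qed.

Lemma le_poweR q (x y : \bar R) : 0 < q -> (0 <= x)%E -> (x <= y)%E -> (x `^ q <= y `^ q)%E.
Proof.
move=> q0 x0 xy; apply: gt0_ler_poweR => //; first exact: ltW.
  by rewrite in_itv /= x0 leey.
by rewrite in_itv /= (le_trans x0)// leey.
Qed.

Lemma nneseries_bound (f : nat -> \bar R) (B : \bar R) : (forall l, (0 <= f l)%E) ->
  (forall L, (\sum_(l < L) f l <= B)%E) -> (\sum_(l <oo) f l <= B)%E.
Proof.
move=> f0 h; apply: lime_le; first by apply: is_cvg_nneseries => l _ _; exact: f0.
by near=> L; rewrite big_mkord.
Unshelve. all: by end_near. Qed.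

Lemma nneseries_pow_le (a : nat -> R) q (B : \bar R) : 0 < q -> (forall l, 0 <= a l) ->
  (forall L, (((\sum_(l < L) a l) `^ q)%:E <= B)%E) -> ((\sum_(l <oo) (a l)%:E) `^ q <= B)%E.
Proof.
move=> q0 a0 h; have B0 : (0 <= B)%E by apply: le_trans (h 0%N); rewrite lee_fin powR_ge0.
case: B h B0 => [b| |] h B0 //; last by rewrite leey.
rewrite lee_fin in B0.
have le : (\sum_(l <oo) (a l)%:E <= (b `^ q^-1)%:E)%E.
  apply: nneseries_bound => [l|L]; first by rewrite lee_fin.
  rewrite sumEFin lee_fin; have s0 : 0 <= \sum_(l < L) a l by apply: sumr_ge0.
  have qi : 0 <= q^-1 by rewrite invr_ge0 ltW.
  have := h L; rewrite lee_fin => hL.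
  have := ge0_ler_powR qi (powR_ge0 _ _ : _ \in Num.nneg) (B0 : _ \in Num.nneg) hL.
  by rewrite -powRrM mulfV ?gt_eqF// powRr1.
have n0 : (0 <= \sum_(l <oo) (a l)%:E)%E by apply: nneseries_ge0 => l _ _; rewrite lee_fin.
apply: (@le_trans _ _ ((b `^ q^-1)%:E `^ q)%E).
  exact: le_poweR.
by rewrite poweR_EFin -powRrM mulVf ?gt_eqF// powRr1.
Qed.

Lemma nneseries_suptrick q a u C : 0 < q -> (forall l, 0 <= a l) -> (forall l, 0 < u l) ->
  (forall L, \sum_(l < L) (u l) `^ q^-1 <= C) ->
  ((\sum_(l <oo) (a l)%:E) `^ q <= (C `^ q)%:E * \sum_(l <oo) ((u l)^-1 * (a l) `^ q)%:E)%E.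
Proof.
move=> q0 a0 u0 hC; apply: nneseries_pow_le => // L.
have t0 l : 0 <= (u l)^-1 * (a l) `^ q by rewrite mulr_ge0 ?invr_ge0 ?powR_ge0// ltW.
apply: (@le_trans _ _ ((C `^ q * \sum_(l < L) ((u l)^-1 * (a l) `^ q))%:E)).
  by rewrite lee_fin; apply: suptrick.
rewrite EFinM; apply: lee_wpmul2l; first by rewrite lee_fin powR_ge0.
rewrite -sumEFin -(big_mkord xpredT (fun l => ((u l)^-1 * (a l) `^ q)%:E)).
by apply: nneseries_lim_ge => l _ _; rewrite lee_fin.
Qed.

End power_sums.

(** * Dyadic lower bounds for Riesz potentials *)

Section potentials.
Variable R : realType.
Implicit Types (r s d q b : R) (x y z w : Pt R) (l L : nat).

Lemma measurable_dist disp (T : measurableType disp) (f g : T -> Pt R) : measT f -> measT g ->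
  measT (fun t => `|f t - g t|).
Proof.
move=> mf mg; under eq_fun do rewrite prod_normE.
have c1 (h : T -> Pt R) : measT h -> measT (fun t => (h t).1).
  by move=> mh; exact: measurableT_comp.
have c2 (h : T -> Pt R) : measT h -> measT (fun t => (h t).2).
  by move=> mh; exact: measurableT_comp.
by apply: measurable_maxr; apply: measurableT_comp => //; apply: measurable_funB; (apply: c1 || apply: c2).
Qed.

Lemma measurable_ind disp (T : measurableType disp) (f g : T -> Pt R) (h : T -> R) : measT f -> measT g ->
  measT h -> measT (fun t => \1_(cbx (f t) (h t)) (g t) : R).
Proof.
move=> mf mg mh; have md := measurable_dist mg mf.
have -> : (fun t => \1_(cbx (f t) (h t)) (g t) : R) = \1_[set t | `|g t - f t| <= h t].
  by apply/funext => t; rewrite !indicE; congr (nat_of_bool _)%:R; apply/idP/idP => /set_mem; rewrite /cbx /= => ?; apply: mem_set.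
apply: measurable_indic.
have -> : [set t | `|g t - f t| <= h t] = (fun t => h t - `|g t - f t|) @^-1` `[0, +oo[%classic.
  by apply/seteqP; split => t; rewrite /= in_itv/= andbT subr_ge0.
by rewrite -[X in measurable X]setTI; apply: (measurable_funB mh md).
Qed.

Definition sc (r0 : R) l : R := r0 / 2 ^+ l.

Lemma sc_gt0 r0 l : 0 < r0 -> 0 < sc r0 l.
Proof. by move=> h; rewrite /sc divr_gt0// exprn_gt0. Qed.

Lemma sc_powN r0 b l : 0 < r0 -> (sc r0 l) `^ (- b) = r0 `^ (- b) * (2 `^ b) ^+ l.
Proof.
move=> h; have p2 : 0 <= (2 ^+ l)^-1 :> R by rewrite invr_ge0 exprn_ge0.
rewrite /sc powRM ?(ltW h)//; congr (_ * _).
rewrite -powR_inv1 ?exprn_ge0// -powRrM mulN1r opprK.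
by rewrite -(powR_mulrn _ (ler0n R 2)) powRAC powR_mulrn// powR_ge0.
Qed.

Lemma powRN_le b (x y : R) : 0 <= b -> 0 < x -> x <= y -> y `^ (- b) <= x `^ (- b).
Proof.
move=> b0 x0 xy; have y0 : 0 < y by exact: lt_le_trans xy.
rewrite !powRN lef_pV2 ?posrE ?powR_gt0//; apply: ge0_ler_powR => //; rewrite nnegrE ltW//.
Qed.

Lemma two_powR b : 1 <= b -> 2 <= 2 `^ b :> R.
Proof. by move=> h; rewrite -{1}[2]powRr1//; apply: ler_powR => //; rewrite ler1n. Qed.

(** Only scales at least [d/2] contribute, and the smallest of them dominates. The factor [4^b]
    compares [(d/2)^(-b)] with the kernel, whose Euclidean distance is at most [2d]. *)
Lemma kernel_lower (a b r0 : R) x y L : a - 2 = - b -> 1 <= b -> 0 < r0 ->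
  ((\sum_(l < L) (sc r0 l) `^ (- b) * \1_(cbx x (2 * sc r0 l)) y)%:E <= (2 * 4 `^ b)%:E * riesz_kernel a x y)%E.
Proof.
move=> ab b1 r00; rewrite /riesz_kernel; have b0 : 0 <= b by lra.
have C0 : 0 < 2 * 4 `^ b :> R by rewrite mulr_gt0// powR_gt0.
case: eqP => [_|/eqP xy]; first by rewrite gt0_muley ?lte_fin// leey.
rewrite -EFinM lee_fin ab; set d := `|y - x|.
have d0 : 0 < d by rewrite normr_gt0 subr_eq0 eq_sym.
have cd : cabs (csub x y) <= 2 * d by rewrite /d distrC; exact: cabs_le.
have c0 : 0 < cabs (csub x y) by apply: lt_le_trans (cabs_ge _); rewrite csubE -normrN opprB.
apply: (@le_trans _ _ (2 * (d / 2) `^ (- b))); last first.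
  rewrite -mulrA ler_pM2l//; have -> : d / 2 = 4^-1 * (2 * d) by field.
  rewrite powRM ?invr_ge0 ?mulr_ge0// ?(ltW d0)//.
  rewrite -{1}(@powR_inv1 _ 4)// -powRrM mulN1r opprK; apply: ler_wpM2l; first exact: powR_ge0.
  exact: powRN_le.
rewrite (eq_bigr (fun l : 'I_L => if d <= 2 * sc r0 l then r0 `^ (- b) * (2 `^ b) ^+ l else 0)) => [|l _]; last first.
  rewrite -sc_powN// indicE; case: ifPn => h; first by rewrite mem_set ?mulr1.
  by rewrite memNset ?mulr0// /cbx /= => h'; move/negP: h.
rewrite -big_mkcond /=; apply: (@geo_top _ (fun l => d <= 2 * sc r0 l)); [exact: powR_ge0|exact: two_powR|exact: powR_ge0|].
by move=> l hl; rewrite -sc_powN//; apply: powRN_le => //; [lra|rewrite ler_pdivrMr// mulrC].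
Qed.

Section measure.
Variable mu : {finite_measure set (Pt R) -> \bar R}.

Definition V r x : R := fine (mu (cbx x r)).

Lemma mu_fin (A : set (Pt R)) : measurable A -> mu A \is a fin_num.
Proof. by move=> mA; apply: fin_num_measure. Qed.

Lemma VE r x : mu (cbx x r) = (V r x)%:E.
Proof. by rewrite /V fineK// mu_fin//; exact: measurable_cbx. Qed.

Lemma V_ge0 r x : 0 <= V r x.
Proof. by rewrite /V fine_ge0// measure_ge0. Qed.

Lemma V_le r s x y : (forall z, cbx x r z -> cbx y s z) -> V r x <= V s y.
Proof. by move=> h; rewrite -lee_fin -!VE; apply: le_measure; rewrite ?inE//; exact: measurable_cbx. Qed.

Lemma V_int r x : (\int[mu]_y (\1_(cbx x r) y)%:E = (V r x)%:E)%E.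
Proof. by rewrite integral_indic; [rewrite setIT; exact: VE| |exact: measurable_cbx]. Qed.

Lemma tonelli_mu (f : Pt R * Pt R -> \bar R) : measT f -> (forall p, (0 <= f p)%E) ->
  (\int[@lebm R]_x (\int[mu]_y f (x, y)) = \int[mu]_y (\int[@lebm R]_x f (x, y)))%E.
Proof. by move=> mf f0; exact: fubini_tonelli. Qed.

Lemma measurable_int_mu (f : Pt R * Pt R -> \bar R) : measT f -> (forall p, (0 <= f p)%E) ->
  measT (fun x => \int[mu]_y f (x, y))%E.
Proof. by move=> mf f0; exact: measurable_fun_fubini_tonelli_F. Qed.

Lemma V_meas r : measT (V r).
Proof.
have h : measT (fun x => \int[mu]_y (\1_(cbx x r) y)%:E)%E.
  apply: (@measurable_int_mu (fun p => (\1_(cbx p.1 r) p.2)%:E)) => [|p]; last by rewrite lee_fin.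
  by apply/measurable_EFinP; apply: measurable_ind.
have -> : V r = fine \o (fun x => \int[mu]_y (\1_(cbx x r) y)%:E)%E by apply/funext => x /=; rewrite V_int.
exact: measurableT_comp.
Qed.

Lemma measurable_kernel (a : R) : measT (fun p : Pt R * Pt R => riesz_kernel a p.1 p.2).
Proof.
rewrite /riesz_kernel.
have mc : measT (@cabs R).
  apply: measurable_cont2; apply: ct_comp; first exact: sqrt_continuous.
  by apply: ctD; apply: ctX; [exact: ct_fst|exact: ct_snd].
have mB : measT (fun p : Pt R * Pt R => csub p.1 p.2).
  by apply/measurable_fun_pairP; split; apply: measurable_funB; do 2! (apply: measurableT_comp => //).
apply: measurable_fun_ifT => //.
  apply: (measurable_fun_bool true).
  have -> : (fun p : Pt R * Pt R => p.1 == p.2) @^-1` [set true] = (fun p : Pt R * Pt R => `|p.1 - p.2|) @^-1` [set 0].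
    apply/seteqP; split => p /=; first by move=> /eqP ->; rewrite subrr normr0.
    by move=> /eqP; rewrite normr_eq0 subr_eq0.
  by rewrite setTI -[X in measurable X]setTI; apply: measurable_dist.
apply/measurable_EFinP; apply: (measurableT_comp (measurable_powR _)).
exact: measurableT_comp mc mB.
Qed.

Lemma kernel_ge0 (a : R) x y : (0 <= riesz_kernel a x y)%E.
Proof. by rewrite /riesz_kernel; case: ifP => // _; rewrite lee_fin powR_ge0. Qed.

Lemma measurable_pot (a : R) : measT (riesz_pot a mu).
Proof. by apply: (@measurable_int_mu (fun p => riesz_kernel a p.1 p.2)) => [|p]; [exact: measurable_kernel|exact: kernel_ge0]. Qed.

Lemma pot_ge0 (a : R) x : (0 <= riesz_pot a mu x)%E.
Proof. by apply: integral_ge0 => y _; exact: kernel_ge0. Qed.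

Lemma pot_lower (a b r0 : R) x L : a - 2 = - b -> 1 <= b -> 0 < r0 ->
  ((\sum_(l < L) (sc r0 l) `^ (- b) * V (2 * sc r0 l) x)%:E <= (2 * 4 `^ b)%:E * riesz_pot a mu x)%E.
Proof.
move=> ab b1 r00; have C0 : 0 < 2 * 4 `^ b :> R by rewrite mulr_gt0// powR_gt0.
have mk : measT (fun y => riesz_kernel a x y).
  exact: (measurableT_comp (measurable_kernel a) (pair1_measurable x)).
have mi l : measT (fun y => ((sc r0 l) `^ (- b) * \1_(cbx x (2 * sc r0 l)) y)%:E).
  by apply/measurable_EFinP; apply: measurable_funM => //; exact: measurable_1cbx.
rewrite /riesz_pot -ge0_integralZl ?lee_fin ?(ltW C0)// => [|y _]; last exact: kernel_ge0.
have -> : ((\sum_(l < L) (sc r0 l) `^ (- b) * V (2 * sc r0 l) x)%:E =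
    \int[mu]_y (\sum_(l < L) (sc r0 l) `^ (- b) * \1_(cbx x (2 * sc r0 l)) y)%:E)%E.
  under eq_integral do rewrite -sumEFin.
  rewrite -(big_mkord xpredT (fun l => (sc r0 l) `^ (- b) * V (2 * sc r0 l) x)).
  under eq_integral do rewrite -(big_mkord xpredT (fun l => ((sc r0 l) `^ (- b) * \1_(cbx x (2 * sc r0 l)) _)%:E)).
  rewrite ge0_integral_sum//; last by move=> l y _; rewrite lee_fin mulr_ge0 ?powR_ge0.
  rewrite -sumEFin; apply: eq_bigr => l _; rewrite EFinM -V_int -ge0_integralZl//.
  - by apply/measurable_EFinP; exact: measurable_1cbx.
  - by rewrite lee_fin powR_ge0.
apply: ge0_le_integral => //.
- by move=> y _; rewrite lee_fin; apply: sumr_ge0 => l _; rewrite mulr_ge0 ?powR_ge0.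
- apply/measurable_EFinP; apply: measurable_sum => l; apply: measurable_funM => //.
  exact: measurable_1cbx.
- by apply: measurable_funeM.
- by move=> y _; exact: kernel_lower.
Qed.

(** For [q >= 1] a sum of [q]-th powers over the scales is at most the [q]-th power of the sum,
    which the potential dominates. *)
Lemma energy (a b q r0 : R) : a - 2 = - b -> 1 <= b -> 1 <= q -> 0 < r0 ->
  (\sum_(l <oo) \int[@lebm R]_x (((sc r0 l) `^ (- b) * V (2 * sc r0 l) x) `^ q)%:E <=
   ((2 * 4 `^ b) `^ q)%:E * \int[@lebm R]_x ((riesz_pot a mu x) `^ q))%E.
Proof.
move=> ab b1 q1 r00; have q0 : 0 < q by lra.
have C0 : 0 < 2 * 4 `^ b :> R by rewrite mulr_gt0// powR_gt0.
have mf l : measT (fun x => (((sc r0 l) `^ (- b) * V (2 * sc r0 l) x) `^ q)%:E).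
  apply/measurable_EFinP; apply: (measurableT_comp (measurable_powR _)); apply: measurable_funM => //; exact: V_meas.
have mI : measT (fun x => (riesz_pot a mu x) `^ q)%E.
  by apply: (measurableT_comp (measurable_poweR _)); exact: measurable_pot.
apply: nneseries_bound => [l|L]; first by apply: integral_ge0 => x _; rewrite lee_fin powR_ge0.
rewrite -(big_mkord xpredT (fun l => (\int[@lebm R]_x (((sc r0 l) `^ (- b) * V (2 * sc r0 l) x) `^ q)%:E)%E)).
rewrite -ge0_integral_sum//; last by move=> l x _; rewrite lee_fin powR_ge0.
rewrite -ge0_integralZl ?lee_fin ?powR_ge0// => [|x _]; last exact: poweR_ge0.
apply: ge0_le_integral => //.
- by move=> x _; apply: sume_ge0 => l _; rewrite lee_fin powR_ge0.
- by apply: emeasurable_sum => l; exact: mf.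
- by apply: measurable_funeM.
move=> x _; rewrite big_mkord sumEFin.
have t0 l : 0 <= (sc r0 l) `^ (- b) * V (2 * sc r0 l) x by rewrite mulr_ge0 ?powR_ge0 ?V_ge0.
apply: (@le_trans _ _ (((\sum_(l < L) (sc r0 l) `^ (- b) * V (2 * sc r0 l) x) `^ q)%:E)).
  by rewrite lee_fin; apply: (@powR_superadd _ _ (fun l => (sc r0 l) `^ (- b) * V (2 * sc r0 l) x)).
rewrite -!poweR_EFin -poweRM ?lee_fin ?(ltW C0)//; last exact: pot_ge0.
apply: le_poweR => //; first by rewrite lee_fin; apply: sumr_ge0 => l _.
exact: pot_lower.
Qed.

End measure.
End potentials.

(** * Energy of the kernel integrals on the image side *)

Section dyadic_energy.
Variable R : realType.
Variables (H M r0 s0 q k : R) (Phi Psi : Pt R -> Pt R) (mu : {finite_measure set (Pt R) -> \bar R}).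
Hypotheses (H1 : 1 <= H) (K : cancel Phi Psi) (K' : cancel Psi Phi) (cPsi : continuous Psi) (hq : qs H Phi)
  (hM : forall z, `|Psi z - z| <= M) (s00 : 0 < s0) (hr0 : s0 + 2 * M <= r0) (q1 : 1 < q)
  (k0 : 0 < k) (k1 : k < 1) (kth : theta H < k) (kq : 4 * 2^-1 `^ q < k).
Implicit Types (n m l N L : nat) (x y z w : Pt R).

Lemma r0_gt0 : 0 < r0.
Proof. by have := le_trans (normr_ge0 _) (hM 0); have := s00; have := hr0; lra. Qed.

Lemma q_gt0 : 0 < q. Proof. by have := q1; lra. Qed.

Definition hstep n w := w + ((sc s0 n, 0) : Pt R).
(** The source-side size of a step of length [sc s0 n] at [w]; by quasisymmetry, up to constants,
    the size of the preimage of any square of generation [n] near [w]. *)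
Definition Dn n w : R := `|Psi (hstep n w) - Psi w|.

(* the junk value at y = Psi w is 0 *)
Definition gk n w y : R := \1_(cbx (Psi w) r0) y * (Num.min 1 (Dn n w / `|Psi w - y|) / `|Psi w - y|).
Definition Tn n w : \bar R := (\int[mu]_y (gk n w y)%:E)%E.

Lemma mPsi : measT Psi. Proof. exact: measurable_cont22. Qed.

Lemma hstep_cont n : continuous (hstep n).
Proof. by move=> w; apply: cvgD; [exact: cvg_id|exact: cvg_cst]. Qed.

Lemma measurable_Dn n : measT (Dn n).
Proof.
apply: measurable_dist; last exact: mPsi.
exact: (measurableT_comp mPsi (measurable_cont22 (@hstep_cont n))).
Qed.

Lemma measurable_gk n : measT (fun p : Pt R * Pt R => gk n p.1 p.2).
Proof.
have mP : measT (fun p : Pt R * Pt R => Psi p.1) by exact: (measurableT_comp mPsi measurable_fst).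
have md : measT (fun p : Pt R * Pt R => `|Psi p.1 - p.2|) by apply: measurable_dist.
have mi : measT (fun p : Pt R * Pt R => `|Psi p.1 - p.2|^-1).
  have -> : (fun p : Pt R * Pt R => `|Psi p.1 - p.2|^-1) = (fun p => `|Psi p.1 - p.2| `^ (-1)).
    by apply/funext => p; rewrite powR_inv1.
  exact: (measurableT_comp (measurable_powR _) md).
have mD : measT (fun p : Pt R * Pt R => Dn n p.1) by exact: (measurableT_comp (measurable_Dn n) measurable_fst).
apply: measurable_funM; first by apply: measurable_ind.
apply: measurable_funM => //; apply: measurable_minr => //; exact: measurable_funM.
Qed.

Lemma Dn_ge0 n w : 0 <= Dn n w. Proof. exact: normr_ge0. Qed.

Lemma gk_ge0 n w y : 0 <= gk n w y.
Proof. by rewrite /gk mulr_ge0// mulr_ge0 ?invr_ge0// le_min ler01 mulr_ge0 ?invr_ge0// Dn_ge0. Qed.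

Lemma Tn_ge0 n w : (0 <= Tn n w)%E.
Proof. by apply: integral_ge0 => y _; rewrite lee_fin gk_ge0. Qed.

Lemma measurable_Tn n : measT (Tn n).
Proof.
apply: (@measurable_int_mu _ mu (fun p => (gk n p.1 p.2)%:E)) => [|p]; last by rewrite lee_fin gk_ge0.
by apply/measurable_EFinP; exact: measurable_gk.
Qed.

Lemma sc0 (r : R) : sc r 0 = r. Proof. by rewrite /sc expr0 divr1. Qed.
Lemma scS (r : R) n : sc r n.+1 = sc r n / 2. Proof. by rewrite /sc exprS; field; rewrite expf_neq0. Qed.
Lemma scD (r : R) m n : sc r (m + n) = sc r m / 2 ^+ n.
Proof. by rewrite /sc exprD; field; rewrite !expf_neq0. Qed.
Lemma sc_le (r : R) m n : 0 <= r -> (m <= n)%N -> sc r n <= sc r m.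
Proof.
move=> rp mn; rewrite /sc ler_wpM2l// lef_pV2 ?posrE ?exprn_gt0// ler_weXn2l//; lra.
Qed.

Lemma dyadic_index (r d : R) : 0 < d -> d <= r -> exists m, sc r m / 2 < d <= sc r m.
Proof.
move=> d0 dr; have r00 : 0 < r by lra.
have ex : exists n, sc r n.+1 < d.
  have [n hn] := @exp_small _ 2^-1 (d / r) ltac:(lra) ltac:(lra) ltac:(by rewrite divr_gt0).
  exists n; apply: (@le_lt_trans _ _ (sc r n)); first by apply: sc_le; [exact: ltW|].
  by rewrite /sc -exprVn mulrC -ltr_pdivlMr.
case: (ex_minnP ex) => m hm hmin; exists m; rewrite -scS hm /=.
case: m hm hmin => [|m] hm hmin; first by rewrite sc0.
by rewrite leNgt; apply/negP => h; have := hmin m h; rewrite ltnn.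
Qed.

Lemma Dn_gt0 n w : 0 < Dn n w.
Proof.
rewrite /Dn normr_gt0 subr_eq0; apply/eqP => /(can_inj K') e.
have : (hstep n w).1 = w.1 by rewrite e.
by rewrite /hstep /=; have := sc_gt0 n s00; lra.
Qed.

Lemma Dn_le n w : Dn n w <= r0.
Proof.
have h1 := hM (hstep n w); have h2 := hM w.
have e : `|hstep n w - w| <= s0.
  rewrite /hstep addrAC subrr add0r prod_normE /= normr0 ge_max ger0_norm ?(ltW (sc_gt0 _ s00))//.
  by rewrite (ltW s00) andbT -[leRHS]sc0; apply: sc_le => //; exact: ltW.
have := ler_distD (hstep n w) (Psi (hstep n w)) (Psi w); have := ler_distD w (hstep n w) (Psi w).
rewrite (distrC w (Psi w)) /Dn; have := hr0; lra.
Qed.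

Definition cl l x : R := V mu (sc r0 l) x / sc r0 l.
Definition el l x : R := (V mu (2 * sc r0 l) x / sc r0 l) `^ q.

Lemma cl_ge0 l x : 0 <= cl l x.
Proof. by rewrite divr_ge0 ?V_ge0// ltW// sc_gt0// r0_gt0. Qed.

Lemma nneseries_term (f : nat -> \bar R) l : (forall i, (0 <= f i)%E) -> (f l <= \sum_(i <oo) f i)%E.
Proof.
move=> f0; apply: le_trans (@nneseries_lim_ge _ f xpredT 0 l.+1 (fun i _ _ => f0 i)).
by rewrite big_nat_recr//=; rewrite leeDr// sume_ge0.
Qed.

(** At distance [d] from [Psi w] the single scale with [sc r0 l / 2 < d <= sc r0 l] already
    dominates the kernel, with a factor 2 for each of the two quotients by [d]. *)
Lemma Tn_sum n w : (Tn n w <= \sum_(l <oo) (4 * (Num.min 1 (Dn n w / sc r0 l) * cl l (Psi w)))%:E)%E.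
Proof.
have r00 := r0_gt0.
have mn l : 0 <= Num.min 1 (Dn n w / sc r0 l).
  by rewrite le_min ler01 divr_ge0 ?Dn_ge0// ltW// sc_gt0.
pose f l y : \bar R := ((4 * (Num.min 1 (Dn n w / sc r0 l) / sc r0 l)) * \1_(cbx (Psi w) (sc r0 l)) y)%:E.
have c0 l : 0 <= 4 * (Num.min 1 (Dn n w / sc r0 l) / sc r0 l).
  by apply: mulr_ge0 => //; rewrite divr_ge0// ltW// sc_gt0.
have f0 l y : (0 <= f l y)%E by rewrite lee_fin mulr_ge0.
have mf l : measT (f l).
  apply/measurable_EFinP; apply: measurable_funM => //; exact: measurable_1cbx.
have -> : (\sum_(l <oo) (4 * (Num.min 1 (Dn n w / sc r0 l) * cl l (Psi w)))%:E = \int[mu]_y \sum_(l <oo) f l y)%E.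
  rewrite integral_nneseries//; apply: eq_eseriesr => l _.
  under eq_integral do rewrite /f EFinM.
  rewrite ge0_integralZl//; last by rewrite lee_fin.
    by rewrite V_int -EFinM /cl; congr (_%:E); ring.
  by apply/measurable_EFinP; exact: measurable_1cbx.
apply: ge0_le_integral => //.
- by move=> y _; rewrite lee_fin gk_ge0.
- by apply/measurable_EFinP; exact: (measurableT_comp (measurable_gk n) (pair1_measurable w)).
- by apply: ge0_emeasurable_sum => // l y _ _.
move=> y _; rewrite /gk indicE; case: (boolP (y \in _)) => [/set_mem|_]; last first.
  by rewrite mul0r; apply: nneseries_ge0.
rewrite /cbx /= mul1r distrC => yr; set d := `|Psi w - y| in yr *.
have [->|dn] := eqVneq d 0; first by rewrite invr0 !mulr0; apply: nneseries_ge0.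
have d0 : 0 < d by rewrite lt_def dn normr_ge0.
have [l /andP[l1 l2]] := dyadic_index d0 yr.
apply: (le_trans _ (nneseries_term l (fun i => f0 i y))).
have s1 := sc_gt0 l r00; set s := sc r0 l in l1 l2 s1 *.
rewrite lee_fin indicE mem_set ?mulr1; last by rewrite /cbx /= distrC.
have di : d^-1 <= 2 / s by rewrite -[2]invrK -invfM lef_pV2 ?posrE; lra.
have D0 := Dn_ge0 n w.
have mm : Num.min 1 (Dn n w / d) <= 2 * Num.min 1 (Dn n w / s).
  have h : Dn n w / d <= 2 * (Dn n w / s) by rewrite mulrCA; apply: ler_wpM2l.
  case: (leP 1 (Dn n w / s)) => h1; first by rewrite mulr1 ge_min; apply/orP; left; lra.
  by rewrite ge_min h orbT.
apply: (@le_trans _ _ ((2 * Num.min 1 (Dn n w / s)) * (2 / s))).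
  by apply: ler_pM => //; [rewrite le_min ler01 divr_ge0// ltW|rewrite invr_ge0 ltW].
by rewrite le_eqVlt; apply/orP; left; apply/eqP; ring.
Qed.

(** By truncated subtraction this is the scale of index [max l m]: small enough to average balls of
    scale [l], and small enough for [Dn] of scale [m] to be controlled by quasisymmetry. *)
Definition rho l m : R := sc r0 m / 2 ^+ (l - m).

Lemma rhoE l m : rho l m = sc r0 l / 2 ^+ (m - l).
Proof. by rewrite /rho -!scD; congr sc; lia. Qed.

Lemma rho_gt0 l m : 0 < rho l m.
Proof. by rewrite /rho divr_gt0 ?exprn_gt0// sc_gt0// r0_gt0. Qed.

Lemma el_ge0 l x : 0 <= el l x. Proof. exact: powR_ge0. Qed.

Lemma measurable_el l : measT (el l).
Proof. by apply: (measurableT_comp (measurable_powR _)); apply: measurable_funM => //; exact: V_meas. Qed.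

(** For [z] within [rho l m] of [x] the ball defining [cl] at [x] lies in the doubled ball defining
    [el] at [z]; this pointwise bound is then averaged over [z]. *)
Lemma cl_average l m x :
  (((cl l x) `^ q)%:E <= (((2 * rho l m) ^+ 2)^-1)%:E * \int[@lebm R]_z (\1_(cbx x (rho l m)) z * el l z)%:E)%E.
Proof.
have p0 := rho_gt0 l m; set p := rho l m in p0 *.
have P2 : 0 < (2 * p) ^+ 2 by rewrite exprn_gt0// mulr_gt0.
have pl : p <= sc r0 l.
  by rewrite /p rhoE ler_pdivrMr ?exprn_gt0// ler_peMr ?exprn_ege1 ?ler1n// ltW// sc_gt0// r0_gt0.
have s1 := sc_gt0 l r0_gt0.
have mi : measT (\1_(cbx x p) : Pt R -> R) by exact: measurable_1cbx.
rewrite -ge0_integralZl; last 4 first.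
- by [].
- by apply/measurable_EFinP; apply: measurable_funM => //; exact: measurable_el.
- by move=> z _; rewrite lee_fin mulr_ge0// el_ge0.
- by rewrite lee_fin invr_ge0 ltW.
have -> : ((cl l x) `^ q)%:E = (\int[@lebm R]_z ((((2 * p) ^+ 2)^-1 * (cl l x) `^ q) * \1_(cbx x p) z)%:E)%E.
  under eq_integral do rewrite EFinM.
  rewrite ge0_integralZl//; last 2 first.
  - exact/measurable_EFinP.
  - by rewrite lee_fin mulr_ge0 ?invr_ge0 ?powR_ge0// ltW.
  rewrite integral_indic//; [|exact: measurable_cbx].
  rewrite setIT [X in (_ * X)%E](leb2_cbx x (ltW p0)) -EFinM; congr (_%:E).
  by rewrite mulrAC mulVf ?mul1r// gt_eqF.
apply: ge0_le_integral => //.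
- by move=> z _; rewrite lee_fin !mulr_ge0 ?invr_ge0 ?powR_ge0// ltW.
- by apply/measurable_EFinP; apply: measurable_funM.
- by apply: measurable_funeM; apply/measurable_EFinP; apply: measurable_funM => //; exact: measurable_el.
move=> z _; rewrite -EFinM lee_fin -mulrA; apply: ler_wpM2l; first by rewrite invr_ge0 ltW.
rewrite indicE; case: (boolP (z \in _)) => [/set_mem|_]; rewrite ?mulr0 ?mul0r//.
rewrite /cbx /= mulr1 mul1r => zx; apply: ge0_ler_powR.
- exact: ltW q_gt0.
- by rewrite nnegrE cl_ge0.
- by rewrite nnegrE divr_ge0 ?V_ge0// ltW.
rewrite ler_pM2r ?invr_gt0//; apply: V_le => y; rewrite /cbx /= => h.
by have := ler_distD x y z; rewrite (distrC x z); lra.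
Qed.

(** The factor [2^-q] per step is the gain from [min(1, D/sc)] at scales above the size [D]; [1/k]
    per step, in either direction, is the price paid in [suptrick]. *)
Definition wt l m : R := k^-1 ^+ (l - m) * (2^-1 `^ q / k) ^+ (m - l).
Definition chi n m w : R := (sc r0 m / 2 < Dn n w <= sc r0 m)%R%:R.
Definition cq : R := 4 `^ q * ((1 - k `^ q^-1)^-1 + (1 - k `^ q^-1)^-1) `^ q.

Lemma wt_ge0 l m : 0 <= wt l m.
Proof. by rewrite mulr_ge0 ?exprn_ge0 ?divr_ge0 ?powR_ge0 ?invr_ge0 ?(ltW k0). Qed.

Lemma cq_ge0 : 0 <= cq. Proof. by rewrite mulr_ge0// powR_ge0. Qed.

Lemma kq_lt1 : k `^ q^-1 < 1.
Proof.
rewrite -[ltRHS](_ : 1 `^ q^-1 = 1); last by rewrite powR1.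
by apply: gt0_ltr_powR; rewrite ?invr_gt0 ?q_gt0// nnegrE// ltW.
Qed.

Lemma powRX (x y : R) n : 0 <= x -> (x ^+ n) `^ y = (x `^ y) ^+ n.
Proof. by move=> x0; rewrite -(powR_mulrn _ x0) powRAC powR_mulrn// powR_ge0. Qed.

Lemma Tn_pow n m w : sc r0 m / 2 < Dn n w <= sc r0 m ->
  (Tn n w `^ q <= cq%:E * \sum_(l <oo) (wt l m * (cl l (Psi w)) `^ q)%:E)%E.
Proof.
move=> /andP[D1 D2]; have r00 := r0_gt0; have q0 := q_gt0.
pose u l := k ^+ (l - m) * k ^+ (m - l).
have u0 l : 0 < u l by rewrite mulr_gt0// exprn_gt0.
pose a l := 4 * (Num.min 1 (Dn n w / sc r0 l) * cl l (Psi w)).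
have mn l : 0 <= Num.min 1 (Dn n w / sc r0 l).
  by rewrite le_min ler01 divr_ge0 ?Dn_ge0// ltW// sc_gt0.
have a0 l : 0 <= a l by rewrite mulr_ge0// mulr_ge0// cl_ge0.
have hC L : \sum_(l < L) (u l) `^ q^-1 <= (1 - k `^ q^-1)^-1 + (1 - k `^ q^-1)^-1.
  rewrite (eq_bigr (fun l : 'I_L => (k `^ q^-1) ^+ (l - m) * (k `^ q^-1) ^+ (m - l))) => [|l _].
    by apply: geo2; rewrite ?powR_ge0 ?kq_lt1.
  by rewrite /u powRM ?exprn_ge0 ?(ltW k0)// !powRX// ltW.
apply: (le_trans (le_poweR q0 (Tn_ge0 n w) (Tn_sum n w))).
apply: (le_trans (nneseries_suptrick q0 a0 u0 hC)).
rewrite /cq EFinM -muleA muleCA.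
rewrite -(@nneseriesZl _ (fun l => (wt l m * (cl l (Psi w)) `^ q)%:E) xpredT (4 `^ q) 0); last first.
  by move=> l _; rewrite lee_fin mulr_ge0 ?wt_ge0 ?powR_ge0.
apply: lee_wpmul2l; first by rewrite lee_fin powR_ge0.
apply: lee_nneseries => [l _ _|l _]; first by rewrite lee_fin mulr_ge0 ?invr_ge0 ?powR_ge0// ltW.
have c0 := cl_ge0 l (Psi w).
have -> : a l `^ q = 4 `^ q * ((Num.min 1 (Dn n w / sc r0 l)) `^ q * (cl l (Psi w)) `^ q).
  by rewrite /a (powRM _ (ler0n R 4) (mulr_ge0 (mn l) c0)) (powRM _ (mn l) c0).
rewrite -EFinM lee_fin.
rewrite mulrCA; apply: ler_wpM2l; first exact: powR_ge0.
rewrite mulrA; apply: ler_wpM2r; first exact: powR_ge0.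
have mb : Num.min 1 (Dn n w / sc r0 l) <= 2^-1 ^+ (m - l).
  have [ml|lm] := leqP m l; first by rewrite (eqP (ml : (m - l == 0)%N)) expr0 ge_min lexx.
  rewrite ge_min; apply/orP; right; rewrite ler_pdivrMr ?sc_gt0//; apply: (le_trans D2).
  by rewrite -{1}(subnKC (ltnW lm)) scD exprVn mulrC.
have mq : (Num.min 1 (Dn n w / sc r0 l)) `^ q <= (2^-1 `^ q) ^+ (m - l).
  by rewrite -powRX ?invr_ge0//; apply: ge0_ler_powR; rewrite ?nnegrE ?(ltW q0)// exprn_ge0// invr_ge0.
rewrite /u /wt exprMn !exprVn invfM -mulrA; apply: ler_wpM2l; first by rewrite invr_ge0 exprn_ge0// ltW.
by rewrite mulrC; apply: ler_wpM2r => //; rewrite invr_ge0 exprn_ge0// ltW.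
Qed.


Lemma chi_ge0 n m w : 0 <= chi n m w. Proof. by rewrite /chi. Qed.

Lemma measurable_chi n m : measT (chi n m).
Proof.
have -> : chi n m = \1_(Dn n @^-1` `]sc r0 m / 2, sc r0 m]%classic).
  by apply/funext => w; rewrite /chi indicE; congr (nat_of_bool _)%:R; apply/idP/idP; rewrite in_setE /= in_itv.
by apply: measurable_indic; rewrite -[X in measurable X]setTI; apply: measurable_Dn.
Qed.

Lemma sc_inv2 (r : R) n : (sc r n ^+ 2)^-1 = (r ^+ 2)^-1 * 4 ^+ n.
Proof.
rewrite /sc expr_div_n invf_div mulrC; congr (_ * _).
by rewrite -exprM mulnC exprM; congr (_ ^+ _); rewrite expr2; lra.
Qed.

Lemma measurable_indPsi x (r : R) : measT (fun w => \1_(cbx x r) (Psi w) : R).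
Proof. by apply: measurable_ind => //; exact: mPsi. Qed.

(** For fixed [w] the sum over [n] has ratio 4 and its last term dominates; there quasisymmetry
    gives [sc s0 n >= L/(2H)], with [L] the image size of a step of scale [m] at [x]. What remains
    is the area of the image of the square of half side [rho l m], which decays like [theta^(l-m)].
    The constant is the product of [8 H^2 / L^2] and [4 H^2 L^2]. *)
Lemma bracket N l m x :
  (\int[@lebm R]_w (\sum_(0 <= n < N) ((sc s0 n ^+ 2)^-1 * (chi n m w * \1_(cbx x (rho l m)) (Psi w))))%:E <=
   (32 * H ^+ 4 * theta H ^+ (l - m))%:E)%E.
Proof.
have r00 := r0_gt0; have p0 := rho_gt0 l m; have rm := sc_gt0 m r00.
have H0 : 0 < H by have := H1; lra.
pose x1 := x + ((sc r0 m, 0) : Pt R); pose L := `|Phi x1 - Phi x|.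
have x1x : `|x1 - x| = sc r0 m by rewrite /x1 addrAC subrr add0r prod_normE /= normr0 ger0_norm ?max_l// ltW.
have L0 : 0 < L.
  rewrite normr_gt0 subr_eq0; apply/eqP => /(can_inj K) e; move: x1x; rewrite e subrr normr0; lra.
pose W := 4 * H ^+ 2 / L ^+ 2.
have L2 : 0 < L ^+ 2 by exact: exprn_gt0.
have W0 : 0 <= W by rewrite divr_ge0 ?(ltW L2)// mulr_ge0// sqr_ge0.
have mA : measurable (Psi @^-1` cbx x (rho l m)) by exact: (measurable_pre cPsi (measurable_cbx _ _)).
have pr : rho l m <= sc r0 m.
  by rewrite /rho ler_pdivrMr ?exprn_gt0// ler_peMr ?exprn_ege1 ?ler1n// ltW.
have pt w : \sum_(0 <= n < N) ((sc s0 n ^+ 2)^-1 * (chi n m w * \1_(cbx x (rho l m)) (Psi w))) <=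
    2 * W * \1_(Psi @^-1` cbx x (rho l m)) w.
  rewrite !indicE (_ : (w \in Psi @^-1` _) = (Psi w \in cbx x (rho l m))); last by apply/idP/idP; rewrite !in_setE.
  case: (boolP (Psi w \in _)) => [/set_mem hw|_]; last first.
    by rewrite mulr0 big1// => n _; rewrite !mulr0.
  rewrite mulr1; pose P n := (sc r0 m / 2 < Dn n w <= sc r0 m)%R.
  rewrite big_mkord (eq_bigr (fun n : 'I_N => if P n then (s0 ^+ 2)^-1 * 4 ^+ n else 0)) => [|n _]; last first.
    by rewrite sc_inv2 /chi -/(P n); case: (P n); rewrite !mulr1 ?mulr0.
  rewrite -big_mkcond; apply: geo_top => //; [by rewrite invr_ge0 sqr_ge0|lra|].
  move=> n /andP[D1 D2]; rewrite -sc_inv2 /W -[leRHS]invrK lef_pV2 ?posrE; last 2 first.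
  - by rewrite exprn_gt0// sc_gt0.
  - by rewrite invr_gt0 divr_gt0// mulr_gt0// exprn_gt0.
  rewrite invf_div ler_pdivrMr; last by rewrite mulr_gt0// exprn_gt0.
  have -> : sc s0 n ^+ 2 * (4 * H ^+ 2) = (2 * H * sc s0 n) ^+ 2 by ring.
  have sn := sc_gt0 n s00.
  have sH : 0 <= 2 * H * sc s0 n by apply: mulr_ge0; [lra|exact: ltW].
  rewrite lerXn2r ?nnegrE ?(ltW L0)//.
  have st : `|Phi (Psi w) - Phi (Psi (hstep n w))| = sc s0 n.
    by rewrite !K' /hstep opprD addrA subrr add0r normrN prod_normE /= normr0 (ger0_norm (ltW sn)) max_l// ltW.
  have hw' : `|Psi w - x| <= sc r0 m by exact: le_trans pr.
  have D' : `|Psi w - Psi (hstep n w)| = Dn n w by rewrite distrC.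
  have a1 : `|Phi (Psi w) - Phi x1| <= H * sc s0 n.
    by rewrite -st; apply: hq; rewrite D'; have := ler_distD x (Psi w) x1; rewrite (distrC x x1) x1x; lra.
  have a2 : `|Phi (Psi w) - Phi x| <= H * sc s0 n by rewrite -st; apply: hq; rewrite D'; lra.
  by have := ler_distD (Phi (Psi w)) (Phi x1) (Phi x); rewrite (distrC (Phi x1) (Phi (Psi w))) -/L; lra.
apply: (@le_trans _ _ (\int[@lebm R]_w ((2 * W)%:E * (\1_(Psi @^-1` cbx x (rho l m)) w)%:E))%E).
  apply: ge0_le_integral => //.
  - move=> w _; rewrite lee_fin; apply: sumr_ge0 => n _; rewrite mulr_ge0 ?invr_ge0 ?sqr_ge0// mulr_ge0// chi_ge0//.
  - apply/measurable_EFinP; apply: measurable_sum => n; apply: measurable_funM => //; apply: measurable_funM.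
      exact: measurable_chi.
    exact: measurable_indPsi.
  - by apply: measurable_funeM; apply/measurable_EFinP; exact: measurable_indic.
  - by move=> w _; rewrite -EFinM lee_fin; exact: pt.
rewrite ge0_integralZl//; last 2 first.
- by apply/measurable_EFinP; exact: measurable_indic.
- by rewrite lee_fin mulr_ge0.
rewrite integral_indic// setIT.
apply: (@le_trans _ _ ((2 * W)%:E * ((theta H ^+ (l - m))%:E * ((2 * (H * L)) ^+ 2)%:E))%E).
  apply: lee_wpmul2l; first by rewrite lee_fin mulr_ge0.
  have d := area_decayX H1 K K' cPsi hq x (l - m) rm.
  apply: (le_trans d); apply: lee_wpmul2l; first by rewrite lee_fin exprn_ge0// theta_ge0.
  apply: area_upper => //; rewrite x1x; lra.
rewrite -!EFinM lee_fin le_eqVlt; apply/orP; left; apply/eqP; rewrite /W; field.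
by rewrite gt_eqF.
Qed.

Definition G n m l (p : Pt R * Pt R) : R :=
  cq * (wt l m * ((2 * rho l m) ^+ 2)^-1) * (chi n m p.1 * \1_(cbx p.2 (rho l m)) (Psi p.1) * el l p.2).

Let c1 l m : R := cq * (wt l m * ((2 * rho l m) ^+ 2)^-1).

Lemma c1_ge0 l m : 0 <= c1 l m.
Proof. by rewrite /c1 mulr_ge0 ?cq_ge0// mulr_ge0 ?wt_ge0// invr_ge0 sqr_ge0. Qed.

Lemma G_ge0 n m l p : 0 <= G n m l p.
Proof. by rewrite /G mulr_ge0 ?c1_ge0// mulr_ge0 ?el_ge0// mulr_ge0 ?chi_ge0. Qed.

Lemma measurable_G n m l : measT (G n m l).
Proof.
apply: measurable_funM => //; apply: measurable_funM; last exact: (measurableT_comp (measurable_el l) measurable_snd).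
apply: measurable_funM; first exact: (measurableT_comp (measurable_chi n m) measurable_fst).
apply: measurable_ind => //; exact: (measurableT_comp mPsi measurable_fst).
Qed.

Lemma cbxC x y (r : R) : \1_(cbx x r) y = \1_(cbx y r) x :> R.
Proof. by rewrite !indicE; congr (nat_of_bool _)%:R; apply/idP/idP; rewrite !in_setE /cbx /= distrC. Qed.

(** The scale [m] of [Dn n w] depends on [w]; summing over all [m] with the indicator [chi] removes
    this dependence before Tonelli is applied. *)
Lemma Tn_powG n w : (Tn n w `^ q <= \sum_(m <oo) \sum_(l <oo) \int[@lebm R]_x (G n m l (w, x))%:E)%E.
Proof.
have g0 m l : (0 <= \int[@lebm R]_x (G n m l (w, x))%:E)%E.
  by apply: integral_ge0 => x _; rewrite lee_fin G_ge0.
have [m hm] := dyadic_index (Dn_gt0 n w) (Dn_le n w).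
apply: le_trans (nneseries_term m (fun i => nneseries_ge0 (fun l _ _ => g0 i l))).
apply: (le_trans (Tn_pow hm)).
rewrite -nneseriesZl; last by move=> l _; rewrite lee_fin mulr_ge0 ?wt_ge0 ?powR_ge0.
apply: lee_nneseries => [l _ _|l _].
  by rewrite mule_ge0// lee_fin ?cq_ge0// mulr_ge0 ?wt_ge0 ?powR_ge0.
have mi : measT (fun x => (\1_(cbx (Psi w) (rho l m)) x * el l x)%:E).
  by apply/measurable_EFinP; apply: measurable_funM; [exact: measurable_1cbx|exact: measurable_el].
have e x : (G n m l (w, x))%:E = ((c1 l m)%:E * (\1_(cbx (Psi w) (rho l m)) x * el l x)%:E)%E.
  by rewrite -EFinM /G /= /chi hm mul1r cbxC.
under eq_integral do rewrite e.
rewrite ge0_integralZl//; last 2 first.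
- by move=> x _; rewrite lee_fin mulr_ge0// el_ge0.
- by rewrite lee_fin c1_ge0.
have -> : (c1 l m)%:E = (cq%:E * ((wt l m)%:E * (((2 * rho l m) ^+ 2)^-1)%:E))%E by rewrite -!EFinM.
rewrite -!muleA; apply: lee_wpmul2l; first by rewrite lee_fin cq_ge0.
rewrite [in leLHS]EFinM; apply: lee_wpmul2l; first by rewrite lee_fin wt_ge0.
exact: cl_average.
Qed.

Definition En : \bar R := (\sum_(l <oo) \int[@lebm R]_x ((sc r0 l ^+ 2)^-1 * el l x)%:E)%E.

(** The 8 is the 32 of [bracket] divided by the 4 in the area of the averaging square; the two
    series are those of [wt] multiplied by area decay and by the area factor [4^(m-l)]. *)
Definition CE : R := 8 * H ^+ 4 * cq * ((1 - theta H / k)^-1 + (1 - 4 * 2^-1 `^ q / k)^-1).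

Lemma int_el_Z l (c : R) : 0 <= c -> (c%:E * \int[@lebm R]_x (el l x)%:E = \int[@lebm R]_x (c%:E * (el l x)%:E))%E.
Proof.
move=> c0; rewrite ge0_integralZl; [by []|exact: measurableT| | |].
- by apply/measurable_EFinP; exact: measurable_el.
- by move=> x _; rewrite lee_fin el_ge0.
- by rewrite lee_fin.
Qed.

Lemma G_sum N m l : (\sum_(0 <= n < N) (((sc s0 n ^+ 2)^-1)%:E * \int[@lebm R]_w \int[@lebm R]_x (G n m l (w, x))%:E) <=
  (c1 l m * (32 * H ^+ 4 * theta H ^+ (l - m)))%:E * \int[@lebm R]_x (el l x)%:E)%E.
Proof.
have i0 n : 0 <= (sc s0 n ^+ 2)^-1 by rewrite invr_ge0 sqr_ge0.
pose F (p : Pt R * Pt R) : R := \sum_(0 <= n < N) ((sc s0 n ^+ 2)^-1 * G n m l p).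
have mF : measT F by apply: measurable_sum => n; apply: measurable_funM => //; exact: measurable_G.
have F0 p : 0 <= F p by apply: sumr_ge0 => n _; rewrite mulr_ge0// G_ge0.
have mG n : measT (fun p => (G n m l p)%:E) by apply/measurable_EFinP; exact: measurable_G.
have mGs n (w : Pt R) : measT (fun x => (G n m l (w, x))%:E) by exact: (measurableT_comp (mG n) (pair1_measurable w)).
have -> : (\sum_(0 <= n < N) (((sc s0 n ^+ 2)^-1)%:E * \int[@lebm R]_w \int[@lebm R]_x (G n m l (w, x))%:E) =
   \int[@lebm R]_w \int[@lebm R]_x (F (w, x))%:E)%E.
  under [RHS]eq_integral => w _.
    under eq_integral do rewrite -sumEFin.
    rewrite ge0_integral_sum//; last 2 first.
    - by move=> n; apply/measurable_EFinP; apply: measurable_funM => //; exact: (measurableT_comp (measurable_G n m l) (pair1_measurable w)).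
    - by move=> n x _; rewrite lee_fin mulr_ge0// G_ge0.
    over.
  rewrite ge0_integral_sum//; last 2 first.
  - move=> n; apply: (@measurable_int_snd R (fun p => ((sc s0 n ^+ 2)^-1 * G n m l p)%:E)) => [|p].
      by apply/measurable_EFinP; apply: measurable_funM => //; exact: measurable_G.
    by rewrite lee_fin mulr_ge0// G_ge0.
  - by move=> n w _; apply: integral_ge0 => x _; rewrite lee_fin mulr_ge0// G_ge0.
  apply: eq_bigr => n _; rewrite -ge0_integralZl//; last 3 first.
  - by apply: (@measurable_int_snd R (fun p => (G n m l p)%:E)) => // p; rewrite lee_fin G_ge0.
  - by move=> w _; apply: integral_ge0 => x _; rewrite lee_fin G_ge0.
  - by rewrite lee_fin.
  apply: eq_integral => w _; rewrite -ge0_integralZl//; last 3 first.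
  - exact: mGs.
  - by move=> x _; rewrite lee_fin G_ge0.
  - by rewrite lee_fin.
have te : (\int[@lebm R]_w \int[@lebm R]_x (F (w, x))%:E = \int[@lebm R]_x \int[@lebm R]_w (F (w, x))%:E)%E.
  apply: (@tonelli R (fun p => (F p)%:E)); first exact/measurable_EFinP.
  by move=> p; rewrite lee_fin.
rewrite te.
have H0 : 0 <= H by have := H1; lra.
have cp : 0 <= c1 l m * (32 * H ^+ 4 * theta H ^+ (l - m)).
  apply: mulr_ge0; first exact: c1_ge0.
  by apply: mulr_ge0; [apply: mulr_ge0; [exact: (ler0n R 32)|exact: exprn_ge0]|apply: exprn_ge0; exact: theta_ge0].
rewrite (int_el_Z l cp); apply: ge0_le_integral.
- by [].
- by move=> x _; apply: integral_ge0 => w _; rewrite lee_fin.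
- apply: (@measurable_int_fst R (fun p => (F p)%:E)); first exact/measurable_EFinP.
  by move=> p; rewrite lee_fin.
- by apply: measurable_funeM; apply/measurable_EFinP; exact: measurable_el.
move=> x _.
have e w : (F (w, x))%:E = ((c1 l m * el l x)%:E * (\sum_(0 <= n < N) ((sc s0 n ^+ 2)^-1 * (chi n m w * \1_(cbx x (rho l m)) (Psi w))))%:E)%E.
  rewrite -EFinM /F mulr_sumr; congr (_%:E); apply: eq_bigr => n _; rewrite /G /= /c1; ring.
clear cp te mG mGs mF F0.
under eq_integral do rewrite e.
rewrite [leLHS]ge0_integralZl; last 4 first.
- by [].
- apply/measurable_EFinP; apply: measurable_sum => n; apply: measurable_funM => //; apply: measurable_funM.
    exact: measurable_chi.
  exact: measurable_indPsi.
- move=> w _; rewrite lee_fin; apply: sumr_ge0 => n _; rewrite mulr_ge0// mulr_ge0// chi_ge0.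
- by rewrite lee_fin mulr_ge0 ?c1_ge0// el_ge0.
apply: (le_trans (lee_wpmul2l _ (bracket N l m x))); first by rewrite lee_fin mulr_ge0 ?c1_ge0// el_ge0.
by rewrite -!EFinM lee_fin mulrAC.
Qed.

(** After Tonelli the interaction of the scales [l] and [m] decays with ratio [theta/k] for [l > m],
    by area decay, and [4 * 2^-q / k] for [l < m], from the kernel against the area normalization.
    The choice of [k] makes both ratios less than 1. *)
Lemma dyadic_energy N : (\sum_(0 <= n < N) (((sc s0 n ^+ 2)^-1)%:E * \int[@lebm R]_w (Tn n w `^ q)) <= CE%:E * En)%E.
Proof.
have H0 : 0 < H by have := H1; lra.
have i0 n : 0 <= (sc s0 n ^+ 2)^-1 by rewrite invr_ge0 sqr_ge0.
have mG n m l : measT (fun p => (G n m l p)%:E) by apply/measurable_EFinP; exact: measurable_G.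
have gi0 n m l w : (0 <= \int[@lebm R]_x (G n m l (w, x))%:E)%E.
  by apply: integral_ge0 => x _; rewrite lee_fin G_ge0.
have gii0 n m l : (0 <= \int[@lebm R]_w \int[@lebm R]_x (G n m l (w, x))%:E)%E.
  by apply: integral_ge0 => w _.
have mgi n m l : measT (fun w => \int[@lebm R]_x (G n m l (w, x))%:E)%E.
  by apply: (@measurable_int_snd R (fun p => (G n m l p)%:E)) => // p; rewrite lee_fin G_ge0.
have mS n m : measT (fun w => \sum_(l <oo) \int[@lebm R]_x (G n m l (w, x))%:E)%E.
  by apply: ge0_emeasurable_sum.
have S0 n m w : (0 <= \sum_(l <oo) \int[@lebm R]_x (G n m l (w, x))%:E)%E by apply: nneseries_ge0.
have s1 n : (\int[@lebm R]_w (Tn n w `^ q) <= \sum_(m <oo) \sum_(l <oo) \int[@lebm R]_w \int[@lebm R]_x (G n m l (w, x))%:E)%E.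
  have -> : (\sum_(m <oo) \sum_(l <oo) \int[@lebm R]_w \int[@lebm R]_x (G n m l (w, x))%:E =
     \int[@lebm R]_w \sum_(m <oo) \sum_(l <oo) \int[@lebm R]_x (G n m l (w, x))%:E)%E.
    rewrite integral_nneseries; [|by []|by move=> m; exact: mS|by []].
    apply: eq_eseriesr => m _; rewrite integral_nneseries; [by []|exact: measurableT|by move=> l; exact: mgi|by []].
  apply: ge0_le_integral => //.
  - by move=> w _; exact: poweR_ge0.
  - by apply: (measurableT_comp (measurable_poweR _)); exact: measurable_Tn.
  - by apply: ge0_emeasurable_sum => [m w _ _|m _]; [exact: S0|exact: mS].
  - by move=> w _; exact: Tn_powG.
apply: (@le_trans _ _ (\sum_(m <oo) \sum_(l <oo) \sum_(0 <= n < N) (((sc s0 n ^+ 2)^-1)%:E * \int[@lebm R]_w \int[@lebm R]_x (G n m l (w, x))%:E))%E).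
  under eq_eseriesr => m _.
    rewrite nneseries_sum_nat; last by move=> n l; rewrite mule_ge0// lee_fin.
    over.
  rewrite nneseries_sum_nat; last by move=> n m; apply: nneseries_ge0 => l _ _; rewrite mule_ge0// lee_fin.
  apply: lee_sum => n _.
  under eq_eseriesr => m _ do rewrite nneseriesZl//.
  rewrite nneseriesZl; last by move=> m _; apply: nneseries_ge0.
  by apply: lee_wpmul2l; rewrite ?lee_fin.
have ie0 l : (0 <= \int[@lebm R]_x (el l x)%:E)%E by apply: integral_ge0 => x _; rewrite lee_fin el_ge0.
have cc0 l m : 0 <= c1 l m * (32 * H ^+ 4 * theta H ^+ (l - m)).
  by rewrite mulr_ge0 ?c1_ge0// mulr_ge0 ?exprn_ge0 ?theta_ge0// mulr_ge0// exprn_ge0// ltW.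
apply: (@le_trans _ _ (\sum_(m <oo) \sum_(l <oo) ((c1 l m * (32 * H ^+ 4 * theta H ^+ (l - m)))%:E * \int[@lebm R]_x (el l x)%:E))%E).
  apply: lee_nneseries => [m _ _|m _].
    by apply: nneseries_ge0 => l _ _; apply: sume_ge0 => n _; rewrite mule_ge0// lee_fin.
  apply: lee_nneseries => [l _ _|l _]; last exact: G_sum.
  by apply: sume_ge0 => n _; rewrite mule_ge0// lee_fin.
rewrite nneseries_interchange; last by move=> m l; rewrite mule_ge0// lee_fin.
rewrite /En -nneseriesZl; last first.
  by move=> l _; apply: integral_ge0 => x _; rewrite lee_fin mulr_ge0// ?invr_ge0 ?sqr_ge0 ?el_ge0.
apply: lee_nneseries => [l _ _|l _].
  by apply: nneseries_ge0 => m _ _; rewrite mule_ge0// lee_fin.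
have j0 : 0 <= (sc r0 l ^+ 2)^-1 by rewrite invr_ge0 sqr_ge0.
have -> : (\int[@lebm R]_x ((sc r0 l ^+ 2)^-1 * el l x)%:E = ((sc r0 l ^+ 2)^-1)%:E * \int[@lebm R]_x (el l x)%:E)%E.
  under eq_integral do rewrite EFinM.
  rewrite ge0_integralZl//.
  - by apply/measurable_EFinP; exact: measurable_el.
  - by move=> x _; rewrite lee_fin el_ge0.
rewrite muleA; under eq_eseriesr do rewrite muleC.
apply: nneseries_bound => [m|L]; first by rewrite mule_ge0// lee_fin.
rewrite -ge0_sume_distrr; last by move=> m _; rewrite lee_fin.
rewrite muleC; apply: lee_wpmul2r => //; rewrite sumEFin -EFinM lee_fin.
have tk : 0 <= theta H / k by rewrite divr_ge0 ?theta_ge0// ltW.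
have tk1 : theta H / k < 1 by rewrite ltr_pdivrMr// mul1r.
have qk : 0 <= 4 * 2^-1 `^ q / k by rewrite divr_ge0 ?mulr_ge0 ?powR_ge0// ltW.
have qk1 : 4 * 2^-1 `^ q / k < 1 by rewrite ltr_pdivrMr// mul1r.
rewrite (eq_bigr (fun m : 'I_L => 8 * H ^+ 4 * cq * (sc r0 l ^+ 2)^-1 * ((4 * 2^-1 `^ q / k) ^+ (m - l) * (theta H / k) ^+ (l - m)))) => [|m _]; last first.
  rewrite /c1 /wt rhoE.
  have -> : ((2 * (sc r0 l / 2 ^+ (m - l))) ^+ 2)^-1 = 4^-1 * (sc r0 l ^+ 2)^-1 * 4 ^+ (m - l).
    rewrite [4 ^+ (m - l)](_ : _ = (2 ^+ (m - l)) ^+ 2); last by rewrite -exprM mulnC exprM; congr (_ ^+ _); rewrite expr2; lra.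
    by field; rewrite gt_eqF ?expf_neq0// sc_gt0// r0_gt0.
  have scn : sc r0 l != 0 by rewrite gt_eqF// sc_gt0// r0_gt0.
  have kn : k != 0 by rewrite gt_eqF.
  move: (sc r0 l) scn => S Sn.
  rewrite !exprMn !exprVn; move: (expf_neq0 (l - m) kn) (expf_neq0 (m - l) kn).
  move: ((2^-1 `^ q) ^+ (m - l)) (theta H ^+ (l - m)) (4 ^+ (m - l)) (k ^+ (l - m)) (k ^+ (m - l)) => A B F C D Cn Dn'.
  by field; rewrite Sn Cn Dn'.
rewrite -mulr_sumr /CE mulrAC; apply: ler_wpM2r => //; apply: ler_wpM2l.
  by rewrite mulr_ge0 ?cq_ge0// mulr_ge0// exprn_ge0// ltW.
by rewrite addrC; apply: geo2.
Qed.

End dyadic_energy.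

(** * Oscillation of the Cauchy kernel on a square *)

Section kernel_bounds.
Variable R : realType.
Implicit Types (x y z w c : Pt R).

Lemma kab_le y z : `|ka y z| <= `|z - y|^-1 /\ `|kb y z| <= `|z - y|^-1.
Proof.
have [->|zy] := eqVneq z y; first by rewrite /ka /kb !subrr normr0 !mul0r oppr0 normr0 invr0.
have d0 : 0 < `|z - y| by rewrite normr_gt0 subr_eq0.
have N1 := nsq_ge (ltW d0) (lexx _); have N0 : 0 < nsq y z by apply: lt_le_trans N1; exact: exprn_gt0.
have b (a : R) : `|a| <= `|z - y| -> `|a / nsq y z| <= `|z - y|^-1.
  move=> h; rewrite normrM normfV (gtr0_norm N0) ler_pdivrMr// mulrC ler_pdivlMr//.
  by apply: le_trans N1; rewrite expr2; apply: ler_wpM2r => //; exact: ltW.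
by split; rewrite ?/kb ?normrN; apply: b; [exact: (norm_fst (z - y))|exact: (norm_snd (z - y))].
Qed.

(** The identity [1/(z-y) - 1/(z'-y) = (z'-z)/((z-y)(z'-y))], written out in real coordinates. *)
Lemma kab_diff y z z' : z != y -> z' != y ->
  `|ka y z - ka y z'| <= 4 * `|z - z'| / (`|z - y| * `|z' - y|) /\ `|kb y z - kb y z'| <= 4 * `|z - z'| / (`|z - y| * `|z' - y|).
Proof.
move=> zy zy'.
have d0 : 0 < `|z - y| by rewrite normr_gt0 subr_eq0.
have d0' : 0 < `|z' - y| by rewrite normr_gt0 subr_eq0.
have N1 := nsq_ge (ltW d0) (lexx _); have N0 : 0 < nsq y z by apply: lt_le_trans N1; exact: exprn_gt0.
have N1' := nsq_ge (ltW d0') (lexx _); have N0' : 0 < nsq y z' by apply: lt_le_trans N1'; exact: exprn_gt0.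
have a1 : `|z.1 - y.1| <= `|z - y| := norm_fst (z - y).
have a2 : `|z.2 - y.2| <= `|z - y| := norm_snd (z - y).
have b1 : `|z'.1 - y.1| <= `|z' - y| := norm_fst (z' - y).
have b2 : `|z'.2 - y.2| <= `|z' - y| := norm_snd (z' - y).
have u1 : `|z.1 - z'.1| <= `|z - z'| := norm_fst (z - z').
have u2 : `|z.2 - z'.2| <= `|z - z'| := norm_snd (z - z').
have gen (p q : R) : `|p| <= 2 * (`|z - y| * `|z' - y|) -> `|q| <= 2 * (`|z - y| * `|z' - y|) ->
    `|((z'.1 - z.1) * p + (z'.2 - z.2) * q) / (nsq y z * nsq y z')| <= 4 * `|z - z'| / (`|z - y| * `|z' - y|).
  move=> hp hq; have P0 : 0 < nsq y z * nsq y z' by exact: mulr_gt0.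
  rewrite normrM normfV (gtr0_norm P0) ler_pdivrMr//.
  apply: (@le_trans _ _ (4 * `|z - z'| * (`|z - y| * `|z' - y|))).
    apply: (le_trans (ler_normD _ _)); rewrite !normrM (distrC z'.1) (distrC z'.2).
    have := ler_pM (normr_ge0 _) (normr_ge0 _) u1 hp; have := ler_pM (normr_ge0 _) (normr_ge0 _) u2 hq.
    by set D := `|z - y| * _; lra.
  rewrite -[leRHS]mulrA; apply: ler_wpM2l; first by rewrite mulr_ge0.
  rewrite [leRHS]mulrC ler_pdivlMr ?mulr_gt0// mulrACA; apply: ler_pM; rewrite ?mulr_ge0//.
have n0 : nsq y z != 0 by rewrite gt_eqF.
have n0' : nsq y z' != 0 by rewrite gt_eqF.
have t1 (s t s' t' A B : R) : `|s| <= A -> `|t| <= A -> `|s'| <= B -> `|t'| <= B -> `|s * s' + t * t'| <= 2 * (A * B).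
  move=> h1 h2 h3 h4; apply: (le_trans (ler_normD _ _)); rewrite !normrM.
  have := ler_pM (normr_ge0 _) (normr_ge0 _) h1 h3; have := ler_pM (normr_ge0 _) (normr_ge0 _) h2 h4; lra.
split.
- rewrite (_ : ka y z - ka y z' = ((z'.1 - z.1) * ((z.1 - y.1) * (z'.1 - y.1) + (z.2 - y.2) * - (z'.2 - y.2)) +
     (z'.2 - z.2) * ((z.1 - y.1) * (z'.2 - y.2) + (z.2 - y.2) * (z'.1 - y.1))) / (nsq y z * nsq y z')).
    by apply: gen; apply: t1; rewrite ?normrN.
  by rewrite /ka; move: n0 n0'; rewrite /nsq => ? ?; field; apply/andP.
- rewrite (_ : kb y z - kb y z' = ((z'.1 - z.1) * ((z.1 - y.1) * - (z'.2 - y.2) + (z.2 - y.2) * - (z'.1 - y.1)) +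
     (z'.2 - z.2) * ((z.1 - y.1) * (z'.1 - y.1) + (z.2 - y.2) * - (z'.2 - y.2))) / (nsq y z * nsq y z')).
    by apply: gen; apply: t1; rewrite ?normrN.
  by rewrite /kb; move: n0 n0'; rewrite /nsq => ? ?; field; apply/andP.
Qed.

(** If [y] is within a few image sizes of [Psi c], the kernel itself is bounded by [gk] and the
    constants are 0. Otherwise [Psi w] stays away from [y] and the value at the centre is
    subtracted, which gains the factor [D/d]. *)
Lemma gk_kernel H (r0 s0 : R) Psi n y c : 1 <= H -> qs H Psi -> 0 < s0 ->
  exists A B : R, forall w, `|w - c| <= 2 * sc s0 n -> `|y - Psi w| <= r0 ->
  `|ka y (Psi w) - A| <= 20 * H ^+ 2 * gk r0 s0 Psi n w y /\ `|kb y (Psi w) - B| <= 20 * H ^+ 2 * gk r0 s0 Psi n w y.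
Proof.
move=> H1 hq s00; have l0 := sc_gt0 n s00; set l := sc s0 n in l0 *.
pose c' : Pt R := c + (l, 0); pose DQ := `|Psi c' - Psi c|.
have nl : `|((l, 0) : Pt R)| = l by rewrite prod_normE /= normr0 (ger0_norm (ltW l0)) max_l// ltW.
have H0 : 0 <= H by lra.
have main w : `|w - c| <= 2 * l -> [/\ `|Psi w - Psi c| <= H * Dn s0 Psi n w, `|Psi w - Psi c| <= H * DQ & DQ <= 2 * H * Dn s0 Psi n w].
  move=> wc; have e1 : `|w - hstep s0 n w| = l by rewrite /hstep opprD addNKr normrN.
  have e2 : `|c - c'| = l by rewrite /c' opprD addNKr normrN.
  have h1 : `|Psi w - Psi c| <= H * Dn s0 Psi n w by rewrite /Dn (distrC _ (Psi w)); apply: hq; rewrite e1; lra.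
  have h2 : `|Psi w - Psi c| <= H * DQ by rewrite /DQ (distrC (Psi w)) (distrC (Psi c')); apply: hq; rewrite e2 distrC; lra.
  have h3 : `|Psi w - Psi c'| <= H * Dn s0 Psi n w.
    rewrite /Dn (distrC _ (Psi w)); apply: hq; rewrite e1.
    have := ler_distD c w c'; rewrite e2; lra.
  split => //; rewrite /DQ; have := ler_distD (Psi w) (Psi c') (Psi c); rewrite (distrC (Psi c') (Psi w)); lra.
have H2 : H <= H ^+ 2 by rewrite expr2 ler_peMr.
(* [gk] contains a minimum, so both competing bounds have to be shown in each case. *)
have ge (w : Pt R) (X : R) : 0 < `|Psi w - y| -> `|y - Psi w| <= r0 ->
   X <= 20 * H ^+ 2 / `|Psi w - y| -> X <= 20 * H ^+ 2 * (Dn s0 Psi n w / `|Psi w - y|) / `|Psi w - y| -> X <= 20 * H ^+ 2 * gk r0 s0 Psi n w y.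
  move=> d0 dr h1 h2; rewrite /gk indicE mem_set ?mul1r; last by rewrite /cbx /=.
  by rewrite mulrA; case: (leP 1 (Dn s0 Psi n w / `|Psi w - y|)); rewrite ?mulr1.
have [small|big] := leP `|y - Psi c| (2 * H * DQ).
  exists 0, 0 => w wc wr; have [h1 h2 h3] := main w wc; rewrite !subr0.
  have [e|zy] := eqVneq (Psi w) y.
    by rewrite e /ka /kb !subrr !mul0r oppr0 normr0; rewrite mulr_ge0 ?gk_ge0 ?mulr_ge0 ?exprn_ge0.
  have d0 : 0 < `|Psi w - y| by rewrite normr_gt0 subr_eq0.
  have D0 : 0 <= Dn s0 Psi n w := normr_ge0 _.
  have dD : `|Psi w - y| <= 5 * H ^+ 2 * Dn s0 Psi n w.
    have := ler_distD (Psi c) (Psi w) y; rewrite (distrC (Psi c) y).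
    have := ler_wpM2l H0 h3; have := ler_wpM2r D0 H2; rewrite expr2; lra.
  have [k1 k2] := kab_le y (Psi w).
  have q1 : `|Psi w - y|^-1 <= 20 * H ^+ 2 / `|Psi w - y|.
    by rewrite -[leLHS]mul1r ler_pM2r ?invr_gt0//; lra.
  have q2 : `|Psi w - y|^-1 <= 20 * H ^+ 2 * (Dn s0 Psi n w / `|Psi w - y|) / `|Psi w - y|.
    rewrite -[leLHS]mul1r ler_pM2r ?invr_gt0// mulrA ler_pdivlMr// mul1r; apply: (le_trans dD).
    by have : 0 <= H ^+ 2 * Dn s0 Psi n w by [rewrite mulr_ge0 ?exprn_ge0]; lra.
  by split; apply: ge => //; (apply: le_trans q1 || apply: le_trans q2).
exists (ka y (Psi c)), (kb y (Psi c)) => w wc wr; have [h1 h2 h3] := main w wc.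
have u0 : 0 <= `|Psi w - Psi c| := normr_ge0 _.
have v0 : 0 < `|Psi c - y| by rewrite distrC; apply: le_lt_trans big; rewrite mulr_ge0 ?mulr_ge0 ?normr_ge0.
have a1 := ler_distD (Psi c) (Psi w) y; have a2 := ler_distD (Psi w) (Psi c) y.
rewrite (distrC (Psi c) (Psi w)) in a2; rewrite distrC in big.
have d0 : 0 < `|Psi w - y| by lra.
have n1 : Psi w != y by rewrite -subr_eq0 -normr_gt0.
have n2 : Psi c != y by rewrite -subr_eq0 -normr_gt0.
have [k1 k2] := kab_diff n1 n2.
have q1 : 4 * `|Psi w - Psi c| / (`|Psi w - y| * `|Psi c - y|) <= 20 * H ^+ 2 / `|Psi w - y|.
  rewrite invfM mulrA [leLHS]mulrAC ler_pM2r ?invr_gt0// ler_pdivrMr//.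
  by have := ler_wpM2r (ltW v0) H2; have := ler_wpM2r (ltW v0) H1; lra.
have q2 : 4 * `|Psi w - Psi c| / (`|Psi w - y| * `|Psi c - y|) <= 20 * H ^+ 2 * (Dn s0 Psi n w / `|Psi w - y|) / `|Psi w - y|.
  rewrite invfM mulrA [leLHS]mulrAC ler_pM2r ?invr_gt0// ler_pdivrMr// mulrA mulrAC ler_pdivlMr//.
  have D0 : 0 <= Dn s0 Psi n w := normr_ge0 _.
  have dv : `|Psi w - y| <= 2 * `|Psi c - y| by lra.
  have uD : `|Psi w - Psi c| <= H ^+ 2 * Dn s0 Psi n w by apply: (le_trans h1); exact: ler_wpM2r.
  have := ler_pM u0 (ltW d0) uD dv.
  have : 0 <= H ^+ 2 * Dn s0 Psi n w * `|Psi c - y| by rewrite !mulr_ge0// ?exprn_ge0// ltW.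
  lra.
by split; apply: ge => //; [apply: le_trans k1 q1|apply: le_trans k1 q2|apply: le_trans k2 q1|apply: le_trans k2 q2].
Qed.

End kernel_bounds.

(** * Bounding the mass by a sum over a cover of the image set *)

Section cover.
Variables (R : realType) (H M r0 s0 s Co : R) (Phi Psi : Pt R -> Pt R) (E : set (Pt R)).
Variables (N : nat) (n_ : nat -> nat) (c_ : nat -> Pt R).
Local Notation l j := (sc s0 (n_ j)).
Local Notation ind j := (\1_(cbx (c_ j) (2 * l j))).
Hypotheses (hS : qsp H M Phi Psi E) (H1 : 1 <= H) (s00 : 0 < s0) (s0' : 0 <= s)
  (srt : forall i j, (i <= j < N)%N -> (n_ i <= n_ j)%N)
  (ov : forall J n w, (J <= N)%N -> \sum_(i < J) (n_ i == n)%:R * \1_(cbx (c_ i) (2 * sc s0 n)) w <= Co)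
  (cov : forall x, E x -> exists2 j, (j < N)%N & `|Phi x - c_ j| <= l j / 2)
  (bnd : forall j w, (j < N)%N -> `|w - c_ j| <= 2 * l j -> `|w| < s /\ forall y, E y -> `|y - Psi w| <= r0).
Implicit Types (i j J : nat) (w y : Pt R).

Let l0 j : 0 < l j. Proof. exact: sc_gt0. Qed.

(* products of 1 - sqc: the differences Pc j - Pc (j + 1) form the partition of unity subordinate to the squares *)
Fixpoint Pc j w : R := if j is i.+1 then Pc i w * (1 - sqc (c_ i) (l i) w) else 1.
Fixpoint Pc1 j w : R := if j is i.+1 then Pc1 i w * (1 - sqc (c_ i) (l i) w) + Pc i w * (0 - sqc1 (c_ i) (l i) w) else 0.
Fixpoint Pc2 j w : R := if j is i.+1 then Pc2 i w * (1 - sqc (c_ i) (l i) w) + Pc i w * (0 - sqc2 (c_ i) (l i) w) else 0.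

Lemma Pc_C1 j : C1 (Pc j) (Pc1 j) (Pc2 j).
Proof.
elim: j => [|j ih]; first exact: C1_cst.
exact: (C1_M ih (C1_B (C1_cst 1) (sqc_C1 (c_ j) (l j)))).
Qed.

Lemma Pc_bd j w : 0 <= Pc j w <= 1.
Proof.
elim: j => [|j /andP[a b]] /=; first by rewrite ler01 lexx.
have h1 := sqc_ge0 (c_ j) (l j) w; have h2 := sqc_le1 (c_ j) (l j) w.
by rewrite mulr_ge0 ?subr_ge0//= mulr_ile1 ?subr_ge0//; lra.
Qed.

Lemma sqc_ind j w : `|sqc1 (c_ j) (l j) w| <= 2 / l j * ind j w /\ `|sqc2 (c_ j) (l j) w| <= 2 / l j * ind j w.
Proof.
rewrite indicE; case: (boolP (w \in _)) => h; rewrite ?mulr1 ?mulr0; first exact: sqc_bd.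
have [||_ -> ->] := @sqc_out _ (c_ j) (l j) w; rewrite ?normr0//.
by move: h; apply: contraNT; rewrite -ltNge => h; apply/mem_set/ltW.
Qed.

Lemma Pc_step (p P z z1 : R) : 0 <= P <= 1 -> 0 <= z <= 1 -> `|p * (1 - z) + P * (0 - z1)| <= `|p| + `|z1|.
Proof.
move=> /andP[P0 P1] /andP[z0 z1']; apply: (le_trans (ler_normD _ _)); rewrite !normrM sub0r normrN.
by apply: lerD; [apply: ler_piMr|apply: ler_piMl] => //; rewrite ger0_norm//; lra.
Qed.

Lemma Pc1_bd j w : `|Pc1 j w| <= \sum_(i < j) 2 / l i * ind i w /\ `|Pc2 j w| <= \sum_(i < j) 2 / l i * ind i w.
Proof.
elim: j => [|j [h1 h2]]; first by rewrite !big_ord0 /= normr0.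
have z : 0 <= sqc (c_ j) (l j) w <= 1 by rewrite sqc_ge0 sqc_le1.
have [g1 g2] := sqc_ind j w.
rewrite !big_ord_recr; split; (apply: le_trans (Pc_step _ _ (Pc_bd j w) z) _; exact: lerD).
Qed.

Lemma Co_ge0 : 0 <= Co.
Proof. by have := ov 0 0 (leq0n N); rewrite big_ord0; apply. Qed.

(** Squares listed before [j] are at least as large, and at each scale the overlap is at most [Co];
    the gradient bounds thus form a geometric sum dominated by the scale of [j]. This is why the
    cover is sorted by generation. *)
Lemma overlap_sum j w : (j < N)%N -> \sum_(i < j.+1) 2 / l i * ind i w <= 4 * Co / l j.
Proof.
move=> jN.
rewrite (eq_bigr (fun i : 'I_j.+1 => \sum_(n < (n_ j).+1) (2 / sc s0 n) * ((n_ i == n)%:R * \1_(cbx (c_ i) (2 * sc s0 n)) w))) => [|i _]; last first.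
  have ij : (n_ i < (n_ j).+1)%N by rewrite ltnS; apply: srt; rewrite -ltnS ltn_ord.
  rewrite (bigD1 (Ordinal ij))//= eqxx mul1r big1 ?addr0// => n /eqP nn.
  by rewrite (_ : (_ == _) = false) ?mul0r ?mulr0//; apply/eqP => e; apply: nn; apply/val_inj; rewrite /= e.
rewrite exchange_big /=.
apply: (@le_trans _ _ (\sum_(n < (n_ j).+1) 2 * Co / s0 * 2 ^+ n)).
  apply: ler_sum => n _; rewrite -mulr_sumr.
  apply: (@le_trans _ _ (2 / sc s0 n * Co)); first by apply: ler_wpM2l; [rewrite divr_ge0// ltW// sc_gt0|exact: ov].
  by rewrite /sc invfM invrK le_eqVlt; apply/orP; left; apply/eqP; ring.
have k0 : 0 <= 2 * Co / s0 by rewrite !mulr_ge0 ?Co_ge0// invr_ge0 ltW.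
have e : 4 * Co / l j = 2 * (2 * Co / s0 * 2 ^+ n_ j) by rewrite /sc invfM invrK; ring.
rewrite e (eq_bigl (fun n : 'I_(n_ j).+1 => (n <= n_ j)%N)) => [|n]; last by rewrite -ltnS ltn_ord.
apply: (@geo_top _ (fun n => (n <= n_ j)%N)) => //.
- by rewrite mulr_ge0 ?exprn_ge0.
- by move=> n nj; apply: ler_wpM2l => //; rewrite ler_weXn2l// ler1n.
Qed.

Definition et1 j w := Pc1 j w - Pc1 j.+1 w.
Definition et2 j w := Pc2 j w - Pc2 j.+1 w.

(** The difference [Pc j - Pc (j+1)] is [Pc j] times the [j]-th cutoff, so its gradient lives on the
    [j]-th dilated square and involves only cutoffs up to index [j]. *)
Lemma et_bd j w : (j < N)%N -> `|et1 j w| <= 4 * Co / l j * ind j w /\ `|et2 j w| <= 4 * Co / l j * ind j w.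
Proof.
move=> jN; rewrite /et1 /et2 /=.
have r1 (p P z z1 : R) : p - (p * (1 - z) + P * (0 - z1)) = p * z + P * z1 by ring.
rewrite !r1 indicE; case: (boolP (w \in _)) => h; rewrite ?mulr1 ?mulr0; last first.
  have [||-> -> ->] := @sqc_out _ (c_ j) (l j) w; rewrite ?mulr0 ?addr0 ?normr0//.
  by move: h; apply: contraNT; rewrite -ltNge => h; apply/mem_set/ltW.
have st (p P z z1 : R) : 0 <= P <= 1 -> 0 <= z <= 1 -> `|p * z + P * z1| <= `|p| + `|z1|.
  move=> /andP[P0 P1] /andP[z0 z1']; apply: (le_trans (ler_normD _ _)); rewrite !normrM.
  by apply: lerD; [apply: ler_piMr|apply: ler_piMl] => //; rewrite ger0_norm.
have z : 0 <= sqc (c_ j) (l j) w <= 1 by rewrite sqc_ge0 sqc_le1.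
have [g1 g2] := sqc_ind j w; have [h1 h2] := Pc1_bd j w; have := overlap_sum w jN; rewrite big_ord_recr /= => h3.
split; (apply: le_trans (st _ _ _ _ (Pc_bd j w) z) _; apply: le_trans h3; exact: lerD).
Qed.

Definition gi j y w : R := ind j w * gk r0 s0 Psi (n_ j) w y.

Lemma gi_ge0 j y w : 0 <= gi j y w.
Proof. by rewrite /gi mulr_ge0 ?gk_ge0. Qed.

Lemma measurable_gi j : measT (fun p : Pt R * Pt R => gi j p.2 p.1).
Proof.
apply: measurable_funM; first by apply: measurable_ind.
by apply: measurable_gk; exact: (qp_c' hS).
Qed.

Lemma measurable_gi1 j y : measT (gi j y).
Proof. exact: (measurableT_comp (measurable_gi j) (pair2_measurable y)). Qed.

Lemma measurable_kab y : measT (fun w => ka y (Psi w)) /\ measT (fun w => kb y (Psi w)).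
Proof.
have mP := measurable_cont22 (qp_c' hS).
have mN : measT (@nsq R y) by apply: measurable_cont2; have [] := nsq_C1 y.
have m1 (f : Pt R -> R) : continuous f -> measT (fun w => f (Psi w) / nsq y (Psi w)).
  move=> cf; apply: measurable_funM; first exact: (measurableT_comp (measurable_cont2 cf) mP).
  have -> : (fun w => (nsq y (Psi w))^-1) = (fun w => nsq y (Psi w) `^ (-1)).
    by apply/funext => w; rewrite powR_inv1// addr_ge0 ?sqr_ge0.
  exact: (measurableT_comp (measurable_powR _) (measurableT_comp mN mP)).
split; first by apply: (m1 (fun z => z.1 - y.1)); apply: ctB; [exact: ct_fst|exact: ct_cst].
by apply: measurable_funN; apply: (m1 (fun z => z.2 - y.2)); apply: ctB; [exact: ct_snd|exact: ct_cst].
Qed.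

(** [320 = 2 * 20 * 4 * 2]: two components of the kernel, the constants of [gk_kernel] and [et_bd],
    and the value 1/2 in [pairing]. *)
Definition CQ : R := 320 * H ^+ 2 * Co.

Lemma CQ_ge0 : 0 <= CQ.
Proof. by apply: mulr_ge0 Co_ge0; apply: mulr_ge0; [exact: (ler0n R 320)|exact: sqr_ge0]. Qed.

Lemma CQl_ge0 j : 0 <= CQ / 2 / l j.
Proof. by rewrite !divr_ge0 ?CQ_ge0// ltW. Qed.

(** The gradient of a compactly supported function has mean zero, so the kernel may be replaced by
    its deviation from the constants of [gk_kernel]. This turns the non-integrable size [1/d] into
    the smaller [gk]. *)
Lemma et_int j y : (j < N)%N -> E y -> (\int[@lebm R]_w (gi j y w)%:E < +oo)%E ->
  L1 s (dbarint Psi y (et1 j) (et2 j)) /\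
  ((- bint s (dbarint Psi y (et1 j) (et2 j)))%:E <= (CQ / 2 / l j)%:E * \int[@lebm R]_w (gi j y w)%:E)%E.
Proof.
move=> jN Ey fin.
have mh : measT (fun w => (gi j y w)%:E) by apply/measurable_EFinP; exact: measurable_gi1.
have le : (\int[@leb2 R]_(w in bx s) (gi j y w)%:E <= \int[@lebm R]_w (gi j y w)%:E)%E.
  rewrite -lebmE; apply: ge0_subset_integral => //; [exact: measurable_bx|by move=> w _; rewrite lee_fin gi_ge0].
have Lh : L1 s (gi j y).
  apply/integrableP; split; first exact: measurable_funS mh.
  apply: le_lt_trans fin; apply: le_trans le; rewrite le_eqVlt; apply/orP; left; apply/eqP.
  by apply: eq_integral => w _ /=; rewrite ger0_norm// gi_ge0.
have [A [B hAB]] := gk_kernel r0 (n_ j) y (c_ j) H1 (qp_q' hS) s00.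
(* [u] carries the oscillation of the kernel, [v] the subtracted constants; [v] is a combination of
   partial derivatives of a function vanishing on the boundary and integrates to 0. *)
pose u w := (ka y (Psi w) - A) * et1 j w - (kb y (Psi w) - B) * et2 j w.
pose v w := A * et1 j w - B * et2 j w.
have hC := C1_B (Pc_C1 j) (Pc_C1 j.+1); have [_ c1 c2 p1 p2] := hC.
have cv : continuous v by apply: ctB; apply: ctM => //; exact: ct_cst.
have z w : `|w| = s -> Pc j w - Pc j.+1 w = 0.
  move=> hw; rewrite /=; have [|-> _ _] := @sqc_out _ (c_ j) (l j) w (l0 j); last by rewrite subr0 mulr1 subrr.
  by rewrite leNgt; apply/negP => /ltW /(bnd jN) []; rewrite hw ltxx.
have [mk1 mk2] := measurable_kab y.
have mu' : measT u.
  by apply: measurable_funB; apply: measurable_funM; (exact: measurable_cont2 || apply: measurable_funB => //).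
have q0 := CQl_ge0 j.
have ub w : `|u w| <= CQ / 2 / l j * gi j y w.
  have [e1 e2] := et_bd w jN; rewrite /u /gi; move: e1 e2; rewrite indicE.
  case: (boolP (w \in _)) => [/set_mem h|_]; rewrite ?mulr0 ?mul0r ?mulr1 ?mul1r; last first.
    rewrite !normr_le0 => /eqP a1 /eqP a2.
    by rewrite a1 a2 !mulr0 subrr normr0.
  move=> e1 e2; have [_ /(_ y Ey) hr] := bnd jN h; have [k1 k2] := hAB w h hr.
  apply: (le_trans (ler_normB _ _)); rewrite !normrM.
  have := ler_pM (normr_ge0 _) (normr_ge0 _) k1 e1; have := ler_pM (normr_ge0 _) (normr_ge0 _) k2 e2.
  rewrite /CQ; move: (gk _ _ _ _ _ _) (l j)^-1 (H ^+ 2) => G L HH; lra.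
have Lu : L1 s u.
  by apply: (@L1_le _ s u (fun w => CQ / 2 / l j * gi j y w)) => //; [exact: measurable_funS mu'|exact: L1Z].
have Lv := L1_cont s cv.
have eq w : dbarint Psi y (et1 j) (et2 j) w = u w + v w by rewrite /dbarint /u /v; ring.
have bv : bint s v = 0.
  have L1' := L1_cont s c1; have L2' := L1_cont s c2.
  rewrite /v bintB ?bintZ//; [|exact: L1Z|exact: L1Z].
  by rewrite (bint_pdv_bd s0' p1 c1 z) (bint_pdv_bd s0' p2 c2 z) !mulr0 subrr.
split; first by apply: (@eq_L1 _ s (fun w => u w + v w)) => [w _|]; [rewrite eq|exact: L1D].
rewrite (eq_bint (g := fun w => u w + v w)) => [|w _]; last exact: eq.
rewrite bintD// bv addr0; apply: (@le_trans _ _ ((CQ / 2 / l j * bint s (gi j y))%:E)).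
  rewrite lee_fin -bintZ//; apply: le_trans (ler_norm _) _; rewrite normrN.
  apply: le_trans (bint_abs Lu) _; apply: le_bint => //; [exact: L1_abs|exact: L1Z].
by rewrite EFinM; apply: lee_wpmul2l; rewrite ?lee_fin// EFin_bint.
Qed.

(** The partition functions add up to [1 - Pc N], a cutoff equal to 1 near [Phi(E)], to which
    [pairing] applies; the sum is built up one index at a time to keep integrability. If one of the
    integrals is infinite the bound is immediate. *)
Lemma pairing_sum y : E y -> ((2^-1)%:E <= \sum_(j < N) (CQ / 2 / l j)%:E * \int[@lebm R]_w (gi j y w)%:E)%E.
Proof.
move=> Ey.
have I0 j : (0 <= \int[@lebm R]_w (gi j y w)%:E)%E by apply: integral_ge0 => w _; rewrite lee_fin gi_ge0.
have p0 := CQl_ge0.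
have t0 j : (0 <= (CQ / 2 / l j)%:E * \int[@lebm R]_w (gi j y w)%:E)%E by rewrite mule_ge0// lee_fin.
have Co1 : 0 < Co.
  have [j jN hj] := cov Ey; have := ov (n_ j) (Phi y) (leqnn N); apply: lt_le_trans.
  rewrite (bigD1 (Ordinal jN))//= eqxx mul1r ltr_pwDl//; last by apply: sumr_ge0 => i _; rewrite mulr_ge0.
  by rewrite indicE mem_set// /cbx /=; have := l0 j; lra.
have CQ0 : 0 < CQ.
  by apply: mulr_gt0 Co1; apply: mulr_gt0; [exact: (ltr0n R 320)|apply: exprn_gt0; have := H1; lra].
have [[j0 jinf]|fin] := pselect (exists j : 'I_N, \int[@lebm R]_w (gi j y w)%:E = +oo)%E.
  rewrite (bigD1 j0)//= jinf gt0_muley; last by rewrite lte_fin !divr_gt0.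
  by rewrite addye ?leey// gt_eqF// (lt_le_trans (ltNyr 0))// sume_ge0.
have {}fin j : (j < N)%N -> (\int[@lebm R]_w (gi j y w)%:E < +oo)%E.
  by move=> jN; rewrite ltey; apply/eqP => h; apply: fin; exists (Ordinal jN).
have part J : (J <= N)%N -> L1 s (dbarint Psi y (fun w => 0 - Pc1 J w) (fun w => 0 - Pc2 J w)) /\
    ((- bint s (dbarint Psi y (fun w => 0 - Pc1 J w) (fun w => 0 - Pc2 J w)))%:E <=
     \sum_(j < J) (CQ / 2 / l j)%:E * \int[@lebm R]_w (gi j y w)%:E)%E.
  elim: J => [_|J ih JN].
    have e w : dbarint Psi y (fun w0 => 0 - Pc1 0 w0) (fun w0 => 0 - Pc2 0 w0) w = 0 by rewrite /dbarint /=; ring.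
    have Lz : L1 s (fun=> 0 : R) by apply: L1_cont; exact: ct_cst.
    split; first by apply: (eq_L1 _ Lz) => w _; rewrite e.
    by rewrite (eq_bint (g := fun=> 0)) => [|w _]; [rewrite bint_cst// mul0r oppr0 big_ord0|exact: e].
  have [L2' b2] := ih (ltnW JN); have [L3 b3] := et_int JN Ey (fin J JN).
  have e w : dbarint Psi y (fun w0 => 0 - Pc1 J.+1 w0) (fun w0 => 0 - Pc2 J.+1 w0) w =
     dbarint Psi y (fun w0 => 0 - Pc1 J w0) (fun w0 => 0 - Pc2 J w0) w + dbarint Psi y (et1 J) (et2 J) w.
    by rewrite /dbarint /et1 /et2; move: (Pc1 J.+1 w) (Pc2 J.+1 w) => a b; ring.
  split; first by apply: (eq_L1 _ (L1D L2' L3)) => w _; rewrite e.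
  rewrite (eq_bint (fun w _ => e w)).
  by rewrite bintD// opprD EFinD big_ord_recr /=; apply: leeD.
have [_ b] := part N (leqnn N); apply: le_trans b; rewrite lee_fin.
(* The last square has the smallest scale; half of it is a distance from [Phi(E)] within which some
   cutoff of the cover still equals 1. *)
have d0 : 0 < sc s0 (n_ N.-1) / 2 by rewrite divr_gt0// sc_gt0.
have := pairing hS Ey (C1_B (C1_cst 1) (Pc_C1 N)) d0 s0'; rewrite div1r => pr.
rewrite lerNr; apply: pr => [w x Ex hw|w hw].
  have [j jN hj] := cov Ex.
  have ln : sc s0 (n_ N.-1) <= l j.
    by apply: sc_le; [exact: ltW|apply: srt; case: (N) jN => // n; rewrite ltnS /= => ->; rewrite ltnSn].
  have [|e _ _] := @sqc_in _ (c_ j) (l j) w (l0 j); first by have := ler_distD (Phi x) w (c_ j); lra.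
  suff -> : Pc N w = 0 by rewrite subr0.
  elim: (N) jN => // n ih; rewrite ltnS leq_eqVlt => /orP[/eqP <-|/ih /= ->]; rewrite ?mul0r//=.
  by rewrite e subrr mulr0.
suff -> : Pc N w = 1 by rewrite subrr.
have : forall J, (J <= N)%N -> Pc J w = 1 by
  elim=> //= J ih JN; rewrite ih ?(ltnW JN)//; have [|-> _ _] := @sqc_out _ (c_ J) (l J) w (l0 J); rewrite ?subr0 ?mulr1//;
  rewrite leNgt; apply/negP => /ltW /(bnd JN) []; rewrite ltNge hw.
by apply.
Qed.

Variable mu : {finite_measure set (Pt R) -> \bar R}.

(** [pairing_sum] is integrated against [mu] over [E]; Tonelli turns the inner integrals of [gk]
    over [y] into [Tn]. *)
Lemma cover_sum : (mu E <= CQ%:E * \sum_(j < N) ((l j)^-1)%:E * \int[@lebm R]_w ((ind j w)%:E * Tn r0 s0 Psi mu (n_ j) w))%E.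
Proof.
have mE : measurable E by apply: measurable_closed2; apply: compact_closed2; exact: (qp_E hS).
have I0 j y : (0 <= \int[@lebm R]_w (gi j y w)%:E)%E by apply: integral_ge0 => w _; rewrite lee_fin gi_ge0.
have p0 := CQl_ge0.
have mh j : measT (fun p : Pt R * Pt R => (gi j p.2 p.1)%:E) by apply/measurable_EFinP; exact: measurable_gi.
have mI j : measT (fun y => \int[@lebm R]_w (gi j y w)%:E)%E.
  by apply: (@measurable_int_fst R (fun p => (gi j p.2 p.1)%:E)) => // p; rewrite lee_fin gi_ge0.
have e1 j : (\int[@lebm R]_w ((ind j w)%:E * Tn r0 s0 Psi mu (n_ j) w) = \int[mu]_y \int[@lebm R]_w (gi j y w)%:E)%E.
  rewrite -(@tonelli_mu R mu (fun p => (gi j p.2 p.1)%:E)) => [|//|p]; last by rewrite lee_fin gi_ge0.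
  apply: eq_integral => w _; rewrite /Tn -ge0_integralZl.
  - by apply: eq_integral => y _; rewrite -EFinM.
  - by [].
  - by apply/measurable_EFinP; exact: (measurableT_comp (measurable_gk _ _ (qp_c' hS) _) (pair1_measurable w)).
  - by move=> y _; rewrite lee_fin gk_ge0.
  - by rewrite lee_fin.
have e2 : (mu E = \int[mu]_y (\1_E y)%:E)%E by rewrite integral_indic// setIT.
have e3 : (CQ%:E * \sum_(j < N) ((l j)^-1)%:E * \int[@lebm R]_w ((ind j w)%:E * Tn r0 s0 Psi mu (n_ j) w) =
   \int[mu]_y (2%:E * \sum_(j < N) (CQ / 2 / l j)%:E * \int[@lebm R]_w (gi j y w)%:E))%E.
  have t0 j : (0 <= ((l j)^-1)%:E * \int[@lebm R]_w ((ind j w)%:E * Tn r0 s0 Psi mu (n_ j) w))%E.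
    by rewrite e1 mule_ge0 ?lee_fin ?invr_ge0 ?(ltW (l0 j))// integral_ge0.
  rewrite ge0_sume_distrr//.
  rewrite ge0_integralZl; last 4 first.
  - by [].
  - by apply: emeasurable_sum => j; apply: measurable_funeM.
  - by move=> y _; apply: sume_ge0 => j _; rewrite mule_ge0// lee_fin.
  - by rewrite lee_fin.
  rewrite ge0_integral_sum; last 3 first.
  - by [].
  - by move=> j; apply: measurable_funeM.
  - by move=> j y _; rewrite mule_ge0// lee_fin.
  rewrite ge0_sume_distrr => [|j _]; last by apply: integral_ge0 => y _; rewrite mule_ge0// lee_fin.
  apply: eq_bigr => j _; rewrite ge0_integralZl//; last by rewrite lee_fin.
  by rewrite e1 !muleA -!EFinM; congr (_%:E * _)%E; field; rewrite gt_eqF.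
rewrite e3 e2; apply: ge0_le_integral.
- by [].
- by move=> y _; rewrite lee_fin.
- by apply/measurable_EFinP; exact: measurable_indic.
- by apply: measurable_funeM; apply: emeasurable_sum => j; apply: measurable_funeM.
move=> y _; rewrite indicE; case: (boolP (y \in E)) => [/set_mem Ey|_].
  apply: le_trans (lee_wpmul2l _ (pairing_sum Ey)) => //.
  by rewrite -EFinM mulfV.
by rewrite mule_ge0// sume_ge0// => j _; rewrite mule_ge0// lee_fin.
Qed.

End cover.

(** * Max-flow on the tree of squares, realized as a measure *)

Lemma finite_measure_of d (T : measurableType d) (R : realType) (mu : {measure set T -> \bar R}) : (mu setT < +oo)%E ->
  exists nu : {finite_measure set T -> \bar R}, forall A, nu A = mu A.
Proof. by move=> h; exists (mfrestr measurableT h) => A; exact: (congr1 mu (setIT A)). Qed.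

Lemma pushforward_finite d1 d2 (T1 : measurableType d1) (T2 : measurableType d2) (R : realType) (m : {measure set T1 -> \bar R}) (f : T1 -> T2) :
  (m setT < +oo)%E -> measT f -> exists nu : {finite_measure set T2 -> \bar R}, forall A, nu A = m (f @^-1` A).
Proof.
move=> fin mf.
pose m' : {measure set T2 -> \bar R} := measure_function_pushforward__canonical__measure_function_Measure m mf.
by have [//|nu hnu] := @finite_measure_of _ _ _ m'; exists nu.
Qed.

Section flow.
Variables (R : realType) (s0 : R) (Z : set (Pt R)) (b : nat -> nat -> R).
Hypotheses (s00 : 0 < s0) (b0 : forall n k, 0 <= b n k) (cZ : closed Z) (hZ : Z `<=` cbx 0 (s0 / 2)).
Implicit Types (n k d i j N : nat) (t : R) (x z w : Pt R) (f : nat -> R).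

Local Notation l n := (sc s0 n).

Definition S4 f k : R := f (4 * k + 0)%N + f (4 * k + 1)%N + f (4 * k + 2)%N + f (4 * k + 3)%N.

Lemma sum4 f N : \sum_(j < 4 * N) f j = \sum_(k < N) S4 f k.
Proof.
elim: N => [|N ih]; first by rewrite muln0 !big_ord0.
by rewrite mulnSr addn4 !big_ord_recr /= ih /S4 !addrA addn0 !addn1 !addn2 !addn3.
Qed.

Lemma S4_ge0 f k : (forall j, 0 <= f j) -> 0 <= S4 f k.
Proof. by move=> h; rewrite !addr_ge0. Qed.

Lemma S4_le f g k : (forall j, f j <= g j) -> S4 f k <= S4 g k.
Proof. by move=> h; rewrite !lerD. Qed.

(* centre of the k-th square of generation n; the children of k are 4k, .., 4k + 3 *)
Fixpoint cen n k : Pt R := if n is n'.+1 then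
  ((cen n' (k %/ 4)).1 + l n' / 4 * (if odd k then 1 else -1), (cen n' (k %/ 4)).2 + l n' / 4 * (if (k %% 4 < 2)%N then -1 else 1)) else 0.

Lemma half_pm (P : bool) (c : R) : 0 <= c -> `|c / 4 * (if P then 1 else -1)| <= c / 4 /\ `|c / 4 * (if P then -1 else 1)| <= c / 4.
Proof. by move=> c0; case: P; rewrite ?mulrN ?normrN mulr1 ger0_norm//; lra. Qed.

Lemma cen_step n k : `|(cen n.+1 k).1 - (cen n (k %/ 4)).1| <= l n / 4 /\ `|(cen n.+1 k).2 - (cen n (k %/ 4)).2| <= l n / 4.
Proof.
by rewrite /= !(addrC (_ (cen n _))) !addrK; split; [have [h _] := half_pm (odd k) (ltW (sc_gt0 n s00))|have [_ h] := half_pm (k %% 4 < 2)%N (ltW (sc_gt0 n s00))].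
Qed.

Lemma cbxP x r z : cbx x r z <-> `|z.1 - x.1| <= r /\ `|z.2 - x.2| <= r.
Proof. by rewrite /cbx /= prod_normE /= ge_max; split => [/andP[]|[-> ->]]. Qed.

Lemma cbx_tri (c x z : Pt R) (r s : R) : cbx c r z -> cbx x s z -> cbx x (s + r) c.
Proof. by rewrite /cbx /= => h1 h2; have := ler_distD z c x; rewrite (distrC c z); lra. Qed.

Lemma cenE n k i : (i < 4)%N ->
  cen n.+1 (4 * k + i) = ((cen n k).1 + l n / 4 * (if odd i then 1 else -1), (cen n k).2 + l n / 4 * (if (i < 2)%N then -1 else 1)).
Proof.
move=> i4 /=; rewrite (_ : ((4 * k + i) %/ 4)%N = k); last lia.
rewrite (_ : odd (4 * k + i) = odd i); last by rewrite oddD oddM.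
by rewrite (_ : ((4 * k + i) %% 4)%N = i)//; lia.
Qed.

Lemma cen_child n k z : cbx (cen n k) (l n / 2) z -> exists2 i, (i < 4)%N & cbx (cen n.+1 (4 * k + i)) (l n.+1 / 2) z.
Proof.
move=> /cbxP[]; rewrite !ler_norml => /andP[a1 a2] /andP[b1 b2].
have g (p c : R) : - (l n / 2) <= p - c -> p - c <= l n / 2 ->
    (`|p - (c + l n / 4 * 1)| <= l n.+1 / 2) \/ (`|p - (c + l n / 4 * -1)| <= l n.+1 / 2).
  by move=> h1 h2; rewrite scS !ler_norml; case: (lerP c p) => h; [left|right]; apply/andP; split; lra.
case: (g _ _ a1 a2) => h1; case: (g _ _ b1 b2) => h2.
- by exists 3%N => //; apply/cbxP; rewrite cenE.
- by exists 1%N => //; apply/cbxP; rewrite cenE.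
- by exists 2%N => //; apply/cbxP; rewrite cenE.
- by exists 0%N => //; apply/cbxP; rewrite cenE.
Qed.

Definition I1 (p c r : R) : R := (`|p - c| < r)%R%:R.
Definition osq n k z : R := I1 z.1 (cen n k).1 (l n / 2) * I1 z.2 (cen n k).2 (l n / 2).

Lemma I1_halves (p c r : R) : I1 p (c + r / 4 * 1) (r / 2 / 2) + I1 p (c + r / 4 * -1) (r / 2 / 2) <= I1 p c (r / 2).
Proof.
rewrite /I1 !ltr_norml; case: ltP => a1; case: ltP => a2; case: ltP => a3; case: ltP => a4; case: ltP => a5; case: ltP => a6; rewrite /= ?addr0 ?add0r//; lra.
Qed.

(** Disjointness of the open squares of one generation, as a bound on the sum of indicators.
    Splitting a square into four factors into splitting each side into two halves. *)
Lemma cen_disjoint n z : \sum_(k < 4 ^ n) osq n k z <= 1.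
Proof.
have I0 p c r : 0 <= I1 p c r by rewrite /I1.
have I1' p c r : I1 p c r <= 1 by rewrite /I1; case: (_ < _).
elim: n => [|n ih]; first by rewrite expn0 big_ord1 mulr_ile1.
apply: le_trans ih; rewrite expnS (sum4 (fun k => osq n.+1 k z)).
apply: ler_sum => k _; rewrite /S4 /osq !cenE//= scS.
have := ler_pM _ _ (I1_halves z.1 (cen n k).1 (l n)) (I1_halves z.2 (cen n k).2 (l n)).
rewrite !addr_ge0// => /(_ isT isT); apply: le_trans; rewrite le_eqVlt; apply/orP; left; apply/eqP; ring.
Qed.

(** Area count: squares of half side [l n / 4] about the centres in question have total area at most
    that of the square of half side [r l n + l n / 4] containing them. *)
Lemma cen_overlap n w (r : R) : 0 <= r -> \sum_(k < 4 ^ n) (\1_(cbx w (r * l n)) (cen n k) : R) <= (4 * r + 1) ^+ 2.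
Proof.
move=> r0; have L := sc_gt0 n s00.
have q0 : 0 <= l n / 4 by lra.
have mi c s : measT (fun z : Pt R => (\1_(cbx c s) z)%:E : \bar R).
  by apply/measurable_EFinP; exact: measurable_1cbx.
have i c s : 0 <= s -> (\int[@lebm R]_z (\1_(cbx c s) z)%:E = ((2 * s) ^+ 2)%:E)%E.
  by move=> hs; rewrite integral_indic; [rewrite setIT; exact: leb2_cbx|exact: measurableT|exact: measurable_cbx].
have : ((\sum_(k < 4 ^ n) (\1_(cbx w (r * l n)) (cen n k) * (l n / 2) ^+ 2))%:E <= ((2 * (r * l n + l n / 4)) ^+ 2)%:E)%E.
  rewrite -(i w (r * l n + l n / 4)); last by rewrite addr_ge0// mulr_ge0// ltW.
  have -> : ((\sum_(k < 4 ^ n) (\1_(cbx w (r * l n)) (cen n k) * (l n / 2) ^+ 2))%:E =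
      \int[@lebm R]_z (\sum_(k < 4 ^ n) (\1_(cbx w (r * l n)) (cen n k))%:E * (\1_(cbx (cen n k) (l n / 4)) z)%:E))%E.
    rewrite -(big_mkord xpredT (fun k => \1_(cbx w (r * l n)) (cen n k) * (l n / 2) ^+ 2)) -sumEFin.
    under eq_integral do rewrite -(big_mkord xpredT (fun k => ((\1_(cbx w (r * l n)) (cen n k))%:E * (\1_(cbx (cen n k) (l n / 4)) _)%:E)%E)).
    rewrite ge0_integral_sum; [|by []|by move=> k; apply: measurable_funeM; exact: mi|by move=> k z _; rewrite mule_ge0// lee_fin].
    apply: eq_bigr => k _; rewrite ge0_integralZl; [|by []|exact: mi|by move=> z _; rewrite lee_fin|by rewrite lee_fin].
    by rewrite i// -EFinM; congr (_ * _ ^+ 2)%:E; field.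
  apply: ge0_le_integral.
  - by [].
  - by move=> z _; apply: sume_ge0 => k _; rewrite mule_ge0// lee_fin.
  - by apply: emeasurable_sum => k; apply: measurable_funeM; exact: mi.
  - exact: mi.
  move=> z _; under eq_bigr do rewrite -EFinM.
  rewrite sumEFin lee_fin.
  apply: (@le_trans _ _ (\sum_(k < 4 ^ n) \1_(cbx w (r * l n + l n / 4)) z * osq n k z)).
    apply: ler_sum => k _; rewrite /osq /I1 !indicE.
    case: (boolP (cen n k \in _)) => [/set_mem|_]; last by rewrite mul0r !mulr_ge0.
    case: (boolP (z \in cbx (cen n k) _)) => [/set_mem|_]; last by rewrite mulr0 !mulr_ge0.
    move=> h1 h2; rewrite mem_set; last by move: h1 h2; rewrite /cbx /=; have := ler_distD (cen n k) z w; lra.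
    have /cbxP[g1 g2] := h1.
    have L2 : l n / 4 < l n / 2 by lra.
    by rewrite (le_lt_trans g1 L2) (le_lt_trans g2 L2) !mulr1.
  rewrite -mulr_sumr -[leRHS]mulr1; apply: ler_wpM2l => //; exact: cen_disjoint.
rewrite lee_fin -mulr_suml (_ : 2 * (r * l n + l n / 4) = (4 * r + 1) * (l n / 2)); last by field.
have h2 : 0 < (l n / 2) ^+ 2 by apply: exprn_gt0; lra.
by rewrite [((_ + 1) * _) ^+ 2]exprMn (ler_pM2r h2).
Qed.

Definition meets n k := `[< exists z, Z z /\ cbx (cen n k) (l n / 2) z >].
(** Squares that miss [Z] get capacity 0; this forces the resulting measure to live on [Z]. *)
Definition bZ n k : R := if meets n k then b n k else 0.
(** The minimal cut: the least cost of separating the [k]-th square of generation [n] from its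
    descendants by cutting at most [d] generations below it. It decreases in [d], and [cm] is its
    limit. *)
Fixpoint cont d n k : R := if d is d'.+1 then Num.min (bZ n k) (S4 (cont d' n.+1) k) else bZ n k.
Definition cm n k : R := limn (fun d => cont d n k).

Lemma bZ_ge0 n k : 0 <= bZ n k. Proof. by rewrite /bZ; case: ifP. Qed.

Lemma cont_ge0 d n k : 0 <= cont d n k.
Proof. by elim: d n k => [|d ih] n k /=; rewrite ?le_min bZ_ge0//= S4_ge0. Qed.

Lemma cont_decr d n k : cont d.+1 n k <= cont d n k.
Proof.
elim: d n k => [|d ih] n k; first by rewrite /= ge_min lexx.
rewrite [cont d.+2 _ _]/= [cont d.+1 n k]/= le_min !ge_min lexx /=; apply/orP; right.
by apply: S4_le => j; exact: ih.
Qed.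

Lemma cm_cvg n k : (fun d => cont d n k) @ \oo --> cm n k.
Proof.
apply: nonincreasing_is_cvgn; first by apply/nonincreasing_seqP => d; exact: cont_decr.
by exists 0 => _ [d _ <-]; exact: cont_ge0.
Qed.

Lemma cm_ge0 n k : 0 <= cm n k.
Proof. by apply: limr_ge; [exact: cm_cvg|near=> d; exact: cont_ge0]. Unshelve. all: by end_near. Qed.

Lemma cm_le d n k : cm n k <= cont d n k.
Proof.
apply: (@nonincreasing_cvgn_ge _ (fun d => cont d n k)); last exact: cm_cvg.
by apply/nonincreasing_seqP => e; exact: cont_decr.
Qed.

(** In the limit the cut value of a node is at most that of its children together, so any admissible
    flow into the node can be passed on. *)
Lemma cm_S4 n k : cm n k <= S4 (cm n.+1) k.
Proof.
have c1 : (fun d => cont d.+1 n k) @ \oo --> cm n k by rewrite (cvg_shiftS (fun d => cont d n k)); exact: cm_cvg.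
have c2 : (fun d => S4 (cont d n.+1) k) @ \oo --> S4 (cm n.+1) k by rewrite /S4; repeat (apply: cvgD); exact: cm_cvg.
by apply: (ler_cvg_to c1 c2); near=> d; rewrite /= ge_min lexx orbT.
Unshelve. all: by end_near. Qed.

(** The maximal flow: each node shares its mass among its children in proportion to their cut
    values. If these are all 0 the quotient is 0 by convention, and the mass of the node is then 0
    as well. *)
Fixpoint fl n k : R := if n is n'.+1 then fl n' (k %/ 4) * cm n k / S4 (cm n) (k %/ 4) else cm 0 0.

Lemma fl_ge0 n k : 0 <= fl n k.
Proof. by elim: n k => [|n ih] k /=; rewrite ?cm_ge0// !mulr_ge0 ?invr_ge0 ?S4_ge0 ?cm_ge0// => j; exact: cm_ge0. Qed.

Lemma fl_le n k : (k < 4 ^ n)%N -> fl n k <= cm n k.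
Proof.
elim: n k => [|n ih] k; first by rewrite expn0 ltnS leqn0 => /eqP ->.
rewrite expnS => kn /=; have k4 : (k %/ 4 < 4 ^ n)%N by rewrite ltn_divLR// mulnC.
have h := le_trans (ih _ k4) (cm_S4 n (k %/ 4)); set S := S4 _ _ in h *.
have S0 : 0 <= S by apply: S4_ge0 => j; exact: cm_ge0.
move: S0; rewrite le_eqVlt => /orP[/eqP <-|S0]; first by rewrite invr0 mulr0 cm_ge0.
by rewrite ler_pdivrMr// mulrC; apply: ler_wpM2l => //; exact: cm_ge0.
Qed.

Lemma fl_S4 n k : (k < 4 ^ n)%N -> S4 (fl n.+1) k = fl n k.
Proof.
move=> kn; have e i : (i < 4)%N -> fl n.+1 (4 * k + i) = fl n k * cm n.+1 (4 * k + i) / S4 (cm n.+1) k.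
  by move=> i4 /=; rewrite (_ : ((4 * k + i) %/ 4)%N = k)//; lia.
rewrite {1}/S4 !e//.
have S0 : 0 <= S4 (cm n.+1) k by apply: S4_ge0 => j; exact: cm_ge0.
move: S0; rewrite le_eqVlt => /orP[/eqP S0|S0].
  rewrite -S0 invr0 !mulr0 !addr0; apply/esym/eqP; rewrite eq_le fl_ge0 andbT S0.
  exact: le_trans (fl_le kn) (cm_S4 _ _).
by rewrite -!mulrDl -!mulrDr -/(S4 _ _) mulfK// gt_eqF.
Qed.

Definition Lf n k : R := \sum_(j < k) fl n j.

Lemma Lf_le n j k : (j <= k)%N -> Lf n j <= Lf n k.
Proof.
elim: k => [|k ih]; first by rewrite leqn0 => /eqP ->.
rewrite leq_eqVlt => /orP[/eqP ->//|/ih h]; rewrite /Lf big_ord_recr /= -[leLHS]addr0; apply: lerD => //; exact: fl_ge0.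
Qed.

Lemma Lf4 n k : (k <= 4 ^ n)%N -> Lf n.+1 (4 * k) = Lf n k.
Proof. by move=> kn; rewrite /Lf sum4; apply: eq_bigr => j _; rewrite fl_S4// (leq_trans _ kn). Qed.

Lemma Lf_tot n : Lf n (4 ^ n) = cm 0 0.
Proof. by elim: n => [|n ih]; [rewrite /Lf expn0 big_ord1|rewrite expnS Lf4]. Qed.

(** Consecutive intervals of lengths [fl n k] give nested partitions of [[0, cm 0 0[]. The measure
    is the image of Lebesgue measure under the map that follows the nested squares, so no set
    function has to be extended from squares to Borel sets. *)
Definition In n k t := Lf n k <= t < Lf n k.+1.

Lemma In_parent n k t : (k < 4 ^ n.+1)%N -> In n.+1 k t -> In n (k %/ 4) t /\ (k %/ 4 < 4 ^ n)%N.
Proof.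
rewrite expnS => kn /andP[h1 h2]; have k4 : (k %/ 4 < 4 ^ n)%N by rewrite ltn_divLR// mulnC.
split => //; rewrite /In -(Lf4 (ltnW k4)) -(Lf4 k4); apply/andP; split.
  by apply: le_trans h1; apply: Lf_le; lia.
by apply: lt_le_trans h2 _; apply: Lf_le; lia.
Qed.

Lemma In_ex n t : 0 <= t < cm 0 0 -> exists2 k, (k < 4 ^ n)%N & In n k t.
Proof.
move=> /andP[t0 tM]; have ex : exists k, (k < 4 ^ n)%N && (t < Lf n k.+1).
  have p : (0 < 4 ^ n)%N by rewrite expn_gt0.
  by exists (4 ^ n).-1; rewrite !prednK// leqnn Lf_tot.
case: (ex_minnP ex) => k /andP[kn tk] hm; exists k => //; rewrite /In tk andbT.
case: k kn tk hm => [|k] kn tk hm; first by rewrite /Lf big_ord0.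
by rewrite leNgt; apply/negP => h; have := hm k; rewrite h (ltnW kn) ltnn => /(_ isT).
Qed.

Lemma In_uniq n j k t : In n j t -> In n k t -> j = k.
Proof.
have h (a c : nat) : In n a t -> In n c t -> (a <= c)%N.
  move=> /andP[a1 _] /andP[_ c2]; rewrite leqNgt; apply/negP => ca.
  by have := le_lt_trans (le_trans (Lf_le n ca) a1) c2; rewrite ltxx.
by move=> hj hk; apply/eqP; rewrite eqn_leq !h.
Qed.

Lemma In_dom n k t : (k < 4 ^ n)%N -> In n k t -> 0 <= t < cm 0 0.
Proof.
move=> kn /andP[h1 h2]; apply/andP; split.
  by apply: le_trans h1; apply: sumr_ge0 => j _; exact: fl_ge0.
by rewrite -(Lf_tot n); apply: lt_le_trans h2 _; exact: Lf_le.
Qed.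

Section coordinate.
Variable pr : Pt R -> R.
Hypothesis hpr : forall n k, `|pr (cen n.+1 k) - pr (cen n (k %/ 4))| <= l n / 4.

Definition Xc n t : R := \sum_(k < 4 ^ n) (In n k t)%:R * pr (cen n k).
(** On [[0, cm 0 0[] the terms are the lower edges of the nested squares, which increase with [n];
    outside, [Xc] is 0 and the limit is 0. *)
Definition gam t : R := limn (fun n => Xc n t - l n / 2).

Lemma XcE n k t : (k < 4 ^ n)%N -> In n k t -> Xc n t = pr (cen n k).
Proof.
move=> kn h; rewrite /Xc (bigD1 (Ordinal kn))//= h mul1r big1 ?addr0// => j /eqP jk.
case: (boolP (In n j t)) => [h'|_]; last by rewrite mul0r.
by case: jk; apply/val_inj; exact: In_uniq h' h.
Qed.

Lemma Xc0 n t : ~ (0 <= t < cm 0 0) -> Xc n t = 0.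
Proof.
move=> h; rewrite /Xc big1// => k _; case: (boolP (In n k t)) => [h'|_]; last by rewrite mul0r.
by case: h; exact: In_dom h'.
Qed.

Lemma Xc_step n t : `|Xc n.+1 t - Xc n t| <= l n / 4.
Proof.
have [h|/negP h] := boolP (0 <= t < cm 0 0); last by rewrite !Xc0// subrr normr0 divr_ge0// ltW// sc_gt0.
have [k kn hk] := In_ex n.+1 h; have [hp kp] := In_parent kn hk.
by rewrite (XcE kn hk) (XcE kp hp).
Qed.

Lemma Xc_mono n N t : (n <= N)%N -> Xc n t - l n / 2 <= Xc N t - l N / 2 /\ Xc N t + l N / 2 <= Xc n t + l n / 2.
Proof.
elim: N => [|N ih]; first by rewrite leqn0 => /eqP ->.
rewrite leq_eqVlt => /orP[/eqP ->//|/ih[h1 h2]]; have := Xc_step N t; rewrite ler_norml scS => /andP[a1 a2].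
split; lra.
Qed.

Lemma gam_cvg t : (fun n => Xc n t - l n / 2) @ \oo --> gam t.
Proof.
apply: nondecreasing_is_cvgn; first by move=> n N nN; have [] := Xc_mono t nN.
exists (Xc 0 t + l 0%N / 2) => _ [n _ <-]; have [_] := Xc_mono t (leq0n n); have := sc_gt0 n s00; lra.
Qed.

Lemma gam_near n t : `|gam t - Xc n t| <= l n / 2.
Proof.
rewrite ler_norml; apply/andP; split.
  rewrite lerBrDr addrC; apply: limr_ge; [exact: gam_cvg|near=> N].
  have nN : (n <= N)%N by near: N; exact: nbhs_infty_ge.
  by have [] := Xc_mono t nN.
rewrite lerBlDr addrC; apply: limr_le; [exact: gam_cvg|near=> N].
have nN : (n <= N)%N by near: N; exact: nbhs_infty_ge.
have [_] := Xc_mono t nN; have := sc_gt0 N s00; lra.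
Unshelve. all: by end_near. Qed.

Lemma measurable_In n k : measurable [set t : measurableTypeR R | In n k t].
Proof. by rewrite (_ : [set _ | _] = `[Lf n k, Lf n k.+1[%classic)//; apply/seteqP; split => t; rewrite /= in_itv. Qed.

Lemma measurable_gam : measT (gam : measurableTypeR R -> R).
Proof.
apply: (@measurable_fun_cvg _ _ R setT (fun n t => Xc n t - l n / 2)) => [n|t _]; last exact: gam_cvg.
apply: measurable_funB => //; apply: measurable_sum => k; apply: measurable_funM => //.
have -> : (fun t => (In n k t)%:R : R) = \1_[set t | In n k t].
  by apply/funext => t; rewrite indicE; congr (nat_of_bool _)%:R; apply/idP/idP => [/mem_set|/set_mem].
by apply: measurable_indic; exact: measurable_In.
Qed.

End coordinate.

Definition gamma t : Pt R := (gam (fun z => z.1) t, gam (fun z => z.2) t).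

Lemma measurable_gamma : measT (gamma : measurableTypeR R -> Pt R).
Proof.
apply/measurable_fun_pairP; split.
  by apply: (@measurable_gam (fun z => z.1)) => n k; have [] := cen_step n k.
by apply: (@measurable_gam (fun z => z.2)) => n k; have [] := cen_step n k.
Qed.

Lemma gamma_near n k t : (k < 4 ^ n)%N -> In n k t -> cbx (cen n k) (l n / 2) (gamma t).
Proof.
move=> kn h; apply/cbxP; split.
  by rewrite -(XcE (fun z => z.1) kn h); apply: gam_near => m j; have [] := cen_step m j.
by rewrite -(XcE (fun z => z.2) kn h); apply: gam_near => m j; have [] := cen_step m j.
Qed.

Local Notation m1 := (@lebesgue_measure R).

Lemma leb_In n k : m1 [set t | In n k t] = (fl n k)%:E.
Proof.
have -> : [set t | In n k t] = `[Lf n k, Lf n k.+1[%classic by apply/seteqP; split => t; rewrite /= in_itv.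
have e : Lf n k.+1 = Lf n k + fl n k by rewrite /Lf big_ord_recr.
rewrite lebesgue_measure_itv /= lte_fin; case: ltP => h; first by rewrite -EFinB e addrAC subrr add0r.
by congr (_%:E); apply/eqP; rewrite eq_le fl_ge0/=; move: h; rewrite e; lra.
Qed.

(** At each generation the interval containing [t] has positive length, so its square has positive
    capacity and meets [Z]. The squares shrink to [gamma t], and [Z] is closed. *)
Lemma gamma_Z t : 0 <= t < cm 0 0 -> Z (gamma t).
Proof.
move=> ht; apply: contrapT => nZ.
have : nbhs (gamma t) (~` Z) by apply: open_nbhs_nbhs; split => //; exact: closed_openC.
rewrite -nbhs_ballE => -[e /= e0 he].
have [n hn] := @exp_small R 2^-1 (e / s0) ltac:(lra) ltac:(lra) ltac:(by rewrite divr_gt0).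
have le : l n < e by rewrite /sc -exprVn mulrC -ltr_pdivlMr.
have [k kn hk] := In_ex n ht.
have nm : meets n k = false.
  apply/negP => /asboolP[z [Zz hz]]; apply: (he z _ Zz).
  rewrite -ball_normE /=; apply: le_lt_trans le; have h := gamma_near kn hk.
  by have := ler_distD (cen n k) (gamma t) z; move: h hz; rewrite /cbx /= (distrC z); lra.
have : fl n k <= 0 by apply: (le_trans (fl_le kn)); apply: (le_trans (cm_le 0 n k)); rewrite /= /bZ nm.
by move: hk; rewrite /In /Lf big_ord_recr /= => /andP[h1 h2] h3; move: h1 h2 h3; set S := \sum_(i < k) _; lra.
Qed.

(** When [gamma t] lies in a given ball, the square of generation [n] assigned to [t] has its centre
    within [l n / 2] of that ball. The preimage is thus covered by the corresponding intervals, of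
    length [fl n k <= bZ n k]. *)
Lemma flow_measure : exists nu : {finite_measure set (Pt R) -> \bar R},
  [/\ nu setT = (cm 0 0)%:E, nu (~` Z) = 0%E &
   forall n x r, (nu (cbx x r) <= (\sum_(k < 4 ^ n) \1_(cbx x (r + l n / 2)) (cen n k) * bZ n k)%:E)%E].
Proof.
pose D : set (measurableTypeR R) := `[(0 : R), cm 0 0[%classic.
have mD : measurable D by exact: measurable_itv.
have eT : mrestr m1 mD setT = m1 D := congr1 m1 (setTI D).
have [|nu hnu] := @pushforward_finite _ _ _ _ _ (mrestr m1 mD) gamma _ measurable_gamma.
  have h0 : (m1 D < +oo)%E by rewrite /D lebesgue_measure_itv /=; case: ifP => _; rewrite -?EFinB ltry.
  exact: (eq_ind_r (fun v => (v < +oo)%E) h0 eT).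
exists nu; split.
- have -> : nu setT = m1 D by rewrite hnu; exact: eT.
  rewrite /D lebesgue_measure_itv /= lte_fin; case: ltP => [_|h].
    by rewrite -EFinB subr0.
  by congr (_%:E); apply/eqP; rewrite eq_le h cm_ge0.
- have e0 : gamma @^-1` (~` Z) `&` D = set0.
    by apply/seteqP; split => [t []|//]; rewrite /D /= in_itv/= => h /gamma_Z.
  rewrite hnu; exact: (etrans (congr1 m1 e0) (measure0 m1)).
move=> n x r; rewrite hnu.
pose A := gamma @^-1` cbx x r `&` D.
have mA : measurable A.
  by apply: measurableI => //; rewrite -[X in measurable X]setTI; apply: measurable_gamma => //; exact: measurable_cbx.
rewrite [leLHS](_ : _ = m1 A)//.
have iI k : (m1 [set t | In n k t] = \int[m1]_t ((In n k t)%:R)%:E)%E.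
  have -> : (m1 [set t | In n k t] = \int[m1]_t (\1_[set t | In n k t] t)%:E)%E.
    by rewrite integral_indic// ?setIT//; exact: measurable_In.
  by apply: eq_integral => t _; rewrite indicE; congr (_%:R%:E); congr nat_of_bool; apply/idP/idP => [/set_mem|/mem_set].
have mI k : measT (fun t : measurableTypeR R => ((In n k t)%:R)%:E : \bar R).
  apply/measurable_EFinP; have -> : (fun t => (In n k t)%:R : R) = \1_[set t | In n k t].
    by apply/funext => t; rewrite indicE; congr (nat_of_bool _)%:R; apply/idP/idP => [/mem_set|/set_mem].
  by apply: measurable_indic; exact: measurable_In.
apply: (@le_trans _ _ (\sum_(k < 4 ^ n) (\1_(cbx x (r + l n / 2)) (cen n k) * fl n k)%:E)%E); last first.
  rewrite sumEFin lee_fin; apply: ler_sum => k _; apply: ler_wpM2l => //.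
  by apply: (le_trans (fl_le (ltn_ord k))); exact: (cm_le 0).
have -> : (\sum_(k < 4 ^ n) (\1_(cbx x (r + l n / 2)) (cen n k) * fl n k)%:E =
   \int[m1]_t (\sum_(k < 4 ^ n) (\1_(cbx x (r + l n / 2)) (cen n k))%:E * ((In n k t)%:R)%:E))%E.
  rewrite -(big_mkord xpredT (fun k => (\1_(cbx x (r + l n / 2)) (cen n k) * fl n k)%:E)).
  under eq_integral do rewrite -(big_mkord xpredT (fun k => ((\1_(cbx x (r + l n / 2)) (cen n k))%:E * ((In n k _)%:R)%:E)%E)).
  rewrite ge0_integral_sum; [|by []|by move=> k; apply: measurable_funeM; exact: mI|by move=> k z _; rewrite mule_ge0// lee_fin].
  apply: eq_bigr => k _; rewrite ge0_integralZl; [|by []|exact: mI|by move=> z _; rewrite lee_fin|by rewrite lee_fin].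
  by rewrite -iI leb_In EFinM.
have -> : (m1 A = \int[m1]_t (\1_A t)%:E)%E by rewrite integral_indic// setIT.
apply: ge0_le_integral.
- by [].
- by move=> t _; rewrite lee_fin.
- by apply/measurable_EFinP; exact: measurable_indic.
- by apply: emeasurable_sum => k; apply: measurable_funeM; exact: mI.
move=> t _; rewrite indicE; case: (boolP (t \in A)) => [/set_mem[h1 h2]|_]; last first.
  by apply: sume_ge0 => k _; rewrite mule_ge0// lee_fin.
have ht : 0 <= t < cm 0 0 by move: h2; rewrite /D /= in_itv.
have [k kn hk] := In_ex n ht; rewrite (bigD1 (Ordinal kn))//= hk mule1.
rewrite -[leLHS]adde0; apply: leeD; last by apply: sume_ge0 => j _; rewrite mule_ge0// lee_fin.
rewrite lee_fin indicE mem_set//; have h := gamma_near kn hk.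
exact: cbx_tri h h1.
Qed.

(** Following the smaller of the two terms in [cont] at each node produces a cover realizing the
    cut. A square missing [Z] contributes the empty list, in accordance with [bZ]. *)
Lemma cover_list d n k : (k < 4 ^ n)%N -> exists F : seq (nat * nat),
  [/\ all (fun p => p.2 < 4 ^ p.1)%N F,
   forall z, Z z -> cbx (cen n k) (l n / 2) z -> exists2 p, p \in F & cbx (cen p.1 p.2) (l p.1 / 2) z &
   \sum_(p <- F) b p.1 p.2 <= cont d n k].
Proof.
have base n1 k1 : (k1 < 4 ^ n1)%N -> exists F : seq (nat * nat),
  [/\ all (fun p => p.2 < 4 ^ p.1)%N F,
   forall z, Z z -> cbx (cen n1 k1) (l n1 / 2) z -> exists2 p, p \in F & cbx (cen p.1 p.2) (l p.1 / 2) z &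
   \sum_(p <- F) b p.1 p.2 <= bZ n1 k1].
  move=> k1n; rewrite /bZ; case: (boolP (meets n1 k1)) => [_|hm].
    exists [:: (n1, k1)]; split; [by rewrite /= k1n|by move=> z _ hz; exists (n1, k1); rewrite ?mem_seq1|by rewrite big_seq1].
  by exists [::]; split=> [//|z Zz hz|]; [case/negP: hm; apply/asboolP; exists z|rewrite big_nil].
elim: d n k => [|d ih] n k kn /=; first exact: base.
case: (lerP (bZ n k) (S4 (cont d n.+1) k)) => h; first exact: base.
have kk i : (i < 4)%N -> (4 * k + i < 4 ^ n.+1)%N by rewrite expnS; lia.
have [F0 [a0 z0 s0']] := ih n.+1 (4 * k + 0)%N (kk 0%N isT).
have [F1 [a1 z1 s1']] := ih n.+1 (4 * k + 1)%N (kk 1%N isT).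
have [F2 [a2 z2 s2']] := ih n.+1 (4 * k + 2)%N (kk 2%N isT).
have [F3 [a3 z3 s3']] := ih n.+1 (4 * k + 3)%N (kk 3%N isT).
exists (F0 ++ F1 ++ F2 ++ F3); split; first by rewrite !all_cat a0 a1 a2.
  move=> z Zz /cen_child[i i4 hz].
  case: i i4 hz => [_ /(z0 z Zz)|[_ /(z1 z Zz)|[_ /(z2 z Zz)|[_ /(z3 z Zz)|//]]]] [p pF hp];
    by exists p => //; rewrite !mem_cat pF ?orbT.
by rewrite !big_cat /= /S4 !addrA !lerD.
Qed.

(** Max-flow min-cut duality: the flow is at least what every finite cover costs. Sorting the cover
    by generation leaves its cost unchanged and removing duplicates can only lower it, so both may
    be assumed, as [cover_sum] needs. *)
Lemma cm_lower (c : R) :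
  (forall F : seq (nat * nat), uniq F -> sorted (fun p p' => p.1 <= p'.1)%N F -> all (fun p => p.2 < 4 ^ p.1)%N F ->
    (forall z, Z z -> exists2 p, p \in F & cbx (cen p.1 p.2) (l p.1 / 2) z) -> c <= \sum_(p <- F) b p.1 p.2) -> c <= cm 0 0.
Proof.
move=> h; apply: limr_ge; first exact: cm_cvg.
near=> d; have [F [aF zF sF]] := @cover_list d 0 0 isT.
apply: le_trans sF; pose le := fun p p' : nat * nat => (p.1 <= p'.1)%N.
pose G := sort le (undup F).
have pG : perm_eq G (undup F) by rewrite /G perm_sort.
have mG p : (p \in G) = (p \in F) by rewrite (perm_mem pG) mem_undup.
apply: (@le_trans _ _ (\sum_(p <- G) b p.1 p.2)).
  apply: h.
  - by rewrite (perm_uniq pG) undup_uniq.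
  - by apply: sort_sorted => p p'; exact: leq_total.
  - by apply/allP => p; rewrite mG; move/allP: aF; apply.
  - move=> z Zz; have [|p pF hp] := zF z Zz; first by rewrite /sc expr0 divr1; exact: hZ.
    by exists p => //; rewrite mG.
rewrite (perm_big _ pG) /=; elim: (F) => // p F' ih /=; case: ifP => _; rewrite ?big_cons ?lerD2l//.
by apply: (le_trans ih); rewrite lerDr.
Unshelve. all: by end_near. Qed.

End flow.

(** * Jensen's inequality for extended nonnegative functions *)

Section jensen.
Variable R : realType.
Implicit Types (x w : Pt R).

(** Young's inequality with a free parameter [c] is integrated over the square and [c] is then
    optimized. It also shows that the integral of [T] is finite once that of [T^q] is. *)
Lemma jensen (q r : R) x (T : Pt R -> \bar R) : 1 < q -> 0 < r -> measT T -> (forall w, (0 <= T w)%E) ->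
  ((\int[@lebm R]_w ((\1_(cbx x r) w)%:E * T w)) `^ q <= (((2 * r) ^+ 2) `^ (q - 1))%:E * \int[@lebm R]_w ((\1_(cbx x r) w)%:E * T w `^ q))%E.
Proof.
move=> q1 r0 mT T0; have q0 : 0 < q by lra.
have mi : measT (fun w : Pt R => (\1_(cbx x r) w)%:E : \bar R).
  by apply/measurable_EFinP; exact: measurable_1cbx.
have mTq : measT (fun w => T w `^ q)%E by apply: (measurableT_comp (measurable_poweR _)).
set X := (\int[@lebm R]_w ((\1_(cbx x r) w)%:E * T w))%E; set Y := (\int[@lebm R]_w ((\1_(cbx x r) w)%:E * T w `^ q))%E.
set B := (2 * r) ^+ 2; have B0 : 0 < B by rewrite exprn_gt0// mulr_gt0.
have Y0 : (0 <= Y)%E by apply: integral_ge0 => w _; rewrite mule_ge0 ?lee_fin ?poweR_ge0.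
have X0 : (0 <= X)%E by apply: integral_ge0 => w _; rewrite mule_ge0 ?lee_fin.
pose q' := q / (q - 1).
have q'0 : 0 < q' by rewrite divr_gt0//; lra.
have qq : q^-1 + q'^-1 = 1 by rewrite /q' invf_div; field; rewrite gt_eqF.
have young (c : R) : 0 < c -> (c%:E * X <= q^-1%:E * Y + (c `^ q' / q' * B)%:E)%E.
  move=> c0.
  have -> : (c%:E * X = \int[@lebm R]_w (c%:E * ((\1_(cbx x r) w)%:E * T w)))%E.
    rewrite ge0_integralZl; [by []|exact: measurableT|by apply: emeasurable_funM|by move=> w _; rewrite mule_ge0 ?lee_fin|by rewrite lee_fin ltW].
  have -> : (q^-1%:E * Y + (c `^ q' / q' * B)%:E = \int[@lebm R]_w (q^-1%:E * ((\1_(cbx x r) w)%:E * T w `^ q) + (c `^ q' / q')%:E * (\1_(cbx x r) w)%:E))%E.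
    have c'0 : 0 <= c `^ q' / q' by rewrite divr_ge0 ?powR_ge0// ltW.
    have i0 : 0 <= q^-1 by rewrite invr_ge0 ltW.
    rewrite ge0_integralD; last 5 first.
    - by [].
    - by move=> w _; rewrite !mule_ge0 ?lee_fin ?poweR_ge0.
    - by apply: measurable_funeM; apply: emeasurable_funM.
    - by move=> w _; rewrite mule_ge0 ?lee_fin.
    - by apply: measurable_funeM.
    rewrite ge0_integralZl; [|by []|by apply: emeasurable_funM|by move=> w _; rewrite mule_ge0 ?lee_fin ?poweR_ge0|by rewrite lee_fin].
    rewrite ge0_integralZl; [|by []|by []|by move=> w _; rewrite lee_fin|by rewrite lee_fin].
    rewrite integral_indic; [|by []|exact: measurable_cbx].
    by rewrite setIT [X in (_ + _ * X)%E](leb2_cbx x (ltW r0)) -EFinM.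
  apply: ge0_le_integral.
  - by [].
  - by move=> w _; rewrite !mule_ge0 ?lee_fin// ltW.
  - by apply: measurable_funeM; apply: emeasurable_funM.
  - by apply: emeasurable_funD; [apply: measurable_funeM; apply: emeasurable_funM|apply: measurable_funeM].
  move=> w _; rewrite indicE; case: (_ \in _); last by rewrite !mul0e !mule0 addr0.
  rewrite !mul1e mule1; have := T0 w; case: (T w) => [t| |] // t0.
    rewrite poweR_EFin -!EFinM -EFinD lee_fin mulrC [_^-1 * _]mulrC; apply: conjugate_powR => //; exact: ltW.
  by rewrite poweRyr ?gt_eqF// !gt0_muley ?lte_fin ?invr_gt0// addye ?leey.
have [->|Yfin] := eqVneq Y +oo%E; first by rewrite gt0_muley ?leey// lte_fin powR_gt0.
have [y Ye y0] : exists2 y, Y = y%:E & 0 <= y.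
  by move: Y0 Yfin; case: (Y) => // y; rewrite lee_fin => y0 _; exists y.
have [z Xe z0] : exists2 z, X = z%:E & 0 <= z.
  have := young 1 ltr01; rewrite mul1e Ye -EFinM -EFinD; move: X0; case: (X) => // z; by rewrite lee_fin => h _; exists z.
rewrite Xe Ye poweR_EFin -EFinM lee_fin.
move: z0; rewrite le_eqVlt => /orP[/eqP <-|z0]; first by rewrite powR0 ?gt_eqF// mulr_ge0// powR_ge0.
(* The mean value of [T]; Young's inequality is sharp for constant [T = A] when [c = A^(q-1)]. *)
pose A := z / B; have A0 : 0 < A by rewrite divr_gt0.
have e2 : z = A * B by rewrite /A divfK// gt_eqF.
clearbody A.
have e1 : (A `^ (q - 1)) `^ q' = A `^ (q - 1) * A.
  by rewrite -powRrM /q' mulrCA mulfV ?mulr1 ?subr_eq0 ?gt_eqF// [RHS]mulrC (mulr_powRB1 (ltW A0) q0).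
have := young (A `^ (q - 1)) (powR_gt0 _ A0); rewrite Xe Ye -!EFinM -EFinD lee_fin e1 e2 => h.
have h2 : A `^ (q - 1) * (A * B) <= y.
  have e3 : q'^-1 = 1 - q^-1 by rewrite -qq addrC addKr.
  move: h; rewrite e3; set D := A `^ (q - 1) => h.
  have : q^-1 * (D * (A * B)) <= q^-1 * y by lra.
  by rewrite ler_pM2l// invr_gt0.
have AB : 0 <= A * B by rewrite mulr_ge0// ltW.
rewrite -(mulr_powRB1 AB q0) powRM ?(ltW A0) ?(ltW B0)//.
have -> : A * B * (A `^ (q - 1) * B `^ (q - 1)) = B `^ (q - 1) * (A `^ (q - 1) * (A * B)) by ring.
by apply: ler_wpM2l => //; exact: powR_ge0.
Qed.

Lemma poweR_add (q : R) (x y : \bar R) : 0 < q -> (0 <= x)%E -> (0 <= y)%E -> ((x + y) `^ q <= (2 `^ q)%:E * (x `^ q + y `^ q))%E.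
Proof.
move=> q0 x0 y0.
have gen (a b : \bar R) : (0 <= a)%E -> (a <= b)%E -> ((a + b) `^ q <= (2 `^ q)%:E * (a `^ q + b `^ q))%E.
  move=> a0 ab; have b0 := le_trans a0 ab.
  apply: (@le_trans _ _ ((2%:E * b) `^ q)%E).
    by apply: le_poweR => //; [exact: adde_ge0|rewrite mule_natl mule2n leeD2r].
  by rewrite poweRM ?lee_fin// poweR_EFin; apply: lee_wpmul2l; rewrite ?lee_fin ?powR_ge0// leeDr// poweR_ge0.
case: (leP x y) => h; first exact: gen.
by rewrite addeC [in leRHS]addeC; apply: gen => //; exact: ltW.
Qed.

End jensen.

(** * Wolff's inequality with local control of the measure *)

Section wolff.
Variables (R : realType) (q s0 Cv a : R) (nu : {finite_measure set (Pt R) -> \bar R}) (T : nat -> Pt R -> \bar R).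
Local Notation l n := (sc s0 n).
Local Notation be := (1 + 2 / q).
Implicit Types (n m k N : nat) (x y w : Pt R).

Definition hh n x : \bar R := ((Cv / l n)%:E * \int[@lebm R]_w ((\1_(cbx x (6 * l n)) w)%:E * T n w))%E.

Hypotheses (q2 : 2 < q) (s00 : 0 < s0) (Cv0 : 0 <= Cv) (ha : a - 2 = - be)
  (T0 : forall n w, (0 <= T n w)%E) (mT : forall n, measT (T n))
  (hV : forall n x y, `|x - y| <= l n -> ((V nu (2 * l n) y)%:E <= hh n x)%E)
  (supp : nu (~` cbx 0 (s0 / 2)) = 0%E).

Let q0 : 0 < q. Proof. by have := q2; lra. Qed.
Let q1 : 1 < q. Proof. by have := q2; lra. Qed.
Let l0 n : 0 < l n. Proof. exact: sc_gt0. Qed.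
Let be1 : 1 < be. Proof. by rewrite ltrDl divr_gt0. Qed.
Let be2 : be < 2. Proof. by have : 2 / q < 1; [rewrite ltr_pdivrMr// mul1r|lra]. Qed.

Let mi (r : R) : measT (fun p : Pt R * Pt R => (\1_(cbx p.1 r) p.2)%:E : \bar R).
Proof. by apply/measurable_EFinP; apply: measurable_ind. Qed.

Let i0 (r : R) x y : (0 <= (\1_(cbx x r) y)%:E :> \bar R)%E. Proof. by rewrite lee_fin. Qed.

Lemma int_ball (r : R) y : 0 <= r -> (\int[@lebm R]_x (\1_(cbx x r) y)%:E = ((2 * r) ^+ 2)%:E)%E.
Proof.
move=> r0; under eq_integral do rewrite cbxC.
rewrite integral_indic; [|by []|exact: measurable_cbx].
by rewrite setIT; exact: leb2_cbx.
Qed.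

Lemma int_ball_ave (f : Pt R -> \bar R) (r : R) : 0 <= r -> measT f -> (forall w, (0 <= f w)%E) ->
  (\int[@lebm R]_x \int[@lebm R]_w ((\1_(cbx x r) w)%:E * f w) = ((2 * r) ^+ 2)%:E * \int[@lebm R]_w f w)%E.
Proof.
move=> r0 mf f0.
rewrite (@tonelli R (fun p => ((\1_(cbx p.1 r) p.2)%:E * f p.2)%E)) /=; last 2 first.
- by apply: emeasurable_funM => //; exact: (measurableT_comp mf measurable_snd).
- by move=> p; rewrite mule_ge0.
rewrite -ge0_integralZl; [|by []|by []|by []|by rewrite lee_fin sqr_ge0].
apply: eq_integral => w _; rewrite ge0_integralZr; [|by []| |by []|exact: f0].
  by rewrite int_ball.
exact: (measurableT_comp (mi r) (pair2_measurable w)).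
Qed.

Lemma hh_ge0 n x : (0 <= hh n x)%E.
Proof.
rewrite /hh; apply: mule_ge0; first by rewrite lee_fin divr_ge0// ltW.
by apply: integral_ge0 => w _; rewrite mule_ge0.
Qed.

Lemma measurable_hh n : measT (hh n).
Proof.
apply: measurable_funeM; apply: (@measurable_int_snd R (fun p => (\1_(cbx p.1 (6 * l n)) p.2)%:E * T n p.2)%E) => [|p].
  by apply: emeasurable_funM => //; exact: (measurableT_comp (mT n) measurable_snd).
by rewrite mule_ge0.
Qed.

(** Jensen on squares of side [12 l n], then Tonelli; 144 is the square of 12. *)
Lemma hh_pow n : (\int[@lebm R]_x (hh n x `^ q) <= ((144 * Cv) `^ q * l n `^ q)%:E * \int[@lebm R]_w (T n w `^ q))%E.
Proof.
have L := l0 n; have L6 : 0 < 6 * l n by rewrite mulr_gt0.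
have mTq : measT (fun w => T n w `^ q)%E by apply: (measurableT_comp (measurable_poweR _)); exact: mT.
have c0 : 0 <= Cv / l n by rewrite divr_ge0// ltW.
set B := (2 * (6 * l n)) ^+ 2; have B0 : 0 < B by rewrite exprn_gt0// mulr_gt0.
have mJ : measT (fun x => \int[@lebm R]_w ((\1_(cbx x (6 * l n)) w)%:E * T n w `^ q))%E.
  apply: (@measurable_int_snd R (fun p => (\1_(cbx p.1 (6 * l n)) p.2)%:E * T n p.2 `^ q)%E) => [|p].
    by apply: emeasurable_funM => //; exact: (measurableT_comp mTq measurable_snd).
  by rewrite mule_ge0// poweR_ge0.
apply: (@le_trans _ _ (\int[@lebm R]_x (((Cv / l n) `^ q * B `^ (q - 1))%:E * \int[@lebm R]_w ((\1_(cbx x (6 * l n)) w)%:E * T n w `^ q)))%E).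
  apply: ge0_le_integral.
  - by [].
  - by move=> x _; exact: poweR_ge0.
  - by apply: (measurableT_comp (measurable_poweR _)); exact: measurable_hh.
  - exact: measurable_funeM.
  move=> x _; rewrite /hh poweRM ?lee_fin//; last by apply: integral_ge0 => w _; rewrite mule_ge0.
  rewrite poweR_EFin EFinM -muleA; apply: lee_wpmul2l; first by rewrite lee_fin powR_ge0.
  exact: jensen.
rewrite ge0_integralZl; [|by []|by []|by move=> x _; apply: integral_ge0 => w _; rewrite mule_ge0 ?poweR_ge0|by rewrite lee_fin mulr_ge0 ?powR_ge0].
rewrite int_ball_ave; [|exact: ltW|by []|by move=> w; exact: poweR_ge0].
rewrite -/B muleA -EFinM; apply: lee_wpmul2r; first by apply: integral_ge0 => w _; exact: poweR_ge0.
rewrite lee_fin -mulrA [B `^ _ * B]mulrC (mulr_powRB1 (ltW B0) q0) -(powRM _ c0 (ltW B0)).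
rewrite -(powRM _ (mulr_ge0 (ler0n R 144) Cv0) (ltW L)) (_ : Cv / l n * B = 144 * Cv * l n)//.
by rewrite /B; field; rewrite gt_eqF.
Qed.

(** Weighted by [l^-q] and summed over [n], these are the dyadic Wolff energy of [nu]: here
    [2 - alpha p = p], and [p (q - 1) = q]. *)
Definition JK n : \bar R := (\int[nu]_y ((V nu (2 * l n) y) `^ (q - 1))%:E)%E.

Lemma JK_ge0 n : (0 <= JK n)%E. Proof. by apply: integral_ge0 => y _; rewrite lee_fin powR_ge0. Qed.

Let mVq n : measT (fun y => ((V nu (2 * l n) y) `^ (q - 1))%:E : \bar R).
Proof. by apply/measurable_EFinP; apply: (measurableT_comp (measurable_powR _)); exact: V_meas. Qed.

(** The area factor spreads each [y] over the square of half side [l n] about it. There [V^(q-1)] is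
    at most [hh n x ^(q-1)], and the [nu]-mass of the points [y] near [x] supplies the missing
    power. *)
Lemma JK_le n : (((2 * l n) ^+ 2)%:E * JK n <= \int[@lebm R]_x (hh n x `^ q))%E.
Proof.
have L := l0 n; have B0 : 0 <= (2 * l n) ^+ 2 by exact: sqr_ge0.
have v0 y : 0 <= (V nu (2 * l n) y) `^ (q - 1) by exact: powR_ge0.
pose f (p : Pt R * Pt R) : \bar R := ((\1_(cbx p.1 (l n)) p.2)%:E * ((V nu (2 * l n) p.2) `^ (q - 1))%:E)%E.
have mf : measT f by apply: emeasurable_funM => //; exact: (measurableT_comp (mVq n) measurable_snd).
have f0 p : (0 <= f p)%E by rewrite mule_ge0 ?lee_fin.
have -> : (((2 * l n) ^+ 2)%:E * JK n = \int[nu]_y \int[@lebm R]_x f (x, y))%E.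
  rewrite /JK -ge0_integralZl; [|by []|exact: mVq|by move=> y _; rewrite lee_fin|by rewrite lee_fin].
  apply: eq_integral => y _; rewrite /f /= ge0_integralZr; [|by []| |by []|by rewrite lee_fin].
    by rewrite int_ball// ltW.
  exact: (measurableT_comp (mi (l n)) (pair2_measurable y)).
rewrite -tonelli_mu//; apply: ge0_le_integral.
- by [].
- by move=> x _; apply: integral_ge0 => y _.
- exact: measurable_int_mu.
- by apply: (measurableT_comp (measurable_poweR _)); exact: measurable_hh.
move=> x _; have q10 : 0 < q - 1 by have := q1; lra.
have h0 := hh_ge0 n x.
apply: (@le_trans _ _ (\int[nu]_y ((hh n x `^ (q - 1)) * (\1_(cbx x (l n)) y)%:E))%E).
  apply: ge0_le_integral.
  - by [].
  - by move=> y _.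
  - exact: (measurableT_comp mf (pair1_measurable x)).
  - by apply: measurable_funeM; exact: (measurableT_comp (mi (l n)) (pair1_measurable x)).
  move=> y _; rewrite /f /= indicE; case: (boolP (y \in _)) => [/set_mem|_]; last by rewrite mul0e mule0.
  rewrite /cbx /= distrC mul1e mule1 => xy; rewrite -poweR_EFin; apply: le_poweR => //; first by rewrite lee_fin V_ge0.
  exact: hV.
rewrite ge0_integralZl; [|by []|exact: (measurableT_comp (mi (l n)) (pair1_measurable x))|by []|exact: poweR_ge0].
rewrite V_int; have : ((V nu (l n) x)%:E <= hh n x)%E.
  apply: (le_trans _ (@hV n x x _)); last by rewrite subrr normr0 ltW.
  by rewrite lee_fin; apply: V_le => z; rewrite /cbx /=; lra.
move=> hv; apply: (le_trans (lee_wpmul2l (poweR_ge0 _ _) hv)).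
move: h0; case: (hh n x) => [t| |] // t0; last by rewrite !poweRyr ?gt_eqF// mulyy.
by rewrite !poweR_EFin -EFinM lee_fin mulrC mulr_powRB1.
Qed.

Definition CJ : R := (144 * Cv) `^ q / 4.

Lemma JK_T n : ((l n `^ (- q))%:E * JK n <= CJ%:E * (((l n ^+ 2)^-1)%:E * \int[@lebm R]_w (T n w `^ q)))%E.
Proof.
have L := l0 n; have B0 : 0 < (2 * l n) ^+ 2 by rewrite exprn_gt0// mulr_gt0.
have h := le_trans (JK_le n) (hh_pow n).
have c0 : 0 <= l n `^ (- q) * ((2 * l n) ^+ 2)^-1 by rewrite mulr_ge0 ?powR_ge0// invr_ge0 ltW.
have := lee_wpmul2l (_ : (0 <= (l n `^ (- q) * ((2 * l n) ^+ 2)^-1)%:E)%E) h; rewrite lee_fin => /(_ c0).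
rewrite !muleA -!EFinM -[_ / _ * _ ^+ 2]mulrA mulVf ?mulr1 ?gt_eqF//.
congr (_ <= _ * _)%E; rewrite /CJ; congr (_%:E).
have e : l n `^ (- q) * l n `^ q = 1 by rewrite powRN mulVf// gt_eqF// powR_gt0.
rewrite [LHS](_ : _ = l n `^ (- q) * l n `^ q * ((144 * Cv) `^ q / (2 * l n) ^+ 2)); last by ring.
by rewrite e mul1r exprMn; field; rewrite gt_eqF.
Qed.

(** Integrating [a_m a_k^(q-1)] gives the decay [2^((be-2)(m-k))], which is [kap^(2(m-k))]; one half
    of it pays for the weights in [gm], the other half sums the series. *)
Definition kap : R := 2 `^ ((be - 2) / 2).
Definition an n x : R := l n `^ (- be) * V nu (l n) x.
Definition C1w : R := ((1 - 0)^-1 + (1 - kap `^ (q - 1)^-1)^-1) `^ (q - 1).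

Let kap0 : 0 < kap. Proof. exact: powR_gt0. Qed.

Let kap_pow (p : R) : 0 < p -> kap `^ p < 1.
Proof.
move=> p0; rewrite /kap -powRrM (_ : _ * p = - ((2 - be) / 2 * p)); last by field; rewrite gt_eqF.
have c0 : 0 < (2 - be) / 2 * p by rewrite mulr_gt0 ?divr_gt0 ?subr_gt0.
have e1 : 1 `^ ((2 - be) / 2 * p) = 1 :> R by rewrite powR1.
rewrite powRN invf_lt1 ?powR_gt0// -[ltLHS]e1.
by apply: gt0_ltr_powR; rewrite ?nnegrE ?ltr1n.
Qed.

Let kap1 : kap < 1. Proof. by rewrite -(powRr1 (ltW kap0)); exact: kap_pow. Qed.

Lemma an_ge0 n x : 0 <= an n x. Proof. by rewrite mulr_ge0 ?powR_ge0 ?V_ge0. Qed.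

(** The tangent inequality for the convex power, read off from Young's inequality applied to [s] and
    [t^(q-1)]. *)
Lemma pow_step (s t : R) : 0 <= s -> s <= t -> t `^ q - s `^ q <= q * (t - s) * t `^ (q - 1).
Proof.
move=> s0' st; have t0 := le_trans s0' st.
have q'0 : 0 < q / (q - 1) by rewrite divr_gt0//; have := q1; lra.
have qq : q^-1 + (q / (q - 1))^-1 = 1 by rewrite invf_div; field; rewrite gt_eqF.
have := conjugate_powR s0' (powR_ge0 t (q - 1)) q0 q'0 qq.
have e : (t `^ (q - 1)) `^ (q / (q - 1)) = t `^ q.
  by rewrite -powRrM mulrCA mulfV ?mulr1// subr_eq0 gt_eqF.
rewrite e invf_div -(mulr_powRB1 t0 q0); set u := t `^ (q - 1); set v := s `^ q => h.
have : q * (s * u) <= q * (v / q + t * u * ((q - 1) / q)) by rewrite ler_pM2l.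
rewrite mulrDr [q * (v / q)]mulrC divfK ?gt_eqF// [q * (_ * (_ / q))](_ : _ = t * u * (q - 1)); last by field; rewrite gt_eqF.
lra.
Qed.

Definition gm m x : R := \sum_(k < m.+1) q * C1w * kap^-1 ^+ (m - k) * (an m x * an k x `^ (q - 1)).

(** The power of the sum is telescoped by [pow_step], so that [a_m] meets only the [(q-1)]-th power
    of the sum over the coarser scales [k <= m], which [suptrick] expands. *)
Lemma sum_pow_le x N : (\sum_(m < N) an m x) `^ q <= \sum_(m < N) gm m x.
Proof.
elim: N => [|N ih]; first by rewrite !big_ord0 powR0// gt_eqF.
rewrite !big_ord_recr /=; set S := \sum_(m < N) an m x in ih *.
have S0 : 0 <= S by apply: sumr_ge0 => m _; exact: an_ge0.
have q10 : 0 < q - 1 by have := q1; lra.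
have := pow_step S0 (_ : S <= S + an N x); rewrite lerDl an_ge0 => /(_ isT).
rewrite [S + _ - S]addrC addKr => h.
apply: (@le_trans _ _ (S `^ q + q * an N x * (S + an N x) `^ (q - 1))); first lra.
apply: lerD ih _.
have hC : \sum_(k < N.+1) (kap ^+ (N - k)) `^ (q - 1)^-1 <= (1 - 0)^-1 + (1 - kap `^ (q - 1)^-1)^-1.
  rewrite (eq_bigr (fun k : 'I_N.+1 => 0 ^+ (k - N) * (kap `^ (q - 1)^-1) ^+ (N - k))) => [|k _].
    by apply: geo2; rewrite ?powR_ge0 ?kap_pow ?invr_gt0.
  by rewrite (eqP (_ : (k - N == 0)%N)) ?expr0 ?mul1r ?powRX ?(ltW kap0)// subn_eq0 -ltnS.
have := suptrick q10 (fun k => an_ge0 k x) (fun k => exprn_gt0 (N - k) kap0) hC.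
rewrite big_ord_recr /= -/S -/C1w => h2.
apply: (le_trans (ler_wpM2l _ h2)); first by rewrite mulr_ge0 ?an_ge0// ltW.
rewrite /gm mulrA mulr_sumr le_eqVlt; apply/orP; left; apply/eqP; apply: eq_bigr => k _.
by rewrite exprVn; ring.
Qed.

Definition W x : \bar R := (\sum_(m <oo) (an m x)%:E)%E.

Lemma gm_ge0 m x : 0 <= gm m x.
Proof.
apply: sumr_ge0 => k _; rewrite !mulr_ge0 ?V_ge0 ?powR_ge0 ?exprn_ge0 ?invr_ge0 ?(ltW kap0) ?(ltW q0)//.
Qed.

Lemma W_pow x : (W x `^ q <= \sum_(m <oo) (gm m x)%:E)%E.
Proof.
apply: nneseries_pow_le => // [m|L]; first exact: an_ge0.
apply: (@le_trans _ _ (\sum_(m < L) gm m x)%:E); first by rewrite lee_fin; exact: sum_pow_le.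
rewrite -sumEFin -(big_mkord xpredT (fun m => (gm m x)%:E)).
by apply: nneseries_lim_ge => m _ _; rewrite lee_fin gm_ge0.
Qed.

Lemma measurable_an n : measT (an n).
Proof. by apply: measurable_funM => //; exact: V_meas. Qed.

Lemma scale_exponents m k : (k <= m)%N ->
  l m `^ (- be) * (l k `^ (- be)) `^ (q - 1) * (2 * l m) ^+ 2 = 4 * kap ^+ (2 * (m - k)) * l k `^ (- q).
Proof.
move=> km; set d := (m - k)%N; have -> : l m = sc (l k) d by rewrite -{1}(subnKC km) scD.
clearbody d; move: (l k) (l0 k) => D L; rewrite sc_powN// /sc -powRrM.
have -> : kap ^+ (2 * d) = (2 `^ be / 4) ^+ d.
  rewrite exprM; congr (_ ^+ _); rewrite /kap -powR_mulrn ?powR_ge0// -powRrM divfK// powRD; last by rewrite pnatr_eq0 implybT.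
  by rewrite powRN powR_mulrn// expr2; congr (_ / _); lra.
have -> : D `^ (- q) = D `^ (- be) * D `^ (- be * (q - 1)) * D ^+ 2.
  rewrite -(powR_mulrn _ (ltW L)) -!powRD ?(gt_eqF L) ?implybT//; congr (_ `^ _); field; by rewrite gt_eqF.
move: (D `^ (- be)) (D `^ (- be * (q - 1))) (2 `^ be) => A B C.
have e4 : 4 ^+ d = (2 ^+ d) ^+ 2 :> R by rewrite -exprM mulnC exprM; congr (_ ^+ d); rewrite expr2; lra.
by rewrite expr_div_n e4; field; rewrite expf_neq0.
Qed.

(** Integrating [nu(cbx x (l m))] in [x] produces the area [(2 l m)^2] against [dnu(y)]; for such
    [x] the ball of the coarser radius [l k] about [x] lies in the doubled ball about [y]. *)
Lemma an_int m k : (k <= m)%N ->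
  (\int[@lebm R]_x (an m x * an k x `^ (q - 1))%:E <= (4 * kap ^+ (2 * (m - k)))%:E * ((l k `^ (- q))%:E * JK k))%E.
Proof.
move=> km; pose c := l m `^ (- be) * (l k `^ (- be)) `^ (q - 1).
have c0 : 0 <= c by rewrite mulr_ge0 ?powR_ge0.
pose f (p : Pt R * Pt R) : \bar R := ((\1_(cbx p.1 (l m)) p.2)%:E * ((V nu (l k) p.1) `^ (q - 1))%:E)%E.
have mVk : measT (fun x => ((V nu (l k) x) `^ (q - 1))%:E : \bar R).
  by apply/measurable_EFinP; apply: (measurableT_comp (measurable_powR _)); exact: V_meas.
have mf : measT f by apply: emeasurable_funM => //; exact: (measurableT_comp mVk measurable_fst).
have f0 p : (0 <= f p)%E by rewrite mule_ge0 ?lee_fin ?powR_ge0.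
have fi x : (0 <= \int[nu]_y f (x, y))%E by apply: integral_ge0.
have -> : (\int[@lebm R]_x (an m x * an k x `^ (q - 1))%:E = c%:E * \int[@lebm R]_x \int[nu]_y f (x, y))%E.
  rewrite -ge0_integralZl; [|by []|exact: measurable_int_mu|by []|by rewrite lee_fin].
  apply: eq_integral => x _; rewrite /f /= ge0_integralZr; [|by []| |by []|by rewrite lee_fin powR_ge0].
    by rewrite V_int -!EFinM /an powRM ?powR_ge0 ?V_ge0//; congr (_%:E); rewrite /c; ring.
  exact: (measurableT_comp (mi (l m)) (pair1_measurable x)).
have -> : ((4 * kap ^+ (2 * (m - k)))%:E * ((l k `^ (- q))%:E * JK k) = c%:E * (((2 * l m) ^+ 2)%:E * JK k))%E.
  by rewrite !muleA -!EFinM -scale_exponents.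
apply: lee_wpmul2l; first by rewrite lee_fin.
rewrite tonelli_mu// /JK -ge0_integralZl; [|by []|exact: mVq|by move=> y _; rewrite lee_fin powR_ge0|by rewrite lee_fin sqr_ge0].
apply: ge0_le_integral.
- by [].
- by move=> y _; apply: integral_ge0.
- exact: measurable_fun_fubini_tonelli_G.
- exact: measurable_funeM.
move=> y _; rewrite -(int_ball y (ltW (l0 m))) -ge0_integralZr; [|by []|exact: (measurableT_comp (mi (l m)) (pair2_measurable y))|by []|by rewrite lee_fin powR_ge0].
apply: ge0_le_integral.
- by [].
- by [].
- exact: (measurableT_comp mf (pair2_measurable y)).
- by apply: emeasurable_funM => //; exact: (measurableT_comp (mi (l m)) (pair2_measurable y)).
move=> x _; rewrite /f /= indicE; case: (boolP (y \in _)) => [/set_mem|_]; last by rewrite !mul0e.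
rewrite /cbx /= !mul1e lee_fin => xy; apply: ge0_ler_powR; rewrite ?nnegrE ?V_ge0//; first by have := q1; lra.
apply: V_le => z; rewrite /cbx /= => zx.
by have := ler_distD x z y; rewrite (distrC x y); have := sc_le (ltW s00) km; lra.
Qed.

Lemma tri_sum (c : R) (e : nat -> \bar R) N : 0 <= c -> (forall k, (0 <= e k)%E) ->
  (\sum_(m < N) \sum_(k < m.+1) (c ^+ (m - k))%:E * e k = \sum_(k < N) (\sum_(j < N - k) c ^+ j)%:E * e k)%E.
Proof.
move=> c0 e0; elim: N => [|N ih]; first by rewrite !big_ord0.
rewrite big_ord_recr /= ih.
have -> : (\sum_(k < N) (\sum_(j < N - k) c ^+ j)%:E * e k = \sum_(k < N.+1) (\sum_(j < N - k) c ^+ j)%:E * e k)%E.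
  by rewrite big_ord_recr /= subnn big_ord0 mul0e adde0.
rewrite -big_split /=; apply: eq_bigr => k _.
rewrite -ge0_muleDl ?lee_fin ?exprn_ge0 ?sumr_ge0// => [|j _]; last exact: exprn_ge0.
by rewrite subSn ?big_ord_recr//= -ltnS.
Qed.

Definition Ek : \bar R := (\sum_(k <oo) (l k `^ (- q))%:E * JK k)%E.

Let e0 k : (0 <= (l k `^ (- q))%:E * JK k)%E. Proof. by rewrite mule_ge0 ?JK_ge0// lee_fin powR_ge0. Qed.

Let Dw : R := 4 * (q * C1w).
Let Dw0 : 0 <= Dw. Proof. by rewrite !mulr_ge0 ?powR_ge0// ltW. Qed.

Lemma gm_int m : (\int[@lebm R]_x (gm m x)%:E <= Dw%:E * \sum_(k < m.+1) (kap ^+ (m - k))%:E * ((l k `^ (- q))%:E * JK k))%E.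
Proof.
pose c k := q * C1w * kap^-1 ^+ (m - k).
have c0 k : 0 <= c k by rewrite !mulr_ge0 ?powR_ge0 ?exprn_ge0 ?invr_ge0 ?(ltW kap0)// ltW.
pose g k x := an m x * an k x `^ (q - 1).
have g0 k x : 0 <= g k x by rewrite mulr_ge0 ?an_ge0 ?powR_ge0.
have mg' k : measT (g k).
  apply: measurable_funM; first exact: measurable_an.
  by apply: (measurableT_comp (measurable_powR _)); exact: measurable_an.
have mg k : measT (fun x => (g k x)%:E : \bar R) by exact/measurable_EFinP.
have -> : (\int[@lebm R]_x (gm m x)%:E = \sum_(k < m.+1) (c k)%:E * \int[@lebm R]_x (g k x)%:E)%E.
  rewrite -(big_mkord xpredT (fun k => (c k)%:E * \int[@lebm R]_x (g k x)%:E)%E).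
  under eq_integral do rewrite /gm -sumEFin -(big_mkord xpredT (fun k => (c k * g k _)%:E)).
  rewrite ge0_integral_sum; [|by []|by move=> k; apply/measurable_EFinP; apply: measurable_funM; [exact: measurable_cst|exact: mg']|by move=> k x _; rewrite lee_fin mulr_ge0].
  apply: eq_bigr => k _; under eq_integral do rewrite EFinM.
  by rewrite ge0_integralZl; [|by []|exact: mg|by move=> x _; rewrite lee_fin|by rewrite lee_fin].
rewrite ge0_sume_distrr => [|k _]; last by rewrite mule_ge0// lee_fin exprn_ge0// ltW.
apply: lee_sum => k _.
apply: (le_trans (lee_wpmul2l _ (an_int _))); [by rewrite lee_fin|by rewrite -ltnS|].
rewrite !(muleA _ (_%:E)) -!EFinM le_eqVlt; apply/orP; left; apply/eqP; congr (_%:E * _)%E; congr (_ * _).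
rewrite /c /Dw exprVn mul2n -addnn exprD; field; by rewrite expf_neq0// gt_eqF.
Qed.

Lemma near_int : (\int[@lebm R]_x (W x `^ q) <= (Dw / (1 - kap))%:E * Ek)%E.
Proof.
have mg m : measT (fun x => (gm m x)%:E : \bar R).
  apply/measurable_EFinP; apply: measurable_sum => k; apply: measurable_funM => //; apply: measurable_funM; first exact: measurable_an.
  by apply: (measurableT_comp (measurable_powR _)); exact: measurable_an.
have k1 : 0 < 1 - kap by rewrite subr_gt0.
apply: (@le_trans _ _ (\int[@lebm R]_x \sum_(m <oo) (gm m x)%:E)%E).
  apply: ge0_le_integral.
  - by [].
  - by move=> x _; exact: poweR_ge0.
  - apply: (measurableT_comp (measurable_poweR _)); apply: ge0_emeasurable_sum => [m x _ _|m _]; first by rewrite lee_fin an_ge0.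
    by apply/measurable_EFinP; exact: measurable_an.
  - by apply: ge0_emeasurable_sum => [m x _ _|m _]; [rewrite lee_fin gm_ge0|exact: mg].
  - by move=> x _; exact: W_pow.
rewrite integral_nneseries; [|by []|exact: mg|by move=> m x _; rewrite lee_fin gm_ge0].
apply: nneseries_bound => [m|N]; first by apply: integral_ge0 => x _; rewrite lee_fin gm_ge0.
apply: (@le_trans _ _ (\sum_(m < N) (Dw%:E * \sum_(k < m.+1) (kap ^+ (m - k))%:E * ((l k `^ (- q))%:E * JK k)))%E).
  by apply: lee_sum => m _; exact: gm_int.
rewrite -ge0_sume_distrr => [|m _]; last by apply: sume_ge0 => k _; rewrite mule_ge0// lee_fin exprn_ge0// ltW.
rewrite (tri_sum N (ltW kap0) e0) (_ : (Dw / (1 - kap))%:E = (Dw%:E * ((1 - kap)^-1)%:E)%E)// -[leRHS]muleA; apply: lee_wpmul2l; first by rewrite lee_fin.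
apply: (@le_trans _ _ (\sum_(k < N) ((1 - kap)^-1)%:E * ((l k `^ (- q))%:E * JK k))%E).
  by apply: lee_sum => k _; apply: lee_wpmul2r => //; rewrite lee_fin; apply: geo_sum => //; exact: ltW.
rewrite -ge0_sume_distrr//; apply: lee_wpmul2l; first by rewrite lee_fin invr_ge0 ltW.
rewrite -(big_mkord xpredT (fun k => (l k `^ (- q))%:E * JK k)%E).
by apply: nneseries_lim_ge => k _ _.
Qed.

Local Notation D := (cbx (0%R : Pt R) (s0 / 2)%R).
Definition mx x : R := Num.max `|x| s0.
Definition N0 : R := V nu (2 * l 0%N) 0.

Let l00 : l 0%N = s0. Proof. by rewrite /sc expr0 divr1. Qed.

Let mx0 x : 0 < mx x. Proof. by rewrite lt_max s00 orbT. Qed.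

(** Within distance [s0] one dyadic term dominates the kernel. Beyond it, since [|y| <= s0/2], the
    distance is at least half of [mx x]. *)
Lemma kernel_upper x y : `|y| <= s0 / 2 ->
  (riesz_kernel a x y <= (2 `^ be)%:E * (\sum_(m <oo) (l m `^ (- be) * \1_(cbx x (l m)) y)%:E + (mx x `^ (- be))%:E))%E.
Proof.
move=> ys; have b0 : 0 <= be by have := be1; lra.
have t0 m : (0 <= (l m `^ (- be) * \1_(cbx x (l m)) y)%:E)%E by rewrite lee_fin mulr_ge0 ?powR_ge0.
have S0 : (0 <= \sum_(m <oo) (l m `^ (- be) * \1_(cbx x (l m)) y)%:E)%E by apply: nneseries_ge0.
have p2 : 0 < 2 `^ be :> R by exact: powR_gt0.
rewrite /riesz_kernel; case: eqP => [xy|/eqP xy].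
  suff -> : (\sum_(m <oo) (l m `^ (- be) * \1_(cbx x (l m)) y)%:E = +oo)%E by rewrite addye// gt0_muley ?lte_fin.
  (* On the diagonal every term of the series is at least [s0^(-be)], so the series is infinite like
     the kernel; [L] terms exceed [A]. *)
  apply/eqyP => A A0; pose L := (Num.bound (A / s0 `^ (- be))).
  apply: le_trans (@nneseries_lim_ge _ _ xpredT 0 L (fun m _ _ => t0 m)).
  rewrite big_mkord sumEFin lee_fin.
  apply: (@le_trans _ _ (\sum_(m < L) s0 `^ (- be))).
    have -> : \sum_(m < L) s0 `^ (- be) = s0 `^ (- be) * L%:R by rewrite sumr_const card_ord mulr_natr.
    rewrite -ler_pdivrMl ?powR_gt0// mulrC.
    by apply: ltW; apply: archi_boundP; rewrite divr_ge0 ?powR_ge0// ltW.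
  apply: ler_sum => m _; rewrite indicE mem_set ?mulr1; last by rewrite /cbx /= xy subrr normr0 ltW.
  by apply: powRN_le => //; rewrite -[leRHS]l00; apply: sc_le => //; exact: ltW.
have d0 : 0 < `|x - y| by rewrite normr_gt0 subr_eq0.
have kd : cabs (csub x y) `^ (a - 2) <= `|x - y| `^ (- be) by rewrite ha; apply: powRN_le => //; rewrite -csubE; exact: cabs_ge.
have half (t s : R) : 0 < t -> t / 2 <= s -> s `^ (- be) <= 2 `^ be * t `^ (- be).
  move=> t1 ts; have t2 : 0 < t / 2 by rewrite divr_gt0.
  apply: (le_trans (powRN_le b0 t2 ts)); rewrite powRM ?invr_ge0 ?(ltW t1)// mulrC.
  by rewrite -(@powR_inv1 _ 2)// -powRrM mulN1r opprK.
case: (leP `|x - y| s0) => h.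
  have [m /andP[h1 h2]] := dyadic_index d0 h.
  apply: (@le_trans _ _ ((2 `^ be)%:E * (l m `^ (- be) * \1_(cbx x (l m)) y)%:E)%E).
    rewrite indicE mem_set; last by rewrite /cbx /= distrC.
    by rewrite mulr1 -EFinM lee_fin; apply: (le_trans kd); apply: half => //; exact: ltW.
  apply: lee_wpmul2l; first by rewrite lee_fin ltW.
  apply: (le_trans (nneseries_term m t0)); by rewrite leeDl// lee_fin powR_ge0.
apply: (@le_trans _ _ ((2 `^ be)%:E * (mx x `^ (- be))%:E)%E).
  rewrite -EFinM lee_fin; apply: (le_trans kd); apply: half => //.
  by rewrite /mx; have := ler_distD y x 0; rewrite !subr0 => h2; case: (leP `|x| s0) => _; lra.
by apply: lee_wpmul2l; rewrite ?lee_fin ?(ltW p2)// leeDr.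
Qed.

Let cbxD (z : Pt R) : D z -> `|z| <= s0 / 2. Proof. by rewrite /cbx /= subr0. Qed.

Lemma int_supp (f : Pt R -> \bar R) : measT f -> (forall y, (0 <= f y)%E) ->
  (\int[nu]_y f y = \int[nu]_(y in D) f y)%E.
Proof.
move=> mf f0; have mD : measurable (cbx (0 : Pt R) (s0 / 2)) by exact: measurable_cbx.
have mC : measurable (~` D) by exact: measurableC.
rewrite -(setUv D) ge0_integral_setU; [|exact: mD|exact: mC|exact: measurable_funTS|by move=> y _|by apply/disj_setPS => z []].
rewrite [X in (_ + X)%E](_ : _ = 0%E) ?adde0//.
by apply: null_set_integral => //; exact: measurable_funTS.
Qed.

Lemma N0_tot : (nu setT = N0%:E)%E.
Proof.
rewrite /N0 -VE l00; apply/eqP; rewrite eq_le; apply/andP; split; last first.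
  by apply: le_measure; rewrite ?inE//; exact: measurable_cbx.
rewrite -(setUv (D)); apply: (le_trans (measureU2 _ _ _)); [exact: measurable_cbx|by apply: measurableC; exact: measurable_cbx|].
rewrite /= supp adde0; apply: le_measure; rewrite ?inE; try exact: measurable_cbx.
by move=> z; rewrite /cbx /=; have := s00; lra.
Qed.

Lemma pot_upper x : (riesz_pot a nu x <= (2 `^ be)%:E * (W x + (mx x `^ (- be) * N0)%:E))%E.
Proof.
have t0 m y : (0 <= (l m `^ (- be) * \1_(cbx x (l m)) y)%:E)%E by rewrite lee_fin mulr_ge0 ?powR_ge0.
have mt m : measT (fun y => (l m `^ (- be) * \1_(cbx x (l m)) y)%:E : \bar R).
  by apply/measurable_EFinP; apply: measurable_funM => //; exact: measurable_1cbx.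
have mS : measT (fun y => \sum_(m <oo) (l m `^ (- be) * \1_(cbx x (l m)) y)%:E)%E.
  by apply: ge0_emeasurable_sum => [m y _ _|m _]; [exact: t0|exact: mt].
have S0 y : (0 <= \sum_(m <oo) (l m `^ (- be) * \1_(cbx x (l m)) y)%:E)%E by apply: nneseries_ge0.
have p0 : (0 <= (mx x `^ (- be))%:E)%E by rewrite lee_fin powR_ge0.
have mk : measT (fun y => riesz_kernel a x y) by exact: (measurableT_comp (measurable_kernel a) (pair1_measurable x)).
have -> : ((2 `^ be)%:E * (W x + (mx x `^ (- be) * N0)%:E) =
   \int[nu]_y ((2 `^ be)%:E * (\sum_(m <oo) (l m `^ (- be) * \1_(cbx x (l m)) y)%:E + (mx x `^ (- be))%:E)))%E.
  rewrite ge0_integralZl; [|by []|by apply: emeasurable_funD|by move=> y _; rewrite adde_ge0|by rewrite lee_fin powR_ge0].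
  rewrite ge0_integralD; [|by []|by []|exact: mS|by []|exact: measurable_cst].
  have -> : (\int[nu]__ (mx x `^ (- be))%:E = (mx x `^ (- be) * N0)%:E)%E.
    rewrite integral_cst; last exact: measurableT.
    by rewrite EFinM; congr (_ * _)%E; exact: N0_tot.
  congr (_ * (_ + _))%E.
  rewrite integral_nneseries//; apply: eq_eseriesr => m _; under eq_integral do rewrite EFinM.
  rewrite ge0_integralZl; [by rewrite V_int -EFinM|exact: measurableT| |by move=> y _|by rewrite lee_fin powR_ge0].
  by apply/measurable_EFinP; exact: measurable_1cbx.
have mR : measT (fun y => (2 `^ be)%:E * (\sum_(m <oo) (l m `^ (- be) * \1_(cbx x (l m)) y)%:E + (mx x `^ (- be))%:E))%E.
  by apply: measurable_funeM; apply: emeasurable_funD.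
rewrite /riesz_pot !int_supp//; last 2 first.
- by move=> y; exact: kernel_ge0.
- by move=> y; rewrite mule_ge0 ?adde_ge0// lee_fin powR_ge0.
apply: ge0_le_integral.
- exact: measurable_cbx.
- by move=> y _; exact: kernel_ge0.
- exact: measurable_funTS.
- exact: measurable_funTS.
by move=> y /cbxD; exact: kernel_upper.
Qed.

Lemma measurable_mx (p : R) : measT (fun x => mx x `^ p).
Proof.
apply: (measurableT_comp (measurable_powR _)); apply: measurable_maxr => //.
by apply: (eq_measurable_fun (fun x : Pt R => `|x - 0|)) => [x _|]; [rewrite subr0|apply: measurable_dist].
Qed.

(** The exponent [be * q = q + 2] exceeds the dimension by [q]; decomposing the plane into squares
    of half side [s0 2^j] leaves a geometric series of ratio [2^-q]. *)
Lemma far_int : (\int[@lebm R]_x ((mx x `^ (- be)) `^ q)%:E <= (8 * 2 `^ (q + 2) * s0 `^ (- q))%:E)%E.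
Proof.
pose Q := q + 2; have Q0 : 0 <= Q by rewrite /Q; have := q2; lra.
have bq : be * q = Q by rewrite /Q; field; rewrite gt_eqF.
pose L j : R := s0 * 2 ^+ j.
have L0 j : 0 < L j by rewrite mulr_gt0// exprn_gt0.
pose f j x : \bar R := ((2 `^ Q * L j `^ (- Q))%:E * (\1_(cbx x (L j)) 0)%:E)%E.
have f0 j x : (0 <= f j x)%E by rewrite mule_ge0// lee_fin mulr_ge0 ?powR_ge0.
have mf j : measT (f j) by apply: measurable_funeM; exact: (measurableT_comp (mi (L j)) (pair2_measurable (0 : Pt R))).
apply: (@le_trans _ _ (\int[@lebm R]_x \sum_(j <oo) f j x)%E).
  apply: ge0_le_integral.
  - by [].
  - by move=> x _; rewrite lee_fin powR_ge0.
  - by apply/measurable_EFinP; apply: (measurableT_comp (measurable_powR _)); exact: measurable_mx.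
  - by apply: ge0_emeasurable_sum => [j x _ _|j _]; [exact: f0|exact: mf].
  move=> x _; have ex : exists j, `|x| <= L j.
    have := @archi_boundP _ (`|x| / s0) ltac:(by rewrite divr_ge0// ltW); set n := Num.bound _ => hn.
    exists n; rewrite /L [leRHS]mulrC -ler_pdivrMr//; apply: le_trans (ltW hn) _.
    by rewrite -natrX ler_nat; apply: ltnW; exact: ltn_expl.
  case: (ex_minnP ex) => j hj jm; apply: (le_trans _ (nneseries_term j (fun j => f0 j x))).
  rewrite /f indicE mem_set; last by rewrite /cbx /= sub0r normrN.
  rewrite mule1 lee_fin -powRrM mulNr bq.
  have t2 : 0 < L j / 2 by rewrite divr_gt0.
  have -> : 2 `^ Q * L j `^ (- Q) = (L j / 2) `^ (- Q).
    by rewrite powRM ?invr_ge0 ?(ltW (L0 j))// mulrC -(@powR_inv1 _ 2)// -powRrM mulN1r opprK.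
  apply: powRN_le => //; rewrite le_max; case: j hj jm t2 => [|j] hj jm _.
    by rewrite /L expr0 mulr1; apply/orP; right; have := s00; lra.
  have e : L j.+1 / 2 = L j by rewrite /L exprS; field.
  apply/orP; left; rewrite e.
  by rewrite leNgt; apply/negP => /ltW /jm; rewrite ltnn.
rewrite integral_nneseries; [|by []|exact: mf|by []].
apply: nneseries_bound => [j|N]; first by apply: integral_ge0.
rewrite (eq_bigr (fun j : 'I_N => (4 * 2 `^ Q * s0 `^ (- q) * ((2 `^ q)^-1) ^+ j)%:E)) => [|j _]; last first.
  rewrite /f ge0_integralZl; [|by []|exact: (measurableT_comp (mi (L j)) (pair2_measurable (0 : Pt R)))|by []|by rewrite lee_fin mulr_ge0 ?powR_ge0].
  rewrite int_ball ?(ltW (L0 j))// -EFinM; congr (_%:E).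
  have -> : L j `^ (- Q) = L j `^ (- q) * (L j ^+ 2)^-1.
    by rewrite -powR_mulrn ?(ltW (L0 j))// -powRN -powRD ?(gt_eqF (L0 j)) ?implybT//; congr (_ `^ _); rewrite /Q; lra.
  have -> : L j `^ (- q) = s0 `^ (- q) * ((2 `^ q)^-1) ^+ j.
    by rewrite /L powRM ?exprn_ge0 ?(ltW s00)// powRX// [2 `^ (- q)]powRN.
  by field; rewrite gt_eqF.
rewrite sumEFin lee_fin -mulr_sumr.
have h2 : (2 `^ q)^-1 <= 2^-1 :> R by rewrite lef_pV2 ?posrE ?powR_gt0//; apply: two_powR; exact: ltW.
have i2 : 0 <= (2 `^ q)^-1 :> R by rewrite invr_ge0 powR_ge0.
have h1 : 2^-1 < 1 :> R by rewrite invf_lt1 ?ltr1n.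
have h := @geo_sum _ _ N i2 (le_lt_trans h2 h1).
have h3 : (1 - (2 `^ q)^-1)^-1 <= 2 :> R by rewrite -[leRHS]invrK lef_pV2 ?posrE; lra.
have c0 : 0 <= 2 `^ Q * s0 `^ (- q) by rewrite mulr_ge0 ?powR_ge0.
have := ler_wpM2l c0 (le_trans h h3); rewrite -/Q.
set S := \sum_(i < N) _; lra.
Qed.

(** Every ball of radius [2 s0] about a point of the square carrying [nu] has full mass. *)
Lemma N0_pow : ((N0 `^ q)%:E <= JK 0)%E.
Proof.
have Dsub (w : Pt R) : `|w| <= s0 / 2 -> D `<=` cbx w (2 * l 0%N).
  by move=> wD z /cbxD zD; rewrite /cbx /= l00; have := ler_normB z w; have := s00; lra.
have N00 : 0 <= N0 by exact: V_ge0.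
have q10 : 0 <= q - 1 by have := q1; lra.
have -> : ((N0 `^ q)%:E = \int[nu]_(y in D) (N0 `^ (q - 1))%:E)%E.
  rewrite integral_cst; last exact: measurable_cbx.
  have hD : (nu (D) = N0%:E)%E.
    rewrite -N0_tot; apply/eqP; rewrite eq_le; apply/andP; split.
      by apply: le_measure; rewrite ?inE//; exact: measurable_cbx.
    rewrite -(setUv (D)); apply: (le_trans (measureU2 _ _ _)); [exact: measurable_cbx|by apply: measurableC; exact: measurable_cbx|].
    by rewrite /= supp adde0.
  transitivity ((N0 `^ (q - 1))%:E * N0%:E)%E; first by rewrite -EFinM mulrC mulr_powRB1.
  by congr (_ * _)%E; exact: esym hD.
rewrite /JK int_supp; [|exact: mVq|by move=> y; rewrite lee_fin powR_ge0].
apply: ge0_le_integral.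
- exact: measurable_cbx.
- by move=> y _; rewrite lee_fin powR_ge0.
- exact: measurable_cst.
- by apply: measurable_funTS; exact: mVq.
move=> y /cbxD yD; rewrite lee_fin; apply: ge0_ler_powR; rewrite ?nnegrE ?V_ge0//.
rewrite -lee_fin -N0_tot -VE -[leRHS]adde0 -[X in (_ <= _ + X)%E]supp.
apply: (@le_trans _ _ (nu (D) + nu (~` D))%E).
  rewrite -{1}(setUv (D)); apply: measureU2; [exact: measurable_cbx|by apply: measurableC; exact: measurable_cbx].
apply: leeD => //; apply: le_measure; rewrite ?inE; try exact: measurable_cbx.
exact: Dsub.
Qed.

Definition CW : R := (2 `^ be) `^ q * 2 `^ q * (Dw / (1 - kap) + 8 * 2 `^ (q + 2)) * CJ.

(** The near part is [near_int]. The far part is at most a multiple of [s0^-q JK 0], the first term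
    of the same energy, so no dependence on the top scale remains. *)
Lemma wolff : (\int[@lebm R]_x (riesz_pot a nu x `^ q) <= CW%:E * \sum_(k <oo) (((l k ^+ 2)^-1)%:E * \int[@lebm R]_w (T k w `^ q)))%E.
Proof.
have mW : measT W.
  apply: ge0_emeasurable_sum => [m x _ _|m _]; first by rewrite lee_fin an_ge0.
  by apply/measurable_EFinP; exact: measurable_an.
have W0 x : (0 <= W x)%E by apply: nneseries_ge0 => m _ _; rewrite lee_fin an_ge0.
have N00 : 0 <= N0 by exact: V_ge0.
have F0 x : 0 <= mx x `^ (- be) * N0 by rewrite mulr_ge0 ?powR_ge0.
pose P : R := (2 `^ be) `^ q * 2 `^ q; have P0 : 0 <= P by rewrite mulr_ge0 ?powR_ge0.
have mWq : measT (fun x => W x `^ q)%E by apply: (measurableT_comp (measurable_poweR _)).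
have mFq : measT (fun x => ((mx x `^ (- be)) `^ q)%:E : \bar R).
  by apply/measurable_EFinP; apply: (measurableT_comp (measurable_powR _)); exact: measurable_mx.
have Fq0 x : (0 <= ((mx x `^ (- be)) `^ q)%:E)%E by rewrite lee_fin powR_ge0.
have Wq0 x : (0 <= W x `^ q)%E by exact: poweR_ge0.
have nq0 : (0 <= (N0 `^ q)%:E)%E by rewrite lee_fin powR_ge0.
have mG : measT (fun x => W x `^ q + (N0 `^ q)%:E * ((mx x `^ (- be)) `^ q)%:E)%E.
  by apply: emeasurable_funD => //; exact: measurable_funeM.
apply: (@le_trans _ _ (\int[@lebm R]_x (P%:E * (W x `^ q + (N0 `^ q)%:E * ((mx x `^ (- be)) `^ q)%:E)))%E).
  apply: ge0_le_integral.
  - by [].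
  - by move=> x _; exact: poweR_ge0.
  - by apply: (measurableT_comp (measurable_poweR _)); exact: measurable_pot.
  - exact: measurable_funeM.
  move=> x _; apply: (le_trans (le_poweR q0 (pot_ge0 _ _ _) (pot_upper x))).
  rewrite poweRM ?lee_fin ?powR_ge0//; last by rewrite adde_ge0// lee_fin.
  rewrite poweR_EFin (_ : P%:E = ((2 `^ be) `^ q)%:E * (2 `^ q)%:E)%E// -[leRHS]muleA; apply: lee_wpmul2l; first by rewrite lee_fin powR_ge0.
  have := poweR_add q0 (W0 x) (_ : (0 <= (mx x `^ (- be) * N0)%:E)%E); rewrite lee_fin => /(_ (F0 x)).
  by rewrite (_ : (mx x `^ (- be) * N0)%:E `^ q = (N0 `^ q)%:E * ((mx x `^ (- be)) `^ q)%:E)%E// poweR_EFin powRM ?powR_ge0// mulrC.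
have eCW : CW = P * (Dw / (1 - kap) + 8 * 2 `^ (q + 2)) * CJ by [].
rewrite eCW; clear eCW; clearbody P.
have sg k : (0 <= ((l k ^+ 2)^-1)%:E * \int[@lebm R]_w (T k w `^ q))%E.
  by rewrite mule_ge0 ?lee_fin ?invr_ge0 ?sqr_ge0//; apply: integral_ge0 => w _; exact: poweR_ge0.
have CJ0 : 0 <= CJ by rewrite divr_ge0 ?powR_ge0.
have k1 : 0 < 1 - kap by rewrite subr_gt0.
have D0 : 0 <= Dw / (1 - kap) by rewrite divr_ge0// ltW.
have E0 : (0 <= Ek)%E by apply: nneseries_ge0.
have EJ : (Ek <= CJ%:E * \sum_(k <oo) (((l k ^+ 2)^-1)%:E * \int[@lebm R]_w (T k w `^ q)))%E.
  rewrite -nneseriesZl//.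
  by apply: lee_nneseries => [k _ _|k _]; [exact: e0|exact: JK_T].
rewrite ge0_integralZl; [|by []|exact: mG|by move=> x _; rewrite adde_ge0// mule_ge0|by rewrite lee_fin].
rewrite ge0_integralD; [|by []|by []|exact: mWq|by move=> x _; rewrite mule_ge0|exact: measurable_funeM].
rewrite ge0_integralZl; [|by []|exact: mFq|by []|by []].
rewrite [leRHS](_ : _ = P%:E * ((Dw / (1 - kap) + 8 * 2 `^ (q + 2))%:E * (CJ%:E * \sum_(k <oo) (((l k ^+ 2)^-1)%:E * \int[@lebm R]_w (T k w `^ q)))))%E; last first.
  by rewrite !muleA -!EFinM.
apply: lee_wpmul2l; first by rewrite lee_fin.
apply: (@le_trans _ _ ((Dw / (1 - kap) + 8 * 2 `^ (q + 2))%:E * Ek)%E); last first.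
  by apply: lee_wpmul2l => //; rewrite lee_fin addr_ge0// mulr_ge0 ?powR_ge0.
have F8 : 0 <= 8 * 2 `^ (q + 2) :> R by rewrite mulr_ge0 ?powR_ge0.
rewrite EFinD ge0_muleDl ?lee_fin//; apply: leeD; first exact: near_int.
apply: (@le_trans _ _ (JK 0 * (8 * 2 `^ (q + 2) * s0 `^ (- q))%:E)%E).
  by apply: lee_pmul => //; [apply: integral_ge0|exact: N0_pow|exact: far_int].
rewrite muleC EFinM -muleA; apply: lee_wpmul2l; first by rewrite lee_fin mulr_ge0 ?powR_ge0.
by rewrite -{1}l00; exact: (nneseries_term 0 e0).
Qed.

End wolff.

(** * Transfer of a measure from the set to its image *)

Section transfer.
Variable R : realType.
Implicit Types (x y z w : Pt R).

Lemma uniq_sum (F : seq (nat * nat)) (n N : nat) (g : nat -> R) : uniq F -> all (fun p => p.2 < 4 ^ p.1)%N F -> (forall k, 0 <= g k) ->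
  N = (4 ^ n)%N -> \sum_(p <- F) (p.1 == n)%:R * g p.2 <= \sum_(k < N) g k.
Proof.
move=> uF aF g0 ->.
rewrite (eq_big_seq (fun p => \sum_(k < 4 ^ n) (p == (n, nat_of_ord k))%:R * g k)) => [|p pF]; last first.
  have [pn|pn] := eqVneq p.1 n; last first.
    rewrite mul0r big1// => k _; rewrite (_ : (p == _) = false) ?mul0r//.
    by apply/negP => /eqP e; rewrite e eqxx in pn.
  have kn : (p.2 < 4 ^ n)%N by rewrite -pn; move/allP: aF => /(_ p pF).
  have ep : (n, p.2) = p by rewrite -pn -surjective_pairing.
  rewrite (bigD1 (Ordinal kn))//= ep eqxx big1 ?addr0// => k /eqP kp.
  rewrite (_ : (p == _) = false) ?mul0r//; apply/negP => /eqP e; apply: kp; apply/val_inj; by rewrite /= e.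
rewrite exchange_big /=; apply: ler_sum => k _; rewrite -mulr_suml -[leRHS]mul1r; apply: ler_wpM2r => //.
elim: (F) uF => [|p F' ih] /= => [_|/andP[pF uF]]; first by rewrite big_nil.
rewrite big_cons; case: eqP => e; last by rewrite add0r ih.
rewrite big_seq big1 ?addr0// => p' p'F; rewrite (_ : (p' == _) = false)//.
by apply/negP => /eqP e'; move: pF; rewrite e -e' p'F.
Qed.

Lemma cen_bound (s0 : R) (n k : nat) : 0 < s0 -> `|cen s0 n k| <= (s0 - sc s0 n) / 2.
Proof.
move=> s00; elim: n k => [|n ih] k; first by rewrite normr0 sc0 subrr mul0r.
have [h1 h2] := cen_step s00 n k; have := ih (k %/ 4)%N; rewrite !prod_normE !ge_max => /andP[g1 g2].
have := ler_normD ((cen s0 n.+1 k).1 - (cen s0 n (k %/ 4)).1) (cen s0 n (k %/ 4)).1.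
have := ler_normD ((cen s0 n.+1 k).2 - (cen s0 n (k %/ 4)).2) (cen s0 n (k %/ 4)).2.
by rewrite !subrK scS => k1 k2; apply/andP; split; lra.
Qed.

(** The constant is fixed before the maps, the set and the measure, so it depends on [q] and [H]
    alone, while [M] and the scales [s0], [r0] vary with the configuration. *)
Lemma transfer_finite (q H : R) : 2 < q -> 1 <= H -> exists2 C, 0 < C &
  forall M (Phi Psi : Pt R -> Pt R) (E : set (Pt R)) (mu : {finite_measure set (Pt R) -> \bar R}) (a : R), a - 2 = - (1 + 2 / q) ->
  qsp H M Phi Psi E -> (\int[@lebm R]_x (riesz_pot a mu x `^ q) <= 1)%E ->
  exists nu : {finite_measure set (Pt R) -> \bar R},
    [/\ nu (~` (Phi @` E)) = 0%E, (\int[@lebm R]_x (riesz_pot a nu x `^ q) <= C%:E)%E & (mu E <= C%:E * nu setT)%E].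
Proof.
move=> q2 H1; have q1 : 1 < q by lra.
have q0 : 0 < q by lra.
pose b := 1 + 2 / q; have b1 : 1 <= b by rewrite lerDl divr_ge0// ltW.
have t1 := theta_lt1 H1; have t0 := theta_ge0 H1.
(* [4 * 2^-q] is [2^(2-q)]; here [q > 2], that is [p < 2], enters. *)
have q4 : 0 < 4 * 2^-1 `^ q < 1.
  have e2 : 2^-1 `^ q = 2^-1 `^ (q - 2) * 4^-1 :> R.
    have -> : 4^-1 = 2^-1 `^ 2 :> R by rewrite powR_mulrn ?invr_ge0// expr2 -invfM; congr _^-1; lra.
    by rewrite -powRD ?subrK// invr_eq0 pnatr_eq0 implybT.
  rewrite e2 mulrCA mulfV// mulr1 powR_gt0 ?invr_gt0//=.
  have e1 : 1 `^ (q - 2) = 1 :> R by rewrite powR1.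
  by rewrite -[ltRHS]e1; apply: gt0_ltr_powR; rewrite ?nnegrE ?subr_gt0 ?invf_lt1 ?ltr1n ?invr_ge0.
(* Midway between 1 and the larger of the two decay rates, so that both quotients by [k] stay below
   1. *)
pose k := (1 + Num.max (theta H) (4 * 2^-1 `^ q)) / 2.
have [k0 k1 kth kq] : [/\ 0 < k, k < 1, theta H < k & 4 * 2^-1 `^ q < k].
  have h1 : theta H <= Num.max (theta H) (4 * 2^-1 `^ q) by rewrite le_max lexx.
  have h2 : 4 * 2^-1 `^ q <= Num.max (theta H) (4 * 2^-1 `^ q) by rewrite le_max lexx orbT.
  have h3 : Num.max (theta H) (4 * 2^-1 `^ q) < 1 by rewrite gt_max t1; case/andP: q4.
  by rewrite /k; move: h1 h2 h3; set m := Num.max _ _ => *; split; lra.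
pose C1 := CE H q k * (2 * 4 `^ b) `^ q; pose C2 := `|CW q 81| * C1; pose CQ' := CQ H 81.
exists (Num.max 1 (Num.max C2 CQ')); first by rewrite lt_max ltr01.
move=> M Phi Psi E mu a ha hS hmu.
have [K K' cP cS cE M0 hM hM' hq hq' hd] := hS.
have cZ : compact (Phi @` E) by apply: continuous_compact => //; exact: continuous_subspaceT.
have [B B0 hB] := bounded_compact cE; have [B' B'0 hB'] := bounded_compact cZ.
(* The root square, of half side [s0 / 2], then contains [Phi(E)]. *)
pose s0 := 2 * B' + 1; have s00 : 0 < s0 by rewrite /s0; lra.
(* Large enough that [E] lies within [r0] of [Psi w] for every [w] in a dilated square of the tree,
   and that every [Dn] is at most [r0]. *)
pose r0 := B + 2 * M + 4 * s0; have r00 : 0 < r0 by rewrite /r0; lra.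
have sr : s0 + 2 * M <= r0 by rewrite /r0; lra.
pose T := Tn r0 s0 Psi mu.
have T0 n w : (0 <= T n w)%E by exact: Tn_ge0.
have mT n : measT (T n) by apply: measurable_Tn.
have mTq n : measT (fun w => T n w `^ q)%E by apply: (measurableT_comp (measurable_poweR _)); exact: mT.
pose IT n := (((sc s0 n ^+ 2)^-1)%:E * \int[@lebm R]_w (T n w `^ q))%E.
have Tq0 n : (0 <= \int[@lebm R]_w (T n w `^ q))%E by apply: integral_ge0 => w _; exact: poweR_ge0.
have IT0 n : (0 <= IT n)%E by rewrite mule_ge0// lee_fin invr_ge0 sqr_ge0.
have l0 n : 0 < sc s0 n by exact: sc_gt0.
have CE0 : 0 <= CE H q k.
  rewrite /CE; apply: mulr_ge0.
    by apply: mulr_ge0; [apply: mulr_ge0; [|apply: exprn_ge0; lra]|exact: cq_ge0].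
  by apply: addr_ge0; rewrite invr_ge0 subr_ge0 ler_pdivrMr// mul1r ltW.
have C10 : 0 <= C1 by rewrite mulr_ge0 ?powR_ge0.
have energy_T : (\sum_(n <oo) IT n <= C1%:E)%E.
  apply: nneseries_bound => // N; rewrite -(big_mkord xpredT IT).
  apply: (le_trans (dyadic_energy mu H1 K K' cS hq hM' s00 sr q1 k0 k1 kth kq N)).
  rewrite (_ : C1%:E = (CE H q k)%:E * ((2 * 4 `^ b) `^ q)%:E)%E//; apply: lee_wpmul2l; first by rewrite lee_fin.
  (* The exponent of the kernel matches the area normalization: [l^-2 (V/l)^q = (l^-b V)^q] for
     [b = 1 + 2/q]. *)
  have -> : En r0 q mu = (\sum_(l <oo) \int[@lebm R]_x ((sc r0 l `^ (- b) * V mu (2 * sc r0 l) x) `^ q)%:E)%E.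
    apply: eq_eseriesr => l _; apply: eq_integral => x _; congr (_%:E); rewrite /el.
    have L := sc_gt0 l r00; have v0 := V_ge0 mu (2 * sc r0 l) x.
    move: (sc r0 l) (V mu (2 * sc r0 l) x) L v0 => L v L0 v0.
    rewrite !powRM ?powR_ge0 ?invr_ge0 ?(ltW L0)// mulrCA [RHS]mulrC; congr (_ * _).
    rewrite -(@powR_inv1 _ L) ?(ltW L0)// -!powRrM -(powR_mulrn 2 (ltW L0)) -powRN -powRD ?(gt_eqF L0) ?implybT//.
    by congr (_ `^ _); rewrite /b; field; rewrite gt_eqF.
  apply: (le_trans (energy mu ha b1 (ltW q1) r00)).
  by rewrite -[leRHS]mule1; apply: lee_wpmul2l; rewrite ?lee_fin ?powR_ge0.
have Tfin n : (\int[@lebm R]_w (T n w `^ q) < +oo)%E.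
  have h := le_trans (nneseries_term n IT0) energy_T.
  rewrite ltey; apply/eqP => e; move: h; rewrite /IT e gt0_muley ?leye_eq//.
  by rewrite lte_fin invr_gt0 exprn_gt0.
have mI c (s : R) : measT (fun w : Pt R => (\1_(cbx c s) w)%:E : \bar R).
  by apply/measurable_EFinP; exact: measurable_1cbx.
have mIT c (s : R) n : measT (fun w => (\1_(cbx c s) w)%:E * T n w)%E.
  by apply: emeasurable_funM; [exact: mI|exact: mT].
pose I n c := (\int[@lebm R]_w ((\1_(cbx c (2 * sc s0 n)) w)%:E * T n w))%E.
have I0 n c : (0 <= I n c)%E by apply: integral_ge0 => w _; rewrite mule_ge0 ?lee_fin.
(* The capacities in the flow are real numbers; Jensen and the finite energy of [T] provide
   finiteness. *)
have Ifin n c : (I n c \is a fin_num).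
  have l2 : 0 < 2 * sc s0 n by rewrite mulr_gt0.
  rewrite ge0_fin_numE//; have := jensen c q1 l2 (mT n) (T0 n); rewrite -/(I n c) => h.
  apply: (@lty_poweRy _ _ q); first by rewrite gt_eqF.
  apply: (le_lt_trans h); apply: lte_mul_pinfty; rewrite ?lee_fin ?powR_ge0//.
  apply: le_lt_trans (Tfin n); apply: ge0_le_integral.
  - by [].
  - by move=> w _; rewrite mule_ge0 ?lee_fin ?poweR_ge0.
  - by apply: emeasurable_funM; [exact: mI|exact: mTq].
  - exact: mTq.
  move=> w _; rewrite -[leRHS]mul1e; apply: lee_wpmul2r; first exact: poweR_ge0.
  by rewrite lee_fin indicE; case: (_ \in _).
pose bb n j := fine (((sc s0 n)^-1)%:E * I n (cen s0 n j))%E.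
have ci n : (0 <= ((sc s0 n)^-1)%:E)%E by rewrite lee_fin invr_ge0 ltW.
have bbE n j : ((bb n j)%:E = ((sc s0 n)^-1)%:E * I n (cen s0 n j))%E by rewrite /bb fineK// fin_numM.
have bb0 n j : 0 <= bb n j by rewrite -lee_fin bbE mule_ge0.
have hZ : Phi @` E `<=` cbx 0 (s0 / 2).
  by move=> z hz; rewrite /cbx /= subr0; have := hB' z hz; rewrite /s0; clear -B'0; lra.
have [nu [nuT nuZ nuV]] := flow_measure s00 bb0 (compact_closed2 cZ).
have mE : measurable E by apply: measurable_closed2; exact: compact_closed2.
have CQ0 : 0 < CQ'.
  by apply: mulr_gt0; [apply: mulr_gt0; [exact: (ltr0n R 320)|apply: exprn_gt0; clear -H1; lra]|exact: (ltr0n R 81)].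
have muE : mu E \is a fin_num by exact: mu_fin.
(* [(4 * 2 + 1)^2] squares of one generation at most have their centre within two side lengths of a
   point. *)
have c81 n w : \sum_(j < 4 ^ n) \1_(cbx w (2 * sc s0 n)) (cen s0 n j) <= 81 :> R.
  by apply: (le_trans (cen_overlap s00 n w (ler0n R 2))); rewrite expr2; clear; lra.
have low : fine (mu E) / CQ' <= cm s0 (Phi @` E) bb 0 0.
  apply: (cm_lower s00 bb0 hZ) => F uF sF aF cF.
  rewrite ler_pdivrMr// mulrC -lee_fin fineK//.
  pose nn i := (nth (0, 0)%N F i).1; pose cc i := cen s0 (nn i) (nth (0, 0)%N F i).2.
  have srt i j : (i <= j < size F)%N -> (nn i <= nn j)%N.
    move=> /andP[ij jF]; have tr : transitive (fun p p' : nat * nat => p.1 <= p'.1)%N by move=> p1 p2 p3; exact: leq_trans.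
    have rf : reflexive (fun p p' : nat * nat => p.1 <= p'.1)%N by move=> p1; exact: leqnn.
    by apply: (sorted_leq_nth tr rf (0, 0)%N sF) => //; rewrite inE//; exact: leq_ltn_trans jF.
  have ov (J n : nat) w : (J <= size F)%N -> \sum_(i < J) (nn i == n)%:R * \1_(cbx (cc i) (2 * sc s0 n)) w <= 81 :> R.
    move=> JF; pose F' := take J F.
    have sF' : size F' = J by rewrite size_takel.
    apply: (@le_trans _ _ (\sum_(p <- F') (p.1 == n)%:R * \1_(cbx w (2 * sc s0 n)) (cen s0 n p.2))).
      rewrite (big_nth (0, 0)%N) big_mkord sF'; apply: ler_sum => i _.
      rewrite nth_take// -/(nn i); case: eqP => [e|_]; last by rewrite !mul0r.
      by rewrite !mul1r /cc e cbxC.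
    apply: (le_trans (@uniq_sum F' n _ (fun j => \1_(cbx w (2 * sc s0 n)) (cen s0 n j)) _ _ _ erefl)) => //.
      exact: take_uniq.
    by apply/allP => p /mem_take pF; move/allP: aF; apply.
  have cov x : E x -> exists2 j, (j < size F)%N & `|Phi x - cc j| <= sc s0 (nn j) / 2.
    move=> Ex; have [|p pF hp] := cF (Phi x); first by exists x.
    by exists (index p F); rewrite ?index_mem// /cc /nn nth_index.
  have bnd j w : (j < size F)%N -> `|w - cc j| <= 2 * sc s0 (nn j) -> `|w| < 3 * s0 /\ forall y, E y -> `|y - Psi w| <= r0.
    move=> jF hw; have cb := cen_bound (nn j) (nth (0, 0)%N F j).2 s00; rewrite -/(cc j) in cb.
    have l1 : sc s0 (nn j) <= s0 by rewrite -[leRHS](sc0 s0); apply: sc_le => //; exact: ltW.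
    have w2 : `|w| <= 2 * s0 by have := ler_normD (w - cc j) (cc j); rewrite subrK; clear -cb l1 hw; lra.
    split=> [|y Ey]; first by clear -w2 s00; lra.
    have := ler_normB y (Psi w); have := ler_normD (Psi w - w) w; rewrite subrK.
    by have := hM' w; have := hB y Ey; rewrite /r0; clear -w2 s00 M0; lra.
  have s3 : 0 <= 3 * s0 by rewrite mulr_ge0// ltW.
  have := cover_sum hS H1 s00 s3 srt ov cov bnd mu.
  have -> : ((CQ' * \sum_(p <- F) bb p.1 p.2)%:E = CQ'%:E * \sum_(j < size F) (bb (nn j) (nth (0, 0)%N F j).2)%:E)%E.
    by rewrite (big_nth (0, 0)%N) big_mkord sumEFin.
  congr (_ <= _ * _)%E; by apply: eq_bigr => j _; rewrite bbE.
(* The distances add up to [1 + (2 + 1/2) + 2] side lengths, which the radius 6 in [hh] covers; the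
   overlap is again at most 81. *)
have hV n x y : `|x - y| <= sc s0 n -> ((V nu (2 * sc s0 n) y)%:E <= hh s0 81 T n x)%E.
  move=> xy; rewrite -VE; apply: (le_trans (nuV n y (2 * sc s0 n))).
  set r := 2 * sc s0 n + sc s0 n / 2.
  apply: (@le_trans _ _ (\sum_(j < 4 ^ n) ((sc s0 n)^-1)%:E * \int[@lebm R]_w ((\1_(cbx y r) (cen s0 n j))%:E * ((\1_(cbx (cen s0 n j) (2 * sc s0 n)) w)%:E * T n w)))%E).
    rewrite -sumEFin; apply: lee_sum => j _.
    rewrite ge0_integralZl; [|by []|exact: mIT|by move=> w _; rewrite mule_ge0 ?lee_fin|by rewrite lee_fin].
    rewrite muleCA -/(I n _) -bbE -EFinM lee_fin; apply: ler_wpM2l => //.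
    by rewrite /bZ; case: ifP.
  rewrite -ge0_sume_distrr => [|j _]; last by apply: integral_ge0 => w _; rewrite !mule_ge0 ?lee_fin.
  rewrite /hh [81 / _]mulrC EFinM -muleA; apply: lee_wpmul2l => //.
  rewrite -ge0_integralZl; [|by []|exact: mIT|by move=> w _; rewrite mule_ge0 ?lee_fin|by rewrite lee_fin].
  rewrite -(big_mkord xpredT (fun j => (\int[@lebm R]_w ((\1_(cbx y r) (cen s0 n j))%:E * ((\1_(cbx (cen s0 n j) (2 * sc s0 n)) w)%:E * T n w)))%E)).
  rewrite -ge0_integral_sum; [|by []|by move=> j; apply: measurable_funeM; exact: mIT|by move=> j w _; rewrite !mule_ge0 ?lee_fin].
  apply: ge0_le_integral.
  - by [].
  - by move=> w _; apply: sume_ge0 => j _; rewrite !mule_ge0 ?lee_fin.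
  - by apply: emeasurable_sum => j; apply: measurable_funeM; exact: mIT.
  - by apply: measurable_funeM; exact: mIT.
  move=> w _; rewrite big_mkord.
  apply: (@le_trans _ _ (\sum_(j < 4 ^ n) (\1_(cbx w (2 * sc s0 n)) (cen s0 n j) * \1_(cbx x (6 * sc s0 n)) w)%:E * T n w)%E).
    apply: lee_sum => j _; rewrite muleA -EFinM; apply: lee_wpmul2r => //; rewrite lee_fin !indicE.
    case: (boolP (cen s0 n j \in cbx y r)) => [/set_mem h1|_]; last by rewrite mul0r mulr_ge0.
    case: (boolP (w \in cbx (cen s0 n j) _)) => [/set_mem h2|_]; last by rewrite mulr0 mulr_ge0.
    move: h1 h2; rewrite /cbx /= /r => h1 h2.
    rewrite mem_set /=; last by rewrite distrC.
    rewrite mem_set ?mulr1//=.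
    have := ler_distD (cen s0 n j) w x; have := ler_distD y (cen s0 n j) x.
    by rewrite (distrC y x); have := l0 n; clear -xy h1 h2; lra.
  rewrite -ge0_sume_distrl => [|j _]; last by rewrite lee_fin mulr_ge0.
  rewrite muleA -EFinM; apply: lee_wpmul2r => //; rewrite sumEFin lee_fin -mulr_suml; exact: ler_wpM2r.
have supp : nu (~` cbx 0 (s0 / 2)) = 0%E.
  apply/eqP; rewrite -measure_le0 -nuZ; apply: le_measure; rewrite ?inE.
  - by apply: measurableC; exact: measurable_cbx.
  - by apply: measurableC; apply: measurable_closed2; exact: compact_closed2.
  - exact: subsetC.
have w := @wolff R q s0 81 a nu T q2 s00 (ler0n R 81) ha T0 mT hV supp.
exists nu; split => //.
- apply: (le_trans w); apply: (@le_trans _ _ C2%:E); last by rewrite lee_fin !le_max lexx orbT.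
  apply: (@le_trans _ _ (`|CW q 81|%:E * \sum_(n <oo) IT n)%E).
    by apply: lee_wpmul2r; [apply: nneseries_ge0 => n _ _; exact: IT0|rewrite lee_fin ler_norm].
  by rewrite /C2 EFinM; apply: lee_wpmul2l; rewrite ?lee_fin.
rewrite nuT; apply: (@le_trans _ _ (CQ' * cm s0 (Phi @` E) bb 0 0)%:E).
  by rewrite -(fineK muE) lee_fin mulrC -ler_pdivrMr.
rewrite lee_fin; apply: ler_wpM2r; last by rewrite !le_max lexx !orbT.
exact: cm_ge0.
Qed.

End transfer.

(** * Comparison of capacities *)

Section capacity.
Variable R : realType.
Implicit Types (x y z w : Pt R).

(** The kernel has a positive lower bound for [x] in the unit square and [y] in [E], so infinite
    mass would make the potential infinite on that square, whose area is 4. *)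
Lemma finite_of_pot (a b q : R) (E : set (Pt R)) (mu : {measure set (Pt R) -> \bar R}) : a - 2 = - b -> 0 <= b -> 0 < q -> compact E ->
  (\int[@lebm R]_x (riesz_pot a mu x `^ q) <= 1)%E -> (mu E < +oo)%E.
Proof.
move=> ab b0 q0 cE hmu; have [B B0 hB] := bounded_compact cE.
have mE : measurable E by apply: measurable_closed2; exact: compact_closed2.
pose c : R := (2 * (B + 1)) `^ (- b).
have c0 : 0 < c by rewrite powR_gt0// mulr_gt0// ltr_wpDl.
rewrite ltey; apply/eqP => muE.
have pot1 x : cbx 0 1 x -> riesz_pot a mu x = +oo%E.
  rewrite /cbx /= subr0 => x1; apply/eqP; rewrite -leye_eq.
  have -> : (+oo = \int[mu]_y (c * \1_E y)%:E)%E.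
    under eq_integral do rewrite EFinM.
    rewrite ge0_integralZl; [|by []|by apply/measurable_EFinP; exact: measurable_indic|by move=> y _; rewrite lee_fin|by rewrite lee_fin ltW].
    by rewrite integral_indic// setIT muE gt0_muley.
  apply: ge0_le_integral.
  - by [].
  - by move=> y _; rewrite lee_fin mulr_ge0// ltW.
  - by apply/measurable_EFinP; apply: measurable_funM => //; exact: measurable_indic.
  - exact: (measurableT_comp (measurable_kernel a) (pair1_measurable x)).
  move=> y _; rewrite indicE; case: (boolP (y \in E)) => [/set_mem Ey|_]; last by rewrite mulr0; exact: kernel_ge0.
  rewrite mulr1 /riesz_kernel; case: eqP => [_|/eqP xy]; first by rewrite leey.
  have d0 : 0 < `|x - y| by rewrite normr_gt0 subr_eq0.
  rewrite lee_fin ab; apply: powRN_le => //.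
    by apply: lt_le_trans d0 _; rewrite -csubE; exact: cabs_ge.
  by apply: (le_trans (cabs_le _)); rewrite csubE ler_pM2l//; have := ler_normB x y; have := hB y Ey; lra.
have : (4%:E <= \int[@lebm R]_x (riesz_pot a mu x `^ q))%E.
  pose D : set (measurableTypeR R * measurableTypeR R) := cbx (0 : Pt R) 1.
  have mD : measurable D by exact: measurable_cbx.
  rewrite ge0_integralTE => [|x]; last exact: poweR_ge0.
  apply: ereal_sup_ubound; exists (indic_nnsfun R mD).
    move=> x; rewrite [leLHS](_ : _ = (\1_D x)%:E)// indicE; case: (boolP (x \in _)) => [/set_mem hx|_]; last exact: poweR_ge0.
    by rewrite pot1// poweRyr ?gt_eqF// leey.
  have -> : 4 = (2 * 1) ^+ 2 :> R by rewrite mulr1 expr2; lra.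
  by rewrite sintegral_indic; exact: leb2_cbx.
by move=> /le_trans /(_ hmu); rewrite lee_fin leNgt ltr1n.
Qed.

(** Each admissible [mu] is transferred to the image set and the result rescaled to be admissible
    there; the rescaling and the loss of mass combine to [(C0 / la)^p]. *)
Lemma capacity_le (p H : R) : 1 < p -> p < 2 -> 1 <= H -> exists2 C, 1 <= C & forall M (Phi Psi : Pt R -> Pt R) (E : set (Pt R)),
  qsp H M Phi Psi E -> (riesz_cap (2 / p - 1) p E <= C%:E * riesz_cap (2 / p - 1) p (Phi @` E))%E.
Proof.
move=> p1 p2 H1; pose q := p / (p - 1); pose a := 2 / p - 1.
have p0 : 0 < p by lra.
have pm : 0 < p - 1 by lra.
have q2 : 2 < q by rewrite ltr_pdivlMr//; lra.
have q0 : 0 < q by lra.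
have ha : a - 2 = - (1 + 2 / q) by rewrite /a /q invf_div; field; rewrite !gt_eqF.
have [C0 C00 hC] := transfer_finite q2 H1.
have b0 : 0 <= 1 + 2 / q by rewrite addr_ge0// divr_ge0// ltW.
(* The potential is linear in the measure, so scaling by [la] divides its [q]-th power integral by
   [C0]. *)
pose la := C0 `^ (- q^-1); have la0 : 0 < la by exact: powR_gt0.
have lq : la `^ q = C0^-1 by rewrite /la -powRrM mulNr mulVf ?gt_eqF// powR_inv1// ltW.
exists (Num.max 1 ((C0 / la) `^ p)); first by rewrite le_max lexx.
move=> M Phi Psi E hS; have cE := qp_E hS.
have mE : measurable E by apply: measurable_closed2; exact: compact_closed2.
have cZ : compact (Phi @` E) by apply: continuous_compact => //; apply: continuous_subspaceT; exact: (qp_c hS).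
have mZ : measurable (Phi @` E) by apply: measurable_closed2; exact: compact_closed2.
rewrite {1}/riesz_cap; apply: ge_ereal_sup => _ [mu [mu0 [muN ->]]].
have potq (m : {measure set (Pt R) -> \bar R}) : Lq_norm q (riesz_pot a m) = ((\int[@lebm R]_x (riesz_pot a m x `^ q)) `^ q^-1)%E.
  by rewrite /Lq_norm lebmE.
have I0 (m : {measure set (Pt R) -> \bar R}) : (0 <= \int[@lebm R]_x (riesz_pot a m x `^ q))%E.
  by apply: integral_ge0 => x _; exact: poweR_ge0.
have mu1 : (\int[@lebm R]_x (riesz_pot a mu x `^ q) <= 1)%E.
  have := le_poweR q0 (poweR_ge0 _ _) (_ : (Lq_norm q (riesz_pot a mu) <= 1)%E).
  by rewrite potq -poweRrM mulVf ?gt_eqF// poweRe1// poweR1r; apply; rewrite -potq.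
have muf := finite_of_pot ha b0 q0 cE mu1.
(* The restriction of [mu] to [E], finite by [muf], agrees with [mu] on measurable sets because [mu]
   vanishes off [E]. *)
have [mu' hmu'] : exists mu' : {finite_measure set (Pt R) -> \bar R}, forall A, measurable A -> mu' A = mu A.
  exists (mfrestr mE muf) => A mA.
  have -> : mu A = (mu (A `&` E) + mu (A `\` E))%E.
    rewrite -measureU; [by rewrite setUIDK|exact: measurableI|exact: measurableD|by rewrite setDE setIACA setICr setI0].
  rewrite [X in (_ + X)%E](_ : _ = 0%E) ?adde0//.
  apply/eqP; rewrite -measure_le0 -mu0; apply: le_measure; rewrite ?inE; [exact: measurableD|exact: measurableC|by move=> z []].
have pe x : riesz_pot a mu' x = riesz_pot a mu x by apply: eq_measure_integral => A mA _; exact: hmu'.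
have [|nu [nu0 nu1 nu2]] := hC M Phi Psi E mu' a ha hS.
  by under eq_integral do rewrite pe.
pose nu' : {measure set (Pt R) -> \bar R} := mscale (NngNum (ltW la0)) nu.
have nuE A : nu' A = (la%:E * nu A)%E by [].
have nuZ : nu setT = nu (Phi @` E).
  rewrite -(setUv (Phi @` E)) measureU//; [|exact: measurableC|exact: setICr].
  transitivity (nu (Phi @` E) + 0)%E; last exact: adde0.
  by congr (_ + _)%E; exact: nu0.
apply: (@le_trans _ _ ((Num.max 1 ((C0 / la) `^ p))%:E * (nu' (Phi @` E) `^ p))%E); last first.
  apply: lee_wpmul2l; first by rewrite lee_fin le_max ler01.
  apply: ereal_sup_ubound; exists nu'; split; last split=> //.
    by rewrite nuE nu0 mule0.
  rewrite potq -(poweR1r q^-1); apply: le_poweR; rewrite ?invr_gt0//.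
  have -> : (\int[@lebm R]_x (riesz_pot a nu' x `^ q) = (C0^-1)%:E * \int[@lebm R]_x (riesz_pot a nu x `^ q))%E.
    rewrite -ge0_integralZl; [|by []| |by move=> x _; exact: poweR_ge0|by rewrite lee_fin invr_ge0 ltW].
      apply: eq_integral => x _; rewrite /riesz_pot ge0_integral_mscale; [|by []| |by move=> y _; exact: kernel_ge0].
        rewrite poweRM ?lee_fin ?(ltW la0)//; last by apply: integral_ge0 => y _; exact: kernel_ge0.
        by rewrite poweR_EFin lq.
      exact: (measurableT_comp (measurable_kernel a) (pair1_measurable x)).
    by apply: (measurableT_comp (measurable_poweR _)); exact: measurable_pot.
  apply: (le_trans (lee_wpmul2l _ nu1)); first by rewrite lee_fin invr_ge0 ltW.
  by rewrite -EFinM mulVf ?gt_eqF.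
apply: (@le_trans _ _ (((C0 / la) `^ p)%:E * (nu' (Phi @` E) `^ p))%E); last first.
  by apply: lee_wpmul2r; [exact: poweR_ge0|rewrite lee_fin le_max lexx orbT].
rewrite -poweR_EFin -poweRM ?lee_fin ?divr_ge0 ?(ltW C00) ?(ltW la0)//.
apply: le_poweR => //; rewrite nuE muleA -EFinM divfK ?gt_eqF// -nuZ.
by rewrite -hmu'.
Qed.

End capacity.
Theorem mainTheorem6 (R : realType) (K p : R) :
  1 <= K -> 1 < p -> p < 2 ->
  exists2 C : R, 1 <= C &
    forall (E : set (Pt R)) (phi : Pt R -> Pt R),
      compact E -> principal phi -> quasiconformal K phi ->
      conformal_on (~` E) phi ->
      ((C^-1)%:E * riesz_cap (2 / p - 1) p E <= riesz_cap (2 / p - 1) p (phi @` E))%E /\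
      (riesz_cap (2 / p - 1) p (phi @` E) <= C%:E * riesz_cap (2 / p - 1) p E)%E.
Proof.
move=> K1 p1 p2; have Q0 : 0 <= K + K ^+ 3 by rewrite addr_ge0 ?exprn_ge0//; lra.
have [H H1 hH] := qcnorm_qsp Q0; have [C C0 hC] := capacity_le p1 p2 H1.
exists C => // E phi cE pr qc cf.
have [M [psi [fx [fy [gx [gy hN]]]]]] := qc_normalize K1 cE pr qc cf.
have [h1 h2] := hH _ _ _ _ _ _ _ _ hN; split; last first.
  (* The upper bound is the one-sided estimate for [psi] and the set [phi(E)], whose image under
     [psi] is [E]. *)
  have := hC _ _ _ _ h2; rewrite image_comp (_ : psi \o phi = id) ?image_id//.
  by apply/funext => z; exact: (qp_K h1).
by rewrite lee_pdivrMl ?(lt_le_trans ltr01)//; exact: hC h1.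
Qed.
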